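(* Let $X$ and $Y$ be two cellular multipointed $d$-spaces related by a finite zigzag sequence of globular subdivisions. Then the associated flows $\mathrm{cat}(X)$ and $\mathrm{cat}(Y)$ are related by a finite zigzag of transfinite compositions of pushouts of generating subdivisions (elements of $\mathrm{cell}(\mathcal{T}^{cof})$) and of weak equivalences of the q-model structure of flows. In particular, the two flows $\mathrm{cat}(X)$ and $\mathrm{cat}(Y)$ are dihomotopy equivalent. Moreover, the generating subdivisions can be taken of the form of a q-cofibrant replacement of the inclusion of the poset $\{0<1\}$ into a globular poset.
   Context: **Multipointed $d$-spaces.** $\mathbf{Top}$ denotes either the category of $\Delta$-generated spaces or that of $\Delta$-Hausdorff $\Delta$-generated spaces (either choice); it is bicomplete and cartesian closed with internal hom $\mathbf{TOP}(-,-)$, and $\Delta$-kelleyfication is the right adjoint of the inclusion of $\Delta$-generated spaces into topological spaces. $\mathcal{M}$ is the set of nondecreasing surjective maps $[0,1]\to[0,1]$. The normalized composition $\gamma_1*_N\gamma_2$ of paths with $\gamma_1(1)=\gamma_2(0)$ is $\gamma_1(2t)$ for $t\le 1/2$ and $\gamma_2(2t-1)$ for $t\ge 1/2$. A multipointed $d$-space is a triple $X=(|X|,X^0,\mathbb{P}^{top}X)$ with $|X|$ a space (the underlying space), $X^0\subset|X|$ a set (the states) and $\mathbb{P}^{top}X$ a set of continuous maps $[0,1]\to|X|$ (the execution paths) such that $\gamma(0),\gamma(1)\in X^0$ for every execution path $\gamma$, and $\mathbb{P}^{top}X$ is closed under $\gamma\mapsto\gamma\phi$ for $\phi\in\mathcal{M}$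 and under normalized composition. A map $f:X\to Y$ is a continuous map $|X|\to|Y|$ taking $X^0$ to $Y^0$ and execution paths to execution paths. $\mathbb{P}^{top}_{\alpha,\beta}X$ is the set of execution paths from $\alpha$ to $\beta$ with the $\Delta$-kelleyfication of the topology induced by $\mathbf{TOP}([0,1],|X|)$. A set $S$ is viewed as $(S,S,\varnothing)$. The topological globe $\mathrm{Glob}^{top}(Z)$ of a space $Z$ has underlying space the quotient of $\{0,1\}\sqcup(Z\times[0,1])$ by $(z,0)=0$, $(z,1)=1$ for all $z$, states $\{0,1\}$, and execution paths $t\mapsto(z,\phi(t))$ with $z\in Z$, $\phi\in\mathcal{M}$. $\mathbf{D}^n$ is the closed unit disk of $\mathbb{R}^n$, $\mathbf{S}^{n-1}$ its boundary sphere, $\mathbf{D}^0=\{0\}$, $\mathbf{S}^{-1}=\varnothing$. The q-model structure of multipointed $d$-spaces is the combinatorial model structure with generating cofibrations $I^{gl,top}\cup\{C,R\}$, where $I^{gl,top}=\{\mathrm{Glob}^{top}(\mathbf{S}^{n-1})\subset\mathrm{Glob}^{top}(\mathbf{D}^n)\mid n\ge0\}$, $C:\varnothing\to\{0\}$, $R:\{0,1\}\to\{0\}$; weak equivalences are the maps bijective on states and inducing weak homotopy equivalences $\mathbb{P}^{top}_{\alpha,\beta}X\to\mathbb{P}^{top}_{f(\alpha),f(\beta)}Y$ for all states $\alpha,\beta$; fibrations are the maps inducing Serre fibrations (q-fibrations) on all these spaces. For a class $\mathcal{K}$ of maps, $\mathrm{cell}(\mathcal{K})$ is the class of transfinite compositions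 of pushouts of elements of $\mathcal{K}$. A multipointed $d$-space $X$ is cellular if $\varnothing\to X$ is in $\mathrm{cell}(I^{gl,top}\cup\{C,R\})$. **Flows.** A flow is a small semicategory (category without required identities) enriched over $\mathbf{Top}$: a set of states $X^0$, spaces of execution paths $\mathbb{P}_{\alpha,\beta}X$, and a continuous strictly associative composition. Maps of flows are enriched semifunctors. Sets are flows with empty path spaces. A poset is viewed as a flow with exactly one execution path from $u$ to $v$ if $u<v$ and none otherwise. $\mathrm{Glob}(Z)$ is the flow with states $0,1$ whose only possibly nonempty path space is $\mathbb{P}_{0,1}=Z$. The q-model structure of flows is the combinatorial model structure with generating cofibrations $I^{gl}\cup\{C,R\}$, $I^{gl}=\{\mathrm{Glob}(\mathbf{S}^{n-1})\subset\mathrm{Glob}(\mathbf{D}^n)\mid n\ge0\}$, $C:\varnothing\to\{0\}$, $R:\{0,1\}\to\{0\}$; weak equivalences are the maps bijective on states and inducing weak homotopy equivalences on all path spaces; fibrations are the maps inducing q-fibrations on all path spaces. **The functor $\mathrm{cat}$.** $\mathrm{cat}$ takes a multipointed $d$-space $X$ to the flow with states $X^0$, with $\mathbb{P}_{\alpha,\beta}\mathrm{cat}(X)$ the quotient of $\mathbb{P}^{top}_{\alpha,\beta}X$ by the equivalence relation generated by reparametrization by $\mathcal{M}$, and with composition induced by normalized composition. **Globular subdivision.** A map of multipointed $d$-spaces $f:X\to Y$ is a globular subdivision if $X$ and $Y$ are cellular and $f$ induces a homeomorphism $|X|\cong|Y|$. **Generating subdivisions.** A poset is bounded if it has a bottom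 element and a top element which are distinct. $\mathcal{T}$ is the class of inclusions of finite bounded posets $P_1\subset P_2$ preserving the bottom and the top elements. A generating subdivision is a q-cofibration of flows $f^{cof}:P_1^{cof}\to P_2^{cof}$ between q-cofibrant flows for which there are $f:P_1\subset P_2$ in $\mathcal{T}$ and weak equivalences of flows $P_1^{cof}\to P_1$, $P_2^{cof}\to P_2$ forming a commutative square with $f^{cof}$ and $f$; it is then called a q-cofibrant replacement of $f$. $\mathcal{T}^{cof}$ is an arbitrary choice of one generating subdivision $f^{cof}$ for each $f\in\mathcal{T}$. **Globular poset.** A globular poset is a finite poset $\{0,1\}\sqcup F$ consisting of a smallest element $0$, a biggest element $1$, and a finite number of disjoint finite strictly increasing chains $0<a_1<\dots<a_p<1$ ($p\ge0$), elements of $F$ in different chains being incomparable. **Dihomotopy equivalence.** Two flows are dihomotopy equivalent if they are related by a finite zigzag of weak equivalences of flows and of retracts of transfinite compositions of pushouts of generating subdivisions. *)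

(* Defs.v *)
(* [R : realType] is the real line, [0,1] is the subspace
   [unitI R] of it.  The boolean [hd] selects the category Top: [false] for
   Delta-generated spaces, [true] for Delta-Hausdorff Delta-generated spaces. *)
From HB Require Import structures.
From mathcomp Require Import all_boot all_order all_algebra.
From mathcomp Require Import generic_quotient.
From mathcomp Require Import all_classical wochoice all_reals all_analysis.

Set Implicit Arguments.
Unset Strict Implicit.
Unset Printing Implicit Defensive.

Import Order.TTheory GRing.Theory Num.Theory.
Import numFieldNormedType.Exports.

Local Open Scope classical_set_scope.
Local Open Scope ring_scope.
Local Open Scope quotient_scope.

Record category := Category {
  obj :> Type;
  hom : obj -> obj -> Type;
  idm : forall a, hom a a;
  mcomp : forall a b c, hom b c -> hom a b -> hom a c;
  comp1m : forall a b (f : hom a b), mcomp (idm b) f = f;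
  compm1 : forall a b (f : hom a b), mcomp f (idm a) = f;
  compA : forall a b c d (h : hom c d) (g : hom b c) (f : hom a b),
    mcomp h (mcomp g f) = mcomp (mcomp h g) f }.

Notation "g \c f" := (mcomp g f) (at level 50, left associativity).

Definition subcat (C : category) (P : C -> Prop) : category :=
  @Category {x : C | P x} (fun a b => hom (sval a) (sval b))
    (fun a => idm (sval a)) (fun a b c g f => g \c f)
    (fun a b f => comp1m f) (fun a b f => compm1 f)
    (fun a b c d h g f => compA h g f).

Definition mclass (C : category) := forall a b : C, hom a b -> Prop.

Definition mclassU (C : category) (K L : mclass C) : mclass C :=
  fun a b f => K a b f \/ L a b f.

Definition restrict_class (C : category) (P : C -> Prop) (K : mclass C) :
  mclass (subcat P) := fun a b f => K (sval a) (sval b) f.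

Record arrow (C : category) := Arrow {
  dom : C; cod : C; arr : hom dom cod }.

Section CategoryTheory.
Variable C : category.
Implicit Types (a b c d e : C) (K : mclass C).

Definition is_initial a := forall b, exists! f : hom a b, True.

Definition is_pushout a b c d (f : hom a b) (g : hom a c)
    (i : hom b d) (j : hom c d) :=
  i \c f = j \c g /\
  forall e (u : hom b e) (v : hom c e), u \c f = v \c g ->
    exists! w : hom d e, w \c i = u /\ w \c j = v.

Definition pushout_of K : mclass C := fun c d j =>
  exists (a b : C) (f : hom a b) (g : hom a c) (i : hom b d),
    K a b f /\ is_pushout f g i j.

Definition is_retract a b c d (f : hom a b) (g : hom c d) :=
  exists (i : hom a c) (r : hom c a) (i' : hom b d) (r' : hom d b),
    [/\ r \c i = idm a, r' \c i' = idm b, g \c i = i' \c f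
      & f \c r = r' \c g].

Definition retract_of K : mclass C := fun a b f =>
  exists (c d : C) (g : hom c d), K c d g /\ is_retract f g.

Definition lifts a b c d (f : hom a b) (g : hom c d) :=
  forall (u : hom a c) (v : hom b d), g \c u = v \c f ->
    exists h : hom b c, h \c f = u /\ g \c h = v.

Definition rlp K : mclass C := fun c d g =>
  forall a b (f : hom a b), K a b f -> lifts f g.

Definition llp K : mclass C := fun a b f =>
  forall c d (g : hom c d), K c d g -> lifts f g.

Definition cofibration K : mclass C := llp (rlp K).

Definition cofibrant K b :=
  exists (a : C) (f : hom a b), is_initial a /\ cofibration K f.

Section Tower.
Context {disp : Order.disp_t} {W : orderType disp}.

Record tower := Tower {
  tob : W -> C;
  tmap : forall i j, (i <= j)%O -> hom (tob i) (tob j);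
  tmap_id : forall i (h : (i <= i)%O), tmap h = idm (tob i);
  tmap_comp : forall i j k (h : (i <= j)%O) (h' : (j <= k)%O)
    (h'' : (i <= k)%O), tmap h'' = tmap h' \c tmap h }.

Definition is_colimit (X : tower) (D : W -> Prop) c
    (leg : forall i, D i -> hom (tob X i) c) :=
  (forall i j (h : (i <= j)%O) (Di : D i) (Dj : D j),
     leg j Dj \c tmap X h = leg i Di) /\
  forall e (u : forall i, D i -> hom (tob X i) e),
    (forall i j (h : (i <= j)%O) (Di : D i) (Dj : D j),
       u j Dj \c tmap X h = u i Di) ->
    exists! w : hom c e, forall i (Di : D i), w \c leg i Di = u i Di.

Definition is_succ (i j : W) :=
  (i < j)%O /\ forall k, (k <= i)%O \/ (j <= k)%O.

Definition is_limit (j : W) :=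
  (exists i, (i < j)%O) /\ ~ exists i, is_succ i j.

Definition cocontinuous (X : tower) := forall j, is_limit j ->
  is_colimit (X := X) (D := fun i => (i < j)%O)
    (fun i h => tmap X (ltW h)).

End Tower.

(* A transfinite sequence is indexed by a nonempty well-ordered set (an
   ordinal) with least element [o]; the composition is the map from the
   object at [o] to the colimit of the whole sequence. *)
Inductive transfinite_composition K : mclass C :=
| TransfiniteComposition (disp : Order.disp_t) (W : orderType disp)
    (o : W) (X : @tower disp W) c (leg : forall i, True -> hom (tob X i) c) of
    well_order (<=%O : rel W) & (forall i, (o <= i)%O) & cocontinuous X &
    (forall i j (h : (i <= j)%O), is_succ i j -> K _ _ (tmap X h)) &
    is_colimit leg :
    transfinite_composition K (leg o I).

Definition cell K : mclass C := transfinite_composition (pushout_of K).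

Inductive zigzag K : C -> C -> Prop :=
| zigzag_refl a : zigzag K a a
| zigzag_forth a b c (f : hom a b) of K a b f & zigzag K b c : zigzag K a c
| zigzag_back a b c (f : hom b a) of K b a f & zigzag K b c : zigzag K a c.

End CategoryTheory.

Section SumTopology.
Variables S T : topologicalType.

Definition sum_open (U : set (S + T)) :=
  open ((inl : S -> S + T) @^-1` U) /\ open ((inr : T -> S + T) @^-1` U).

Lemma sum_openT : sum_open setT.
Proof. by split; rewrite preimage_setT; exact: openT. Qed.

Lemma sum_openI : setI_closed sum_open.
Proof. by move=> A B [? ?] [? ?]; split; exact: openI. Qed.

Lemma sum_open_bigU (I : Type) (F : I -> set (S + T)) :
  (forall i, sum_open (F i)) -> sum_open (\bigcup_i F i).
Proof.
by move=> F_open; split; apply: bigcup_open => i _; case: (F_open i).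
Qed.

HB.instance Definition _ :=
  isOpenTopological.Build (S + T)%type sum_openT sum_openI sum_open_bigU.

End SumTopology.

Section Spaces.
Variable R : realType.

Definition unitI : set R := `[0, 1].

Lemma unitI0 : (0 : R) \in unitI.
Proof. by rewrite inE /unitI /= in_itv /= lexx ler01. Qed.

Lemma unitI1 : (1 : R) \in unitI.
Proof. by rewrite inE /unitI /= in_itv /= lexx ler01. Qed.

Definition i0 : unitI := exist _ 0 unitI0.
Definition i1 : unitI := exist _ 1 unitI1.

(* A total function; it is only relevant on elements of [0,1]. *)
Definition to_unitI (x : R) : unitI := insubd i0 x.

Definition disk n : set 'rV[R]_n := [set v | \sum_i v 0 i ^+ 2 <= 1].

(* [sphere n] is S^{n-1}; it is empty for n = 0. *)
Definition sphere n : set 'rV[R]_n := [set v | \sum_i v 0 i ^+ 2 = 1].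

Arguments disk : clear implicits.
Arguments sphere : clear implicits.

Lemma sphere_sub_disk n : sphere n `<=` disk n.
Proof. by move=> v; rewrite /sphere /disk /= => ->. Qed.

Definition sphere_to_disk n (v : sphere n) : disk n :=
  exist _ (val v) (mem_set (sphere_sub_disk (set_mem (valP v)))).

Definition simplex n : set 'rV[R]_n.+1 :=
  [set v | (forall i, 0 <= v 0 i) /\ \sum_i v 0 i = 1].

Arguments simplex : clear implicits.

Definition delta_open (T : topologicalType) (U : set T) :=
  forall n (p : simplex n -> T), continuous p -> open (p @^-1` U).

Definition delta_generated (T : topologicalType) :=
  forall U : set T, delta_open U -> open U.

Definition delta_hausdorff (T : topologicalType) :=
  forall p : unitI -> T, continuous p -> closed (range p).

Definition in_Top (hd : bool) (T : topologicalType) :=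
  delta_generated T /\ (hd -> delta_hausdorff T).

(* The Delta-kelleyfication: [kelley T] is the set [T] with the final topology
   with respect to all continuous maps from simplices to [T]. *)
Definition kelley (T : topologicalType) : Type := let _ := R in T.

Section Kelley.
Variable T : topologicalType.

Lemma delta_openT : delta_open [set: T].
Proof. by move=> n p _; rewrite preimage_setT; exact: openT. Qed.

Lemma delta_openI : setI_closed (@delta_open T).
Proof.
by move=> A B oA oB n p cp; apply: openI; [exact: oA|exact: oB].
Qed.

Lemma delta_open_bigU (I : Type) (F : I -> set T) :
  (forall i, delta_open (F i)) -> delta_open (\bigcup_i F i).
Proof. by move=> oF n p cp; apply: bigcup_open => i _; exact: oF. Qed.

HB.instance Definition _ := Choice.on (kelley T).
HB.instance Definition _ := isOpenTopological.Build (kelley T)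
  delta_openT delta_openI delta_open_bigU.

End Kelley.

(* The internal hom of Top is the kelleyfied compact-open topology. *)
Definition TOP (S T : topologicalType) : topologicalType :=
  kelley (set_type [set f : {compact-open, S -> T} | continuous f]).

Definition TOP_fun (S T : topologicalType) (f : TOP S T) : S -> T := val f.

(* Quotients in Top.  The relation [top_eq hd E] is the smallest equivalence
   relation containing [E] whose quotient is a space of Top.  For [hd = false]
   every quotient qualifies and this is the equivalence relation generated by
   [E]; for [hd = true] one takes the Delta-Hausdorff reflection. *)
Section TopQuotient.
Variables (hd : bool) (T : topologicalType) (E : T -> T -> Prop).

Definition top_eq_prop (x y : T) := forall r : equiv_rel T,
  (forall u v, E u v -> r u v) ->
  (hd -> delta_hausdorff (quotient_topology {eq_quot r})) -> r x y.

Definition top_eq_rel (x y : T) : bool := `[< top_eq_prop x y >].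

Lemma top_eq_refl : reflexive top_eq_rel.
Proof. by move=> x; apply/asboolP => r _ _. Qed.

Lemma top_eq_sym : symmetric top_eq_rel.
Proof.
by move=> x y; apply/asboolP/asboolP => H r Er hr;
  rewrite generic_quotient.equiv_sym; exact: H.
Qed.

Lemma top_eq_trans : transitive top_eq_rel.
Proof.
move=> y x z /asboolP xy /asboolP yz; apply/asboolP => r Er hr.
by apply: (@generic_quotient.equiv_trans _ r y); [exact: xy|exact: yz].
Qed.

Definition top_eq : equiv_rel T :=
  EquivRel top_eq_rel top_eq_refl top_eq_sym top_eq_trans.

Definition top_quotient : topologicalType :=
  quotient_topology {eq_quot top_eq}.

Definition top_proj (x : T) : top_quotient := \pi x.

End TopQuotient.

Section WeakEquivalence.
Variables S T : topologicalType.

Definition joined (A : topologicalType) (x y : A) :=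
  exists p : unitI -> A, [/\ continuous p, p i0 = x & p i1 = y].

(* Representatives of the elements of pi_n(A,a). *)
Definition spheroid (A : topologicalType) n (a : A) (u : disk n -> A) :=
  continuous u /\ forall v, sphere n (val v) -> u v = a.

Definition homotopic_rel (A : topologicalType) n (a : A) (u v : disk n -> A) :=
  exists H : disk n * unitI -> A,
    [/\ continuous H, forall x, H (x, i0) = u x, forall x, H (x, i1) = v x
      & forall x t, sphere n (val x) -> H (x, t) = a].

(* The map induced by [f] is bijective on pi_0 and on pi_n(-,a) for all n >= 1
   and all base points a. *)
Definition weak_homotopy_equivalence (f : S -> T) :=
  [/\ continuous f,
      (forall x y, joined (f x) (f y) -> joined x y) /\
      (forall y, exists x, joined (f x) y)
    & forall n (a : S),
      (forall u v : disk n.+1 -> S, spheroid a u -> spheroid a v ->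
         homotopic_rel (f a) (f \o u) (f \o v) -> homotopic_rel a u v) /\
      (forall v : disk n.+1 -> T, spheroid (f a) v ->
         exists2 u, spheroid a u & homotopic_rel (f a) (f \o u) v)].

End WeakEquivalence.

Definition homeomorphism (S T : topologicalType) (f : S -> T) :=
  continuous f /\
  exists g : T -> S, [/\ continuous g, cancel f g & cancel g f].

Definition reparam : set (unitI -> unitI) :=
  [set phi | {homo phi : s t / val s <= val t} /\ range phi = setT].

Definition concat (T : Type) (g h : unitI -> T) : unitI -> T := fun t =>
  if val t <= 2^-1 then g (to_unitI (2 * val t))
  else h (to_unitI (2 * val t - 1)).

Record md_data := MdData {
  carrier :> topologicalType;
  states : set carrier;
  exec : set (unitI -> carrier) }.

Arguments states : clear implicits.
Arguments exec : clear implicits.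

Definition is_md (hd : bool) (X : md_data) :=
  [/\ in_Top hd X,
      forall g, exec X g ->
        [/\ continuous g, states X (g i0) & states X (g i1)],
      forall g phi, exec X g -> reparam phi -> exec X (g \o phi)
    & forall g h, exec X g -> exec X h -> g i1 = h i0 ->
        exec X (concat g h)].

Definition md_map_axiom (X Y : md_data) (f : X -> Y) :=
  [/\ continuous f, forall x, states X x -> states Y (f x)
    & forall g, exec X g -> exec Y (f \o g)].

Definition md_map (X Y : md_data) := {f : X -> Y | md_map_axiom f}.

Program Definition md_id (X : md_data) : md_map X X := exist _ idfun _.
Next Obligation. by move=> X; split => // x; exact: cvg_id. Qed.

Program Definition md_comp (X Y Z : md_data) (g : md_map Y Z)
  (f : md_map X Y) : md_map X Z := exist _ (sval g \o sval f) _.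
Next Obligation.
move=> X Y Z [g [cg sg eg]] [f [cf sf ef]]; split => /=.
- by move=> x; apply: continuous_comp; [exact: cf|exact: cg].
- by move=> x /sf /sg.
- by move=> h /ef /eg.
Qed.

Lemma md_map_eq (X Y : md_data) (f g : md_map X Y) : sval f = sval g -> f = g.
Proof.
case: f g => [f hf] [g hg] /= fg; subst g.
by rewrite (Prop_irrelevance hf hg).
Qed.

Program Definition MdData_cat : category :=
  @Category md_data md_map md_id md_comp _ _ _.
Next Obligation. by move=> X Y f; exact: md_map_eq. Qed.
Next Obligation. by move=> X Y f; exact: md_map_eq. Qed.
Next Obligation. by move=> *; exact: md_map_eq. Qed.

Definition MdTop (hd : bool) : category := @subcat MdData_cat (is_md hd).

Definition set_md (S : choiceType) : md_data :=
  @MdData (discrete_topology S) setT set0.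

Program Definition set_md_map (S T : choiceType) (f : S -> T) :
  md_map (set_md S) (set_md T) := exist _ f _.
Next Obligation.
move=> S T f; split => //; apply/continuousP => A _.
exact: discrete_open.
Qed.

Section TopologicalGlobe.
Variables (hd : bool) (Z : topologicalType).

Definition globe_pre : topologicalType := (bool + kelley (Z * unitI))%type.

Variant globe_collapse : globe_pre -> globe_pre -> Prop :=
| globe_collapse0 z : globe_collapse (inr (z, i0)) (inl false)
| globe_collapse1 z : globe_collapse (inr (z, i1)) (inl true).

Definition globe_proj (x : globe_pre) : top_quotient hd globe_collapse :=
  top_proj hd globe_collapse x.

Definition globe : md_data :=
  @MdData (top_quotient hd globe_collapse)
    (range (fun b => globe_proj (inl b)))
    [set g | exists z phi, reparam phi /\
       g = fun t => globe_proj (inr (z, phi t))].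

End TopologicalGlobe.

Lemma kelley_continuous (S T : topologicalType) (f : S -> T) :
  continuous f -> continuous (f : kelley S -> kelley T).
Proof.
move=> cf; apply/continuousP => U oU.
have {}oU : delta_open (U : set T) := oU.
suff : delta_open (f @^-1` U) by [].
move=> n p cp; apply: (oU n (f \o p)) => x.
by apply: continuous_comp; [exact: cp|exact: cf].
Qed.

Section TopQuotientMap.
Variables (hd : bool) (S T : topologicalType).
Variables (E : S -> S -> Prop) (F : T -> T -> Prop) (f : S -> T).
Hypothesis (cf : continuous f) (EF : forall x y, E x y -> F (f x) (f y)).

Lemma top_eq_map x y : top_eq hd E x y -> top_eq hd F (f x) (f y).
Proof.
move=> /asboolP exy; apply/asboolP => r Fr hr.
pose r'_rel (u v : S) : bool := r (f u) (f v).
have r'_refl : reflexive r'_rel by move=> u; exact: generic_quotient.equiv_refl.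
have r'_sym : symmetric r'_rel by move=> u v; exact: generic_quotient.equiv_sym.
have r'_trans : transitive r'_rel.
  by move=> v u w; exact: generic_quotient.equiv_trans.
pose r' : equiv_rel S := EquivRel r'_rel r'_refl r'_sym r'_trans.
apply: (exy r') => [u v /EF /Fr //|hd1].
pose Q := quotient_topology {eq_quot r'}.
pose Q' := quotient_topology {eq_quot r}.
pose j (c : Q) : Q' := \pi_Q' (f (repr c)).
have jE u : j (\pi_Q u) = \pi_Q' (f u).
  apply/eqmodP; change (is_true (r' (repr (\pi_Q u)) u)).
  by apply/eqmodP; rewrite reprK.
have j_inj : injective j.
  move=> c d /eqmodP cd; rewrite -[c]reprK -[d]reprK.
  by apply/eqmodP.
have cj : continuous j.
  apply/quotient_continuous; rewrite (_ : j \o _ = \pi_Q' \o f); last first.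
    by apply/funext => u; exact: jE.
  by move=> u; apply: continuous_comp; [exact: cf|exact: pi_continuous].
move=> p cp.
have -> : range p = j @^-1` range (j \o p).
  apply/seteqP; split => [_ [t _ <-]|c [t _ /j_inj <-]]; by exists t.
apply: (closed_comp (f := j)) => [c _|]; first exact: cj.
apply: (hr hd1) => t; apply: continuous_comp; [exact: cp|exact: cj].
Qed.

Definition top_quotient_map (c : top_quotient hd E) : top_quotient hd F :=
  top_proj hd F (f (repr c)).

Lemma top_quotient_mapE x :
  top_quotient_map (top_proj hd E x) = top_proj hd F (f x).
Proof.
by apply/eqmodP; apply: top_eq_map; apply/eqmodP; rewrite reprK.
Qed.

Lemma top_quotient_map_continuous : continuous top_quotient_map.
Proof.
apply/quotient_continuous.
rewrite (_ : _ \o _ = top_proj hd F \o f); last first.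
  by apply/funext => x; exact: top_quotient_mapE.
by move=> x; apply: continuous_comp; [exact: cf|exact: pi_continuous].
Qed.

End TopQuotientMap.

Section GlobeMap.
Variables (hd : bool) (Y Z : topologicalType) (f : Y -> Z).
Hypothesis cf : continuous f.

Definition globe_pre_map (x : globe_pre Y) : globe_pre Z :=
  match x with
  | inl b => inl b
  | inr p => inr (f p.1, p.2)
  end.

Lemma globe_pre_map_continuous : continuous globe_pre_map.
Proof.
have cp : continuous (fun p : Y * unitI => (f p.1, p.2)).
  move=> x; apply: (cvg_pair (F := nbhs x) (G := nbhs (f x.1)) (H := nbhs x.2)
    (f := f \o fst) (g := snd)); last exact: cvg_snd.
  by apply: (@continuous_comp _ _ _ fst f); [exact: cvg_fst|exact: cf].
have ck := kelley_continuous cp.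
by apply/continuousP => A [oA1 oA2]; split => //;
  move/continuousP: ck => /(_ _ oA2).
Qed.

Lemma globe_pre_map_collapse x y :
  globe_collapse x y -> globe_collapse (globe_pre_map x) (globe_pre_map y).
Proof. by case=> z; constructor. Qed.

Definition globe_map_fun : globe hd Y -> globe hd Z :=
  @top_quotient_map hd _ _ (@globe_collapse Y) (@globe_collapse Z)
    globe_pre_map.

Lemma globe_map_axiom : md_map_axiom globe_map_fun.
Proof.
pose mapE := top_quotient_mapE hd globe_pre_map_continuous
  globe_pre_map_collapse.
split.
- apply: top_quotient_map_continuous globe_pre_map_continuous _.
  exact: globe_pre_map_collapse.
- by move=> _ [b _ <-]; exists b => //; rewrite /globe_map_fun mapE.
- move=> _ [z [phi [phiM ->]]]; exists (f z), phi; split => //.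
  by apply/funext => t /=; rewrite /globe_map_fun mapE.
Qed.

Definition globe_map : md_map (globe hd Y) (globe hd Z) :=
  exist _ globe_map_fun globe_map_axiom.

End GlobeMap.

Lemma sphere_to_disk_continuous n : continuous (@sphere_to_disk n).
Proof.
apply/continuousP => _ [A oA <-]; exists A => //.
Qed.

Inductive md_gen (hd : bool) : mclass MdData_cat :=
| md_gen_globe n : md_gen hd (globe_map hd (@sphere_to_disk_continuous n))
| md_gen_C : md_gen hd (set_md_map (of_void unit))
| md_gen_R : md_gen hd (set_md_map (fun _ : bool => tt)).

Definition cellular (hd : bool) (X : MdTop hd) :=
  exists (E : MdTop hd) (f : hom E X),
    is_initial E /\ cell (restrict_class (md_gen hd)) f.

Definition globular_subdivision (hd : bool) : mclass (MdTop hd) :=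
  fun X Y f => [/\ cellular X, cellular Y & homeomorphism (sval f)].

Record flow_data := FlowData {
  flow_state : Type;
  flow_path : flow_state -> flow_state -> topologicalType;
  flow_concat : forall a b c, flow_path a b -> flow_path b c -> flow_path a c }.

(* The product of two spaces in Top is the Delta-kelleyfication of their
   product. *)
Definition is_flow (hd : bool) (F : flow_data) :=
  [/\ forall a b : flow_state F, in_Top hd (flow_path a b),
      forall a b c : flow_state F,
        continuous ((fun x => flow_concat x.1 x.2) :
          kelley (flow_path a b * flow_path b c)%type -> flow_path a c)
    & forall (a b c d : flow_state F) (x : flow_path a b) (y : flow_path b c)
        (z : flow_path c d),
        flow_concat (flow_concat x y) z = flow_concat x (flow_concat y z)].

Record flow_map (F G : flow_data) := FlowMap {
  fm_state :> flow_state F -> flow_state G;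
  fm_path : forall a b, flow_path a b -> flow_path (fm_state a) (fm_state b);
  fm_continuous : forall a b, continuous (@fm_path a b);
  fm_comp : forall a b c (x : flow_path a b) (y : flow_path b c),
    fm_path (flow_concat x y) = flow_concat (fm_path x) (fm_path y) }.

Program Definition flow_id (F : flow_data) : flow_map F F :=
  @FlowMap F F id (fun a b => id) _ _.
Next Obligation. by move=> F a b x; exact: cvg_id. Qed.
Next Obligation. by []. Qed.

Program Definition flow_comp (F G H : flow_data) (g : flow_map G H)
    (f : flow_map F G) : flow_map F H :=
  @FlowMap F H (g \o f) (fun a b x => fm_path g (fm_path f x)) _ _.
Next Obligation.
move=> F G H g f a b x.
by apply: (@continuous_comp _ _ _ (@fm_path _ _ f a b) (@fm_path _ _ g _ _));
  exact: fm_continuous.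
Qed.
Next Obligation. by move=> F G H g f a b c x y /=; rewrite !fm_comp. Qed.

Lemma FlowMap_eq F G s p c1 m1 c2 m2 :
  @FlowMap F G s p c1 m1 = @FlowMap F G s p c2 m2.
Proof. by rewrite (Prop_irrelevance c1 c2) (Prop_irrelevance m1 m2). Qed.

Program Definition FlowData_cat : category :=
  @Category flow_data flow_map flow_id flow_comp _ _ _.
Next Obligation. by move=> F G [s p c m]; exact: FlowMap_eq. Qed.
Next Obligation. by move=> F G [s p c m]; exact: FlowMap_eq. Qed.
Next Obligation. by move=> *; exact: FlowMap_eq. Qed.

Definition Flow (hd : bool) : category := @subcat FlowData_cat (is_flow hd).

Definition empty_space : topologicalType := discrete_topology void.

Definition set_flow (S : Type) : flow_data :=
  @FlowData S (fun _ _ => empty_space) (fun a b c x _ => x).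

Program Definition set_flow_map (S T : Type) (f : S -> T) :
  flow_map (set_flow S) (set_flow T) :=
  @FlowMap (set_flow S) (set_flow T) f (fun a b x => x) _ _.
Next Obligation. by move=> S T f a b []. Qed.
Next Obligation. by move=> S T f a b c []. Qed.

Section Glob.
Variable Z : topologicalType.

(* The states 0 and 1 are [false] and [true]. *)
Definition glob_path (a b : bool) : topologicalType :=
  match a, b with false, true => Z | _, _ => empty_space end.

Definition glob_comp (a b c : bool) :
  glob_path a b -> glob_path b c -> glob_path a c :=
  match a, b, c with
  | false, false, _ => fun x _ => of_void _ x
  | false, true, _ => fun _ y => of_void _ y
  | true, _, _ => fun x _ => of_void _ x
  end.

Definition glob : flow_data := @FlowData bool glob_path glob_comp.

End Glob.

Section GlobMap.
Variables (Y Z : topologicalType) (f : Y -> Z).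
Hypothesis cf : continuous f.

Definition glob_map_path (a b : bool) : glob_path Y a b -> glob_path Z a b :=
  match a, b with false, true => f | _, _ => id end.

Program Definition glob_map : flow_map (glob Y) (glob Z) :=
  @FlowMap (glob Y) (glob Z) id glob_map_path _ _.
Next Obligation. by move=> [] []; rewrite /= => x //; exact: cvg_id. Qed.
Next Obligation. by move=> [] [] [] /= // => -[]. Qed.

End GlobMap.

Inductive flow_gen : mclass FlowData_cat :=
| flow_gen_glob n : flow_gen (glob_map (@sphere_to_disk_continuous n))
| flow_gen_C : flow_gen (set_flow_map (of_void unit))
| flow_gen_R : flow_gen (set_flow_map (fun _ : bool => tt)).

Definition q_cofibration (hd : bool) : mclass (Flow hd) :=
  cofibration (restrict_class flow_gen).

Definition q_cofibrant (hd : bool) (F : Flow hd) :=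
  cofibrant (restrict_class flow_gen) F.

Definition flow_weq : mclass FlowData_cat := fun F G f =>
  bijective (fm_state f) /\
  forall a b, weak_homotopy_equivalence (@fm_path _ _ f a b).

Section PathSpace.
Variable X : md_data.

Definition path_set (a b : X) : set (TOP unitI X) :=
  [set g | [/\ exec X (TOP_fun g), TOP_fun g i0 = a & TOP_fun g i1 = b]].

Definition path_space (a b : X) : topologicalType := kelley (path_set a b).

Definition path_fun a b (p : path_space a b) : unitI -> X := TOP_fun (val p).

Definition reparam_rel a b (p q : path_space a b) :=
  exists2 phi, reparam phi & path_fun q = path_fun p \o phi.

Lemma path_funP a b (p : path_space a b) :
  [/\ exec X (path_fun p), path_fun p i0 = a & path_fun p i1 = b].
Proof. exact: set_mem (valP p). Qed.

End PathSpace.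

Lemma concat0 (T : Type) (g h : unitI -> T) : concat g h i0 = g i0.
Proof.
rewrite /concat /= invr_ge0 ler0n; congr g; apply/val_inj.
by rewrite /to_unitI mulr0 insubdK // unitI0.
Qed.

Lemma concat1 (T : Type) (g h : unitI -> T) : concat g h i1 = h i1.
Proof.
rewrite /concat /= invf_ge1 // (_ : (2 <= 1 :> R) = false); last first.
  by apply/negbTE; rewrite -ltNge ltr1n.
congr h; apply/val_inj.
by rewrite /to_unitI mulr1 -[2]/(1 + 1) addrK insubdK // unitI1.
Qed.

Section Cat.
Variables (hd : bool) (X : MdTop hd).

Lemma concat_continuous (a b c : sval X) (p : path_space a b)
    (q : path_space b c) :
  exec (sval X) (concat (path_fun p) (path_fun q)) /\
  continuous (concat (path_fun p) (path_fun q)).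
Proof.
have [ep _ p1] := path_funP p; have [eq q0 _] := path_funP q.
have [_ Xcont _ Xconcat] := svalP X.
have epq : exec (sval X) (concat (path_fun p) (path_fun q)).
  by apply: Xconcat => //; rewrite p1 q0.
by split => //; have [] := Xcont _ epq.
Qed.

Definition concat_TOP (a b c : sval X) (p : path_space a b)
    (q : path_space b c) : TOP unitI (sval X) :=
  exist (fun f => f \in
      [set f : {compact-open, unitI -> sval X} | continuous f])
    (concat (path_fun p) (path_fun q)) (mem_set (concat_continuous p q).2).

Lemma concat_path_set (a b c : sval X) (p : path_space a b)
  (q : path_space b c) : path_set a c (concat_TOP p q).
Proof.
have [_ p0 _] := path_funP p; have [_ _ q1] := path_funP q.
split; rewrite /TOP_fun /=.
- exact: (concat_continuous p q).1.
- by rewrite concat0.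
- by rewrite concat1.
Qed.

Definition concat_path (a b c : sval X) (p : path_space a b)
    (q : path_space b c) : path_space a c :=
  exist (fun g => g \in path_set a c) (concat_TOP p q)
    (mem_set (concat_path_set p q)).

Definition cat_path (a b : states (sval X)) : topologicalType :=
  top_quotient hd (@reparam_rel (sval X) (val a) (val b)).

(* The functor cat on objects; composition is computed on representatives. *)
Definition cat_flow : flow_data :=
  @FlowData (states (sval X)) cat_path
    (fun a b c x y => top_proj hd _ (concat_path (repr x) (repr y))).

End Cat.

Section PosetFlow.
Context {disp : Order.disp_t}.

(* A one-point space if [u < v], and the empty space otherwise. *)
Definition poset_path (P : porderType disp) (u v : P) : topologicalType :=
  discrete_topology {_ : unit | (u < v)%O}.

Definition poset_comp (P : porderType disp) (u v w : P) (x : poset_path u v)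
    (y : poset_path v w) : poset_path u w :=
  exist _ tt (lt_trans (svalP x) (svalP y)).

Definition poset_flow (P : porderType disp) : flow_data :=
  @FlowData P (@poset_path P) (@poset_comp P).

End PosetFlow.

(* A bounded poset has distinct bottom and top elements. *)
Definition bounded_poset {disp} (P : finTBPOrderType disp) :=
  (\bot : P)%O != \top%O.

Record poset_inclusion := PosetInclusion {
  src_disp : Order.disp_t;
  tgt_disp : Order.disp_t;
  src : finTBPOrderType src_disp;
  tgt : finTBPOrderType tgt_disp;
  incl :> src -> tgt;
  src_bounded : bounded_poset src;
  tgt_bounded : bounded_poset tgt;
  incl_mono : {mono incl : x y / (x <= y)%O};
  incl_bot : incl \bot%O = \bot%O;
  incl_top : incl \top%O = \top%O }.

Lemma incl_lt (f : poset_inclusion) (u v : src f) :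
  (u < v)%O -> (f u < f v)%O.
Proof. by rewrite (leW_mono (@incl_mono f)). Qed.

Program Definition incl_flow (f : poset_inclusion) :
    flow_map (poset_flow (src f)) (poset_flow (tgt f)) :=
  @FlowMap (poset_flow (src f)) (poset_flow (tgt f)) f
    (fun u v x => exist _ tt (incl_lt (svalP x))) _ _.
Next Obligation.
by move=> f u v; apply/continuousP => A _; exact: discrete_open.
Qed.
Next Obligation. by move=> f u v w x y; exact: val_inj. Qed.

Section Subdivision.
Variable hd : bool.

Definition cofibrant_replacement (f : poset_inclusion) (g : arrow (Flow hd)) :=
  [/\ q_cofibration (arr g), q_cofibrant (dom g), q_cofibrant (cod g)
    & exists (w1 : flow_map (sval (dom g)) (poset_flow (src f)))
             (w2 : flow_map (sval (cod g)) (poset_flow (tgt f))),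
        [/\ flow_weq w1, flow_weq w2
          & flow_comp w2 (arr g) = flow_comp (incl_flow f) w1]].

Definition generating_subdivision : mclass (Flow hd) :=
  fun F G g => exists f, cofibrant_replacement f (Arrow g).

(* The values of [T : poset_inclusion -> arrow (Flow hd)] on the inclusions
   satisfying [A]. *)
Variant values_on (T : poset_inclusion -> arrow (Flow hd))
    (A : poset_inclusion -> Prop) : mclass (Flow hd) :=
| ValuesOn f of A f : values_on T A (arr (T f)).

Definition flow_weak_equivalence : mclass (Flow hd) := restrict_class flow_weq.

Definition dihomotopy_equivalent : Flow hd -> Flow hd -> Prop :=
  zigzag (mclassU flow_weak_equivalence
    (retract_of (cell generating_subdivision))).

End Subdivision.

Definition globular_poset {disp} (P : finTBPOrderType disp) :=
  bounded_poset P /\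
  exists chains : seq (seq P),
    [/\ perm_eq (flatten chains)
          [seq x <- enum P | (x != \bot%O) && (x != \top%O)],
        all (sorted <%O) chains
      & pairwise (fun s t => allrel (fun x y => (x >< y)%O) s t) chains].

(* A bounded poset with no element but its bottom and its top is {0<1}. *)
Definition globular_inclusion (f : poset_inclusion) :=
  (forall x : src f, x = \bot%O \/ x = \top%O) /\ globular_poset (tgt f).

End Spaces.

(* Main.v *)
(* Let f : X -> Y be a globular subdivision.  By lifting against the generating
   cofibrations, the space of a cellular X is Hausdorff, its points outside the
   states lie on disjoint open lines, the execution paths are generated by these
   lines, and a function vanishing on the states reaches 1 on every execution
   path.  Hence the states of Y which are not states of X are finitely many
   points on each line, and every execution path of Y is cut at its first and
   last visits to the states of X.  This identifies cat Y with the flow Ext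
   obtained from cat X by formally inserting chains of states in the edges given
   by the lines.

   The pushout W of cat X along the chosen replacements of {0<1} -> chain, one for
   each line, is in cell(T^cof); it is presented by words.  A replacement carries
   a contraction onto the chain joined to the original globe (by lifting in the
   q-model structure), and these contractions give a fibrewise deformation
   retraction of W onto Ext, so that W -> Ext is a weak equivalence. *)
Require Import Defs.
From HB Require Import structures.
From mathcomp Require Import all_boot all_order all_algebra.
From mathcomp Require Import generic_quotient.
From mathcomp Require Import all_classical wochoice all_reals all_analysis.
From mathcomp Require Import lra.
Import Defs.

Set Implicit Arguments.
Unset Strict Implicit.
Unset Printing Implicit Defensive.

Import Order.TTheory GRing.Theory Num.Theory.
Import numFieldNormedType.Exports.

Local Open Scope classical_set_scope.
Local Open Scope ring_scope.
Local Open Scope quotient_scope.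

Arguments exec {R} m _.
Arguments states {R} m _.
Arguments disk {R} n _.
Arguments sphere {R} n _.

(** * Continuity tested on paths *)

Section ContinuityTools.

(** A map out of a Delta-generated space is continuous as soon as it is so along paths, and a path
    in a space of paths is a map on the unit square; continuity is mostly checked in this form. In
    the Delta-Hausdorff case quotients and pushouts are reflections whose points cannot be listed.
    Quotients are therefore used only through their universal property, and two words of the pushout
    are identified when they agree in every flow.

    The main obstacle is the continuity of the inverse of Ext -> cat Y. An execution path may wait
    anywhere, so the times of its first and last visits to the states of X jump. What varies
    continuously is the path held at its first state of X until it gets there, and likewise at its
    last one. A second obstacle is that a path joining two edges at a common state leaves only a
    constant path after the cut. Constant paths must not be limits of execution paths, and the
    function that reaches 1 on every execution path excludes this. Hence the summands of the path
    spaces of Ext are not mixed along a continuous family. *)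

Lemma comp_cont (S T U : topologicalType) (f : S -> T) (g : T -> U) :
  continuous f -> continuous g -> continuous (g \o f).
Proof. by move=> cf cg x; apply: continuous_comp; [exact: cf|exact: cg]. Qed.

Lemma pair_cont (S T U : topologicalType) (f : S -> T) (g : S -> U) :
  continuous f -> continuous g -> continuous (fun x => (f x, g x)).
Proof. by move=> cf cg x; apply: cvg_pair; [exact: cf|exact: cg]. Qed.

Lemma fst_cont (S T : topologicalType) : continuous (@fst S T).
Proof. by move=> x; exact: cvg_fst. Qed.

Lemma snd_cont (S T : topologicalType) : continuous (@snd S T).
Proof. by move=> x; exact: cvg_snd. Qed.

Lemma cst_cont (S T : topologicalType) (t : T) : continuous (fun _ : S => t).
Proof. by move=> x; exact: cvg_cst. Qed.

Lemma id_cont (S : topologicalType) : continuous (fun x : S => x).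
Proof. by move=> x; exact: cvg_id. Qed.

Lemma val_cont (T : topologicalType) (A : set T) :
  continuous (fun x : A => val x).
Proof. exact: (@initial_continuous A T set_val). Qed.

Lemma sub_cont (S T : topologicalType) (A : set T) (f : S -> A) :
  continuous (fun x => val (f x)) -> continuous f.
Proof.
move=> /continuousP cf; apply/continuousP => _ [U oU <-].
exact: (cf U oU).
Qed.

Lemma closed_neg (T : topologicalType) (A : set T) : open (~` A) -> closed A.
Proof. by rewrite openC. Qed.

Lemma open_at (T : topologicalType) (U : set T) :
  (forall x, U x -> nbhs x U) -> open U.
Proof. by move=> H; rewrite openE => x Ux; exact: H. Qed.

Lemma paste_cont (S T : topologicalType) (A B : set S) (f : S -> T) :
  closed A -> closed B -> A `|` B = setT ->
  {within A, continuous f} -> {within B, continuous f} -> continuous f.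
Proof.
move=> cA cB AB fA fB; apply/continuous_subspace_setT; rewrite -AB.
exact: withinU_continuous.
Qed.

Lemma within_ext (S T : topologicalType) (A : set S) (f g : S -> T) :
  continuous g -> (forall x, A x -> f x = g x) -> {within A, continuous f}.
Proof.
move=> cg fg; have E : {in A, (g : subspace A -> T) =1 f} by move=> x /set_mem /fg.
exact: subspace_eq_continuous E (continuous_subspaceT cg).
Qed.

Lemma glue_cont (K : realType) (S T : topologicalType) (phi : S -> K)
    (f g h : S -> T) :
  continuous phi -> continuous f -> continuous g ->
  (forall x, phi x <= 0 -> h x = f x) -> (forall x, 0 <= phi x -> h x = g x) ->
  continuous h.
Proof.
move=> cphi cf cg hf hg.
apply: (@paste_cont _ _ [set x | phi x <= 0] [set x | 0 <= phi x]).
- by apply: (@preimage_closed _ _ phi [set y : K | y <= 0]) => [x _|]; [exact: cphi|exact: closed_le].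
- by apply: (@preimage_closed _ _ phi [set y : K | 0 <= y]) => [x _|]; [exact: cphi|exact: closed_ge].
- by apply/seteqP; split => // x _ /=; case: (leP (phi x) 0) => [|/ltW]; [left|right].
- exact: within_ext cf hf.
- exact: within_ext cg hg.
Qed.

End ContinuityTools.

Lemma set_type_compact (T : topologicalType) (A : set T) :
  compact A -> compact [set: A].
Proof.
move=> cA F FF _.
have FA : (fmap (fun x : A => val x) F) A.
  change (F ((fun x : A => val x) @^-1` A)).
  by apply: (filterS _ filterT) => x _; exact: set_mem (valP x).
have [x [Ax clx]] := cA _ (fmap_proper_filter _ FF) FA.
exists (exist _ x (mem_set Ax)); split => // P Q FP [_ [[C oC <-] Cx] CQ].
have Fv : fmap (fun x : A => val x) F [set val p | p in P].
  by rewrite /fmap /=; apply: filterS FP => p Pp; exists p.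
have nC : nbhs x C by apply: open_nbhs_nbhs; split.
have [_ [[p Pp <-] Cp]] := clx _ _ Fv nC.
by exists p; split => //; apply: CQ.
Qed.

Lemma near_cont (S T : topologicalType) (f g : S -> T) s :
  (\forall z \near s, f z = g z) -> {for s, continuous f} ->
  {for s, continuous g}.
Proof.
move=> E cf A; rewrite -(nbhs_singleton E) => /cf fA.
have {}fA : nbhs s (f @^-1` A) by exact: fA.
by apply: filterS2 E fA => z /= <-.
Qed.

Lemma scale_cont (R : realType) (V : normedModType R) (T : topologicalType)
    (f : T -> R) (v : V) :
  continuous f -> continuous (fun x => f x *: v).
Proof. by move=> cf x; apply: cvgZr_tmp; exact: cf. Qed.

Lemma scaleM_cont (R : realType) (V : normedModType R) (T : topologicalType)
    (f : T -> R) (g : T -> V) :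
  continuous f -> continuous g -> continuous (fun x => f x *: g x).
Proof. by move=> cf cg x; apply: cvgZ; [exact: cf|exact: cg]. Qed.

Section RealContinuity.
Variables (R : realType) (T : topologicalType).
Implicit Types f g : T -> R.

Lemma rcontD f g : continuous f -> continuous g ->
  continuous (fun x => f x + g x).
Proof. by move=> cf cg x; apply: cvgD; [exact: cf|exact: cg]. Qed.

Lemma rcontB f g : continuous f -> continuous g ->
  continuous (fun x => f x - g x).
Proof. by move=> cf cg x; apply: cvgB; [exact: cf|exact: cg]. Qed.

Lemma rcontM f g : continuous f -> continuous g ->
  continuous (fun x => f x * g x).
Proof. by move=> cf cg x; apply: cvgM; [exact: cf|exact: cg]. Qed.

Lemma rcont_max f g : continuous f -> continuous g ->
  continuous (fun x => Num.max (f x) (g x)).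
Proof. by move=> cf cg x; apply: continuous_max; [exact: cf|exact: cg]. Qed.

Lemma rcont_min f g : continuous f -> continuous g ->
  continuous (fun x => Num.min (f x) (g x)).
Proof. by move=> cf cg x; apply: continuous_min; [exact: cf|exact: cg]. Qed.

Lemma rcont_norm f : continuous f -> continuous (fun x => `|f x|).
Proof. by move=> cf x; apply: cvg_norm; exact: cf. Qed.

Lemma rcontV f : (forall x, f x != 0) -> continuous f ->
  continuous (fun x => (f x)^-1).
Proof. by move=> f0 cf x; apply: cvgV; [exact: f0|exact: cf]. Qed.

End RealContinuity.

Lemma coord_cont (R : realType) m n (i : 'I_m) (j : 'I_n) :
  continuous (fun v : 'M[R]_(m, n) => v i j).
Proof. exact: coord_continuous. Qed.

Lemma mx_cont (R : realType) (T : topologicalType) m n (f : T -> 'M[R]_(m, n)) :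
  (forall i j, continuous (fun x => f x i j)) -> continuous f.
Proof.
move=> cf x A /nbhs_ballP[e /= e0 eA].
have : \forall y \near x, forall ij : 'I_m * 'I_n, ball (f x ij.1 ij.2) e (f y ij.1 ij.2).
  apply: filter_forall => -[i j] /=.
  by have := cf i j x; move=> /(_ _ (nbhsx_ballx (f x i j) e e0)).
by apply: filterS => y H; apply: eA; split => // i j; exact: (H (i, j)).
Qed.

(** * The unit interval, and Delta-generated spaces tested on it *)

Section Clamp.
Variable R : realType.
Local Notation I := (@unitI R).

Lemma clamp_subproof (x : R) : Num.max 0 (Num.min 1 x) \in @unitI R.
Proof.
rewrite inE /unitI /= in_itv /= le_max lexx /= ge_max ler01 /=.
by rewrite ge_min lexx.
Qed.

Definition cl (x : R) : I := exist (fun y => y \in @unitI R) _ (clamp_subproof x).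

Lemma I_ge0 (t : I) : 0 <= val t.
Proof. by case: t => t /= /set_mem; rewrite /unitI /= in_itv /= => /andP[]. Qed.

Lemma I_le1 (t : I) : val t <= 1.
Proof. by case: t => t /= /set_mem; rewrite /unitI /= in_itv /= => /andP[]. Qed.

Lemma val_cl (x : R) : 0 <= x -> x <= 1 -> val (cl x) = x.
Proof. by move=> x0 x1 /=; rewrite (min_idPr x1) (max_idPr x0). Qed.

Lemma clK (t : I) : cl (val t) = t.
Proof. by apply/val_inj; rewrite val_cl ?I_ge0 ?I_le1. Qed.

Lemma cl_le0 (x : R) : x <= 0 -> cl x = i0 R.
Proof.
move=> x0; apply/val_inj => /=; rewrite (min_idPr (le_trans x0 ler01)).
exact/max_idPl.
Qed.

Lemma cl_ge1 (x : R) : 1 <= x -> cl x = i1 R.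
Proof.
move=> x1; apply/val_inj => /=; rewrite (min_idPl x1).
by apply/max_idPr; exact: ler01.
Qed.

Lemma cl_cont : continuous cl.
Proof.
apply: sub_cont => x /=; apply: continuous_max; first exact: cvg_cst.
by apply: continuous_min; [exact: cvg_cst|exact: cvg_id].
Qed.

Lemma to_unitIE (x : R) : 0 <= x -> x <= 1 -> to_unitI x = cl x.
Proof.
move=> x0 x1; apply/val_inj; rewrite val_cl // /to_unitI insubdK //.
by rewrite inE /unitI /= in_itv /= x0 x1.
Qed.

Lemma cl_mono x y : x <= y -> val (cl x) <= val (cl y).
Proof.
move=> xy /=; rewrite ge_max !le_max lexx /=.
by case: (leP 1 y) => y1; case: (leP 1 x) => x1; rewrite ?ler01 ?lexx ?orbT //; lra.
Qed.

Lemma cl_near (s : I) x : `|val s - val (cl x)| <= `|val s - x|.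
Proof.
have s0 := I_ge0 s; have s1 := I_le1 s.
have [x0|x0] := leP x 0.
  by rewrite cl_le0 // subr0 !ger0_norm //; lra.
have [x1|x1] := leP 1 x; last by rewrite val_cl // ltW.
rewrite cl_ge1 // (_ : val (i1 R) = 1) // !ler0_norm ?subr_le0 //; last lra.
by rewrite opprB opprB lerD2r.
Qed.

Definition Irev (t : I) : I := cl (1 - val t).

Lemma val_Irev t : val (Irev t) = 1 - val t.
Proof. by rewrite val_cl ?subr_ge0 ?I_le1 // lerBlDr lerDl I_ge0. Qed.

Lemma IrevK : involutive Irev.
Proof. by move=> t; apply/val_inj; rewrite !val_Irev subKr. Qed.

Lemma Irev0 : Irev (i0 R) = i1 R.
Proof. by apply/val_inj; rewrite val_Irev /= subr0. Qed.

Lemma Irev1 : Irev (i1 R) = i0 R.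
Proof. by apply/val_inj; rewrite val_Irev /= subrr. Qed.

Lemma Irev_cont : continuous Irev.
Proof.
by apply: comp_cont cl_cont; apply: rcontB; [exact: cst_cont|exact: val_cont].
Qed.

Lemma I_compact : compact [set: I].
Proof.
by apply: set_type_compact; exact: (@segment_compact R 0 1).
Qed.

Lemma set_type_hausdorff (T : topologicalType) (A : set T) :
  hausdorff_space T -> hausdorff_space A.
Proof.
move=> hT x y xy; apply/val_inj; apply: hT => P Q nP nQ.
have [z [Pz Qz]] := xy _ _ (@val_cont _ A x _ nP) (@val_cont _ A y _ nQ).
by exists (val z).
Qed.

Lemma I_hausdorff : hausdorff_space I.
Proof. by apply: set_type_hausdorff; exact: Rhausdorff. Qed.

Lemma I_locally_compact : locally_compact [set: I].
Proof.
move=> x _; exists setT; first by apply: filterT.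
by split; [exact: I_compact|exact: closedT].
Qed.

(** Tube lemma, from the near-covering form of the compactness of [I]. *)
Lemma I_tube (T : topologicalType) (x : T) (P : set (T * I)) :
  (forall p : T * I, p.1 = x -> nbhs p P) -> nbhs x [set y | forall t, P (y, t)].
Proof.
move=> nP.
have /compact_near_coveringP cov := I_compact.
have : \forall y \near nbhs x, [set: I] `<=` (fun t => P (y, t)).
  apply: (cov T (nbhs x) (fun y t => P (y, t)) _) => t _.
  have [[A B] /= [nA nB] AB] := nP (x, t) erefl.
  by exists (B, A) => // -[t' y] [/= Bt Ay]; apply: AB.
by apply: filterS => y H t; exact: H.
Qed.

Lemma cl_cont0 (U : set I) : nbhs (i0 R) U ->
  exists2 e : R, 0 < e & forall s, 0 <= s -> s < e -> U (cl s).
Proof.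
rewrite -(cl_le0 (lexx 0)) => /(cl_cont (x := 0)) /nbhs_ballP[e /= e0 He].
exists e => // s s0 se; apply: He.
by rewrite /ball /= sub0r normrN ger0_norm.
Qed.

(* A path through the points of a convergent sequence: in the coordinate
   [y = 1/s] it is piecewise linear with value [x] at half-integers. *)
Section SequencePath.
Variables (V : normedModType R) (u : nat -> V) (x : V).
Hypothesis ux : u @ \oo --> x.

Let tent (y : R) : R := Num.max 0 (1 - 2 * `|y|).

Let wave (y : R) : V := let m := Num.truncn y in
  x + tent (y - m%:R) *: (u m - x) + tent (y - m.+1%:R) *: (u m.+1 - x).

Let local_wave (k : nat) (y : R) : V :=
  x + tent (y - k%:R) *: (u k - x) + tent (y - k.+1%:R) *: (u k.+1 - x).

Let tent0 y : 1 <= 2 * `|y| -> tent y = 0.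
Proof. by move=> h; apply/max_idPl; lra. Qed.

(** The formula of [wave] switches at the integers. Each tent has half-width 1/2, so the formula for
    one [k] stays valid half a unit beyond both ends of [[k, k+1]]; this overlap gives continuity at
    the integers. *)
Let waveE k y : 0 <= y -> k%:R - 2^-1 < y -> y < k%:R + 3 / 2 ->
  wave y = local_wave k y.
Proof.
move=> y0 ky yk; rewrite /wave /local_wave.
have /andP[my ym] := truncn_itv y0.
set m := Num.truncn y in my ym *.
have [->//|mk] := eqVneq m k.
have [mlt|] := ltnP m k.
  have mk1 : k = m.+1.
    apply/eqP; rewrite eqn_leq mlt andbT leqNgt; apply/negP.
    rewrite -(@ler_nat R) -[m.+2%:R]natr1 => H2.
    by move: ym ky H2; rewrite -[m.+1%:R]natr1; lra.
  subst k; rewrite (tent0 (y := y - m%:R)); last first.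
    by move: ky ym; rewrite -[m.+1%:R]natr1 => ky ym; rewrite ger0_norm; lra.
  rewrite (tent0 (y := y - m.+2%:R)) ?scale0r ?addr0 //.
  move: ky ym; rewrite -[m.+2%:R]natr1 -[m.+1%:R]natr1 => ky ym.
  by rewrite ler0_norm; lra.
rewrite leq_eqVlt eq_sym (negbTE mk) /= => klt.
have mk1 : m = k.+1.
  apply/eqP; rewrite eqn_leq klt andbT leqNgt; apply/negP.
  rewrite -(@ler_nat R) -[k.+2%:R]natr1 -[k.+1%:R]natr1 => H.
  by move: my yk H; lra.
rewrite mk1 in my ym *; rewrite (tent0 (y := y - k.+2%:R)); last first.
  move: yk my; rewrite -[k.+2%:R]natr1 -[k.+1%:R]natr1 => yk my.
  by rewrite ler0_norm; lra.
rewrite (tent0 (y := y - k%:R)) ?scale0r ?addr0 //.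
by move: yk my; rewrite -[k.+1%:R]natr1 => yk my; rewrite ger0_norm; lra.
Qed.

Let tent_cont : continuous tent.
Proof.
apply: rcont_max; first exact: cst_cont.
apply: rcontB; first exact: cst_cont.
by apply: rcontM; [exact: cst_cont|apply: rcont_norm; exact: id_cont].
Qed.

Let local_wave_cont k : continuous (local_wave k).
Proof.
have tc j : continuous (fun y : R => tent (y - j%:R)).
  apply: (@comp_cont _ _ _ (fun y : R => y - j%:R) tent) => //.
  by apply: rcontB; [exact: id_cont|exact: cst_cont].
have sc j (v : V) : continuous (fun y : R => tent (y - j%:R) *: v).
  exact: scale_cont.
move=> y; apply: cvgD; last exact: (sc k.+1).
by apply: cvgD; [exact: cvg_cst|exact: (sc k)].
Qed.

Let wave_cont y : 0 < y -> {for y, continuous wave}.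
Proof.
move=> y0; have /andP[my ym] := truncn_itv (ltW y0); set m := Num.truncn y in my ym.
have E : {near y, local_wave m =1 wave}.
  have nb : \forall z \near y, [/\ 0 < z, m%:R - 2^-1 < z & z < m%:R + 3 / 2].
    near=> z; split; near: z.
    - exact: lt_nbhsr.
    - by apply: lt_nbhsr; lra.
    - by apply: lt_nbhsl; move: ym; rewrite -natr1; lra.
  by apply: filterS nb => z [z0 z1 z2]; rewrite (waveE _ z1 z2) // ltW.
by apply: (@near_cont R V (local_wave m) wave y E); exact: local_wave_cont.
Unshelve. all: by end_near. Qed.

Definition seq_path (s : R) : V := if 0 < s then wave s^-1 else x.

Lemma seq_path_hit k : seq_path (k.+1%:R)^-1 = u k.+1.
Proof.
rewrite /seq_path invr_gt0 ltr0n /= invrK (@waveE k.+1) ?ler0n //; last 2 first.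
- lra.
- lra.
rewrite /local_wave subrr /tent normr0 mulr0 subr0 (max_idPr ler01) scale1r.
rewrite (_ : `|_ - _| = 1) ?mulr1; last first.
  by rewrite -[k.+2%:R]natr1 opprD addNKr normrN normr1.
by rewrite (max_idPl _) ?scale0r ?addr0 ?subrKC //; lra.
Qed.

Lemma seq_path_at s : s <= 0 -> seq_path s = x.
Proof. by rewrite /seq_path leNgt => /negbTE ->. Qed.

(** Two consecutive tents are never positive together, so only one term of the sequence enters at a
    time. Hence the path stays in every convex set containing [x] and the terms. *)
Lemma seq_path_conv s : exists k (l : R),
  [/\ 0 <= l, l <= 1 & seq_path s = x + l *: (u k - x)].
Proof.
rewrite /seq_path; case: ltP => s0; last first.
  by exists 0%N, 0; rewrite scale0r addr0.
rewrite /wave; set y := s^-1.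
have /andP[my ym] : (Num.truncn y)%:R <= y < (Num.truncn y).+1%:R.
  by apply: truncn_itv; rewrite invr_ge0 ltW.
set m := Num.truncn y in my ym *.
have [h|h] := leP (y - m%:R) 2^-1.
  exists m, (tent (y - m%:R)); rewrite (tent0 (y := y - m.+1%:R)).
    by rewrite scale0r addr0 /tent le_max lexx ge_max ler01 /=; split => //; have := normr_ge0 (y - m%:R); lra.
  rewrite -natr1 ler0_norm; move: ym; rewrite -natr1; lra.
exists m.+1, (tent (y - m.+1%:R)); rewrite (tent0 (y := y - m%:R)).
  by rewrite scale0r addr0 /tent le_max lexx ge_max ler01 /=; split => //; have := normr_ge0 (y - m.+1%:R); lra.
by rewrite ger0_norm; lra.
Qed.

Lemma seq_path_cont : continuous seq_path.
Proof.
move=> s; have [s0|s0|s0] := ltgtP 0 s.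
- have E : {near s, (wave \o (fun t => t^-1)) =1 seq_path}.
    by near=> t; rewrite /seq_path ifT //; near: t; exact: lt_nbhsr.
  have C : {for s, continuous (wave \o (fun t : R => t^-1))}.
    apply: continuous_comp; first by apply: inv_continuous; rewrite gt_eqF.
    by apply: wave_cont; rewrite invr_gt0.
  exact: (@near_cont R V _ _ _ E C).
- have E : {near s, (fun=> x) =1 seq_path}.
    by near=> t; rewrite seq_path_at //; near: t; apply: filterS (lt_nbhsl s0) => t /ltW.
  exact: (@near_cont R V _ _ _ E (@cst_cont R V x s)).
- rewrite -s0; apply/cvgrPdist_lt => e e0.
  rewrite (seq_path_at (lexx 0)).
  have := ux; move=> /cvgrPdist_lt /(_ e e0) [N _ uN].
  near=> t; have [t0|t0] := ltP 0 t; last by rewrite seq_path_at // subrr normr0.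
  rewrite /seq_path t0 /wave; set y := t^-1.
  have /andP[my ym] : (Num.truncn y)%:R <= y < (Num.truncn y).+1%:R.
    by apply: truncn_itv; rewrite invr_ge0 ltW.
  have Nm : (N <= Num.truncn y)%N.
    rewrite truncn_ge_nat ?invr_ge0 ?(ltW t0) // /y.
    have tN : t <= N.+1%:R^-1.
      near: t; apply: filterS (lt_nbhsl (_ : 0 < N.+1%:R^-1 :> R)) => [z /ltW //|].
      by rewrite invr_gt0 ltr0n.
    have : N.+1%:R <= t^-1.
      by rewrite -[N.+1%:R]invrK lef_pV2 ?posrE ?invr_gt0 ?ltr0n.
    by apply: le_trans; rewrite ler_nat.
  set m := Num.truncn y in my ym Nm *.
  have t1 : 0 <= tent (y - m%:R) by rewrite /tent le_max lexx.
  have t2 : 0 <= tent (y - m.+1%:R) by rewrite /tent le_max lexx.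
  have t12 : tent (y - m%:R) + tent (y - m.+1%:R) <= 1.
    rewrite /tent ger0_norm ?subr_ge0 // ler0_norm ?subr_le0 ?(ltW ym) //.
    rewrite -[m.+1%:R]natr1; case: (leP 0 (1 - 2 * (y - m%:R)));
      by case: (leP 0 (1 - 2 * - (y - (m%:R + 1)))); lra.
  rewrite -!addrA opprD addNKr normrN.
  apply: (le_lt_trans (ler_normD _ _)); rewrite !normrZ !(ger0_norm t1, ger0_norm t2).
  have := uN m Nm; have := uN m.+1 (leq_trans Nm (leqnSn m)).
  rewrite ![`|x - _|]distrC; set b := `|u m - x|; set c := `|u m.+1 - x| => ce be.
  set p := tent _ in t1 t12 *; set q := tent _ in t2 t12 *.
  have [->|p0] := eqVneq p 0.
    rewrite mul0r add0r.
    have c0 : 0 <= c by exact: normr_ge0.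
    by apply: le_lt_trans ce; nra.
  have : 0 < p by rewrite lt_neqAle eq_sym p0.
  have b0 : 0 <= b by exact: normr_ge0.
  have c0 : 0 <= c by exact: normr_ge0.
  by move=> pp; nra.
Unshelve. all: by end_near. Qed.
End SequencePath.
(** The same notion as [delta_generated], with the interval as the only test space; the equivalence
    is [delta_generatedP]. *)
Definition path_generated (S : topologicalType) := forall U : set S,
  (forall c : I -> S, continuous c -> open (c @^-1` U)) -> open U.

(* Sequences converging fast enough for [d] extend to paths. *)
Definition seq_rich (S : topologicalType) := exists d : S -> S -> R,
  (forall x U, nbhs x U \/
     forall k : nat, exists y, d x y < k.+1%:R^-1 /\ ~ U y) /\
  (forall x (u : nat -> S), (forall k, d x (u k) < k.+1%:R^-1) ->
     exists c : I -> S, [/\ continuous c, c (i0 R) = x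
       & forall k, c (cl k.+1%:R^-1) = u k.+1]).

Lemma near_invS (e : R) : 0 < e -> exists k : nat, k.+1%:R^-1 < e.
Proof.
move=> e0; exists (Num.truncn e^-1).
by rewrite -[ltRHS]invrK ltf_pV2 ?posrE ?invr_gt0 // truncnS_gt.
Qed.

(** If [U] is not a neighbourhood of [x], points outside [U] converge to [x] as fast as wanted. A
    path through them at the times 1/(k+1) starts at [x] and leaves [U] at arbitrarily small times,
    although its preimage of [U] is open. *)
Lemma seq_rich_path_generated (S : topologicalType) :
  seq_rich S -> path_generated S.
Proof.
move=> [d [dn dp]] U Uc; apply: open_at => x Ux.
case: (dn x U) => // /choice[u ux]; exfalso.
have [c [cc c0 cu]] := dp x u (fun k => (ux k).1).
have : nbhs (i0 R) (c @^-1` U) by apply: open_nbhs_nbhs; split; [exact: Uc|rewrite /= c0].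
move=> /cl_cont0 [e e0 He].
have [k ke] := near_invS e0.
by have := He k.+1%:R^-1; rewrite invr_ge0 ler0n /= cu => /(_ isT ke) /(ux k.+1).2.
Qed.

Lemma seq_richM (S T : topologicalType) :
  seq_rich S -> seq_rich T -> seq_rich (S * T)%type.
Proof.
move=> [d [dn dp]] [d' [dn' dp']].
exists (fun x y => Num.max (d x.1 y.1) (d' x.2 y.2)); split.
- move=> [x x'] U; apply/or_asboolP; rewrite -implyNb; apply/implyP.
  move=> /asboolPn nU; apply/asboolP => k; apply: contrapT => H; apply: nU.
  exists ([set y | d x y < k.+1%:R^-1], [set y | d' x' y < k.+1%:R^-1]).
    split => /=.
      by case: (dn x [set y | d x y < k.+1%:R^-1]) => // /(_ k)[y []].
    by case: (dn' x' [set y | d' x' y < k.+1%:R^-1]) => // /(_ k)[y []].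
  move=> [y y'] [/= dy dy']; apply: contrapT => Uy; apply: H; exists (y, y').
  by rewrite gt_max /= dy dy'.
- move=> [x x'] u ux.
  have [k|c [cc c0 cu]] := dp x (fun k => (u k).1).
    by have := ux k; rewrite gt_max => /andP[].
  have [k|c' [cc' c0' cu']] := dp' x' (fun k => (u k).2).
    by have := ux k; rewrite gt_max => /andP[].
  exists (fun t => (c t, c' t)); split => [||k]; first exact: pair_cont.
    by rewrite c0 c0'.
  by rewrite cu cu' -surjective_pairing.
Qed.

(** The distance is that of the ambient norm, and the path is [seq_path], which convexity keeps
    inside [A]. *)
Lemma convex_seq_rich (V : normedModType R) (A : set V) :
  (forall x y l, A x -> A y -> 0 <= l -> l <= 1 -> A (x + l *: (y - x))) ->
  seq_rich A.
Proof.
move=> cA; exists (fun x y => `|val x - val y|); split.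
- move=> x U; have [nU|nU] := pselect (nbhs x U); [by left|right] => k.
  apply: contrapT => H; apply: nU.
  have : nbhs x ((fun y : A => val y) @^-1` ball (val x) k.+1%:R^-1).
    by apply: val_cont; apply: nbhsx_ballx; rewrite invr_gt0 ltr0n.
  apply: filterS => y /= By; apply: contrapT => Uy; apply: H; exists y; split => //.
  by move: By; rewrite -ball_normE.
- move=> x u ux.
  have cu : (fun k => val (u k)) @ \oo --> val x.
    apply/cvgrPdist_lt => e e0; have [k ke] := near_invS e0.
    exists k => // m km; apply: lt_trans (ux m) _.
    apply: le_lt_trans ke; rewrite lef_pV2 ?posrE ?ltr0n // ler_nat.
    exact: km.
  have Ac s : A (seq_path (fun k => val (u k)) (val x) s).
    have [k [l [l0 l1 ->]]] := seq_path_conv (fun k => val (u k)) (val x) s.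
    by apply: cA => //; exact: set_mem (valP _).
  exists (fun t : I => exist (fun y => y \in A) _ (mem_set (Ac (val t)))).
  split => [||k].
  + apply: sub_cont => /=; apply: (comp_cont (@val_cont _ _)).
    exact: seq_path_cont.
  + by apply/val_inj => /=; rewrite seq_path_at.
  + apply/val_inj; rewrite /= -[Num.max _ _]/(val (cl _)) val_cl ?seq_path_hit //.
    by rewrite invf_le1 ?ler1n ?ltr0n.
Qed.

Lemma simplex_seq_rich n : seq_rich (@simplex R n).
Proof.
apply: convex_seq_rich => x y l [x0 x1] [y0 y1] l0 l1; split => [i|].
  rewrite !mxE; have := x0 i; have := y0 i; nra.
under eq_bigr do rewrite !mxE mulrBr.
rewrite big_split /= x1 sumrB -!mulr_sumr x1 y1; lra.
Qed.

Lemma I_seq_rich : seq_rich I.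
Proof.
apply: convex_seq_rich => x y l; rewrite /unitI /= !in_itv /=.
move=> /andP[x0 x1] /andP[y0 y1] l0 l1; rewrite /GRing.scale /=.
apply/andP; split; nra.
Qed.

Lemma simplex_of_I_subproof (t : I) :
  (\row_(i < 2) (if i == 0 then 1 - val t else val t)) \in @simplex R 1.
Proof.
rewrite inE /simplex /=; split=> [i|].
  by rewrite mxE; case: ifP => _; rewrite ?subr_ge0 ?I_le1 ?I_ge0.
by rewrite !big_ord_recl big_ord0 !mxE /= addr0 subrK.
Qed.

Definition simplex_of_I (t : I) : @simplex R 1 :=
  exist (fun y => y \in @simplex R 1) _ (simplex_of_I_subproof t).

Definition I_of_simplex (v : @simplex R 1) : I := cl (val v 0 ord_max).

Lemma simplex_of_IK : cancel simplex_of_I I_of_simplex.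
Proof. by move=> t; rewrite /I_of_simplex /= mxE /= clK. Qed.

Lemma simplex_of_I_cont : continuous simplex_of_I.
Proof.
apply: sub_cont => /=; apply: mx_cont => i j.
under eq_fun do rewrite mxE.
case: (j == 0); last exact: val_cont.
by apply: rcontB; [exact: cst_cont|exact: val_cont].
Qed.

Lemma I_of_simplex_cont : continuous I_of_simplex.
Proof.
apply: comp_cont cl_cont.
apply: (@comp_cont _ _ _ (fun v : @simplex R 1 => val v) (fun v : 'rV[R]_2 => v 0 ord_max)).
  exact: val_cont.
exact: coord_cont.
Qed.

Section DeltaPaths.
Variable T : topologicalType.

(** The interval is a retract of the 1-simplex, so simplices detect at least as much as paths.
    Conversely every simplex is itself path-generated. *)
Lemma delta_open_path (U : set T) :
  delta_open R U <-> forall c : I -> T, continuous c -> open (c @^-1` U).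
Proof.
split=> [dU c cc|pU n p cp].
  have := dU _ _ (comp_cont I_of_simplex_cont cc).
  move=> oU; have : open (simplex_of_I @^-1` ((c \o I_of_simplex) @^-1` U)).
    by move/continuousP: simplex_of_I_cont; exact.
  congr open; apply/seteqP; split => t; rewrite /preimage /=;
    by rewrite simplex_of_IK.
apply: (seq_rich_path_generated (@simplex_seq_rich n)) => c cc.
exact: (pU _ (comp_cont cc cp)).
Qed.

Lemma delta_generatedP : delta_generated R T <-> path_generated T.
Proof.
split=> [dT U Uc|pT U /delta_open_path]; last exact: pT.
by apply: dT; apply/delta_open_path.
Qed.

Lemma kelley_openP (U : set (kelley R T)) :
  open U <-> forall c : I -> T, continuous c -> open (c @^-1` (U : set T)).
Proof. exact: delta_open_path. Qed.

Lemma kelley_id_cont : continuous (fun x : kelley R T => x : T).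
Proof.
by apply/continuousP => U oU; apply/kelley_openP => c /continuousP; exact.
Qed.

Lemma path_to_kelley (c : I -> T) :
  continuous c -> continuous (c : I -> kelley R T).
Proof. by move=> cc; apply/continuousP => U /kelley_openP; exact. Qed.

Lemma path_of_kelley (c : I -> kelley R T) :
  continuous c -> continuous (c : I -> T).
Proof. by move=> cc; apply: comp_cont cc kelley_id_cont. Qed.

End DeltaPaths.

Lemma kelley_delta_generated (T : topologicalType) :
  delta_generated R (kelley R T).
Proof.
apply/delta_generatedP => U Uc; apply/kelley_openP => c cc.
exact/Uc/path_to_kelley.
Qed.

Lemma path_cont (S T : topologicalType) (f : S -> T) : delta_generated R S ->
  (forall c : I -> S, continuous c -> continuous (f \o c)) -> continuous f.
Proof.
move=> /delta_generatedP gS fc; apply/continuousP => U oU; apply: gS => c cc.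
by have /continuousP := fc c cc; exact.
Qed.

Lemma II_delta_generated : delta_generated R (I * I)%type.
Proof.
apply/delta_generatedP; apply: seq_rich_path_generated.
exact: seq_richM I_seq_rich I_seq_rich.
Qed.

(* Delta-Hausdorff spaces, in the form in which the property is inherited. *)
Definition path_separated (T : topologicalType) := forall p q : I -> T,
  continuous p -> continuous q -> closed [set x : I * I | p x.1 = q x.2].

(** Suppose [p s] and [q t] differ. Points are closed, so [p] avoids [q t] on a closed interval
    around [s]. Clamping to that interval ([J]) gives a path [p \o J] with closed image, which [q]
    then avoids near [t]. *)
Lemma delta_hausdorff_separated (T : topologicalType) :
  delta_hausdorff R T -> path_separated T.
Proof.
move=> hT p q cp cq; apply: closed_neg; apply: open_at => -[s t] /= pq.
have cpt (y : T) : closed [set y].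
  have -> : [set y] = range (fun _ : I => y).
    by apply/seteqP; split => [_ ->|_ [_ _ <-]//]; exists (i0 R).
  by apply: hT; exact: cst_cont.
have op : open (p @^-1` ~` [set q t]).
  by have /continuousP := cp; apply; rewrite openC.
have ns : nbhs s (p @^-1` ~` [set q t]).
  by apply: open_nbhs_nbhs; split.
have [e e0 He] : exists2 e : R, 0 < e &
    forall s' : I, `|val s - val s'| <= e -> p s' <> q t.
  move: ns => [_ [[B oB <-]] /= Bs BU].
  have /nbhs_ballP[e /= e0 He] : nbhs (val s) B by apply: open_nbhs_nbhs; split.
  exists (e / 2); first by rewrite divr_gt0.
  move=> s' ss'; apply: BU; apply: He.
  by rewrite /ball /=; apply: le_lt_trans ss' _; rewrite ltr_pdivrMr //; lra.
pose J (r : I) : I := cl (Num.max (val s - e) (Num.min (val s + e) (val r))).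
have cJ : continuous J.
  apply: comp_cont cl_cont; apply: rcont_max; first exact: cst_cont.
  by apply: rcont_min; [exact: cst_cont|exact: val_cont].
have sJ r : `|val s - val (J r)| <= e.
  apply: le_trans (cl_near _ _) _; rewrite ler_norml.
  case: (leP (val s + e) (val r)) => h1.
    by rewrite (max_idPr _); lra.
  by case: (leP (val s - e) (val r)) => h2; lra.
have JE (s' : I) : `|val s - val s'| <= e -> J s' = s'.
  rewrite ler_norml => /andP[h1 h2]; rewrite -[RHS]clK; congr cl.
  by rewrite (min_idPr _) ?(max_idPr _) //; lra.
have cJp := hT _ (comp_cont cJ cp).
have oq : open (q @^-1` ~` range (p \o J)).
  by have /continuousP := cq; apply; rewrite openC.
have nt : nbhs t (q @^-1` ~` range (p \o J)).
  by apply: open_nbhs_nbhs; split => // -[r _ /= E]; exact: He (sJ r) E.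
exists ([set s' : I | `|val s - val s'| < e], q @^-1` ~` range (p \o J)).
  split => //=; have : nbhs s ((fun s' : I => val s') @^-1` ball (val s) e).
    by apply: val_cont; exact: nbhsx_ballx.
  by apply: filterS => s'; rewrite /ball /=.
move=> [s' t'] [/= ss' nt'] E; apply: nt'; exists s' => //=.
by rewrite JE // ltW.
Qed.

Lemma closed_path (S : topologicalType) (C : set S) : delta_generated R S ->
  (forall c : I -> S, continuous c -> closed (c @^-1` C)) -> closed C.
Proof.
move=> /delta_generatedP gS Cc; apply: closed_neg; apply: gS => c cc.
by rewrite preimage_setC openC; exact: Cc.
Qed.

(** The preimage of the image of [p] along a path [c] is the projection of the closed set of
    coincidences of [c] and [p]; the projection along the compact factor is closed. *)
Lemma path_separated_hausdorff (T : topologicalType) :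
  delta_generated R T -> path_separated T -> delta_hausdorff R T.
Proof.
move=> gT sT p cp; apply: (closed_path gT) => c cc.
have cC := sT c p cc cp.
apply: closed_neg; apply: open_at => s ns.
have : nbhs s [set y : I | forall t, (~` [set x : I * I | c x.1 = p x.2]) (y, t)].
  apply: I_tube => -[y t] /= ->; apply: open_nbhs_nbhs; split.
    by rewrite openC.
  by move=> /= E; apply: ns; exists t.
by apply: filterS => y H [t _ /= E]; exact: (H t).
Qed.

(** The separating family is a predicate [P] on maps, so that it may range over all target spaces at
    once: all admissible quotients, all evaluations of a word, all evaluations of a path. *)
Lemma path_separated_joint (T : topologicalType)
    (P : forall U : topologicalType, (T -> U) -> Prop) :
  (forall (U : topologicalType) (f : T -> U),
     P U f -> (forall c : I -> T, continuous c -> continuous (f \o c)) /\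
              path_separated U) ->
  (forall x y, (forall (U : topologicalType) (f : T -> U),
     P U f -> f x = f y) -> x = y) ->
  path_separated T.
Proof.
move=> Pf Pinj p q cp cq; apply: closed_neg; apply: open_at => -[s t] /= pq.
have [U [f [Pff fpq]]] :
    exists (U : topologicalType) (f : T -> U), P U f /\ f (p s) <> f (q t).
  apply: contrapT => H; apply: pq; apply: Pinj => U f Pff.
  by apply: contrapT => fpq; apply: H; exists U, f.
have [cf sU] := Pf U f Pff.
have cl := sU _ _ (cf _ cp) (cf _ cq).
have oU : open (~` [set x : I * I | (f \o p) x.1 = (f \o q) x.2]) by rewrite openC.
have : nbhs ((s, t) : I * I) (~` [set x : I * I | (f \o p) x.1 = (f \o q) x.2]).
  by apply: open_nbhs_nbhs; split.
by apply: filterS => -[s' t'] /= H E; apply: H; rewrite E.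
Qed.

Lemma in_TopP hd (T : topologicalType) : in_Top R hd T <->
  path_generated T /\ (hd -> path_separated T).
Proof.
split=> [[gT hT]|[gT hT]].
  by split; [exact/delta_generatedP|move=> h; exact/delta_hausdorff_separated/hT].
have gT' : delta_generated R T by exact/delta_generatedP.
by split => // h; apply: path_separated_hausdorff => //; exact: hT.
Qed.

End Clamp.

(** * Quotients and mapping spaces *)

Section Connected.
Variable R : realType.
Local Notation I := (@unitI R).

Lemma I_clopen (A : set I) : open A -> closed A -> (exists t, A t) ->
  forall t, A t.
Proof.
move=> oA cA [t0 At0] t.
have : connected [set: I].
  have -> : [set: I] = (@cl R) @` `[0, 1].
    apply/seteqP; split => // x _; exists (val x); last exact: clK.
    by rewrite /= in_itv /= I_ge0 I_le1.
  apply: connected_continuous_connected; first exact: segment_connected.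
  by apply: continuous_subspaceT; exact: cl_cont.
move=> /(_ A) -> //; first by exists t0.
- by exists A => //; rewrite setTI.
- by exists A => //; rewrite setTI.
Qed.

Lemma path_discrete (S : choiceType) (c : I -> discrete_topology S) :
  continuous c -> forall t, c t = c (i0 R).
Proof.
move=> cc; apply: (I_clopen (A := [set t | c t = c (i0 R)])); last by exists (i0 R).
- by move/continuousP: (cc) => /(_ [set c (i0 R)]); apply; exact: discrete_open.
- apply: (@preimage_closed _ _ c [set c (i0 R)]); first by move=> x _; exact: cc.
  exact: discrete_closed.
Qed.

Variables S T : topologicalType.

Lemma inl_cont : continuous (@inl S T).
Proof. by apply/continuousP => U [oU _]. Qed.

Lemma inr_cont : continuous (@inr S T).
Proof. by apply/continuousP => U [_ oU]. Qed.

Lemma sum_cont (Z : topologicalType) (f : S + T -> Z) :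
  continuous (f \o inl) -> continuous (f \o inr) -> continuous f.
Proof.
move=> /continuousP cl /continuousP cr; apply/continuousP => U oU.
by split; [exact: cl|exact: cr].
Qed.

Lemma path_sum (c : I -> (S + T)%type) : continuous c ->
  (exists2 a : I -> S, continuous a & c = inl \o a) \/
  (exists2 b : I -> T, continuous b & c = inr \o b).
Proof.
move=> cc; pose L : set (S + T) := range inl.
have oL : open L.
  split; last by rewrite (_ : _ @^-1` _ = set0) //; [exact: open0|apply/seteqP; split => // x []].
  by rewrite (_ : _ @^-1` _ = setT) //; [exact: openT|apply/seteqP; split => // x _; exists x].
have oL' : open (~` L).
  split.
    by rewrite (_ : _ @^-1` _ = set0) //; [exact: open0|apply/seteqP; split => // x []; exists x].
  by rewrite (_ : _ @^-1` _ = setT) //; [exact: openT|apply/seteqP; split => // x _ []].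
have op (A : set (S + T)) : open A -> open (c @^-1` A).
  by move=> oA; have /continuousP := cc; apply.
have [[t Lt]|nL] := pselect (exists t, (c @^-1` L) t); [left|right].
  have H : forall t, (c @^-1` L) t.
    apply: I_clopen; [exact: op|apply: closed_neg|by exists t].
    by rewrite preimage_setC; exact: op.
  have /choice[a ac] : forall t, exists s, c t = inl s.
    by move=> t'; have [s _ <-] := H t'; exists s.
  exists a; last by apply/funext.
  apply/continuousP => U oU.
  have -> : a @^-1` U = c @^-1` (inl @` U).
    apply/seteqP; split => [x Ux|x [s Us]]; first by exists (a x); rewrite // ac.
    by rewrite ac => -[E]; rewrite /preimage /= -E.
  apply: op; split.
    by rewrite (_ : _ @^-1` _ = U) //; apply/seteqP; split => [x [s Us [<-]]|x Ux] //; exists x.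
  by rewrite (_ : _ @^-1` _ = set0) //; [exact: open0|apply/seteqP; split => // x []].
have /choice[b bc] : forall t, exists s, c t = inr s.
  move=> t; case E : (c t) => [s|s]; last by exists s.
  by exfalso; apply: nL; exists t; rewrite /= E; exists s.
exists b; last by apply/funext.
apply/continuousP => U oU.
have -> : b @^-1` U = c @^-1` (inr @` U).
  apply/seteqP; split => [x Ux|x [s Us]]; first by exists (b x); rewrite // bc.
  by rewrite bc => -[E]; rewrite /preimage /= -E.
apply: op; split.
  by rewrite (_ : _ @^-1` _ = set0) //; [exact: open0|apply/seteqP; split => // x []].
by rewrite (_ : _ @^-1` _ = U) //; apply/seteqP; split => [x [s Us [<-]]|x Ux] //; exists x.
Qed.

Lemma in_Top_sum hd : in_Top R hd S -> in_Top R hd T -> in_Top R hd (S + T)%type.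
Proof.
move=> /in_TopP[gS sS] /in_TopP[gT sT]; apply/in_TopP; split=> [U Uc|h p q cp cq].
  split; [apply: gS => c cc|apply: gT => c cc].
    by apply: (Uc (inl \o c)); exact: comp_cont cc inl_cont.
  by apply: (Uc (inr \o c)); exact: comp_cont cc inr_cont.
case: (path_sum cp) => -[p' cp' ->]; case: (path_sum cq) => -[q' cq' ->].
- rewrite (_ : mkset _ = [set x : I * I | p' x.1 = q' x.2]); first exact: sS.
  by apply/seteqP; split => x /= [] // ->.
- by rewrite (_ : mkset _ = set0); [exact: closed0|apply/seteqP; split].
- by rewrite (_ : mkset _ = set0); [exact: closed0|apply/seteqP; split].
- rewrite (_ : mkset _ = [set x : I * I | p' x.1 = q' x.2]); first exact: sT.
  by apply/seteqP; split => x /= [] // ->.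
Qed.

End Connected.

Section TopFacts.
Variable R : realType.
Local Notation I := (@unitI R).

Lemma in_Top_discrete hd (S : choiceType) : in_Top R hd (discrete_topology S).
Proof.
apply/in_TopP; split=> [U _|h p q cp cq]; first exact: discrete_open.
have [pq|pq] := pselect (p (i0 R) = q (i0 R)).
  rewrite (_ : mkset _ = setT); first exact: closedT.
  by apply/seteqP; split => // x _ /=; rewrite !(path_discrete cp, path_discrete cq).
rewrite (_ : mkset _ = set0); first exact: closed0.
by apply/seteqP; split => // x /=; rewrite (path_discrete cp) (path_discrete cq).
Qed.

Lemma path_separated_inj (S T : topologicalType) (f : S -> T) :
  continuous f -> injective f -> path_separated R T -> path_separated R S.
Proof.
move=> cf fI sT.
apply: (path_separated_joint (P := fun U g => continuous g /\ path_separated R U)).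
  by move=> U g [cg sU]; split => // c cc; exact: comp_cont cc cg.
by move=> x y H; apply/fI/H.
Qed.

Lemma hausdorff_separated (T : topologicalType) :
  hausdorff_space T -> path_separated R T.
Proof.
move=> hT; apply: delta_hausdorff_separated => p cp.
apply: compact_closed => //; apply: continuous_compact; last exact: I_compact.
exact: continuous_subspaceT.
Qed.

Lemma in_Top_I hd : in_Top R hd I.
Proof.
apply/in_TopP; split; first exact: seq_rich_path_generated (@I_seq_rich R).
by move=> _; apply: hausdorff_separated; exact: I_hausdorff.
Qed.

Lemma in_Top_kelley (hd : bool) (T : topologicalType) :
  (hd -> path_separated R T) -> in_Top R hd (kelley R T).
Proof.
move=> sT; apply/in_TopP; split.
  by apply/delta_generatedP; exact: kelley_delta_generated.
move=> /sT.
exact: (path_separated_inj (f := fun x : kelley R T => x : T) (@kelley_id_cont R T)).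
Qed.

Lemma path_separatedM (S T : topologicalType) :
  path_separated R S -> path_separated R T -> path_separated R (S * T)%type.
Proof.
move=> sS sT.
apply: (path_separated_joint (P := fun U g => continuous g /\ path_separated R U)).
  by move=> U g [cg sU]; split => // c cc; exact: comp_cont cc cg.
move=> [x y] [x' y'] H; congr pair.
- by apply: (H S fst); split => //; exact: fst_cont.
- by apply: (H T snd); split => //; exact: snd_cont.
Qed.

Lemma path_separated_sub (T : topologicalType) (A : set T) :
  path_separated R T -> path_separated R A.
Proof. by apply: path_separated_inj; [exact: val_cont|exact: val_inj]. Qed.

Lemma in_Top_sep (hd : bool) T : in_Top R hd T -> hd -> path_separated R T.
Proof. by move=> /in_TopP[]. Qed.

Lemma in_Top_gen hd T : in_Top R hd T -> delta_generated R T.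
Proof. by case. Qed.

Lemma quotient_path_generated (T : topologicalType) (Q : quotType T) :
  path_generated R T -> path_generated R (quotient_topology Q).
Proof.
move=> gT U Uc.
suff oU : open ((\pi_(quotient_topology Q) : T -> _) @^-1` U) by exact: oU.
apply: gT => c cc.
apply: (Uc (\pi_(quotient_topology Q) \o c)); apply: comp_cont cc _; exact: pi_continuous.
Qed.

Section Quotient.
Variables (hd : bool) (T : topologicalType) (E : T -> T -> Prop).
Hypothesis gT : delta_generated R T.

(** The kernel of [f] is one of the relations over which [top_eq] takes the intersection: the
    quotient by it injects continuously into [Z], so it inherits separation, and it is
    Delta-generated as a quotient. *)
Lemma top_quotient_factor (Z : topologicalType) (f : T -> Z) :
  continuous f -> (hd -> path_separated R Z) ->
  (forall x y, E x y -> f x = f y) ->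
  forall x y, top_eq R hd E x y -> f x = f y.
Proof.
move=> cf sZ Ef x y /asboolP H.
pose r (u v : T) : bool := `[< f u = f v >].
have rr : reflexive r by move=> u; apply/asboolP.
have rs : symmetric r by move=> u v; apply/asboolP/asboolP => ->.
have rt : transitive r.
  by move=> v u w /asboolP uv /asboolP vw; apply/asboolP; rewrite uv.
pose e : equiv_rel T := EquivRel r rr rs rt.
suff : e x y by move/asboolP.
apply: H => [u v uv|h]; first by apply/asboolP; exact: Ef.
pose Q := quotient_topology {eq_quot e}.
pose j (c : Q) : Z := f (repr c).
have jE u : j (\pi_Q u) = f u.
  suff : e (repr (\pi_Q u)) u by move/asboolP.
  by apply/eqmodP; rewrite reprK.
have cj : continuous j.
  by apply/quotient_continuous; rewrite (_ : _ \o _ = f) //; apply/funext.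
have jI : injective j.
  move=> c d cd; rewrite -[c]reprK -[d]reprK; apply/eqmodP.
  exact/asboolP.
apply: path_separated_hausdorff; last exact: path_separated_inj cj jI (sZ h).
by apply/delta_generatedP; apply: quotient_path_generated; exact/delta_generatedP.
Qed.

Local Notation Q := (top_quotient R hd E).

Lemma top_proj_surj (c : Q) : exists x, top_proj R hd E x = c.
Proof. by exists (repr c); rewrite /top_proj reprK. Qed.

Lemma top_proj_cont : continuous (top_proj R hd E).
Proof. exact: pi_continuous. Qed.

Lemma top_proj_eq x y : E x y -> top_proj R hd E x = top_proj R hd E y.
Proof. by move=> xy; apply/eqmodP/asboolP => r Er _; exact: Er. Qed.

Lemma top_lift_eq (Z : topologicalType) (f : T -> Z) :
  continuous f -> (hd -> path_separated R Z) ->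
  (forall x y, E x y -> f x = f y) ->
  forall x, f (repr (top_proj R hd E x)) = f x.
Proof.
move=> cf sZ Ef x; apply: (top_quotient_factor cf sZ Ef).
by apply/eqmodP; rewrite reprK.
Qed.

Lemma top_lift_cont (Z : topologicalType) (f : T -> Z) :
  continuous f -> (hd -> path_separated R Z) ->
  (forall x y, E x y -> f x = f y) ->
  continuous (fun c : Q => f (repr c)).
Proof.
move=> cf sZ Ef; apply/quotient_continuous.
by rewrite (_ : _ \o _ = f) //; apply/funext => x; exact: top_lift_eq.
Qed.

(** By definition [top_eq] is an intersection of relations with Delta-Hausdorff quotients, so the
    projections to these quotients separate the points of [Q] jointly. *)
Lemma in_Top_quotient : in_Top R hd Q.
Proof.
apply/in_TopP; split.
  by apply: quotient_path_generated; exact/delta_generatedP.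
move=> h.
apply: (path_separated_joint (P := fun U (f : Q -> U) =>
  continuous f /\ path_separated R U)).
  by move=> U g [cg sU]; split => // c' cc; exact: comp_cont cc cg.
move=> c d H; rewrite -[c]reprK -[d]reprK; apply/eqmodP/asboolP => r Er hr.
pose Q' := quotient_topology {eq_quot r}.
have cp : continuous (\pi_Q' : T -> Q') by exact: pi_continuous.
have sQ : hd -> path_separated R Q'.
  by move=> _; apply: delta_hausdorff_separated; exact: hr.
have EQ x y : E x y -> \pi_Q' x = \pi_Q' y by move=> /Er xy; apply/eqmodP.
apply/eqmodP; apply: (H Q' (fun c => \pi_Q' (repr c))).
by split; [exact: (top_lift_cont cp sQ EQ)|exact: sQ].
Qed.

End Quotient.

(** A generating family of paths, possibly smaller than the set of all paths. The last clause makes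
    every point lie on a member of [F], so that properties of single points can also be read off
    along [F]. *)
Definition final_paths (P : topologicalType) (F : set (I -> P)) :=
  [/\ forall c, F c -> continuous c,
      forall U, (forall c, F c -> open (c @^-1` U)) -> open U
    & forall x, exists c t, F c /\ c t = x].

Lemma final_quotient hd (T : topologicalType) (E : T -> T -> Prop) :
  delta_generated R T ->
  final_paths [set top_proj R hd E \o c | c in [set c : I -> T | continuous c]].
Proof.
move=> /delta_generatedP gT; split.
- by move=> _ [c cc <-]; apply: comp_cont cc _; exact: top_proj_cont.
- move=> U H; apply: (gT (top_proj R hd E @^-1` U)) => c cc.
  by apply: (H (top_proj R hd E \o c)); exists c.
- move=> x; have [y <-] := top_proj_surj x.
  exists (top_proj R hd E \o (fun=> y)), (i0 R); split => //.
  by exists (fun=> y) => //; exact: cst_cont.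
Qed.

Section Currying.
Import ArrowAsCompactOpen.

(** The curried map into the compact-open topology can be tested along [F], because the topology of
    [P] is final for [F]. It can be uncurried again because [I] is locally compact Hausdorff. *)
Lemma final_curry (P Z : topologicalType) (F : set (I -> P)) (g : P -> I -> Z) :
  final_paths F ->
  (forall c, F c -> continuous (fun x : I * I => g (c x.1) x.2)) ->
  continuous (fun x : P * I => g x.1 x.2).
Proof.
move=> [Fc FU Fs] gF.
have E : (fun x : P * I => g x.1 x.2) = uncurry g by apply/funext => -[].
rewrite E; apply: continuous_uncurry; first exact: I_locally_compact.
- exact: I_hausdorff.
- apply/continuousP => W oW; apply: FU => c Fcc.
  have := continuous_curry_fun (gF c Fcc).
  by move=> /continuousP; exact.
- move=> x; have [c [t [Fcc <-]]] := Fs x.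
  apply: (comp_cont (f := fun s => (t, s)) _ (gF c Fcc)).
  by apply: pair_cont; [exact: cst_cont|exact: id_cont].
Qed.

Lemma path_curryP (Z : topologicalType) (g : I -> I -> Z) :
  (forall t, continuous (g t)) ->
  continuous (g : I -> {compact-open, I -> Z}) <->
  continuous (fun x : I * I => g x.1 x.2).
Proof.
move=> cg; split => [H|H]; last exact: (continuous_curry_fun H).
have E : (fun x : I * I => g x.1 x.2) = uncurry g by apply/funext => -[].
rewrite E; apply: continuous_uncurry => //.
- exact: I_locally_compact.
- exact: I_hausdorff.
Qed.

End Currying.

(* Cartesian closedness: in Delta-generated spaces a product of quotient maps
   is a quotient map. *)
Lemma final_prod (P Q Z : topologicalType) (F : set (I -> P))
    (G : set (I -> Q)) (g : P -> Q -> Z) :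
  final_paths F -> final_paths G ->
  (forall c d, F c -> G d -> continuous (fun x : I * I => g (c x.1) (d x.2))) ->
  forall a b, continuous a -> continuous b ->
    continuous (fun t : I => g (a t) (b t)).
Proof.
move=> fF fG gFG a b ca cb.
have sw c : F c -> continuous (fun x : I * I => g (c x.1) (b x.2)).
  move=> Fc.
  have H : continuous (fun x : Q * I => g (c x.2) x.1).
    apply: (final_curry (g := fun q s => g (c s) q) fG) => d Gd.
    apply: (comp_cont (f := fun x : I * I => (x.2, x.1)) _ (gFG c d Fc Gd)).
    by apply: pair_cont; [exact: snd_cont|exact: fst_cont].
  apply: (comp_cont (f := fun x : I * I => (b x.2, x.1)) _ H).
  by apply: pair_cont; [exact: comp_cont (@snd_cont _ _) cb|exact: fst_cont].
have H : continuous (fun x : P * I => g x.1 (b x.2)).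
  exact: (final_curry (g := fun p s => g p (b s)) fF).
apply: (comp_cont (f := fun t => (a t, t)) _ H).
by apply: pair_cont => //; exact: id_cont.
Qed.

Lemma kelley_prod_cont (S T Z : topologicalType) (g : S * T -> Z) :
  (forall a b, continuous a -> continuous b ->
     continuous (fun t : I => g (a t, b t))) ->
  continuous (g : kelley R (S * T)%type -> Z).
Proof.
move=> H; apply: (path_cont (@kelley_delta_generated R _)) => c cc.
have cc' := path_of_kelley cc.
rewrite (_ : _ \o c = fun t => g ((fst \o c) t, (snd \o c) t)).
  apply: H; first exact: comp_cont cc' (@fst_cont _ _).
  exact: comp_cont cc' (@snd_cont _ _).
by apply/funext => t /=; rewrite -surjective_pairing.
Qed.

Lemma kelley_prod_path (S T Z : topologicalType) (g : S * T -> Z) a b :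
  continuous (g : kelley R (S * T)%type -> Z) ->
  continuous a -> continuous b -> continuous (fun t : I => g (a t, b t)).
Proof.
move=> cg ca cb; apply: (comp_cont (f := (fun t => (a t, b t)) : I -> kelley R (S * T)%type)) cg.
by apply: path_to_kelley; exact: pair_cont.
Qed.

Section PathsOfPaths.
Variable T : topologicalType.

Lemma TOP_contP (a : I -> TOP R I T) :
  continuous a <-> continuous (fun x : I * I => TOP_fun (a x.1) x.2).
Proof.
have ca t : continuous (TOP_fun (a t)) by exact: set_mem (valP (a t)).
pose W := set_type [set f : {compact-open, I -> T} | continuous f].
split=> [/path_of_kelley cW|H].
  apply/(path_curryP ca).
  exact: (comp_cont (cW : continuous (a : I -> W)) (@val_cont _ _)).
apply: path_to_kelley; apply: (@sub_cont _ _ _ (a : I -> W)).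
by apply/(path_curryP ca).
Qed.

Lemma TOP_fun_cont (f : TOP R I T) : continuous (TOP_fun f).
Proof. exact: set_mem (valP f). Qed.

Lemma TOP_fun_inj (f g : TOP R I T) : TOP_fun f = TOP_fun g -> f = g.
Proof. exact: val_inj. Qed.

Definition TOP_mk (f : I -> T) (cf : continuous f) : TOP R I T :=
  exist (fun f => f \in [set f : {compact-open, I -> T} | continuous f])
    f (mem_set cf).

Lemma TOP_eval_cont (t : I) : continuous (fun f : TOP R I T => TOP_fun f t).
Proof.
apply: (path_cont (@kelley_delta_generated R _)) => c /TOP_contP cc.
apply: (comp_cont (f := fun s => (s, t)) _ cc).
by apply: pair_cont; [exact: id_cont|exact: cst_cont].
Qed.

Lemma in_Top_TOP (hd : bool) : (hd -> path_separated R T) ->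
  in_Top R hd (TOP R I T).
Proof.
move=> sT; apply/in_TopP; split.
  by apply/delta_generatedP; exact: kelley_delta_generated.
move=> h.
apply: (path_separated_joint (P := fun U (f : TOP R I T -> U) =>
  continuous f /\ path_separated R U)).
  by move=> U g [cg sU]; split => // c' cc; exact: comp_cont cc cg.
move=> f g H; apply/TOP_fun_inj/funext => t.
apply: (H T (fun f => TOP_fun f t)).
by split; [exact: TOP_eval_cont|exact: sT].
Qed.

End PathsOfPaths.

Section PathSpaces.
Variable X : md_data R.

Lemma path_space_contP (a b : X) (p : I -> path_space a b) :
  continuous p <-> continuous (fun x : I * I => path_fun (p x.1) x.2).
Proof.
rewrite -[X in _ <-> X](TOP_contP (fun t => val (p t))).
split=> [/path_of_kelley cp|H].
  exact: (comp_cont (cp : continuous (p : I -> path_set a b)) (@val_cont _ _)).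
apply: path_to_kelley; exact: (@sub_cont _ _ _ (p : I -> path_set a b)).
Qed.

Lemma path_fun_inj (a b : X) (p q : path_space a b) :
  path_fun p = path_fun q -> p = q.
Proof. by move=> pq; apply/val_inj/TOP_fun_inj. Qed.

Lemma path_space_gen (a b : X) : delta_generated R (path_space a b).
Proof. exact: kelley_delta_generated. Qed.

Lemma path_mk_proof (a b : X) (g : I -> X) (cg : continuous g) :
  exec X g -> g (i0 R) = a -> g (i1 R) = b -> TOP_mk cg \in path_set a b.
Proof. by move=> eg g0 g1; apply: mem_set. Qed.

Definition path_mk (a b : X) (g : I -> X) (cg : continuous g) (eg : exec X g)
    (g0 : g (i0 R) = a) (g1 : g (i1 R) = b) : path_space a b :=
  exist (fun f => f \in path_set a b) (TOP_mk cg) (path_mk_proof cg eg g0 g1).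

End PathSpaces.

Lemma reparam_id : reparam (fun t : I => t).
Proof. by split => //; apply/seteqP; split => // x _; exists x. Qed.

Lemma reparam_surj (phi : I -> I) : reparam phi -> forall y, exists x, phi x = y.
Proof.
move=> rp y; have [x _ <-] : range phi y by rewrite rp.2.
by exists x.
Qed.

Lemma reparam0 (phi : I -> I) : reparam phi -> phi (i0 R) = i0 R.
Proof.
move=> rp; have [y Ey] := reparam_surj rp (i0 R).
apply/val_inj/eqP; rewrite eq_le; apply/andP; split; last exact: I_ge0.
by rewrite -Ey; rewrite Ey -[X in _ <= val X]Ey; apply: rp.1; exact: I_ge0.
Qed.

Lemma reparam1 (phi : I -> I) : reparam phi -> phi (i1 R) = i1 R.
Proof.
move=> rp; have [y Ey] := reparam_surj rp (i1 R).
apply/val_inj/eqP; rewrite eq_le; apply/andP; split; first exact: I_le1.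
by rewrite -[X in val X <= _]Ey; apply: rp.1; exact: I_le1.
Qed.

(** A nondecreasing surjection cannot jump: the values [phi s - e/2] and [phi s + e/2], when they
    lie in the interval, are attained on either side of [s], and monotonicity bounds [phi] in
    between. *)
Lemma mono_surj_cont (phi : I -> I) : reparam phi -> continuous phi.
Proof.
move=> rp; apply: sub_cont => s A /nbhs_ballP[e /= e0 He].
have nlt (y : I) : val y < val s -> \forall s' \near s, val y < val s'.
  move=> ys; have : nbhs (val s) [set x | val y < x] by exact: lt_nbhsr.
  by move=> /(@val_cont _ _ s).
have ngt (y : I) : val s < val y -> \forall s' \near s, val s' < val y.
  move=> ys; have : nbhs (val s) [set x | x < val y] by exact: lt_nbhsl.
  by move=> /(@val_cont _ _ s).
have lo : nbhs s [set s' | val (phi s) - e < val (phi s')].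
  have [h|h] := ltP (val (phi s) - e) 0.
    by apply: filterS filterT => s' _; apply: lt_le_trans h (I_ge0 _).
  have p1 := I_le1 (phi s).
  have [y Ey] := reparam_surj rp (cl (val (phi s) - e / 2)).
  have vy : val (phi y) = val (phi s) - e / 2 by rewrite Ey val_cl //; lra.
  have ys : val y < val s.
    by rewrite ltNge; apply/negP => /(rp.1 _ _); rewrite vy; lra.
  apply: filterS (nlt y ys) => s' /ltW /(rp.1 _ _).
  by apply: lt_le_trans; rewrite vy; lra.
have hi : nbhs s [set s' | val (phi s') < val (phi s) + e].
  have [h|h] := ltP 1 (val (phi s) + e).
    by apply: filterS filterT => s' _; apply: le_lt_trans (I_le1 _) h.
  have p1 := I_ge0 (phi s).
  have [y Ey] := reparam_surj rp (cl (val (phi s) + e / 2)).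
  have vy : val (phi y) = val (phi s) + e / 2 by rewrite Ey val_cl //; lra.
  have ys : val s < val y.
    by rewrite ltNge; apply/negP => /(rp.1 _ _); rewrite vy; lra.
  apply: filterS (ngt y ys) => s' /ltW /(rp.1 _ _) h'.
  by apply: le_lt_trans h' _; rewrite vy; lra.
rewrite /fmap /=; apply: filterS2 lo hi => s' l h; apply: He.
by move: l h; rewrite /ball /= ltr_norml => l h; apply/andP; split; lra.
Qed.

Lemma reparam_mk (f : R -> R) : continuous f -> f 0 = 0 -> f 1 = 1 ->
  (forall x y, 0 <= x -> x <= y -> y <= 1 -> f x <= f y) ->
  reparam (fun t : I => cl (f (val t))).
Proof.
move=> cf f0 f1 fm; split=> [s t st|].
  by apply: cl_mono; apply: fm; rewrite ?I_ge0 ?I_le1.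
apply/seteqP; split => // y _.
have [||x] := @IVT R f 0 1 (val y) ler01.
- exact: continuous_subspaceT.
- by rewrite f0 f1 min_l ?max_r ?I_ge0 ?I_le1.
rewrite in_itv /= => /andP[x0 x1] fx; exists (cl x) => //.
by rewrite val_cl // fx clK.
Qed.

Lemma concatE (T : Type) (g h : I -> T) t : concat g h t =
  if val t <= 2^-1 then g (cl (2 * val t)) else h (cl (2 * val t - 1)).
Proof.
rewrite /concat; have t0 := I_ge0 t; have t1 := I_le1 t; case: leP => th.
  by rewrite to_unitIE //; lra.
by rewrite to_unitIE //; lra.
Qed.

Lemma concat_comp (S T : Type) (f : S -> T) (g h : I -> S) :
  f \o concat g h = concat (f \o g) (f \o h).
Proof. by apply/funext => t /=; rewrite !concatE; case: ifP. Qed.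

Definition reparam_concat (phi psi : I -> I) (t : I) : I :=
  if val t <= 2^-1 then cl (val (phi (cl (2 * val t))) / 2)
  else cl ((1 + val (psi (cl (2 * val t - 1)))) / 2).

Lemma val_reparam_concat phi psi t : val (reparam_concat phi psi t) =
  if val t <= 2^-1 then val (phi (cl (2 * val t))) / 2
  else (1 + val (psi (cl (2 * val t - 1)))) / 2.
Proof.
rewrite /reparam_concat; case: ifP => _; rewrite val_cl //.
- have := I_ge0 (phi (cl (2 * val t))); lra.
- have := I_le1 (phi (cl (2 * val t))); lra.
- have := I_ge0 (psi (cl (2 * val t - 1))); lra.
- have := I_le1 (psi (cl (2 * val t - 1))); lra.
Qed.

Lemma reparam_concatP phi psi : reparam phi -> reparam psi ->
  reparam (reparam_concat phi psi).
Proof.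
move=> rp rs; split=> [s t st|].
  rewrite !val_reparam_concat.
  case: (leP (val s) 2^-1) => hs; case: (leP (val t) 2^-1) => ht.
  - by rewrite ler_pM2r //; apply: rp.1; apply: cl_mono; lra.
  - have := I_le1 (phi (cl (2 * val s))).
    by have := I_ge0 (psi (cl (2 * val t - 1))); lra.
  - by move: st hs ht; lra.
  - by rewrite ler_pM2r // lerD2l; apply: rs.1; apply: cl_mono; lra.
apply/seteqP; split => // y _; have y0 := I_ge0 y; have y1 := I_le1 y.
have [yh|yh] := leP (val y) 2^-1.
  have [x Ex] := reparam_surj rp (cl (2 * val y)).
  exists (cl (val x / 2)) => //; apply/val_inj; rewrite val_reparam_concat.
  have x0 := I_ge0 x; have x1 := I_le1 x.
  rewrite val_cl; [|lra|lra]; rewrite ifT; last lra.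
  rewrite (_ : 2 * (val x / 2) = val x); last lra.
  by rewrite clK Ex val_cl; lra.
have [x Ex] := reparam_surj rs (cl (2 * val y - 1)).
exists (cl ((1 + val x) / 2)) => //; apply/val_inj; rewrite val_reparam_concat.
have x0 := I_ge0 x; have x1 := I_le1 x.
rewrite val_cl; [|lra|lra]; case: leP => h.
  have x00 : val x = 0 by lra.
  have xE : x = i0 R by exact/val_inj.
  move: Ex; rewrite xE (reparam0 rs) => /(congr1 val).
  by rewrite val_cl; [rewrite (_ : val (i0 R) = 0) //; lra|lra|lra].
rewrite (_ : 2 * ((1 + val x) / 2) - 1 = val x); last lra.
by rewrite clK Ex val_cl; lra.
Qed.

Lemma concat_reparam (T : Type) (g h : I -> T) phi psi :
  reparam phi -> reparam psi -> g (i1 R) = h (i0 R) ->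
  concat (g \o phi) (h \o psi) = concat g h \o reparam_concat phi psi.
Proof.
move=> rp rs gh; apply/funext => t; rewrite [RHS]/= !concatE.
rewrite val_reparam_concat; case: leP => ht; rewrite /comp.
  have := I_le1 (phi (cl (2 * val t))) => p1; rewrite ifT; last lra.
  by rewrite (_ : 2 * (_ / 2) = val (phi (cl (2 * val t)))) ?clK //; lra.
(* If [psi] is still 0, the new time is exactly 1/2, where [concat] reads its first path; the
   junction hypothesis makes both readings agree. *)
set x := psi _; have x0 := I_ge0 x; case: leP => h'.
  have x00 : val x = 0 by lra.
  have xE : x = i0 R by exact/val_inj.
  by rewrite xE -gh; congr g; rewrite cl_ge1 //=; lra.
by rewrite (_ : 2 * _ - 1 = val x) ?clK //; lra.
Qed.

Lemma concat_cont (S T : topologicalType) (g h : S -> I -> T) :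
  continuous (fun x : S * I => g x.1 x.2) ->
  continuous (fun x : S * I => h x.1 x.2) ->
  (forall s, g s (i1 R) = h s (i0 R)) ->
  continuous (fun x : S * I => concat (g x.1) (h x.1) x.2).
Proof.
move=> cg ch gh.
have ct : continuous (fun x : S * I => val x.2) :> Prop.
  by apply: comp_cont (@snd_cont _ _) (@val_cont _ _).
apply: (glue_cont (phi := fun x : S * I => val x.2 - 2^-1)
  (f := fun x => g x.1 (cl (2 * val x.2)))
  (g := fun x => h x.1 (cl (2 * val x.2 - 1)))).
- by apply: rcontB => //; exact: cst_cont.
- apply: (comp_cont (f := fun x : S * I => (x.1, cl (2 * val x.2))) _ cg).
  apply: pair_cont; first exact: fst_cont.
  by apply: comp_cont (@cl_cont R); apply: rcontM => //; exact: cst_cont.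
- apply: (comp_cont (f := fun x : S * I => (x.1, cl (2 * val x.2 - 1))) _ ch).
  apply: pair_cont; first exact: fst_cont.
  apply: comp_cont (@cl_cont R); apply: rcontB; last exact: cst_cont.
  by apply: rcontM => //; exact: cst_cont.
- by move=> x h2; rewrite concatE ifT //; lra.
- move=> x h2; rewrite concatE; case: leP => // h3.
  have E : val x.2 = 2^-1 by lra.
  by rewrite E cl_ge1 ?cl_le0 //; lra.
Qed.

End TopFacts.

(** * The flow cat X *)

Section CatFlow.
Variables (R : realType) (hd : bool) (X : MdTop R hd).
Local Notation I := (@unitI R).
Local Notation proj a b := (top_proj R hd (@reparam_rel R (sval X) (val a) (val b))).

Definition cls (a b : states (sval X)) (p : path_space (val a) (val b)) :
  cat_path a b := top_proj R hd (@reparam_rel R (sval X) (val a) (val b)) p.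

Lemma cls_cont a b : continuous (@cls a b).
Proof. exact: top_proj_cont. Qed.

Lemma cls_surj a b (x : cat_path a b) : exists p, cls p = x.
Proof. exact: top_proj_surj. Qed.

Lemma cls_reparam a b (p q : path_space (val a) (val b)) phi : reparam phi ->
  path_fun q = path_fun p \o phi -> cls p = @cls a b q.
Proof. by move=> rphi E; apply: top_proj_eq; exists phi. Qed.

Lemma in_Top_cat_path (a b : states (sval X)) : in_Top R hd (cat_path a b).
Proof. exact/in_Top_quotient/path_space_gen. Qed.

Lemma concat_path_cont (S : topologicalType) (a b c : sval X)
    (p : S -> path_space a b) (q : S -> path_space b c) :
  delta_generated R S -> continuous p -> continuous q ->
  continuous (fun s => concat_path (p s) (q s)).
Proof.
move=> gS cp cq; apply: (path_cont gS) => u cu.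
apply/path_space_contP.
apply: (concat_cont (g := fun s => path_fun (p (u s))) (h := fun s => path_fun (q (u s)))).
- by apply/(path_space_contP (fun s => p (u s))); exact: comp_cont cu cp.
- by apply/(path_space_contP (fun s => q (u s))); exact: comp_cont cu cq.
move=> s; have [_ _ ->] := path_funP (p (u s)).
by have [_ -> _] := path_funP (q (u s)).
Qed.

Lemma path_fun_concat (a b c : sval X) (p : path_space a b) (q : path_space b c) :
  path_fun (concat_path p q) = concat (path_fun p) (path_fun q).
Proof. by []. Qed.

Lemma concat_path_reparam (a b c : sval X) (p p' : path_space a b)
    (q q' : path_space b c) :
  reparam_rel p p' -> reparam_rel q q' ->
  reparam_rel (concat_path p q) (concat_path p' q').
Proof.
move=> [phi rphi Ep] [psi rpsi Eq]; exists (reparam_concat phi psi).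
  exact: reparam_concatP.
rewrite !path_fun_concat Ep Eq concat_reparam //.
have [_ _ ->] := path_funP p.
by have [_ -> _] := path_funP q.
Qed.

Lemma reparam_rel_refl (a b : sval X) (p : path_space a b) : reparam_rel p p.
Proof. by exists id => //; exact: reparam_id. Qed.

(** Composition is defined on chosen representatives, and in the Delta-Hausdorff case two
    representatives of one class need not be linked by reparametrizations. Independence of the
    choice comes from the universal property of the quotient, applied to one factor at a time. *)
Lemma flow_concatE (a b c : states (sval X)) (p : path_space (val a) (val b))
    (q : path_space (val b) (val c)) :
  flow_concat (cls p : flow_path (f := cat_flow X) a b) (cls q) = cls (concat_path p q).
Proof.
have sQ : hd -> path_separated R (cat_path a c).
  by apply: in_Top_sep; exact: in_Top_cat_path.
rewrite /flow_concat /=.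
transitivity (cls (concat_path p (repr (cls q)))).
  apply: (top_lift_eq (@path_space_gen R (sval X) _ _)
    (f := fun p => cls (concat_path p (repr (cls q))) : cat_path a c)) => //.
    apply: comp_cont (@cls_cont a c).
    apply: concat_path_cont; [exact: path_space_gen|exact: id_cont|exact: cst_cont].
  move=> p1 p2 p12; apply: top_proj_eq; apply: concat_path_reparam => //.
  exact: reparam_rel_refl.
apply: (top_lift_eq (@path_space_gen R (sval X) _ _)
  (f := fun q => cls (concat_path p q) : cat_path a c)) => //.
  apply: comp_cont (@cls_cont a c).
  apply: concat_path_cont; [exact: path_space_gen|exact: cst_cont|exact: id_cont].
move=> p1 p2 p12; apply: top_proj_eq; apply: concat_path_reparam => //.
exact: reparam_rel_refl.
Qed.

(** The usual reparametrization for associativity has decreasing slopes 2, 1, 1/2; being concave, it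
    is the minimum of its three affine pieces, which makes its continuity immediate. *)
Definition assoc_fun (t : R) : R :=
  Num.min (2 * t) (Num.min (t + 4^-1) ((t + 1) / 2)).

Lemma assoc_funE t : assoc_fun t = if t <= 4^-1 then 2 * t
  else if t <= 2^-1 then t + 4^-1 else (t + 1) / 2.
Proof.
rewrite /assoc_fun; case: (leP t 4^-1) => h1; case: (leP t 2^-1) => h2;
  by [rewrite !min_l; lra | rewrite min_r ?min_l; lra | rewrite min_r ?min_r; lra
     | lra].
Qed.

Lemma concat_assoc (T : Type) (p q r : I -> T) :
  p (i1 R) = q (i0 R) -> q (i1 R) = r (i0 R) ->
  concat (concat p q) r =
  concat p (concat q r) \o (fun t : I => cl (assoc_fun (val t))).
Proof.
move=> pq qr; apply/funext => t; rewrite /comp !concatE.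
have t0 := I_ge0 t; have t1 := I_le1 t.
rewrite assoc_funE; case: (leP (val t) 4^-1) => h1.
  rewrite ifT; last lra.
  by rewrite val_cl ?ifT //; lra.
case: (leP (val t) 2^-1) => h2.
  rewrite !val_cl; [|lra..].
  rewrite ifF; last lra.
  rewrite ifF; last lra.
  rewrite ifT; last lra.
  by congr (q (cl _)); lra.
rewrite !val_cl; [|lra..].
rewrite ifF; last lra.
rewrite ifF; last lra.
by congr (r (cl _)); lra.
Qed.

Lemma reparam_assoc : reparam (fun t : I => cl (assoc_fun (val t))).
Proof.
apply: reparam_mk.
- by apply: rcont_min; [apply: rcontM; [exact: cst_cont|exact: id_cont]|
    apply: rcont_min; [apply: rcontD; [exact: id_cont|exact: cst_cont]|
      apply: rcontM; [apply: rcontD; [exact: id_cont|exact: cst_cont]|exact: cst_cont]]].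
- by rewrite assoc_funE ifT; lra.
- by rewrite assoc_funE !ifF; lra.
- move=> x y x0 xy y1; rewrite !assoc_funE.
  case: (leP x 4^-1); case: (leP x 2^-1); case: (leP y 4^-1); case: (leP y 2^-1); lra.
Qed.

Lemma is_flow_cat : is_flow R hd (cat_flow X).
Proof.
split=> [a b|a b c|a b c d x y z]; first exact: in_Top_cat_path.
- apply: kelley_prod_cont => u v cu cv.
  pose Fq (a b : states (sval X)) := [set (@cls a b) \o c | c in
    [set c : I -> path_space (val a) (val b) | continuous c]].
  have fq a' b' : final_paths (Fq a' b') by apply: final_quotient; exact: path_space_gen.
  apply: (final_prod (g := fun x y => flow_concat (x : flow_path (f := cat_flow X) a b) y) (fq a b) (fq b c)) => //.
  move=> _ _ [p cp <-] [q cq <-].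
  rewrite (_ : (fun _ => _) = (fun x : I * I => cls (concat_path (p x.1) (q x.2)))); last first.
    by apply/funext => x; exact: flow_concatE.
  apply: comp_cont (@cls_cont a c); apply: concat_path_cont.
  + exact: II_delta_generated.
  + exact: comp_cont (@fst_cont _ _) cp.
  + exact: comp_cont (@snd_cont _ _) cq.
- have [p <-] := cls_surj x; have [q <-] := cls_surj y; have [r <-] := cls_surj z.
  rewrite !flow_concatE; symmetry; apply: (cls_reparam reparam_assoc).
  rewrite !path_fun_concat concat_assoc //.
    have [_ _ ->] := path_funP p.
    by have [_ -> _] := path_funP q.
  have [_ _ ->] := path_funP q.
  by have [_ -> _] := path_funP r.
Qed.

End CatFlow.

(** * Lifting through transfinite compositions *)

Section TowerLifting.
Variable C : category.

Lemma pushout_lifts (a b c d x y : C) (f : hom a b) (g : hom a c)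
    (i : hom b d) (j : hom c d) (p : hom x y) :
  is_pushout f g i j -> lifts f p -> lifts j p.
Proof.
move=> [E U] L u v uv.
have [|h [hf ph]] := L (u \c g) (v \c i).
  by rewrite compA uv -compA -E compA.
have [w [[wi wj] _]] := U _ h u hf.
exists w; split=> //.
have vij : (v \c i) \c f = (v \c j) \c g by rewrite -!compA E.
have [w0 [_ uniq]] := U _ (v \c i) (v \c j) vij.
transitivity w0; last exact: uniq.
by symmetry; apply: uniq; rewrite -!compA wi wj ph uv.
Qed.

Context {disp : Order.disp_t} {W : orderType disp}.
Variables (X : @tower C disp W) (c : C) (leg : forall i, True -> hom (tob X i) c).
Hypothesis wo : well_order (<=%O : rel W).
Hypothesis coc : cocontinuous X.
Hypothesis col : is_colimit (D := fun _ => True) leg.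

Lemma wo_least (P : W -> Prop) : (exists i, P i) ->
  exists2 i, P i & forall k, P k -> (i <= k)%O.
Proof.
move=> [i Pi]; have [|m [[/asboolP Pm lm] _]] := wo (A := fun k => `[< P k >]).
  by exists i; apply/asboolP.
by exists m => // k Pk; apply: lm; apply/asboolP.
Qed.

Lemma wo_ind (P : W -> Prop) :
  (forall j, (forall i, (i < j)%O -> P i) -> P j) -> forall j, P j.
Proof.
move=> H j; apply: contrapT => nP.
have [m nPm lm] := wo_least (P := fun k => ~ P k) (ex_intro _ j nP).
apply: nPm; apply: H => i im; apply: contrapT => /lm.
by rewrite leNgt im.
Qed.

Lemma limit_or_succ (j : W) :
  [\/ forall i, (j <= i)%O, exists i, is_succ i j | is_limit j].
Proof.
have [h1|h1] := pselect (forall i, (j <= i)%O); first by apply: Or31.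
have [h2|h2] := pselect (exists i, is_succ i j); first by apply: Or32.
apply: Or33; split => //; apply: contrapT => h; apply: h1 => i.
by rewrite leNgt; apply/negP => ij; apply: h; exists i.
Qed.

Lemma leg_comp i j (h : (i <= j)%O) : leg j I \c tmap X h = leg i I.
Proof. exact: col.1. Qed.

Lemma tmap_compE i j k (h : (i <= j)%O) (h' : (j <= k)%O) (h'' : (i <= k)%O) :
  tmap X h' \c tmap X h = tmap X h''.
Proof. by rewrite (@tmap_comp _ _ _ X _ _ _ h h' h''). Qed.

Section Lift.
Variables (x y : C) (p : hom x y) (o : W) (u : hom (tob X o) x) (v : hom c y).
Hypothesis uv : p \c u = v \c leg o I.
Hypothesis suc : forall i j (h : (i <= j)%O), is_succ i j -> lifts (tmap X h) p.

Let pt := {k : W & hom (tob X k) x}.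

(** A partial lift, seen as a set of pairs (stage, map). It extends [u], lies over [v], is coherent,
    and is closed under passing to smaller stages above [o]. As a set it can be fed to Zorn's
    lemma. *)
Let good (G : set pt) := [/\
  forall k h, G (existT _ k h) -> exists le : (o <= k)%O, h \c tmap X le = u,
  forall k h, G (existT _ k h) -> p \c h = v \c leg k I,
  forall k h k' h', G (existT _ k h) -> G (existT _ k' h') ->
    forall le : (k <= k')%O, h' \c tmap X le = h
  & forall k h k', G (existT _ k h) -> (o <= k')%O -> (k' <= k)%O ->
    exists h', G (existT _ k' h')].

(** Glues a partial lift defined on all stages of [D] above [o] into a map out of the colimit over
    [D]. The relation [Q] sends each stage through any later stage of the partial lift, so that
    stages below [o] get their map through [o]; coherence makes the result independent of the stage
    used. *)
Let extend (G : set pt) (D : W -> Prop) d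
    (l : forall i, D i -> hom (tob X i) d) (v' : hom d y) :
  good G -> is_colimit l -> D o -> (forall i (Di : D i), v' \c l i Di = v \c leg i I) ->
  (forall i, D i -> (o <= i)%O -> exists h, G (existT _ i h)) ->
  exists w : hom d x, p \c w = v' /\
    forall i h (Di : D i), G (existT _ i h) -> w \c l i Di = h.
Proof.
move=> [G1 G2 G3 G4] [l1 l2] Do v'E tot.
pose Q i (h : hom (tob X i) x) := exists k hk (le : (i <= k)%O),
  [/\ D k, G (existT _ k hk) & h = hk \c tmap X le].
have Qex i : D i -> exists h, Q i h.
  move=> Di; have [oi|/ltW io] := leP o i.
    have [h Gh] := tot i Di oi; exists h, i, h, (lexx i); split => //.
    by rewrite tmap_id compm1.
  have [h Gh] := tot o Do (lexx o).
  by exists (h \c tmap X io), o, h, io.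
have Quniq i h h' : Q i h -> Q i h' -> h = h'.
  move=> [k [hk [le [_ Gk ->]]]] [k' [hk' [le' [_ Gk' ->]]]].
  have [kk'|/ltW kk'] := leP k k'.
    by rewrite -(G3 _ _ _ _ Gk Gk' kk') -compA (tmap_compE _ _ le').
  by rewrite -(G3 _ _ _ _ Gk' Gk kk') -compA (tmap_compE _ _ le).
pose f i (Di : D i) : hom (tob X i) x := projT1 (cid (Qex i Di)).
have fQ i Di : Q i (f i Di) by rewrite /f; case: cid.
have pf i Di : p \c f i Di = v' \c l i Di.
  rewrite v'E; have [k [hk [le [Dk Gk ->]]]] := fQ i Di.
  by rewrite compA (G2 _ _ Gk) -compA leg_comp.
have fc i j (le : (i <= j)%O) Di Dj : f j Dj \c tmap X le = f i Di.
  apply: (Quniq i) (fQ i Di).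
  have [k [hk [le' [Dk Gk ->]]]] := fQ j Dj.
  exists k, hk, (le_trans le le'); split => //.
  by rewrite -compA (tmap_compE _ _ (le_trans le le')).
have [w [wl _]] := l2 _ f fc; exists w; split.
  have v'c i j (h : (i <= j)%O) Di Dj :
      (v' \c l j Dj) \c tmap X h = v' \c l i Di by rewrite -compA l1.
  have [w' [_ w'u]] := l2 _ (fun i Di => v' \c l i Di) v'c.
  transitivity w'; last exact: w'u.
  by symmetry; apply: w'u => i Di; rewrite -compA wl pf.
move=> i h Di Gh; rewrite wl; apply: (Quniq i) (fQ i Di) _.
by exists i, h, (lexx i); split => //; rewrite tmap_id compm1.
Qed.

Let add (G : set pt) j (hj : hom (tob X j) x) : good G ->
  (forall i, (i < j)%O -> (o <= i)%O -> exists h, G (existT _ i h)) ->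
  (forall h, ~ G (existT _ j h)) ->
  (exists le : (o <= j)%O, hj \c tmap X le = u) -> p \c hj = v \c leg j I ->
  (forall i h (le : (i <= j)%O), G (existT _ i h) -> hj \c tmap X le = h) ->
  good (G `|` [set existT _ j hj]).
Proof.
move=> [G1 G2 G3 G4] Gbelow Gj hju hjv hjG.
have Glt k h : G (existT _ k h) -> (k < j)%O.
  move=> Gk; rewrite ltNge; apply/negP => jk.
  have [le _] := hju; have [h' /Gj] := G4 _ _ _ Gk le jk; exact.
have E k h : [set existT (fun k => hom (tob X k) x) j hj] (existT _ k h) ->
    exists e : j = k, eq_rect j (fun k => hom (tob X k) x) hj k e = h.
  move=> /esym e.
  exact: (match e in _ = s return (exists e0 : j = projT1 s,
      eq_rect j (fun k => hom (tob X k) x) hj (projT1 s) e0 = projT2 s) with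
    erefl => ex_intro _ erefl erefl end).
split.
- by move=> k h [/G1//|/E[e eh]]; subst k; rewrite -eh.
- by move=> k h [/G2//|/E[e eh]]; subst k; rewrite -eh.
- move=> k h k' h' [Gk|/E[e eh]] [Gk'|/E[e' eh']] le.
  + exact: G3.
  + by subst k'; rewrite -eh' /=; exact: hjG.
  + by subst k; have := Glt _ _ Gk'; rewrite ltNge le.
  + by subst k k'; rewrite -eh -eh' /= tmap_id compm1.
- move=> k h k' [Gk|/E[e eh]] ok' k'k.
    by have [h' Gh'] := G4 _ _ _ Gk ok' k'k; exists h'; left.
  subst k; have [k'j|jk'] := ltP k' j.
    by have [h' Gh'] := Gbelow _ k'j ok'; exists h'; left.
  have ek : k' = j by apply/eqP; rewrite eq_le k'k.
  by subst k'; exists hj; right.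
Qed.

(** A maximal partial lift is total: the least missing stage would be [o] itself, a successor (use
    the lifting hypothesis) or a limit (use [extend] on the colimit of the earlier stages), and in
    each case the partial lift could be enlarged. *)
Lemma tower_lift : exists w : hom c x, w \c leg o I = u /\ p \c w = v.
Proof.
have [G [gG Gmax]] : exists G, good G /\ forall B, G `<` B -> ~ good B.
  apply: Zorn_bigcup => F Fgood tF; split.
  - by move=> k h [G FG Gk]; have [H _ _ _] := Fgood _ FG; exact: H.
  - by move=> k h [G FG Gk]; have [_ H _ _] := Fgood _ FG; exact: H.
  - move=> k h k' h' [G FG Gk] [G' FG' Gk'].
    have [GG'|GG'] := tF _ _ FG FG'.
      by have [_ _ H _] := Fgood _ FG'; apply: H => //; exact: GG'.
    by have [_ _ H _] := Fgood _ FG; apply: H => //; exact: GG'.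
  - move=> k h k' [G FG Gk] ok' k'k.
    have [_ _ _ H] := Fgood _ FG; have [h' Gh'] := H _ _ _ Gk ok' k'k.
    by exists h', G.
have tot i : (o <= i)%O -> exists h, G (existT _ i h).
  apply: contraPP => nG oi.
  have [j [oj nGj] jmin] := wo_least (P := fun k => (o <= k)%O /\
    ~ exists h, G (existT _ k h)) (ex_intro _ i (conj oi nG)).
  have below k : (k < j)%O -> (o <= k)%O -> exists h, G (existT _ k h).
    move=> kj ok; apply: contrapT => H.
    by have := jmin k (conj ok H); rewrite leNgt kj.
  have Gj h : ~ G (existT _ j h) by move=> Gh; apply: nGj; exists h.
  have contra hj : good (G `|` [set existT _ j hj]) -> False.
    move=> gB; apply: (Gmax _ _ gB); split; first by move=> z Gz; left.
    by move=> /(_ (existT _ j hj)); move=> /(_ (or_intror erefl)) /Gj.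
  move: oj; rewrite le_eqVlt => /orP[/eqP oj|oj].
    subst j; apply: (contra u); apply: add => //.
    - by exists (lexx o); rewrite tmap_id compm1.
    - move=> k h le Gk; have [G1 _ _ _] := gG.
      have [le' _] := G1 _ _ Gk.
      have ek : k = o by apply/eqP; rewrite eq_le le le'.
      by exfalso; subst k; exact: Gj Gk.
  case: (limit_or_succ j) => [h|[k kj]|lj].
  - by have := h o; rewrite leNgt oj.
  - have ok : (o <= k)%O by case: (kj.2 o) => //; rewrite leNgt oj.
    have [hk Gk] := below _ kj.1 ok.
    have [G1 G2 G3 G4] := gG.
    have [|hj [hjk phj]] := @suc k j (ltW kj.1) kj hk (v \c leg j I).
      by rewrite (G2 _ _ Gk) -compA leg_comp.
    apply: (contra hj); apply: add => //.
    + exists (ltW oj); have [le <-] := G1 _ _ Gk.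
      by rewrite -hjk -compA (tmap_compE _ _ (ltW oj)).
    + move=> i' h le Gi'.
      case: (kj.2 i') => [i'k|ji'].
        by rewrite -(G3 _ _ _ _ Gi' Gk i'k) -hjk -compA (tmap_compE _ _ le).
      have ei : i' = j by apply/eqP; rewrite eq_le le ji'.
      by exfalso; subst i'; exact: Gj Gi'.
  - have [||hj [phj hjG]] := extend (v' := v \c leg j I) gG (coc lj) oj.
    + by move=> k kj; rewrite -compA leg_comp.
    + by move=> k kj ok; exact: below.
    have [h0 G0] := below _ oj (lexx o).
    have [G1 G2 G3 G4] := gG.
    apply: (contra hj); apply: add => //.
    + exists (ltW oj); rewrite (hjG _ _ oj G0).
      by have [le <-] := G1 _ _ G0; rewrite tmap_id compm1.
    + move=> i' h le Gi'.
      have [i'j|ji'] := ltP i' j.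
        by rewrite -(hjG _ _ i'j Gi'); congr (_ \c tmap X _); exact: Prop_irrelevance.
      have ei : i' = j by apply/eqP; rewrite eq_le le ji'.
      by exfalso; subst i'; exact: Gj Gi'.
have [||w [pw wG]] := extend (v' := v) gG col Logic.I.
- by move=> i [].
- by move=> i _ oi; exact: tot.
exists w; split => //.
have [h0 G0] := tot o (lexx o).
rewrite (wG _ _ Logic.I G0); have [G1 _ _ _] := gG.
by have [le <-] := G1 _ _ G0; rewrite tmap_id compm1.
Qed.

End Lift.
End TowerLifting.

(** * Functions on cellular multipointed d-spaces *)

Section GlobeFacts.
Variables (R : realType) (hd : bool).
Local Notation I := (@unitI R).

Lemma globe_pre_gen (Z : topologicalType) : delta_generated R (globe_pre R Z).
Proof.
apply: (in_Top_gen (hd := false)); apply: in_Top_sum.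
  by apply/in_TopP; split=> // U _; exact: discrete_open.
exact: in_Top_kelley.
Qed.

Section GlobeLift.
Variables (Z T : topologicalType) (a : bool -> T) (f : Z * I -> T).
Hypothesis sT : hd -> path_separated R T.
Hypothesis cf : continuous (f : kelley R (Z * I)%type -> T).
Hypothesis f0 : forall z, f (z, i0 R) = a false.
Hypothesis f1 : forall z, f (z, i1 R) = a true.

Definition globe_lift_pre (x : globe_pre R Z) : T :=
  match x with inl b => a b | inr p => f p end.

Lemma globe_lift_pre_cont : continuous globe_lift_pre.
Proof. by apply: sum_cont => //; apply/continuousP => A _; exact: discrete_open. Qed.

Lemma globe_lift_preE x y : globe_collapse x y ->
  globe_lift_pre x = globe_lift_pre y.
Proof. by case => z /=. Qed.

Definition globe_lift (x : globe R hd Z) : T := globe_lift_pre (repr x).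

Lemma globe_lift_cont : continuous globe_lift.
Proof.
exact: (top_lift_cont (@globe_pre_gen Z) globe_lift_pre_cont sT globe_lift_preE).
Qed.

Lemma globe_liftE x : globe_lift (globe_proj hd x) = globe_lift_pre x.
Proof.
exact: (top_lift_eq (@globe_pre_gen Z) globe_lift_pre_cont sT globe_lift_preE).
Qed.

End GlobeLift.

Lemma globe_ind (Z : topologicalType) (P : globe R hd Z -> Prop) :
  (forall b, P (globe_proj hd (inl b))) ->
  (forall z t, P (globe_proj hd (inr (z, t)))) -> forall x, P x.
Proof.
move=> Pl Pr x; have [y <-] := top_proj_surj x.
by case: y => [b|[z t]]; [exact: Pl|exact: Pr].
Qed.

Lemma globe_proj0 (Z : topologicalType) (z : Z) :
  globe_proj hd (inr (z, i0 R)) = globe_proj hd (inl false) :> globe R hd Z.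
Proof. by apply: top_proj_eq; constructor. Qed.

Lemma globe_proj1 (Z : topologicalType) (z : Z) :
  globe_proj hd (inr (z, i1 R)) = globe_proj hd (inl true) :> globe R hd Z.
Proof. by apply: top_proj_eq; constructor. Qed.

Lemma globe_proj_cont (Z : topologicalType) :
  continuous (@globe_proj R hd Z : globe_pre R Z -> globe R hd Z).
Proof. exact: top_proj_cont. Qed.

Lemma globe_mapE (Y Z : topologicalType) (f : Y -> Z) (cf : continuous f) x :
  sval (globe_map R hd cf) (globe_proj hd x) = globe_proj hd (globe_pre_map (R := R) f x).
Proof.
exact (top_quotient_mapE R hd (globe_pre_map_continuous cf)
  (@globe_pre_map_collapse R Y Z f) x).
Qed.

End GlobeFacts.

(* [valued_md h P] fibres over [X]: its states are the pairs [(s, h s)] and its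
   execution paths the pairs of an execution path of [X] and a path in the
   segment satisfying [P].  Lifting against the projection extends functions. *)
Section Valued.
Variables (R : realType) (hd : bool) (X : MdTop R hd).
Local Notation I := (@unitI R).
Variables (h : sval X -> I) (P : set (I -> I)).
Hypothesis Pr : forall u phi, P u -> reparam phi -> P (u \o phi).
Hypothesis Pc : forall u v, P u -> P v -> u (i1 R) = v (i0 R) -> P (concat u v).

Definition valued_md : md_data R := @MdData R (kelley R (sval X * I)%type)
  [set x | states (sval X) x.1 /\ x.2 = h x.1]
  [set g | [/\ continuous (g : I -> kelley R (sval X * I)%type),
     exec (sval X) (fst \o g),
     (g (i0 R)).2 = h (g (i0 R)).1 /\ (g (i1 R)).2 = h (g (i1 R)).1
   & P (snd \o g)]].

Lemma concat_cont1 (T : topologicalType) (g k : I -> T) : continuous g ->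
  continuous k -> g (i1 R) = k (i0 R) -> continuous (concat g k).
Proof.
move=> cg ck gk.
have H : continuous (fun x : I * I => concat g k x.2).
  apply: (concat_cont (g := fun _ : I => g) (h := fun=> k)) => //.
    exact: comp_cont (@snd_cont _ _) cg.
  exact: comp_cont (@snd_cont _ _) ck.
apply: (comp_cont (f := fun t => (i0 R, t)) _ H).
by apply: pair_cont; [exact: cst_cont|exact: id_cont].
Qed.

Lemma valued_is_md : is_md hd valued_md.
Proof.
have [Xtop Xc Xr Xcc] := svalP X.
split.
- apply: in_Top_kelley => hd1; apply: path_separatedM.
    exact: in_Top_sep Xtop hd1.
  exact: (in_Top_sep (in_Top_I R hd) hd1).
- move=> g [cg eg [g0 g1] Pg]; have [_ s0 s1] := Xc _ eg.
  by split => //; split.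
- move=> g phi [cg eg [g0 g1] Pg] rphi; split => //.
  + exact: comp_cont (mono_surj_cont rphi) cg.
  + exact: (Xr (fst \o g)).
  + by rewrite /= (reparam0 rphi) (reparam1 rphi).
  + exact: (Pr (u := snd \o g)).
- move=> g k [cg eg [g0 g1] Pg] [ck ek [k0 k1] Pk] gk; split.
  + exact: concat_cont1.
  + by rewrite concat_comp; apply: Xcc => //=; rewrite gk.
  + by rewrite concat0 concat1.
  + by rewrite concat_comp; apply: Pc => //=; rewrite gk.
Qed.

Definition valued : MdTop R hd := exist _ valued_md valued_is_md.

Lemma valued_proj_axiom : md_map_axiom (fst : valued_md -> sval X).
Proof.
split => [|x []|g []] //.
exact: comp_cont (@kelley_id_cont R _) (@fst_cont _ _).
Qed.

Definition valued_proj : hom valued X := exist _ _ valued_proj_axiom.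

Definition valued_val (x : sval valued) : I := (x : sval X * I).2.

Lemma valued_val_cont : continuous valued_val.
Proof. exact: comp_cont (@kelley_id_cont R _) (@snd_cont _ _). Qed.

Lemma valued_mk (A : MdTop R hd) (f : hom A X) (u : sval A -> I) :
  continuous u -> (forall s, states (sval A) s -> u s = h (sval f s)) ->
  (forall g, exec (sval A) g -> P (u \o g)) ->
  exists F : hom A valued, valued_proj \c F = f /\
    forall x, valued_val (sval F x) = u x.
Proof.
move=> cu us Pu; have [cf sf ef] := svalP f.
have [Atop Ac _ _] := svalP A.
have ax : md_map_axiom ((fun x => (sval f x, u x)) : sval A -> valued_md).
  split=> [|s As|g eg].
  - apply: (path_cont (in_Top_gen Atop)) => c cc; apply: path_to_kelley.
    by apply: pair_cont; [exact: comp_cont cc cf|exact: comp_cont cc cu].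
  - by split; [exact: sf|exact: us].
  - have [cg g0 g1] := Ac _ eg; split.
    + apply: path_to_kelley.
      by apply: pair_cont; [exact: comp_cont cg cf|exact: comp_cont cg cu].
    + exact: ef.
    + by split => /=; exact: us.
    + exact: Pu.
exists (exist _ _ ax); split => //.
exact: md_map_eq.
Qed.

(** The lifting problem against the globe of a sphere inside the globe of a disk, written for
    functions on cylinders. The last hypothesis keeps track of the fact that the end values come
    from states of [X]. *)
Definition extendable := forall n (a : bool -> I) (u : @sphere R n * I -> I),
  continuous (u : kelley R (@sphere R n * I)%type -> I) ->
  (forall z, u (z, i0 R) = a false) -> (forall z, u (z, i1 R) = a true) ->
  (forall z, P (fun t => u (z, t))) ->
  (exists s s' : sval X, a false = h s /\ a true = h s') ->
  exists v : @disk R n * I -> I,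
    [/\ continuous (v : kelley R (@disk R n * I)%type -> I),
        forall z, v (z, i0 R) = a false /\ v (z, i1 R) = a true,
        forall z t, v (sphere_to_disk z, t) = u (z, t)
      & forall z, P (fun t => v (z, t))].

Hypothesis ext : extendable.

(** Globes are the hypothesis [ext]. For the generator R, the two states have the same image in [X],
    hence the same value, because states of [valued] lie on the graph of [h]. *)
Lemma valued_rlp : rlp (restrict_class (md_gen hd)) valued_proj.
Proof.
move=> [a Ha] [b Hb] f; rewrite /restrict_class /= => gf.
change (@hom (MdData_cat R) a b) in (type of f).
move: Ha Hb; case: a b f / gf => [n||] Ha Hb u v uv.
- have [cu su eu] := svalP u; have [cv sv ev] := svalP v.
  have uE x : (sval u x).1 = sval v (sval (globe_map R hd (@sphere_to_disk_continuous R n)) x).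
    by have := congr1 (fun m => sval m x) uv.
  pose us (p : @sphere R n * I) : I := valued_val (sval u (globe_proj hd (inr p))).
  pose a b : I := h (sval v (globe_proj hd (inl b))).
  have ub b : valued_val (sval u (globe_proj hd (inl b))) = a b.
    have [_ E] : states valued_md (sval u (globe_proj hd (inl b))).
      by apply: su; exists b.
    have E1 := @globe_mapE R hd _ _ _ (@sphere_to_disk_continuous R n) (inl b).
    rewrite /valued_val E; apply: (congr1 h).
    exact: etrans (uE _) (congr1 (sval v) E1).
  have [|||||w [cw w01 wu wP]] := ext (a := a) (u := us).
  + apply: comp_cont valued_val_cont; apply: comp_cont cu.
    apply: comp_cont (@inr_cont _ _) _; exact: globe_proj_cont.
  + by move=> z; rewrite /us globe_proj0 ub.
  + by move=> z; rewrite /us globe_proj1 ub.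
  + move=> z; have [] := eu (fun t => globe_proj hd (inr (z, t))).
      by exists z, id; split => //; exact: reparam_id.
    by [].
  + by exists (sval v (globe_proj hd (inl false))), (sval v (globe_proj hd (inl true))).
  have sI : hd -> path_separated R I by exact: in_Top_sep (in_Top_I R hd).
  have w0 z : w (z, i0 R) = a false by case: (w01 z).
  have w1 z : w (z, i1 R) = a true by case: (w01 z).
  have wE := globe_liftE sI cw w0 w1.
  have [|||F [Fp Fv]] := @valued_mk (exist _ _ Hb) v (globe_lift a w).
  + exact: globe_lift_cont.
  + by move=> _ [b _ <-]; rewrite wE.
  + move=> _ [z [phi [rphi ->]]].
    rewrite (_ : _ \o _ = (fun t => w (z, t)) \o phi); first exact: Pr.
    by apply/funext => t /=; rewrite wE.
  exists F; split => //; apply: md_map_eq; apply/funext => x.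
  have E (y y' : sval X * I) : y.1 = y'.1 -> y.2 = y'.2 -> y = y'.
    by case: y y' => [y1 y2] [? ?] /= -> ->.
  apply: E.
    rewrite uE; exact: (congr1 (fun m => sval m (sval (globe_map R hd (@sphere_to_disk_continuous R n)) x)) Fp).
  rewrite [LHS]Fv; move: x; apply: globe_ind => [b|z t].
    have E1 := @globe_mapE R hd _ _ _ (@sphere_to_disk_continuous R n) (inl b).
    apply: etrans (congr1 (globe_lift a w) E1) _.
    by apply: etrans (wE _) _; exact/esym/ub.
  have E1 := @globe_mapE R hd _ _ _ (@sphere_to_disk_continuous R n) (inr (z, t)).
  apply: etrans (congr1 (globe_lift a w) E1) _.
  by apply: etrans (wE _) _; exact: wu.
- have [cv sv ev] := svalP v.
  pose s := sval v tt.
  have [|||F [Fp Fv]] := @valued_mk (exist _ _ Hb) v (fun x => h (sval v x)).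
  + by apply/continuousP => A _; exact: discrete_open.
  + by [].
  + by move=> g [].
  exists F; split => //; apply: md_map_eq; apply/funext => -[].
- have [cu su eu] := svalP u.
  have uE x : (sval u x).1 = sval v tt.
    by have := congr1 (fun m => sval m x) uv.
  have [|||F [Fp Fv]] := @valued_mk (exist _ _ Hb) v (fun x => h (sval v x)).
  + by apply/continuousP => A _; exact: discrete_open.
  + by [].
  + by move=> g [].
  exists F; split => //; apply: md_map_eq; apply/funext => x.
  have E (y y' : sval X * I) : y.1 = y'.1 -> y.2 = y'.2 -> y = y'.
    by case: y y' => [y1 y2] [? ?] /= -> ->.
  apply: E.
    by rewrite uE; exact: (congr1 (fun m => sval m tt) Fp).
  rewrite [LHS]Fv /= -(uE x).
  by have [_ ->] := su x Logic.I.
Qed.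

End Valued.

(** * Radial extension of functions from spheres to disks *)

Section EuclideanNorm.
Variable R : realType.
Local Notation I := (@unitI R).

Lemma rcont_sum (T : topologicalType) (J : Type) (s : seq J) (f : J -> T -> R) :
  (forall i, continuous (f i)) -> continuous (fun x => \sum_(i <- s) f i x).
Proof.
move=> cf; elim: s => [|i s IH].
  rewrite (_ : (fun _ => _) = fun=> 0); first exact: cst_cont.
  by apply/funext => x; rewrite big_nil.
rewrite (_ : (fun _ => _) = fun x => f i x + \sum_(i <- s) f i x).
  exact: rcontD.
by apply/funext => x; rewrite big_cons.
Qed.

Definition enorm n (v : 'rV[R]_n) : R := Num.sqrt (\sum_i v 0 i ^+ 2).

Lemma sumsq_ge0 n (v : 'rV[R]_n) : 0 <= \sum_i v 0 i ^+ 2.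
Proof. by apply: sumr_ge0 => i _; exact: sqr_ge0. Qed.

Lemma enorm_ge0 n (v : 'rV[R]_n) : 0 <= enorm v.
Proof. exact: sqrtr_ge0. Qed.

Lemma enorm_cont n : continuous (@enorm n).
Proof.
apply: (comp_cont (f := fun v : 'rV[R]_n => \sum_i v 0 i ^+ 2) (g := Num.sqrt)).
  apply: rcont_sum => i; apply: rcontM; exact: coord_cont.
exact: sqrt_continuous.
Qed.

Lemma enormZ n (c : R) (v : 'rV[R]_n) : enorm (c *: v) = `|c| * enorm v.
Proof.
rewrite /enorm; under eq_bigr do rewrite mxE exprMn.
by rewrite -mulr_sumr sqrtrM ?sqr_ge0 // sqrtr_sqr.
Qed.

Lemma enorm_eq0 n (v : 'rV[R]_n) : (enorm v == 0) = (v == 0).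
Proof.
apply/idP/eqP => [|->]; last first.
  by rewrite -(scale0r 0) enormZ normr0 mul0r.
rewrite sqrtr_eq0 => h; apply/rowP => i; rewrite !mxE.
have /eqP : \sum_i v 0 i ^+ 2 = 0 by apply/eqP; rewrite eq_le h sumsq_ge0.
rewrite psumr_eq0 => [/allP/(_ i)|j _]; last exact: sqr_ge0.
by rewrite mem_index_enum sqrf_eq0 => /(_ isT) /eqP.
Qed.

Lemma diskP n (v : 'rV[R]_n) : disk n v <-> enorm v <= 1.
Proof.
rewrite /disk /enorm /= -[X in _ <-> (_ <= X)]sqrtr1 ler_sqrt //; exact: ler01.
Qed.

Lemma sphereP n (v : 'rV[R]_n) : sphere n v <-> enorm v = 1.
Proof.
rewrite /sphere /enorm /=; split=> [->|h]; first exact: sqrtr1.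
by rewrite -[LHS]sqr_sqrtr ?sumsq_ge0 // h expr1n.
Qed.

Lemma disk_enorm n (v : @disk R n) : enorm (val v) <= 1.
Proof. by apply/diskP; exact: set_mem (valP v). Qed.

Lemma sphere_enorm n (v : @sphere R n) : enorm (val v) = 1.
Proof. by apply/sphereP; exact: set_mem (valP v). Qed.

(** Localizes a test along a path: composing with [J] keeps the path in the good region without
    changing it near [s]. *)
Lemma I_shrink (s : I) (N : set I) : nbhs s N ->
  exists J : I -> I, [/\ continuous J, forall r, N (J r)
    & nbhs s [set r | J r = r]].
Proof.
move=> [_ [[B oB <-]] /= Bs BU].
have /nbhs_ballP[e /= e0 He] : nbhs (val s) B by apply: open_nbhs_nbhs; split.
pose d := e / 2.
have d0 : 0 < d by rewrite divr_gt0.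
exists (fun r => cl (Num.max (val s - d) (Num.min (val s + d) (val r)))).
split.
- apply: comp_cont (@cl_cont R); apply: rcont_max; first exact: cst_cont.
  by apply: rcont_min; [exact: cst_cont|exact: val_cont].
- move=> r; apply: BU; apply: He.
  suff K : `|val s - val (cl (Num.max (val s - d) (Num.min (val s + d) (val r))))| < e.
    by rewrite /ball /=; exact: K.
  apply: le_lt_trans (cl_near _ _) _.
  have de : d < e by rewrite /d; lra.
  apply: le_lt_trans de; rewrite ler_norml.
  case: (leP (val s + d) (val r)) => h1.
    by rewrite (max_idPr _); lra.
  by case: (leP (val s - d) (val r)) => h2; lra.
have : nbhs s ((fun r : I => val r) @^-1` ball (val s) d).
  by apply: val_cont; exact: nbhsx_ballx.
apply: filterS => r; rewrite /ball /= ltr_norml => /andP[h1 h2].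
rewrite -[RHS]clK; congr cl; rewrite -[sval r]/(val r) in h1 h2 *.
rewrite -[sval s]/(val s) in h1 h2 *.
by rewrite (min_idPr _) ?(max_idPr _) //; lra.
Qed.

Section Radial.
Variables (n : nat) (u : @sphere R n * I -> I).
Hypothesis cu : continuous (u : kelley R (@sphere R n * I)%type -> I).

(** The value of [u] in the direction of [v]. At the centre there is no direction and the default is
    0; [radial] is then multiplied by a factor vanishing there. *)
Definition radial (v : 'rV[R]_n) (t : I) : R :=
  if insub ((enorm v)^-1 *: v) is Some z then val (u (z : @sphere R n, t)) else 0.

Lemma radial_ge0 v t : 0 <= radial v t.
Proof. by rewrite /radial; case: insubP => // z _ _; exact: I_ge0. Qed.

Lemma radial_le1 v t : radial v t <= 1.
Proof. by rewrite /radial; case: insubP => [z _ _|_]; [exact: I_le1|exact: ler01]. Qed.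

Lemma normalize_sphere (v : 'rV[R]_n) : v != 0 ->
  (enorm v)^-1 *: v \in @sphere R n.
Proof.
move=> v0; apply/mem_set/sphereP; rewrite enormZ ger0_norm ?invr_ge0 ?enorm_ge0 //.
by rewrite mulVf // enorm_eq0.
Qed.

Lemma radialE (v : 'rV[R]_n) (v0 : v != 0) t :
  exists z : @sphere R n, val z = (enorm v)^-1 *: v /\ radial v t = val (u (z, t)).
Proof.
rewrite /radial insubT; first exact: normalize_sphere.
by move=> h; eexists; split; last reflexivity.
Qed.

Lemma radial_sphere (z : @sphere R n) t : radial (val z) t = val (u (z, t)).
Proof.
have z0 : val z != 0 by rewrite -enorm_eq0 sphere_enorm oner_eq0.
have [z' [Ez ->]] := radialE z0 t.
by congr (val (u (_, t))); apply/val_inj; rewrite Ez sphere_enorm invr1 scale1r.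
Qed.

(** At the centre the factor [c] tends to 0 while [radial] is bounded. Elsewhere [I_shrink] keeps
    the path off the centre, and normalizing gives a path on the sphere; the test must be along
    paths because [u] is continuous only for the kelleyfied product. *)
Lemma radial_cont (c : R -> R) (p : I -> @disk R n) (q : I -> I) :
  continuous c -> c 0 = 0 -> continuous p -> continuous q ->
  continuous (fun s => c (enorm (val (p s))) * radial (val (p s)) (q s)).
Proof.
move=> cc c0 cp cq s.
have cvp : continuous (fun s => val (p s)) by exact: comp_cont cp (@val_cont _ _).
have cen : continuous (fun s => enorm (val (p s))) by exact: comp_cont cvp (@enorm_cont n).
have ccen : continuous (fun s => c (enorm (val (p s)))) by exact: comp_cont cen cc.
have [ps0|ps0] := eqVneq (enorm (val (p s))) 0.
  have E : c (enorm (val (p s))) * radial (val (p s)) (q s) = 0.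
    by rewrite ps0 c0 mul0r.
  move=> A; rewrite /continuous_at E => /nbhs_ballP[e /= e0 He].
  have : nbhs s ((fun s => c (enorm (val (p s)))) @^-1` ball 0 e).
    by apply: ccen; rewrite ps0 c0; exact: nbhsx_ballx.
  apply: filterS => r; rewrite /ball /= !sub0r !normrN => hr; apply: He.
  rewrite /ball /= sub0r normrN normrM (ger0_norm (radial_ge0 _ _)).
  apply: le_lt_trans hr; rewrite ler_piMr ?normr_ge0 //; exact: radial_le1.
have oN : nbhs s [set r | enorm (val (p r)) != 0].
  apply: open_nbhs_nbhs; split => //.
  have -> : [set r | enorm (val (p r)) != 0] =
      (fun r => enorm (val (p r))) @^-1` [set x : R | x != 0].
    by [].
  have /continuousP := cen; apply.
  have -> : [set x : R | x != 0] = ~` [set 0].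
    by apply/seteqP; split => x /= /eqP.
  by rewrite openC; exact: closed_eq.
have [J [cJ JN nJ]] := I_shrink oN.
have v0 r : val (p (J r)) != 0 by rewrite -enorm_eq0; exact: JN.
pose w (r : I) : @sphere R n :=
  exist (fun y => y \in @sphere R n) _ (normalize_sphere (v0 r)).
have cw : continuous w.
  apply: sub_cont; apply: scaleM_cont; last exact: (comp_cont cJ cvp).
  by apply: rcontV => //; exact: comp_cont cJ cen.
have cuw : continuous (fun r => val (u (w r, q (J r)))).
  apply: comp_cont (@val_cont _ _).
  by apply: (kelley_prod_path cu) => //; exact: comp_cont cJ cq.
have wE r : radial (val (p (J r))) (q (J r)) = val (u (w r, q (J r))).
  have [z [Ez ->]] := radialE (v0 r) (q (J r)).
  by congr (val (u (_, _))); apply/val_inj.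
have cf : continuous (fun r => c (enorm (val (p r))) * val (u (w r, q (J r)))).
  exact: rcontM.
apply: (@near_cont I R _ _ s _ (cf s)).
by apply: filterS nJ => r /= Jr; rewrite -wE Jr.
Qed.

End Radial.

Variables (hd : bool) (X : MdTop R hd).

(** Interpolates along the radius between the boundary data and the affine function with the same
    end values. *)
Lemma extendable_any (h : sval X -> I) : extendable h [set: I -> I].
Proof.
move=> n a u cu u0 u1 _ _.
pose lin (t : I) : R := (1 - val t) * val (a false) + val t * val (a true).
have lin01 t : 0 <= lin t /\ lin t <= 1.
  have := I_ge0 t; have := I_le1 t; rewrite /lin.
  have := I_ge0 (a false); have := I_le1 (a false).
  have := I_ge0 (a true); have := I_le1 (a true); nra.
have clin : continuous lin.
  apply: rcontD; apply: rcontM; try exact: cst_cont; try exact: val_cont.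
  by apply: rcontB; [exact: cst_cont|exact: val_cont].
pose w (v : 'rV[R]_n) t := enorm v * radial u v t + (1 - enorm v) * lin t.
have w01 v t : enorm v <= 1 -> 0 <= w v t /\ w v t <= 1.
  move=> v1; have v0 := enorm_ge0 v; have [l0 l1] := lin01 t.
  have r0 := radial_ge0 u v t; have r1 := radial_le1 u v t; rewrite /w; nra.
exists (fun x => cl (w (val x.1) x.2)); split.
- apply: kelley_prod_cont => p q cp cq; apply: comp_cont (@cl_cont R).
  apply: rcontD; first exact: (radial_cont cu (c := id) (@id_cont _) erefl cp cq).
  apply: rcontM; last exact: comp_cont cq clin.
  apply: rcontB; first exact: cst_cont.
  apply: comp_cont (@enorm_cont n); exact: comp_cont cp (@val_cont _ _).
- have lin0 : lin (i0 R) = val (a false).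
    by rewrite /lin (_ : val (i0 R) = 0) // subr0 mul1r mul0r addr0.
  have lin1 : lin (i1 R) = val (a true).
    by rewrite /lin (_ : val (i1 R) = 1) // subrr mul1r mul0r add0r.
  have wE v t b : lin t = val (a b) -> (forall z, u (z, t) = a b) ->
      cl (w v t) = a b.
    move=> lt ut; rewrite -[RHS]clK /w lt; congr cl.
    have [v0|v0] := eqVneq v 0.
      have -> : enorm v = 0 by apply/eqP; rewrite enorm_eq0 v0.
      by rewrite mul0r subr0 mul1r add0r.
    have [z' [_ ->]] := radialE u v0 t; rewrite ut.
    by rewrite -mulrDl addrC subrK mul1r.
  by move=> z; split; apply: wE.
- move=> z t; rewrite /w -[val (sphere_to_disk z)]/(val z) sphere_enorm.
  by rewrite subrr mul0r addr0 mul1r radial_sphere clK.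
- by [].
Qed.

Definition peaked : set (I -> I) :=
  [set u | u (i0 R) = i0 R /\ u (i1 R) = i0 R /\ exists t, u t = i1 R].

Lemma peaked_reparam u phi : peaked u -> reparam phi -> peaked (u \o phi).
Proof.
move=> [u0 [u1 [t ut]]] rphi; split; first by rewrite /= (reparam0 rphi).
split; first by rewrite /= (reparam1 rphi).
by have [s st] := reparam_surj rphi t; exists s; rewrite /= st.
Qed.

Lemma peaked_concat u v : peaked u -> peaked v -> u (i1 R) = v (i0 R) ->
  peaked (concat u v).
Proof.
move=> [u0 [u1 [t ut]]] [v0 [v1 _]] _; split; first by rewrite concat0.
split; first by rewrite concat1.
have t0 := I_ge0 t; have t1 := I_le1 t.
exists (cl (val t / 2)); rewrite concatE val_cl; [|lra|lra].
rewrite ifT; last lra.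
by rewrite (_ : 2 * (val t / 2) = val t) ?clK //; lra.
Qed.

(** The extension is the maximum of two terms. The factor [d] is 1 for radius at most 1/2, where
    [hat] reaches 1 at time 1/2; the factor [c] is 1 from radius 1/2 on, where the boundary data in
    the same direction reach 1. So every line of the cylinder still has a peak. *)
Lemma extendable_peaked : extendable (fun _ : sval X => i0 R) peaked.
Proof.
move=> n a u cu u0 u1 Pu [s [s' [a0 a1]]].
pose hat (t : I) : R := 4 * (val t * (1 - val t)).
have hat01 t : 0 <= hat t /\ hat t <= 1.
  have t0 := I_ge0 t; have t1 := I_le1 t; rewrite /hat; split.
    by rewrite mulr_ge0 // mulr_ge0 // subr_ge0.
  have := sqr_ge0 (2 * val t - 1); rewrite expr2; nra.
have chat : continuous hat.
  apply: rcontM; first exact: cst_cont.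
  apply: rcontM; first exact: val_cont.
  by apply: rcontB; [exact: cst_cont|exact: val_cont].
pose c (x : R) : R := Num.min 1 (2 * x).
pose d (x : R) : R := Num.min 1 (2 * (1 - x)).
have cc : continuous c.
  apply: rcont_min; first exact: cst_cont.
  by apply: rcontM; [exact: cst_cont|exact: id_cont].
have cd : continuous d.
  apply: rcont_min; first exact: cst_cont.
  apply: rcontM; first exact: cst_cont.
  by apply: rcontB; [exact: cst_cont|exact: id_cont].
have c01 x : 0 <= x -> 0 <= c x /\ c x <= 1.
  by move=> x0; rewrite /c; case: (leP 1 (2 * x)) => h; split; lra.
have d01 x : x <= 1 -> 0 <= d x /\ d x <= 1.
  by move=> x0; rewrite /d; case: (leP 1 (2 * (1 - x))) => h; split; lra.
pose w (v : 'rV[R]_n) t := Num.max (c (enorm v) * radial u v t) (d (enorm v) * hat t).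
have w01 v t : enorm v <= 1 -> 0 <= w v t /\ w v t <= 1.
  move=> v1; have v0 := enorm_ge0 v; have [l0 l1] := hat01 t.
  have r0 := radial_ge0 u v t; have r1 := radial_le1 u v t.
  have [c0 c1] := c01 _ v0; have [d0 d1] := d01 _ v1.
  rewrite /w le_max ge_max; split; last by apply/andP; split; nra.
  by apply/orP; left; rewrite mulr_ge0.
have wend v t : val t * (1 - val t) = 0 ->
    (forall z, u (z, t) = i0 R) -> cl (w v t) = i0 R.
  move=> ht ut; rewrite /w /hat ht !mulr0 (_ : radial u v t = 0).
    by rewrite mulr0 maxxx cl_le0.
  by rewrite /radial; case: insubP => // z _ _; rewrite ut.
have ends (z : @disk R n) : cl (w (val z) (i0 R)) = i0 R /\ cl (w (val z) (i1 R)) = i0 R.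
  split; apply: wend => //; first by rewrite mul0r.
  - by move=> z'; rewrite u0 a0.
  - by rewrite (_ : val (i1 R) = 1) // subrr mulr0.
  - by move=> z'; rewrite u1 a1.
exists (fun x => cl (w (val x.1) x.2)); split.
- apply: kelley_prod_cont => p q cp cq; apply: comp_cont (@cl_cont R).
  apply: rcont_max.
    by apply: (radial_cont cu cc _ cp cq); rewrite /c mulr0 min_r.
  apply: rcontM; last exact: comp_cont cq chat.
  apply: comp_cont cd; apply: comp_cont (@enorm_cont n).
  exact: comp_cont cp (@val_cont _ _).
- by move=> z; rewrite a0 a1; exact: ends.
- move=> z t; rewrite /w -[val (sphere_to_disk z)]/(val z) sphere_enorm.
  rewrite /d subrr mulr0 min_r // mul0r /c min_l ?mul1r ?radial_sphere; last lra.
  by rewrite max_l ?clK ?I_ge0.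
- move=> z; split; first by case: (ends z).
  split; first by case: (ends z).
  have z1 := disk_enorm z.
  have [h|h] := leP (enorm (val z)) 2^-1.
    exists (cl 2^-1); apply: cl_ge1 => /=; rewrite /w le_max; apply/orP; right.
    rewrite /d min_l; last lra.
    by rewrite mul1r /hat val_cl //; lra.
  have z0 : val z != 0 by rewrite -enorm_eq0; apply/eqP => e0; move: h; rewrite e0; lra.
  have [z' [_ _]] := radialE u z0 (i0 R).
  have [_ [_ [t ut]]] := Pu (exist (fun y => y \in @sphere R n) _ (normalize_sphere z0)).
  exists t; apply: cl_ge1 => /=; rewrite /w le_max; apply/orP; left.
  rewrite /c min_l ?mul1r; last lra.
  have [z'' [Ez ->]] := radialE u z0 t.
  rewrite (_ : z'' = exist (fun y => y \in @sphere R n) _ (normalize_sphere z0)) ?ut //.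
  exact/val_inj.
Qed.

End EuclideanNorm.

(** * Execution paths generated by cells *)

Section GeneratedPaths.
Variable R : realType.
Local Notation I := (@unitI R).

Inductive gen_paths (T : Type) (L : set (I -> T)) : (I -> T) -> Prop :=
| gen_line l : L l -> gen_paths L l
| gen_reparam g phi : gen_paths L g -> reparam phi -> gen_paths L (g \o phi)
| gen_concat g h : gen_paths L g -> gen_paths L h -> g (i1 R) = h (i0 R) ->
    gen_paths L (concat g h).

Definition line_structure (X : md_data R) (L : set (I -> X)) :=
  [/\ L `<=` exec X,
      forall l t, L l -> 0 < val t < 1 -> ~ states X (l t),
      forall p, ~ states X p -> exists l t, [/\ L l, 0 < val t < 1 & l t = p],
      forall l l' t t', L l -> L l' -> 0 < val t < 1 -> 0 < val t' < 1 ->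
        l t = l' t' -> l = l' /\ t = t'
    & exec X `<=` gen_paths L].

End GeneratedPaths.

(** * The lines of a cellular space and the paths they generate *)

Section Cells.
Variables (R : realType) (hd : bool).
Local Notation I := (@unitI R).
Local Notation MdT := (MdTop R hd).
Local Notation obj P H := (exist (fun x => is_md hd x) P H : MdT).

Lemma homP (a b : MdT) (f : hom a b) : @md_map_axiom R (sval a) (sval b) (sval f).
Proof. exact: svalP f. Qed.

(** The attaching data of one cell, kept in [Type] because [step_line] is defined by cases on it;
    [the_step] fixes one choice for each successor step. *)
Inductive step (c d : MdT) (j : hom c d) : Type :=
| GlobeStep n (Hs : is_md hd (globe R hd (@sphere R n)))
    (Hd : is_md hd (globe R hd (@disk R n)))
    (g : @hom MdT (obj _ Hs) c) (k : @hom MdT (obj _ Hd) d) of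
    @is_pushout MdT (obj _ Hs) (obj _ Hd) c d
      (globe_map R hd (@sphere_to_disk_continuous R n)) g k j
| CStep (Hs : is_md hd (set_md R void)) (Hd : is_md hd (set_md R unit))
    (g : @hom MdT (obj _ Hs) c) (k : @hom MdT (obj _ Hd) d) of
    @is_pushout MdT (obj _ Hs) (obj _ Hd) c d
      (set_md_map R (of_void unit)) g k j
| RStep (Hs : is_md hd (set_md R bool)) (Hd : is_md hd (set_md R unit))
    (g : @hom MdT (obj _ Hs) c) (k : @hom MdT (obj _ Hd) d) of
    @is_pushout MdT (obj _ Hs) (obj _ Hd) c d
      (set_md_map R (fun _ : bool => tt)) g k j.

Lemma step_of (c d : MdT) (j : hom c d) :
  pushout_of (restrict_class (md_gen hd)) j -> inhabited (step j).
Proof.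
move=> [[a Ha] [[b Hb] [f [g [k [gf po]]]]]].
rewrite /restrict_class /= in gf.
change (@hom (MdData_cat R) a b) in (type of f).
move: Ha Hb g k po; case: a b f / gf => [n||] Ha Hb g k po; constructor.
- exact: GlobeStep po.
- exact: CStep po.
- exact: RStep po.
Qed.

Definition cell_line n (z : @disk R n) (t : I) : globe R hd (@disk R n) :=
  globe_proj hd (inr (z, t)).

(** Only the interior points of the disk give new lines: over the boundary sphere the lines already
    belong to the previous stage. *)
Definition step_line (c d : MdT) (j : hom c d) (s : step j) : set (I -> sval d) :=
  match s with
  | GlobeStep n _ _ _ k _ =>
      [set l | exists2 z : @disk R n, enorm (val z) < 1
        & l = sval k \o cell_line z]
  | _ => set0
  end.

Lemma step_line_exec (c d : MdT) (j : hom c d) (s : step j) l :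
  step_line s l -> exec (sval d) l.
Proof.
case: s => [n Hs Hd g k _|Hs Hd g k _ []|Hs Hd g k _ []] [z _ ->].
have [_ _ ek] := homP k.
by apply: ek; exists z, id; split => //; exact: reparam_id.
Qed.

Lemma step_bd n (Hs : is_md hd (globe R hd (@sphere R n)))
    (Hd : is_md hd (globe R hd (@disk R n))) (c d : MdT) (j : hom c d)
    (g : @hom MdT (obj _ Hs) c) (k : @hom MdT (obj _ Hd) d) :
    @is_pushout MdT (obj _ Hs) (obj _ Hd) c d
      (globe_map R hd (@sphere_to_disk_continuous R n)) g k j ->
  forall z t, sval k (cell_line (sphere_to_disk z) t) =
    sval j (sval g (globe_proj hd (inr (z, t)))).
Proof.
move=> [E _] z t; set y := globe_proj hd (inr (z, t)).
have pE : sval k (sval (globe_map R hd (@sphere_to_disk_continuous R n)) y) =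
    sval j (sval g y) := congr1 (fun f => sval f y) E.
apply: etrans pE; apply: (congr1 (sval k)); symmetry.
exact (globe_mapE hd (@sphere_to_disk_continuous R n) (inr (z, t))).
Qed.

Lemma set_md_is_md (S : choiceType) : is_md hd (set_md R S).
Proof. by split => //; exact: in_Top_discrete. Qed.

Context {disp : Order.disp_t} {W : orderType disp}.
Variables (o : W) (X : @tower MdT disp W) (c : MdT)
  (leg : forall i, True -> hom (tob X i) c).
Hypotheses (wo : well_order (<=%O : rel W)) (omin : forall i, (o <= i)%O)
  (coc : cocontinuous X)
  (suc : forall i j (h : (i <= j)%O), is_succ i j ->
    pushout_of (restrict_class (md_gen hd)) (tmap X h))
  (col : is_colimit (D := fun _ => True) leg) (ini : is_initial (tob X o)).

Definition the_step i j (h : (i <= j)%O) (s : is_succ i j) : step (tmap X h) :=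
  projT1 (cid (let: inhabits y := step_of (suc h s) in ex_intro (fun _ => True) y Logic.I)).

Definition cell_lines : set (I -> sval c) := [set l | exists i j
  (h : (i <= j)%O) (s : is_succ i j) l0,
  step_line (the_step h s) l0 /\ l = sval (leg j Logic.I) \o l0].

Lemma leg_val i j (h : (i <= j)%O) x :
  sval (leg j Logic.I) (sval (tmap X h) x) = sval (leg i Logic.I) x.
Proof. exact: (congr1 (fun m => sval m x) (leg_comp col h)). Qed.

Lemma cell_lines_exec : cell_lines `<=` exec (sval c).
Proof.
move=> _ [i [j [h [s [l [sl ->]]]]]]; have [_ _ el] := homP (leg j Logic.I).
by apply: el; exact: step_line_exec sl.
Qed.

Lemma empty_start (x : sval (tob X o)) : False.
Proof.
have [f _] := ini (obj _ (set_md_is_md void)).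
by case: (sval f x).
Qed.

Section Generation.
(** The part of [c] covered by states and lines, with the generated paths as execution paths, is a
    multipointed d-space [Y] included in [c]. Showing that all stages map into it, and hence that
    [c] does, avoids describing pushouts and colimits pointwise. *)
Let S : set (sval c) := [set p | states (sval c) p \/
  exists l t, cell_lines l /\ l t = p].

Let Y : md_data R := @MdData R (kelley R S) [set x | states (sval c) (val (x : S))]
  [set g | continuous (g : I -> kelley R S) /\
    gen_paths cell_lines (fun t => val (g t : S))].

Let gen_ends g : gen_paths cell_lines g ->
  states (sval c) (g (i0 R)) /\ states (sval c) (g (i1 R)).
Proof.
elim=> {g} [l Ll|g phi _ [g0 g1] rphi|g h _ [g0 _] _ [_ h1] _].
- by have [_ cX _ _] := svalP c; have [_] := cX _ (cell_lines_exec Ll).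
- by rewrite /= (reparam0 rphi) (reparam1 rphi).
- by rewrite concat0 concat1.
Qed.

Let Y_md : is_md hd Y.
Proof.
split.
- apply: in_Top_kelley => h; apply: path_separated_sub.
  by have [cT _ _ _] := svalP c; exact: in_Top_sep cT h.
- by move=> g [cg /gen_ends[]].
- move=> g phi [cg gg] rphi; split; first exact: comp_cont (mono_surj_cont rphi) cg.
  exact: gen_reparam gg rphi.
- move=> g h [cg gg] [ch gh] E; split; first exact: concat_cont1.
  rewrite (_ : (fun _ => _) = concat (fun t => val (g t : S)) (fun t => val (h t : S))).
    by apply: gen_concat => //; rewrite E.
  exact: (concat_comp (fun x : S => val x) g h).
Qed.

Let Yo : MdT := obj Y Y_md.

Let iota_ax : md_map_axiom ((fun x : Y => val (x : S)) : Y -> sval c).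
Proof.
split=> [|//|g [cg gg]].
  exact: comp_cont (@kelley_id_cont R _) (@val_cont _ _).
have [_ _ cr cc] := svalP c.
suff H u : gen_paths cell_lines u -> exec (sval c) u by exact: H gg.
elim=> {u} [l Ll|u phi _ eg rphi|u h _ eg _ eh gh].
- exact: cell_lines_exec.
- exact: cr.
- exact: cc.
Qed.

Let iota : hom Yo c := exist _ _ iota_ax.

Let iota_mono (a : MdT) (f g : hom a Yo) : iota \c f = iota \c g -> f = g.
Proof.
move=> E; apply: md_map_eq; apply/funext => x; apply/val_inj.
exact: (congr1 (fun m => sval m x) E).
Qed.

Let factor (a : MdT) (f : hom a c) : (forall x, S (sval f x)) ->
  (forall g, exec (sval a) g -> gen_paths cell_lines (sval f \o g)) ->
  exists f', iota \c f' = f.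
Proof.
move=> fS fg; have [cf sf _] := homP f; have [aT ac _ _] := svalP a.
have ax : md_map_axiom ((fun x => exist (fun y => y \in S) _ (mem_set (fS x))) : sval a -> Y).
  have cF : continuous ((fun x => exist (fun y => y \in S) _ (mem_set (fS x))) : sval a -> Y).
    apply: (path_cont (in_Top_gen aT)) => p cp; apply: path_to_kelley.
    by apply: sub_cont; exact: comp_cont cp cf.
  split => // g eg; split; last exact: fg.
  by apply: comp_cont cF; have [] := ac _ eg.
by exists (exist _ _ ax); apply: md_map_eq.
Qed.

(** Well-founded induction on the stage. At a successor, the interior lines of a new globe are
    generators, and its boundary lines factor through the previous stage; the universal properties
    do the gluing because [iota] is a monomorphism. *)
Let factor_leg : forall i, exists m, iota \c m = leg i Logic.I.
Proof.
have colimit_step (D : W -> Prop) (d : MdT) (l : forall i, D i -> hom (tob X i) d)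
    (v : hom d c) : is_colimit l -> (forall i (Di : D i), v \c l i Di = leg i Logic.I) ->
    (forall i, D i -> exists m, iota \c m = leg i Logic.I) ->
    exists m, iota \c m = v.
  move=> [l1 l2] vl IH.
  pose m i (Di : D i) := projT1 (cid (IH i Di)).
  have mE i Di : iota \c m i Di = leg i Logic.I by rewrite /m; case: cid.
  have [|w [wl _]] := l2 _ m.
    by move=> i' j h Di Dj; apply: iota_mono; rewrite compA !mE; exact: leg_comp.
  exists w.
  have vc i' j (h : (i' <= j)%O) Di Dj : (v \c l j Dj) \c tmap X h = v \c l i' Di.
    by rewrite -compA l1.
  have [w' [_ w'u]] := l2 _ (fun i Di => v \c l i Di) vc.
  transitivity w'; last exact: w'u.
  by symmetry; apply: w'u => i' Di; rewrite -compA wl mE vl.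
elim/(wo_ind wo) => j IH.
case: (limit_or_succ j) => [jmin|[i ij]|lj].
- have ejo : j = o by apply/eqP; rewrite eq_le omin jmin.
  subst j; have [f _] := ini Yo; exists f.
  have [g [_ gu]] := ini c.
  by rewrite -(gu (iota \c f)) // -(gu (leg o Logic.I)).
- have [m mE] := IH i ij.1.
  have mS x : S (sval (leg i Logic.I) x).
    by rewrite -mE; exact: set_mem (valP (sval m x : S)).
  have mG g : exec (sval (tob X i)) g -> gen_paths cell_lines (sval (leg i Logic.I) \o g).
    move=> eg; rewrite -mE; have [_ _ em] := homP m.
    by have [_] := em _ eg.
  have [_ lst _] := homP (leg j Logic.I).
  pose h := ltW ij.1.
  have po (a b : MdT) (f : hom a b) (g : hom a (tob X i)) (k : hom b (tob X j)) :
      is_pushout f g k (tmap X h) -> (exists f', iota \c f' = leg j Logic.I \c k) ->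
      exists m, iota \c m = leg j Logic.I.
    move=> [E U] [f' f'E].
    have [|w [[wk wt] _]] := U _ f' m.
      apply: iota_mono; rewrite !compA f'E mE -compA E compA.
      by rewrite leg_comp.
    exists w.
    have vE : (leg j Logic.I \c k) \c f = (leg j Logic.I \c tmap X h) \c g.
      by rewrite -!compA E.
    have [w' [_ w'u]] := U _ _ _ vE.
    transitivity w'; last exact: w'u.
    by symmetry; apply: w'u; rewrite -!compA wk wt f'E mE leg_comp.
  case E : (the_step h ij) => [n Hs Hd g k p|Hs Hd g k p|Hs Hd g k p]; apply: (po _ _ _ _ _ p).
  + have [_ _ eg] := homP g; have [_ sk _] := homP k.
    have line z : enorm (val z) < 1 -> cell_lines (sval (leg j Logic.I) \o (sval k \o cell_line z)).
      move=> z1; exists i, j, h, ij, (sval k \o cell_line z); split => //.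
      by rewrite E; exists z.
    have bd (z : @sphere R n) t : sval (leg j Logic.I) (sval k (cell_line (sphere_to_disk z) t))
        = sval (leg i Logic.I) (sval g (globe_proj hd (inr (z, t)))).
      by rewrite (step_bd p) leg_val.
    have dsk (z : @disk R n) : enorm (val z) < 1 \/ exists y : @sphere R n, sphere_to_disk y = z.
      have := disk_enorm z; rewrite le_eqVlt => /orP[/eqP z1|]; last by left.
      right; have zs : val z \in @sphere R n by apply/mem_set/sphereP.
      by exists (exist (fun y => y \in @sphere R n) _ zs); apply/val_inj.
    apply: factor => [|_ [z [phi [rphi ->]]]].
      apply: globe_ind => [b|z t]; first by left; apply: lst; apply: sk; exists b.
      case: (dsk z) => [z1|[y <-]]; last exact: (eq_ind_r S (mS _) (bd y t)).
      by right; exists (sval (leg j Logic.I) \o (sval k \o cell_line z)), t; split => //; exact: line.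
    case: (dsk z) => [z1|[y <-]].
      by apply: (@gen_reparam R _ _ (sval (leg j Logic.I) \o (sval k \o cell_line z))) => //;
        apply: gen_line; exact: line.
    have E1 : (fun t => sval (leg j Logic.I) (sval k (cell_line (sphere_to_disk y) (phi t)))) =
        sval (leg i Logic.I) \o (sval g \o (fun t => globe_proj hd (inr (y, phi t)))).
      by apply/funext => t; exact: bd.
    apply: (eq_ind_r (gen_paths cell_lines) _ E1).
    by apply: mG; apply: eg; exists y, phi.
  + have [_ sk _] := homP k; apply: factor => [x|g0 []].
    by left; apply: lst; exact: sk.
  + have [_ sk _] := homP k; apply: factor => [x|g0 []].
    by left; apply: lst; exact: sk.
- apply: (colimit_step _ _ _ _ (coc lj)) => [i ij|i ij]; first exact: leg_comp.
  exact: IH.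
Qed.

(** The factorizations of the legs assemble into a section of the inclusion [iota], which is
    therefore onto, on points and on execution paths. *)
Lemma cells_generate :
  (forall p, states (sval c) p \/ exists l t, cell_lines l /\ l t = p) /\
  exec (sval c) `<=` gen_paths cell_lines.
Proof.
have [l1 l2] := col.
pose m i (Di : True) := projT1 (cid (factor_leg i)).
have mE i Di : iota \c m i Di = leg i Logic.I by rewrite /m; case: cid.
have [|w [wl _]] := l2 _ m.
  by move=> i j h [] []; apply: iota_mono; rewrite compA !mE; exact: leg_comp.
have lc i j (h : (i <= j)%O) Di Dj : leg j Dj \c tmap X h = leg i Di.
  by case: Di Dj => -[]; exact: leg_comp.
have [w' [_ w'u]] := l2 _ leg lc.
have wid : iota \c w = idm c.
  transitivity w'; last by apply: w'u => i [] ; rewrite comp1m.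
  by symmetry; apply: w'u => i []; rewrite -compA wl mE.
have wx p : sval iota (sval w p) = p by exact: (congr1 (fun f => sval f p) wid).
split=> [p|g eg].
  by have := set_mem (valP (sval w p : S)); rewrite -[val _]/(sval iota _) wx.
have [_ _ ew] := homP w; have [_] := ew _ eg.
by congr gen_paths; apply/funext => t; exact: wx.
Qed.

End Generation.
End Cells.

(** * Functions separating the points of a cellular space *)

Section Separation.
Variables (R : realType) (hd : bool).
Local Notation I := (@unitI R).
Local Notation MdT := (MdTop R hd).
Local Notation obj P H := (exist (fun x => is_md hd x) P H : MdT).
Context {disp : Order.disp_t} {W : orderType disp}.
Variables (o : W) (X : @tower MdT disp W) (c : MdT)
  (leg : forall i, True -> hom (tob X i) c).
Hypotheses (wo : well_order (<=%O : rel W)) (omin : forall i, (o <= i)%O)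
  (coc : cocontinuous X)
  (suc : forall i j (h : (i <= j)%O), is_succ i j ->
    pushout_of (restrict_class (md_gen hd)) (tmap X h))
  (col : is_colimit (D := fun _ => True) leg) (ini : is_initial (tob X o)).

Lemma extend_from (h : sval c -> I) (P : set (I -> I)) i (u : sval (tob X i) -> I) :
  (forall u phi, P u -> reparam phi -> P (u \o phi)) ->
  (forall u v, P u -> P v -> u (i1 R) = v (i0 R) -> P (concat u v)) ->
  extendable h P ->
  continuous u ->
  (forall s, states (sval (tob X i)) s -> u s = h (sval (leg i Logic.I) s)) ->
  (forall g, exec (sval (tob X i)) g -> P (u \o g)) ->
  exists U : sval c -> I, [/\ continuous U, forall x, U (sval (leg i Logic.I) x) = u x,
    forall s, states (sval c) s -> U s = h s & forall g, exec (sval c) g -> P (U \o g)].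
Proof.
move=> Pr Pc ext cu us Pu.
have [F [Fp Fv]] := valued_mk Pr Pc cu us Pu.
have uv : valued_proj h Pr Pc \c F = idm c \c leg i Logic.I by rewrite comp1m.
have [|w [wF wp]] := tower_lift wo coc col uv.
  move=> i' j le s; have [a [b [f [g [k [Kf po]]]]]] := suc le s.
  by apply: (pushout_lifts po); exact: (@valued_rlp _ _ _ _ _ Pr Pc ext _ _ _ Kf).
have [cw sw ew] := homP w.
have wpE x : (sval w x).1 = x by exact: (congr1 (fun m => sval m x) wp).
exists (fun x => valued_val (sval w x)); split.
- exact: comp_cont cw (@valued_val_cont R hd c h P Pr Pc).
- by move=> x; rewrite -Fv -wF.
- by move=> s /sw [_ E]; rewrite /valued_val E wpE.
- by move=> g /ew [].
Qed.

(** On the pushout, [w] on the new globe is glued to 0 on stage [i]. The result is then extended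
    over all later cells by lifting. *)
Lemma bump i j (le : (i <= j)%O) n (Hs : is_md hd (globe R hd (@sphere R n)))
    (Hd : is_md hd (globe R hd (@disk R n))) (g : @hom MdT (obj _ Hs) (tob X i))
    (k : @hom MdT (obj _ Hd) (tob X j)) (w : @disk R n * I -> I) :
  @is_pushout MdT (obj _ Hs) (obj _ Hd) _ _
      (globe_map R hd (@sphere_to_disk_continuous R n)) g k (tmap X le) ->
  continuous (w : kelley R (@disk R n * I)%type -> I) ->
  (forall z, w (z, i0 R) = i0 R /\ w (z, i1 R) = i0 R) ->
  (forall z t, w (sphere_to_disk z, t) = i0 R) ->
  exists U : sval c -> I, [/\ continuous U, forall s, states (sval c) s -> U s = i0 R,
    forall x, U (sval (leg i Logic.I) x) = i0 R
    & forall z t, U (sval (leg j Logic.I) (sval k (cell_line hd z t))) = w (z, t)].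
Proof.
move=> po cw w01 ws.
pose h (_ : sval c) := i0 R.
have Pr (u phi : I -> I) : [set: I -> I] u -> reparam phi -> [set: I -> I] (u \o phi) by [].
have Pc (u v : I -> I) : [set: I -> I] u -> [set: I -> I] v -> u (i1 R) = v (i0 R) ->
  [set: I -> I] (concat u v) by [].
have [|||A [Ap Av]] := @valued_mk R hd c h setT Pr Pc _ (leg i Logic.I) (fun=> i0 R).
- exact: cst_cont.
- by [].
- by [].
have sI : hd -> path_separated R I by exact: in_Top_sep (in_Top_I R hd).
have w0 z : w (z, i0 R) = i0 R by case: (w01 z).
have w1 z : w (z, i1 R) = i0 R by case: (w01 z).
pose a (_ : bool) := i0 R.
have wE := globe_liftE (a := a) sI cw w0 w1.
have [|||B [Bp Bv]] := @valued_mk R hd c h setT Pr Pc (obj _ Hd)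
    (leg j Logic.I \c k) (globe_lift a w).
- exact: globe_lift_cont.
- by move=> _ [b _ <-]; rewrite wE.
- by [].
have E (y y' : sval c * I) : y.1 = y'.1 -> y.2 = y'.2 -> y = y'.
  by case: y y' => [y1 y2] [? ?] /= -> ->.
have Axy x : sval A x = (sval (leg i Logic.I) x, i0 R).
  by apply: E; [exact: (congr1 (fun m => sval m x) Ap)|exact: Av].
have Bxy x : sval B x = (sval (leg j Logic.I) (sval k x), globe_lift a w x).
  by apply: E; [exact: (congr1 (fun m => sval m x) Bp)|exact: Bv].
have [poE poU] := po.
have [|F [[FB FA] _]] := poU _ B A.
  apply: md_map_eq; apply/funext => x.
  apply: etrans (Bxy _) _; apply: etrans (esym (Axy _)); apply: E.
    apply: etrans (leg_val col le _); apply: (congr1 (sval (leg j Logic.I))).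
    exact: (congr1 (fun m => sval m x) poE).
  move: x; apply: globe_ind => [b|z t].
    have E1 := @globe_mapE R hd _ _ _ (@sphere_to_disk_continuous R n) (inl b).
    by apply: etrans (congr1 (globe_lift a w) E1) _; exact: wE.
  have E1 := @globe_mapE R hd _ _ _ (@sphere_to_disk_continuous R n) (inr (z, t)).
  apply: etrans (congr1 (globe_lift a w) E1) _.
  by apply: etrans (wE _) _; exact: ws.
have [cF sF eF] := homP F.
have [||||U [cU Ul Us _]] := @extend_from h setT j (fun x => valued_val (sval F x)) Pr Pc.
- exact: extendable_any.
- exact: comp_cont cF (@valued_val_cont R hd c h setT Pr Pc).
- by move=> s /sF[].
- by [].
exists U; split => // [x|z t].
  rewrite -(leg_val col le) Ul.
  by apply: etrans (congr1 (fun m => valued_val (sval m x)) FA) _; exact: Av.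
rewrite Ul; apply: etrans (congr1 (fun m => (sval m (cell_line hd z t)).2) FB) _.
by apply: etrans (congr1 snd (Bxy _)) _; exact: (wE (inr (z, t))).
Qed.

Local Notation lines := (cell_lines leg suc).

Lemma cell_linesP l : lines l -> exists i j (le : (i <= j)%O) (s : is_succ i j) n
    (Hs : is_md hd (globe R hd (@sphere R n)))
    (Hd : is_md hd (globe R hd (@disk R n))) (g : @hom MdT (obj _ Hs) (tob X i))
    (k : @hom MdT (obj _ Hd) (tob X j))
    (po : @is_pushout MdT (obj _ Hs) (obj _ Hd) _ _
      (globe_map R hd (@sphere_to_disk_continuous R n)) g k (tmap X le))
    (z : @disk R n),
  [/\ the_step suc le s = GlobeStep po, enorm (val z) < 1
   & l = fun t => sval (leg j Logic.I) (sval k (cell_line hd z t))].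
Proof.
move=> [i [j [le [s [l0 [sl ->]]]]]]; exists i, j, le, s.
case E : (the_step suc le s) sl => [n Hs Hd g k p|Hs Hd g k p|Hs Hd g k p] // [z z1 ->].
by exists n, Hs, Hd, g, k, p, z.
Qed.

(** The first factors vanish on the boundary sphere and at both ends of the globe, and are positive
    elsewhere. The weight [w] is 1 to make a point positive, or the distance to a given point to
    separate two points of one cell. *)
Let bell n (w : @disk R n * I -> R) (p : @disk R n * I) : I :=
  cl ((1 - enorm (val p.1)) * (val p.2 * (1 - val p.2)) * w p).

Let bell_cont n (w : @disk R n * I -> R) : continuous w ->
  continuous (bell w : kelley R (@disk R n * I)%type -> I).
Proof.
move=> cw; suff ck : continuous (bell w : disk n * I -> I).
  exact: comp_cont (@kelley_id_cont R _) ck.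
apply: comp_cont (@cl_cont R); apply: rcontM => //; apply: rcontM.
  apply: rcontB; first exact: cst_cont.
  by apply: comp_cont (@enorm_cont R n); apply: comp_cont (@fst_cont _ _) (@val_cont _ _).
have c2 : continuous (fun p : @disk R n * I => val p.2).
  exact: comp_cont (@snd_cont _ _) (@val_cont _ _).
by apply: rcontM => //; apply: rcontB => //; exact: cst_cont.
Qed.

Let bell01 n (w : @disk R n * I -> R) z :
  bell w (z, i0 R) = i0 R /\ bell w (z, i1 R) = i0 R.
Proof.
by split; apply: cl_le0 => /=; rewrite ?mul0r ?subrr ?mulr0 ?mul0r ?lexx.
Qed.

Let bell_sphere n (w : @disk R n * I -> R) (z : @sphere R n) t :
  bell w (sphere_to_disk z, t) = i0 R.
Proof. by apply: cl_le0; rewrite /= sphere_enorm subrr !mul0r. Qed.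

Let bell_gt0 n (w : @disk R n * I -> R) (z : @disk R n) (t : I) :
  enorm (val z) < 1 -> 0 < val t < 1 -> 0 < w (z, t) -> 0 < val (bell w (z, t)).
Proof.
move=> z1 /andP[t0 t1] w0.
have h : 0 < (1 - enorm (val z)) * (val t * (1 - val t)) * w (z, t).
  by rewrite !mulr_gt0 // subr_gt0.
have [le1|/ltW ge1] := leP ((1 - enorm (val z)) * (val t * (1 - val t)) * w (z, t)) 1.
  by rewrite /bell val_cl //= ltW.
by rewrite /bell cl_ge1 //=; exact: ltr01.
Qed.

Lemma bump_line l t : lines l -> 0 < val t < 1 -> exists U : sval c -> I,
  [/\ continuous U, forall s, states (sval c) s -> U s = i0 R & 0 < val (U (l t))].
Proof.
move=> /cell_linesP[i [j [le [s [n [Hs [Hd [g [k [po [z [_ z1 ->]]]]]]]]]]]] t01.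
have [U [cU U0 _ Uk]] := bump po (bell_cont (w := fun=> 1) (@cst_cont _ _ (1 : R))) (bell01 _) (bell_sphere _).
by exists U; split => //; rewrite Uk; exact: bell_gt0 (ltr01).
Qed.

(** If the cells were attached at different steps, a bump on the later one vanishes on the earlier
    one. In one cell, the bell weighted by the distance to the second point vanishes there and is
    positive at the first. *)
Lemma lines_separated l t l' t' : lines l -> lines l' -> 0 < val t < 1 ->
  0 < val t' < 1 -> (l = l' /\ t = t') \/
  exists U : sval c -> I, continuous U /\ U (l t) <> U (l' t').
Proof.
have lower i j (le : (i <= j)%O) (s : is_succ i j) n
    (Hs : is_md hd (globe R hd (@sphere R n)))
    (Hd : is_md hd (globe R hd (@disk R n))) (g : @hom MdT (obj _ Hs) (tob X i))
    (k : @hom MdT (obj _ Hd) (tob X j))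
    (po : @is_pushout MdT (obj _ Hs) (obj _ Hd) _ _
      (globe_map R hd (@sphere_to_disk_continuous R n)) g k (tmap X le))
    (z : @disk R n) j' u x :
    the_step suc le s = GlobeStep po -> enorm (val z) < 1 -> 0 < val u < 1 ->
    (j' <= i)%O ->
    exists U : sval c -> I, continuous U /\
      U (sval (leg j Logic.I) (sval k (cell_line hd z u))) <>
      U (sval (leg j' Logic.I) x).
  move=> _ z1 u01 ji.
  have [U [cU U0 Ui Uk]] := bump po (bell_cont (w := fun=> 1) (@cst_cont _ _ (1 : R))) (bell01 _) (bell_sphere _).
  exists U; split => //; rewrite -(leg_val col ji) Ui Uk => E.
  by have := bell_gt0 (w := fun=> 1) z1 u01 ltr01; rewrite E /= ltxx.
move=> /cell_linesP[i [j [le [s [n [Hs [Hd [g [k [po [z [E z1 ->]]]]]]]]]]]].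
move=> /cell_linesP[i' [j' [le' [s' [n' [Hs' [Hd' [g' [k' [po' [z' [E' z1' ->]]]]]]]]]]]] t01 t01'.
have [ii'|i'i|eii'] := ltgtP i i'.
- have ji : (j <= i')%O by have [_ /(_ i')[]] := s => //; rewrite leNgt ii'.
  right; have [U [cU Un]] := lower _ _ _ _ _ _ _ _ _ _ _ _ _ (sval k (cell_line hd z t)) E' z1' t01' ji.
  by exists U; split; [exact: cU|move=> /esym; exact: Un].
- have ji : (j' <= i)%O by have [_ /(_ i)[]] := s' => //; rewrite leNgt i'i.
  by right; exact: lower E z1 t01 ji.
subst i'; have ejj : j = j'.
  have [ij h] := s; have [ij' h'] := s'.
  apply/le_anti/andP; split.
    by have [/(lt_le_trans ij')|//] := h j'; rewrite ltxx.
  by have [/(lt_le_trans ij)|//] := h' j; rewrite ltxx.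
subst j'.
(* Both lines come from the same successor step, for which [the_step] has fixed a single cell. *)
have es : s' = s := Prop_irrelevance _ _; have ele : le' = le := bool_irrelevance _ _.
subst s' le'; rewrite E in E'.
case: E' => en; subst n'.
move=> eg ek.
have eD : Hd' = Hd by exact: Prop_irrelevance.
have eS : Hs' = Hs by exact: Prop_irrelevance.
subst Hd' Hs'.
have {ek} ek : k = k'.
  by have := projT2_eq ek; rewrite (Prop_irrelevance (projT1_eq ek) erefl).
subst k'.
have [ezt|nzt] := pselect (z = z' /\ t = t').
  by left; case: ezt => -> ->.
right.
pose w (p : @disk R n * I) := enorm (val p.1 - val z') + `|val p.2 - val t'|.
have cw : continuous w.
  apply: rcontD.
    apply: comp_cont (@enorm_cont R n).
    have c1 : continuous (fun p : @disk R n * I => val p.1).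
      exact: comp_cont (@fst_cont _ _) (@val_cont _ _).
    by move=> p; apply: cvgB; [exact: (c1 p)|exact: cvg_cst].
  apply: rcont_norm; apply: rcontB; last exact: cst_cont.
  exact: comp_cont (@snd_cont _ _) (@val_cont _ _).
have [U [cU _ _ Uk]] := bump po (bell_cont cw) (bell01 _) (bell_sphere _).
exists U; split => //; rewrite !Uk => EU.
have w0 : 0 < w (z, t).
  rewrite lt_neqAle addr_ge0 ?enorm_ge0 ?normr_ge0 // andbT eq_sym.
  rewrite paddr_eq0 ?enorm_ge0 ?normr_ge0 //= enorm_eq0 subr_eq0 normr_eq0 subr_eq0.
  by apply/negP => /andP[/eqP/val_inj ? /eqP/val_inj ?]; case: nzt.
have := bell_gt0 z1 t01 w0; rewrite EU /bell /w /= !subrr normr0 addr0.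
rewrite (_ : enorm 0 = 0); last by apply/eqP; rewrite enorm_eq0.
by rewrite mulr0 minEle ler10 maxxx ltxx.
Qed.

Lemma cell_line_structure : line_structure lines.
Proof.
have [gp ge] := cells_generate wo omin coc suc col ini.
split => //.
- exact: cell_lines_exec.
- move=> l t Ll t01 slt; have [U [_ U0]] := bump_line Ll t01.
  by rewrite U0 //= ltxx.
- move=> p np; have [//|[l [t [Ll lt]]]] := gp p; exists l, t; split => //.
  have [_ cX _ _] := svalP c; have [_ l0 l1] := cX _ (cell_lines_exec Ll).
  rewrite !lt_neqAle I_ge0 I_le1 !andbT; apply/andP; split.
    by apply/eqP => t0; apply: np; rewrite -lt; rewrite (_ : t = i0 R) //; apply/val_inj.
  by apply/eqP => t0; apply: np; rewrite -lt; rewrite (_ : t = i1 R) //; apply/val_inj.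
- move=> l l' t t' Ll Ll' t01 t01' E.
  by have [//|[U [_]]] := lines_separated Ll Ll' t01 t01'; rewrite E.
Qed.

Lemma cellular_separated (p q : sval c) : p <> q ->
  exists U : sval c -> I, continuous U /\ U p <> U q.
Proof.
move=> pq; have [_ _ nst _ _] := cell_line_structure.
have [sp|/nst[l [t [Ll t01 lt]]]] := pselect (states (sval c) p); last first.
  have [sq|/nst[l' [t' [Ll' t01' lt']]]] := pselect (states (sval c) q).
    have [U [cU U0]] := bump_line Ll t01; rewrite lt => Up.
    by exists U; split => // E; move: Up; rewrite E U0 //= ltxx.
  rewrite -lt -lt'; have [[E E']|//] := lines_separated Ll Ll' t01 t01'.
  by case: pq; rewrite -lt -lt' E E'.
have [sq|/nst[l' [t' [Ll' t01' lt']]]] := pselect (states (sval c) q); last first.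
  have [U [cU U0]] := bump_line Ll' t01'; rewrite lt' => Up.
  by exists U; split => // E; move: Up; rewrite -E U0 //= ltxx.
(* Values on states may be prescribed arbitrarily: the extension starts from the initial stage,
   which is empty, and nothing is required along execution paths. *)
pose h (x : sval c) : I := if `[< x = p >] then i1 R else i0 R.
have vac (x : sval (tob X o)) : False by exact: empty_start ini x.
have [||||||U [cU _ Us _]] := @extend_from h setT o (fun=> i0 R).
- by [].
- by [].
- exact: extendable_any.
- exact: cst_cont.
- by move=> s; case: (vac s).
- by [].
exists U; split => //; rewrite !Us // /h asboolT // asboolF; last by move=> /esym.
by move=> /(congr1 val)/= /eqP; rewrite oner_eq0.
Qed.

Lemma cellular_hausdorff : hausdorff_space (sval c).
Proof.
move=> p q clpq; apply: contrapT => /cellular_separated[U [cU]]; apply.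
apply: (@I_hausdorff R) => A B nA nB.
have [x [xA xB]] := clpq _ _ (cU p A nA) (cU q B nB).
by exists (U x).
Qed.

Lemma cellular_peaked : exists U : sval c -> I, [/\ continuous U,
  forall s, states (sval c) s -> U s = i0 R & forall g, exec (sval c) g -> peaked (U \o g)].
Proof.
have vac (x : sval (tob X o)) : False by exact: empty_start ini x.
have [||||||U [cU _ Us Ug]] := @extend_from (fun=> i0 R) (@peaked R) o (fun=> i0 R).
- exact: peaked_reparam.
- exact: peaked_concat.
- exact: extendable_peaked.
- exact: cst_cont.
- by [].
- by move=> g _; case: (vac (g (i0 R))).
by exists U.
Qed.

End Separation.

Lemma cellularP (R : realType) hd (X : MdTop R hd) : cellular X ->
  [/\ hausdorff_space (sval X),
      exists L : set (@unitI R -> sval X), line_structure L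
    & exists U : sval X -> @unitI R, [/\ continuous U,
        forall s, states (sval X) s -> U s = i0 R
      & forall g, exec (sval X) g -> peaked (U \o g)]].
Proof.
move=> [E [f [iE cl]]]; rewrite /cell in cl.
case: E X f / cl iE => disp W o T c leg wo omin coc suc col iE.
split.
- exact: (cellular_hausdorff wo omin coc suc col iE).
- by exists (cell_lines leg suc); exact: (cell_line_structure wo omin coc suc col iE).
- exact: (cellular_peaked wo coc suc col iE).
Qed.

(** * Adding states in the middle of edges *)

Section Plus.
Variables (S : Type) (V : S -> S -> topologicalType)
  (vc : forall a b c, V a b -> V b c -> V a c).
Hypothesis vcA : forall a b c d (x : V a b) (y : V b c) (z : V c d),
  vc (vc x y) z = vc x (vc y z).

(* Adjoining identities. *)
Definition plus (a b : S) : topologicalType :=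
  (V a b + discrete_topology {_ : unit | `[< a = b >]})%type.

Definition pid (a b : S) (e : a = b) : plus a b := inr (exist _ tt (asboolT e)).

Definition uid (a b : S) (x : {_ : unit | `[< a = b >]}) : a = b := asboolW (svalP x).

Definition mul a b c (p : plus a b) (q : plus b c) : plus a c :=
  match p with
  | inl v => match q with
      | inl w => inl (vc v w)
      | inr e => inl (eq_rect b (V a) v c (uid e))
      end
  | inr e => eq_rect_r (fun a => plus a c) q (uid e)
  end.

Lemma sig_unit (b : bool) (x y : {_ : unit | b}) : x = y.
Proof. by apply: val_inj; case: (val x) (val y) => -[]. Qed.

Lemma pidE a b (e : a = b) x : inr x = pid e.
Proof. by rewrite /pid; congr inr; exact: sig_unit. Qed.

Lemma plus_ind a b (P : plus a b -> Prop) : (forall v, P (inl v)) ->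
  (forall e, P (pid e)) -> forall p, P p.
Proof. by move=> Pl Pr [v|e] //; rewrite (pidE (uid e)). Qed.

Lemma mul1p a b (e : a = a) (p : plus a b) : mul (pid e) p = p.
Proof. by rewrite /mul /= (Prop_irrelevance (uid _) erefl). Qed.

Lemma mulp1 a b (e : b = b) (p : plus a b) : mul p (pid e) = p.
Proof.
elim/plus_ind: p => [v|e']; first by rewrite /mul /= (Prop_irrelevance (uid _) erefl).
by subst b; rewrite mul1p /pid; congr inr; exact: sig_unit.
Qed.

Lemma mulll a b c (v : V a b) (w : V b c) : mul (inl v) (inl w) = inl (vc v w).
Proof. by []. Qed.

Lemma mulA a b c d (p : plus a b) (q : plus b c) (r : plus c d) :
  mul (mul p q) r = mul p (mul q r).
Proof.
elim/plus_ind: p => [v|e]; last by subst b; rewrite !mul1p.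
elim/plus_ind: q => [w|e]; last by subst c; rewrite mul1p mulp1.
elim/plus_ind: r => [x|e]; last by subst d; rewrite !mulp1.
by rewrite !mulll vcA.
Qed.

Definition proper a b (p : plus a b) : bool := if p is inl _ then true else false.

Lemma proper_mul a b c (p : plus a b) (q : plus b c) : proper (mul p q) = proper p || proper q.
Proof.
elim/plus_ind: p => [v|e]; last by subst b; rewrite mul1p.
by elim/plus_ind: q => [w|e] //; subst c; rewrite mulp1.
Qed.

Definition getl a b (p : plus a b) : proper p -> V a b :=
  match p with inl v => fun _ => v | inr e => fun h => False_rect _ (notF h) end.

Lemma getlE a b (p : plus a b) (h : proper p) : inl (getl h) = p.
Proof. by case: p h. Qed.

End Plus.
Arguments mul : simpl never.


Section PlusMap.
Variables (S S' : Type) (V : S -> S -> topologicalType) (V' : S' -> S' -> topologicalType)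
  (vc : forall a b c, V a b -> V b c -> V a c)
  (vc' : forall a b c, V' a b -> V' b c -> V' a c)
  (th : S -> S') (f : forall a b, V a b -> V' (th a) (th b)).
Hypothesis fM : forall a b c (x : V a b) (y : V b c), f (vc x y) = vc' (f x) (f y).

Definition plus_map a b (p : plus V a b) : plus V' (th a) (th b) :=
  match p with
  | inl v => inl (f v)
  | inr e => pid V' (congr1 th (uid e))
  end.

Lemma plus_map_pid a b (e : a = b) : plus_map (pid V e) = pid V' (congr1 th e).
Proof. by rewrite /plus_map /=; congr pid; exact: Prop_irrelevance. Qed.

Lemma plus_mapM a b c (p : plus V a b) (q : plus V b c) :
  plus_map (mul vc p q) = mul vc' (plus_map p) (plus_map q).
Proof.
elim/plus_ind: p => [v|e]; last first.
  by subst b; rewrite mul1p plus_map_pid mul1p.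
elim/plus_ind: q => [w|e]; last by subst c; rewrite mulp1 [plus_map (pid V _)]plus_map_pid mulp1.
by rewrite mulll /= fM.
Qed.

End PlusMap.

Section Ext.
Variables (S J : Type) (nn : J -> nat) (src tgt : J -> S).

Inductive est := Old of S | New j of 'I_(nn j).

Definition sx x := match x with Old a => a | New j _ => src j end.
Definition tx x := match x with Old a => a | New j _ => tgt j end.
Definition old x := if x is Old _ then true else false.

Definition chain x y : bool := match x, y with
  | New j i, New j' i' => `[< j = j' >] && (i < i')%N | _, _ => false end.

Lemma chain_sx x y : chain x y -> sx x = sx y.
Proof. by case: x y => [a|j i] [b|j' i'] //= /andP[/asboolP E _]; rewrite E. Qed.

Lemma chain_tx x y : chain x y -> tx x = tx y.
Proof. by case: x y => [a|j i] [b|j' i'] //= /andP[/asboolP E _]; rewrite E. Qed.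

Lemma chain_trans x y z : chain x y -> chain y z -> chain x z.
Proof.
case: x y z => [a|j i] [b|j' i'] [c|j'' i''] //= /andP[/asboolP E h] /andP[/asboolP E' h'].
by subst j' j''; rewrite (ltn_trans h h') andbT; apply/asboolP.
Qed.

Variables (V : S -> S -> topologicalType)
  (vc : forall a b c, V a b -> V b c -> V a c)
  (gam : forall j, V (src j) (tgt j)).
Hypothesis vcA : forall a b c d (x : V a b) (y : V b c) (z : V c d),
  vc (vc x y) z = vc x (vc y z).
Local Notation plus := (plus V).
Local Notation mul := (mul vc).
Local Notation pid := (pid V).

Definition kc x y (e : bool) : bool :=
  if e then `[< tx x = sx y >] && ~~ (old x && old y) else chain x y.

(* A path of the extended flow from [x] to [y] is a path of [V] from the end of
   the edge of [x] to the start of the edge of [y], or one of the two degenerate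
   paths: [true] is the identity (allowed unless [x] and [y] are both old) and
   [false] is the direct path along a common edge. *)
Definition epath x y : topologicalType :=
  (V (tx x) (sx y) + discrete_topology {e : bool | kc x y e})%type.

(** Here the identity is allowed between old states too, so that composition is one formula in
    [plus] and associativity reduces to [mulA]. The paths of the flow are those selected by [eok],
    and [emb] transports the laws back. *)
Definition epre x y : topologicalType :=
  (plus (tx x) (sx y) + discrete_topology {_ : unit | chain x y})%type.

Definition eok x y (u : epre x y) : bool :=
  match u with inl (inr _) => ~~ (old x && old y) | _ => true end.

Lemma kc_id x y : kc x y true -> tx x = sx y.
Proof. by case/andP => /asboolP. Qed.

Definition emb x y (u : epath x y) : epre x y :=
  match u with
  | inl v => inl (inl v)
  | inr (exist true h) => inl (pid (kc_id h))
  | inr (exist false h) => inr (exist _ tt h)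
  end.

Lemma emb_ok x y (u : epath x y) : eok (emb u).
Proof. by case: u => [v|[[] h]] //=; case/andP: h. Qed.

Lemma emb_inj x y : injective (@emb x y).
Proof.
case=> [v|[[] h]] [v'|[[] h']] //=; first by case=> ->.
- by move=> _; rewrite (bool_irrelevance h h').
- by move=> _; rewrite (bool_irrelevance h h').
Qed.

Lemma kc_uid x y (e : {_ : unit | `[< tx x = sx y >]}) :
  ~~ (old x && old y) -> kc x y true.
Proof. by move=> h; rewrite /kc h andbT; exact: svalP e. Qed.

Definition unemb x y (u : epre x y) : eok u -> epath x y :=
  match u with
  | inl (inl v) => fun _ => inl v
  | inl (inr e) => fun h => inr (exist (fun b => kc x y b) true (kc_uid e h))
  | inr c => fun _ => inr (exist (fun b => kc x y b) false (svalP c))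
  end.

Lemma unembK x y (u : epre x y) (h : eok u) : emb (unemb h) = u.
Proof.
case: u h => [[v|e]|c] h //=; last by congr inr; exact: sig_unit.
by congr inl; rewrite /pid; congr inr; exact: sig_unit.
Qed.

(** The factor inserted when composing at [x]: a path arriving at a new state is recorded only up to
    the start of its edge, and a path leaving it only from the end, so the edge itself has to be put
    back. *)
Definition mu x : plus (sx x) (tx x) :=
  match x return plus (sx x) (tx x) with
  | Old a => pid (erefl a)
  | New j _ => inl (gam j)
  end.

Definition ecompp x y z (u : epre x y) (u' : epre y z) : epre x z :=
  match u, u' with
  | inl p, inl q => inl (mul (mul p (mu y)) q)
  | inl p, inr c => inl (mul p (pid (chain_sx (svalP c))))
  | inr c, inl q => inl (mul (pid (chain_tx (svalP c))) q)
  | inr c, inr c' => inr (exist _ tt (chain_trans (svalP c) (svalP c')))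
  end.

Lemma eok_proper x y (p : plus (tx x) (sx y)) :
  eok (inl p : epre x y) = proper p || ~~ (old x && old y).
Proof. by case: p. Qed.

Lemma proper_mu y : proper (mu y) = ~~ old y.
Proof. by case: y. Qed.

Lemma chain_old x y : chain x y -> (old x = false) * (old y = false).
Proof. by case: x y => [a|j i] [b|j' i']. Qed.

Lemma ecompp_ok x y z (u : epre x y) (u' : epre y z) : eok u -> eok u' ->
  eok (ecompp u u').
Proof.
case: u u' => [p|c] [q|c']; rewrite /ecompp ?eok_proper ?proper_mul ?proper_mu //.
- by case: (proper p) (proper q) (old y) (old x) => [] [] [] [].
- by move=> h _; rewrite (chain_old (svalP c')).2 andbF !orbT.
- by move=> _ h; rewrite (chain_old (svalP c)).1 !orbT.
Qed.

Lemma mu_chain x y (c : chain x y) (e : sx x = sx y) (e' : tx x = tx y) :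
  mul (pid e) (mu y) = mul (mu x) (pid e').
Proof.
case: x y c e e' => [a|j i] [b|j' i'] // /andP[/asboolP E _]; subst j' => e e'.
by rewrite [RHS]mulp1; exact: mul1p.
Qed.

Lemma mul_pid a b c (e : a = b) (e' : b = c) (e'' : a = c) :
  mul (pid e) (pid e') = pid e''.
Proof. by subst b c; rewrite mul1p; congr pid; exact: Prop_irrelevance. Qed.

Lemma ecomppA x y z t (u : epre x y) (v : epre y z) (w : epre z t) :
  ecompp (ecompp u v) w = ecompp u (ecompp v w).
Proof.
have mA := mulA vcA.
case: u v w => [p|c] [q|c'] [r|c'']; rewrite /ecompp; last by congr inr; exact: sig_unit.
all: apply: (congr1 inl); rewrite ?mA //.
- apply: (congr1 (mul p)); rewrite -!mA; apply: (congr1 (fun u => mul u r)).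
  exact: mu_chain (svalP c') _ _.
- by apply: (congr1 (mul p)); exact: mul_pid.
- by rewrite -mA; apply: (congr1 (fun u => mul u r)); symmetry; exact: mul_pid.
Qed.

Definition ecomp x y z (u : epath x y) (u' : epath y z) : epath x z :=
  unemb (ecompp_ok (emb_ok u) (emb_ok u')).

Lemma emb_comp x y z (u : epath x y) (u' : epath y z) :
  emb (ecomp u u') = ecompp (emb u) (emb u').
Proof. exact: unembK. Qed.

Definition ext_flow : flow_data := FlowData ecomp.

Lemma ecompA x y z t (u : epath x y) (v : epath y z) (w : epath z t) :
  ecomp (ecomp u v) w = ecomp u (ecomp v w).
Proof. by apply: emb_inj; rewrite !emb_comp ecomppA. Qed.

End Ext.

Section ExtFlow.
Variables (R : realType) (hd : bool).
Local Notation I := (@unitI R).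

Lemma path_plus (S : Type) (V : S -> S -> topologicalType) (a b : S)
    (c : I -> plus V a b) : continuous c ->
  (exists2 v : I -> V a b, continuous v & c = fun r => inl (v r)) \/
  (exists e : a = b, c = fun=> pid V e).
Proof.
move=> /path_sum[[v cv ->]|[e ce ->]]; first by left; exists v.
right; exists (uid (e (i0 R))); apply/funext => r /=.
by rewrite (path_discrete ce); exact: pidE.
Qed.

Lemma mul_path (S : Type) (V : S -> S -> topologicalType)
    (vc : forall a b c, V a b -> V b c -> V a c) (a b c : S)
    (p : I -> plus V a b) (q : I -> plus V b c) : is_flow R hd (FlowData vc) ->
  continuous p -> continuous q -> continuous (fun r => mul vc (p r) (q r)).
Proof.
move=> [_ vcc _] cp cq; have [[v cv ->]|[e ->]] := path_plus cp; last first.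
  by subst b; rewrite (_ : (fun _ => _) = q) //; apply/funext => r; exact: mul1p.
have [[w cw ->]|[e ->]] := path_plus cq; last first.
  subst c; rewrite (_ : (fun _ => _) = fun r => inl (v r)); first exact: comp_cont cv (@inl_cont _ _).
  by apply/funext => r; exact: mulp1.
apply: comp_cont (@inl_cont _ _); exact: kelley_prod_path (vcc a b c) cv cw.
Qed.

Section One.
Variables (S J : Type) (nn : J -> nat) (src tgt : J -> S)
  (V : S -> S -> topologicalType) (vc : forall a b c, V a b -> V b c -> V a c)
  (gam : forall j, V (src j) (tgt j)).
Hypothesis Vflow : is_flow R hd (FlowData vc).
Local Notation E := (@epath S J nn src tgt V).

Lemma path_epath x y (c : I -> E x y) : continuous c ->
  (exists2 v : I -> V (tx tgt x) (sx src y), continuous v & c = fun r => inl (v r)) \/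
  (exists e, c = fun=> inr e).
Proof.
move=> /path_sum[[v cv ->]|[e ce ->]]; first by left; exists v.
by right; exists (e (i0 R)); apply/funext => r /=; rewrite (path_discrete ce).
Qed.

Lemma emb_cont x y : continuous (@emb S J nn src tgt V x y).
Proof.
apply/continuousP => U [[oU1 _] _]; split; last exact: discrete_open.
exact: oU1.
Qed.

Lemma emb_path x y (c : I -> E x y) :
  continuous (fun r => emb (c r)) -> continuous c.
Proof.
move=> cc; have [[v cv Ec]|[e ce Ec]] := path_sum cc; first have [[w cw Ev]|[e Ev]] := path_plus cv.
- rewrite (_ : c = fun r => inl (w r)); first exact: comp_cont cw (@inl_cont _ _).
  apply/funext => r; apply: emb_inj.
  by rewrite [LHS](congr1 (fun f => f r) Ec) /= Ev.
- rewrite (_ : c = fun=> c (i0 R)); first exact: cst_cont.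
  apply/funext => r; apply: emb_inj.
  by rewrite [LHS](congr1 (fun f => f r) Ec) [RHS](congr1 (fun f => f (i0 R)) Ec) /= Ev.
- rewrite (_ : c = fun=> c (i0 R)); first exact: cst_cont.
  apply/funext => r; apply: emb_inj.
  rewrite [LHS](congr1 (fun f => f r) Ec) [RHS](congr1 (fun f => f (i0 R)) Ec) /=.
  by rewrite (path_discrete ce).
Qed.

Lemma in_Top_epath x y : in_Top R hd (E x y).
Proof. by have [VT _ _] := Vflow; apply: in_Top_sum; [exact: VT|exact: in_Top_discrete]. Qed.

Lemma is_flow_ext : is_flow R hd (ext_flow nn vc gam).
Proof.
have [VT vcc vcA] := Vflow.
split; [exact: in_Top_epath| |exact: ecompA vcA].
move=> x y z; apply: kelley_prod_cont => a b ca cb; apply: emb_path.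
rewrite (_ : (fun _ => _) = fun r => ecompp vc gam (emb (a r)) (emb (b r))); last first.
  by apply/funext => r; exact: emb_comp.
have {}ca := comp_cont ca (@emb_cont _ _).
have {}cb := comp_cont cb (@emb_cont _ _).
move: ca cb => /path_sum[[p cp Ep]|[p cp Ep]] /path_sum[[q cq Eq]|[q cq Eq]].
- rewrite (_ : (fun _ => _) = fun r => inl (mul vc (mul vc (p r) (mu gam y)) (q r))).
    apply: comp_cont (@inl_cont _ _); apply: (mul_path Vflow) => //.
    by apply: (mul_path Vflow) => //; exact: cst_cont.
  apply/funext => r.
  by rewrite [emb (a r)](congr1 (fun f => f r) Ep) [emb (b r)](congr1 (fun f => f r) Eq).
- rewrite (_ : (fun _ => _) = fun r => inl (mul vc (p r) (pid V (chain_sx src (svalP (q (i0 R))))))).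
    apply: comp_cont (@inl_cont _ _); apply: (mul_path Vflow) => //; exact: cst_cont.
  apply/funext => r.
  rewrite [emb (a r)](congr1 (fun f => f r) Ep) [emb (b r)](congr1 (fun f => f r) Eq) /=.
  by rewrite (path_discrete cq).
- rewrite (_ : (fun _ => _) = fun r => inl (mul vc (pid V (chain_tx tgt (svalP (p (i0 R))))) (q r))).
    apply: comp_cont (@inl_cont _ _); apply: (mul_path Vflow) => //; exact: cst_cont.
  apply/funext => r.
  rewrite [emb (a r)](congr1 (fun f => f r) Ep) [emb (b r)](congr1 (fun f => f r) Eq) /=.
  by rewrite (path_discrete cp).
- rewrite (_ : (fun _ => _) = fun r => inr (exist _ tt (chain_trans (svalP (p (i0 R))) (svalP (q (i0 R)))))).
    exact: cst_cont.
  apply/funext => r.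
  rewrite [emb (a r)](congr1 (fun f => f r) Ep) [emb (b r)](congr1 (fun f => f r) Eq) /=.
  by congr inr; exact: sig_unit.
Qed.

End One.

Section Functoriality.
Variables (S J : Type) (nn : J -> nat) (src tgt : J -> S)
  (V V' : S -> S -> topologicalType) (vc : forall a b c, V a b -> V b c -> V a c)
  (vc' : forall a b c, V' a b -> V' b c -> V' a c)
  (gam : forall j, V (src j) (tgt j)) (gam' : forall j, V' (src j) (tgt j))
  (f : forall a b, V a b -> V' a b).
Local Notation E V := (@epath S J nn src tgt V).

Definition emap x y (u : E V x y) : E V' x y :=
  match u with inl v => inl (f v) | inr e => inr e end.

Lemma emap_cont x y : (forall a b, continuous (@f a b)) -> continuous (@emap x y).
Proof.
move=> cf; apply/continuousP => U [oU1 oU2]; split => //.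
by have /continuousP/(_ _ oU1) := cf (tx tgt x) (sx src y).
Qed.

Hypothesis fM : forall a b c (x : V a b) (y : V b c), f (vc x y) = vc' (f x) (f y).
Hypothesis fgam : forall j, f (gam j) = gam' j.

Let pm a b (p : plus V a b) : plus V' a b :=
  match p with inl v => inl (f v) | inr e => inr e end.

Let pm_pid a b (e : a = b) : pm (pid V e) = pid V' e.
Proof. by []. Qed.

Let pmM a b c (p : plus V a b) (q : plus V b c) : pm (mul vc p q) = mul vc' (pm p) (pm q).
Proof.
elim/plus_ind: p => [v|e]; last by subst b; rewrite mul1p pm_pid mul1p.
elim/plus_ind: q => [w|e]; last by subst c; rewrite mulp1 [pm (pid V _)]pm_pid mulp1.
by rewrite mulll /= fM.
Qed.

Let em x y (u : @epre S J nn src tgt V x y) : @epre S J nn src tgt V' x y :=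
  match u with inl p => inl (pm p) | inr c => inr c end.

Let em_emb x y (u : E V x y) : em (emb u) = emb (emap u).
Proof. by case: u => [v|[[] h]]. Qed.

Let pm_mu x : pm (mu gam x) = mu (nn := nn) gam' x.
Proof. by case: x => [a|j i] //=; rewrite fgam. Qed.

Lemma emapM x y z (u : E V x y) (u' : E V y z) :
  emap (ecomp vc gam u u') = ecomp vc' gam' (emap u) (emap u').
Proof.
apply: emb_inj; rewrite emb_comp -!em_emb emb_comp.
move: (emb u) (emb u') => [p|c] [q|c'] //.
- by apply: (congr1 inl); rewrite !pmM pm_mu.
- by apply: (congr1 inl); rewrite pmM.
- by apply: (congr1 inl); rewrite pmM.
Qed.

End Functoriality.

(* Maps out of the extended flow: [up x] runs from the new state [x] to the end
   of its edge, [dn x] from the start of the edge to [x], and [ch] along it. *)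
Section MapOut.
Variables (S J : Type) (nn : J -> nat) (src tgt : J -> S)
  (V : S -> S -> topologicalType) (vc : forall a b c, V a b -> V b c -> V a c)
  (gam : forall j, V (src j) (tgt j)).
Local Notation X := (est S nn).
Local Notation E := (@epath S J nn src tgt V).
Variables (G : flow_data) (th : X -> flow_state G).
Local Notation gc := (@flow_concat G).
Hypothesis Gflow : is_flow R hd G.
Local Notation PG := (plus (@flow_path G)).
Local Notation gmul := (mul gc).
Local Notation gpid := (pid (@flow_path G)).
Variables (phi : forall a b, V a b -> flow_path (th (Old nn a)) (th (Old nn b)))
  (up : forall j i, flow_path (th (New S (j := j) i)) (th (Old nn (tgt j))))
  (dn : forall j i, flow_path (th (Old nn (src j))) (th (New S (j := j) i)))
  (ch : forall x y : X, chain x y -> flow_path (th x) (th y)).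

Definition upp x : PG (th x) (th (Old nn (tx tgt x))) :=
  match x with Old a => gpid (erefl (th (Old nn a))) | New j i => inl (up i) end.

Definition dnp x : PG (th (Old nn (sx src x))) (th x) :=
  match x with Old a => gpid (erefl (th (Old nn a))) | New j i => inl (dn i) end.

Local Notation pm := (plus_map (th := fun a => th (Old nn a)) phi).

(** Computed in [G] with identities adjoined, so that old end states contribute no factor;
    [eoutp_proper] recovers a genuine path of [G]. *)
Definition eoutp x y (u : @epre S J nn src tgt V x y) : PG (th x) (th y) :=
  match u with
  | inl p => gmul (gmul (upp x) (pm p)) (dnp y)
  | inr c => inl (ch (svalP c))
  end.

Lemma eoutp_proper x y (u : @epre S J nn src tgt V x y) : eok u -> proper (eoutp u).
Proof.
case: u => [p|c] //; rewrite eok_proper /eoutp !proper_mul.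
have -> : proper (upp x) = ~~ old x by case: (x).
have -> : proper (dnp y) = ~~ old y by case: (y).
rewrite negb_and; case: p => [v|e] /=; first by rewrite orbT.
by rewrite orbF.
Qed.

Definition eout x y (u : E x y) : flow_path (th x) (th y) :=
  getl (eoutp_proper (emb_ok u)).

Lemma eoutE x y (u : E x y) : inl (eout u) = eoutp (emb u).
Proof. exact: getlE. Qed.

Lemma eout_old a b (v : V a b) : eout (inl v : E (Old nn a) (Old nn b)) = phi v.
Proof.
apply: (@inl_inj _ {_ : unit | `[< th (Old nn a) = th (Old nn b) >]}).
by rewrite eoutE /eoutp /emb; apply: etrans (@mulp1 _ _ _ _ _ _ _) _; exact: mul1p.
Qed.

Lemma eout_dn j i h :
  eout (inr (exist (fun e => kc src tgt (Old nn (src j)) (New S i) e) true h)) = dn (j := j) i.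
Proof.
apply: (@inl_inj _ {_ : unit | `[< th (Old nn (src j)) = th (New S i) >]}).
rewrite eoutE /eoutp /emb plus_map_pid.
apply: etrans (congr1 (fun z => mul _ z _) (@mulp1 _ _ _ _ _ _ _)) _; exact: mul1p.
Qed.

Lemma eout_up j i h :
  eout (inr (exist (fun e => kc src tgt (New S i) (Old nn (tgt j)) e) true h)) = up (j := j) i.
Proof.
apply: (@inl_inj _ {_ : unit | `[< th (New S i) = th (Old nn (tgt j)) >]}).
rewrite eoutE /eoutp /emb plus_map_pid.
apply: etrans (@mulp1 _ _ _ _ _ _ _) _; exact: mulp1.
Qed.

Lemma eout_ch x y (h : chain x y) : eout (inr (exist (fun e => kc src tgt x y e) false h)) = ch h.
Proof.
apply: (@inl_inj _ {_ : unit | `[< th x = th y >]}).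
rewrite eoutE /eoutp /emb; congr (inl (ch _)); exact: bool_irrelevance.
Qed.

Lemma eout_cont x y : in_Top R hd (E x y) -> (forall a b, continuous (@phi a b)) ->
  continuous (@eout x y).
Proof.
move=> ET cphi; apply: (path_cont (in_Top_gen ET)) => c cc.
suff : continuous (fun r => (inl (eout (c r)) : PG (th x) (th y))).
  move=> ccc; have [[v cv Ev]|[e Ev]] := path_plus ccc; last by have := congr1 (fun f => f (i0 R)) Ev.
  rewrite (_ : _ \o _ = v) //; apply/funext => r.
  by have := congr1 (fun f => f r) Ev => -[].
case: (path_epath cc) => [[v cv Ev]|[e Ev]]; last first.
  by rewrite (_ : (fun _ => _) = fun=> inl (eout (c (i0 R)))); [exact: cst_cont|rewrite Ev].
rewrite (_ : (fun _ => _) = fun r => gmul (gmul (upp x) (inl (phi (v r)))) (dnp y)); last first.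
  by apply/funext => r; rewrite eoutE Ev.
have Gf : is_flow R hd (FlowData gc) by case: (G) Gflow.
apply: (mul_path Gf); last exact: cst_cont.
apply: (mul_path Gf); first exact: cst_cont.
by apply: comp_cont (@inl_cont _ _); exact: comp_cont cv (cphi _ _).
Qed.

Hypothesis phiM : forall a b c (x : V a b) (y : V b c),
  phi (vc x y) = gc (phi x) (phi y).
Hypothesis du : forall j i, gc (dn i) (up i) = phi (gam j).
Hypothesis d_ch : forall j (i i' : 'I_(nn j)) (h : chain (New S i) (New S i')),
  gc (dn i) (ch h) = dn i'.
Hypothesis ch_u : forall j (i i' : 'I_(nn j)) (h : chain (New S i) (New S i')),
  gc (ch h) (up i') = up i.
Hypothesis ch_ch : forall x y z (h : chain x y) (h' : chain y z) (h'' : chain x z),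
  gc (ch h) (ch h') = ch h''.

Lemma eoutM x y z (u : E x y) (u' : E y z) :
  eout (ecomp vc gam u u') = gc (eout u) (eout u').
Proof.
have [_ _ gA] := Gflow.
have mA := mulA gA.
apply: (@inl_inj _ {_ : unit | `[< th x = th z >]}).
rewrite -mulll !eoutE emb_comp.
have pM := plus_mapM (th := fun a => th (Old nn a)) phiM.
have dup (w : X) : gmul (dnp w) (upp w) = pm (mu gam w).
  case: w => [a|j i]; last by apply: (congr1 inl); exact: du.
  by apply: etrans (mul1p _ _ _) _; rewrite /= /pid; congr inr; exact: sig_unit.
have dch (v w : X) (h : chain v w) : gmul (dnp v) (inl (ch h)) =
    gmul (pm (pid V (chain_sx src h))) (dnp w).
  case: v w h => [a|j i] [b|j' i'] // h; have := h; move=> /andP[/asboolP e _].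
  subst j'; rewrite plus_map_pid mul1p.
  by apply: etrans (mulll _ _ _) _; rewrite d_ch.
have chu (v w : X) (h : chain v w) : gmul (inl (ch h)) (upp w) =
    gmul (upp v) (pm (pid V (chain_tx tgt h))).
  case: v w h => [a|j i] [b|j' i'] // h; have := h; move=> /andP[/asboolP e _].
  subst j'; rewrite plus_map_pid mulp1.
  by apply: etrans (mulll _ _ _) _; rewrite ch_u.
move: (emb u) (emb u') => [p|c] [q|c'] /=.
- rewrite !pM -dup !mA; congr (gmul _ _).
- by rewrite !pM !mA dch.
- by rewrite !pM -!mA chu.
- by apply: (congr1 inl); symmetry; exact: ch_ch.
Qed.

End MapOut.
End ExtFlow.

(** * Flows presented by words *)

Section Presentation.
Variables (R : realType) (hd : bool).
Local Notation I := (@unitI R).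

Inductive cst (p : nat) := Bot | Top | In of 'I_p.
Arguments Bot {p}.
Arguments Top {p}.

Variables (S : Type) (A : S -> S -> topologicalType)
  (ac : forall a b c, A a b -> A b c -> A a c).
Variables (Q : forall p, cst p -> cst p -> topologicalType)
  (qc : forall p (u v w : cst p), Q u v -> Q v w -> Q u w)
  (K : nat -> topologicalType) (gK : forall p, K p -> Q (@Bot p) (@Top p)).
Variables (J : Type) (nn : J -> nat) (src tgt : J -> S)
  (gam : forall j, A (src j) (tgt j)).
Hypotheses (Aflow : is_flow R hd (FlowData ac))
  (Qflow : forall p, is_flow R hd (FlowData (@qc p))).

Local Notation X := (est S nn).

Definition sg j (u : cst (nn j)) : X :=
  match u with Bot => Old nn (src j) | Top => Old nn (tgt j) | In i => New S i end.

(** A cocone under the pushout diagram, with the images of states prescribed by [th]. By [rK] the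
    whole of [K], the path space of the small globe, is sent to one path, the edge [gam j]. *)
Record realization (G : flow_data) (th : X -> flow_state G) := Realization {
  rA : forall a b, A a b -> flow_path (th (Old nn a)) (th (Old nn b));
  rQ : forall j u v, Q u v -> flow_path (th (@sg j u)) (th (@sg j v));
  rA_cont : forall a b, continuous (@rA a b);
  rQ_cont : forall j u v, continuous (@rQ j u v);
  rAM : forall a b c (x : A a b) (y : A b c), rA (ac x y) = flow_concat (rA x) (rA y);
  rQM : forall j u v w (x : Q u v) (y : Q v w),
    rQ (j := j) (qc x y) = flow_concat (rQ x) (rQ y);
  rK : forall j (k : K (nn j)), @rQ j Bot Top (gK k) = rA (gam j) }.

Inductive word : X -> X -> Type :=
| wA a b (v : A a b) : word (Old nn a) (Old nn b)
| wQ j u v (q : Q u v) : word (@sg j u) (@sg j v)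
| wC x y z (w : word x y) (w' : word y z) : word x z.

Fixpoint eval G th (r : @realization G th) x y (w : word x y) : flow_path (th x) (th y) :=
  match w with
  | wA a b v => rA r v
  | wQ j u v q => rQ r q
  | wC x y z w w' => flow_concat (eval r w) (eval r w')
  end.

(** Agreement in every flow of the chosen category, rather than a generated relation: the universal
    property is then immediate, and it is also the right relation in the Delta-Hausdorff case, where
    a generated one might be too fine. *)
Definition word_eq x y : word x y -> set (word x y) := fun w w' =>
  forall G th (r : @realization G th), is_flow R hd G -> eval r w = eval r w'.

Definition wpath_set x y : set (set (word x y)) := [set P | exists w, P = word_eq w].
Definition wpath x y : Type := {P : set (word x y) | wpath_set P}.

HB.instance Definition _ x y := gen_eqMixin (wpath x y).
HB.instance Definition _ x y := gen_choiceMixin (wpath x y).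

Definition wcl x y (w : word x y) : wpath x y := exist _ (word_eq w) (ex_intro _ w erefl).

Lemma wclP x y (w w' : word x y) : wcl w = wcl w' <-> word_eq w w'.
Proof.
split=> [/(congr1 sval)/= E|E]; first by rewrite E => G th r Gf.
suff e : word_eq w = word_eq w'.
  by rewrite /wcl; move: (ex_intro _ w _) (ex_intro _ w' _); rewrite e => h h';
    rewrite (Prop_irrelevance h h').
by apply/seteqP; split=> t wt G th r Gf; rewrite -wt // E.
Qed.

Lemma wcl_surj x y (c : wpath x y) : exists w, c = wcl w.
Proof.
case: c => P [w E]; exists w; subst P.
by rewrite /wcl; congr exist; exact: Prop_irrelevance.
Qed.

Definition wrep x y (c : wpath x y) : word x y := projT1 (cid (wcl_surj c)).

Lemma wrepK x y (c : wpath x y) : wcl (wrep c) = c.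
Proof. by rewrite /wrep; case: cid. Qed.

(* Families of words with a fixed shape and continuously moving letters. *)
Inductive fam : forall x y, (I -> word x y) -> Prop :=
| famA a b (c : I -> A a b) : continuous c -> fam (fun r => wA (c r))
| famQ j u v (c : I -> Q u v) : continuous c -> fam (fun r => @wQ j u v (c r))
| famC x y z (f : I -> word x y) (g : I -> word y z) : fam f -> fam g ->
    fam (fun r => wC (f r) (g r)).

Definition wopen x y (U : set (wpath x y)) :=
  forall f : I -> word x y, fam f -> open [set r | U (wcl (f r))].

Lemma wopenT x y : wopen [set: wpath x y].
Proof. by move=> f _; exact: openT. Qed.

Lemma wopenI x y : setI_closed (@wopen x y).
Proof. by move=> U V oU oV f ff; apply: openI; [exact: oU|exact: oV]. Qed.

Lemma wopen_bigU x y (I : Type) (F : I -> set (wpath x y)) :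
  (forall i, wopen (F i)) -> wopen (\bigcup_i F i).
Proof. by move=> oF f ff; apply: bigcup_open => i _; exact: oF. Qed.

HB.instance Definition _ x y := isOpenTopological.Build (wpath x y)
  (@wopenT x y) (@wopenI x y) (@wopen_bigU x y).

Lemma fam_cont x y (f : I -> word x y) : fam f -> continuous (fun r => wcl (f r)).
Proof. by move=> ff; apply/continuousP => U; exact. Qed.

Lemma fam_const x y (w : word x y) : fam (fun=> w).
Proof.
elim: w => [a b v|j u v q|x' y' z w fw w' fw'].
- exact: (famA (c := fun=> v) (@cst_cont _ _ v)).
- exact: (famQ (c := fun=> q) (@cst_cont _ _ q)).
- exact: famC.
Qed.

Lemma fam_comp x y (f : I -> word x y) (p : I -> I) : continuous p -> fam f ->
  fam (fun r => f (p r)).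
Proof.
move=> cp; elim=> {x y f} [a b c cc|j u v c cc|x y z f g _ ff _ fg].
- by apply: (famA (c := fun r => c (p r))); exact: comp_cont cp cc.
- by apply: (famQ (c := fun r => c (p r))); exact: comp_cont cp cc.
- exact: famC.
Qed.

Lemma fam_final x y : final_paths
  [set c : I -> wpath x y | exists2 f, fam f & c = fun r => wcl (f r)].
Proof.
split=> [_ [f ff ->]|U oU|c]; first exact: fam_cont.
  have : wopen U; last by [].
  by move=> f ff; apply: (oU (fun r => wcl (f r))); exists f.
have [w ->] := wcl_surj c.
by exists (fun=> wcl w), (i0 R); split => //; exists (fun=> w) => //; exact: fam_const.
Qed.

Definition wconcat x y z (c : wpath x y) (d : wpath y z) : wpath x z :=
  wcl (wC (wrep c) (wrep d)).

Lemma wconcatE x y z (w : word x y) (w' : word y z) :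
  wconcat (wcl w) (wcl w') = wcl (wC w w').
Proof.
by apply/wclP => G th r Gf /=; congr flow_concat; apply: (iffLR (wclP _ _) (wrepK _)).
Qed.

Definition wflow : flow_data := FlowData wconcat.

Section Evaluation.
Variables (G : flow_data) (th : X -> flow_state G) (r : realization th).
Hypothesis Gflow : is_flow R hd G.

Definition evalW x y (c : wpath x y) : flow_path (th x) (th y) := eval r (wrep c).

Lemma evalWE x y (w : word x y) : evalW (wcl w) = eval r w.
Proof. by apply: (iffLR (wclP _ _) (wrepK (wcl w))). Qed.

Lemma evalW_cont x y : continuous (@evalW x y).
Proof.
apply/continuousP => U oU; have : wopen (@evalW x y @^-1` U); last by [].
move=> f ff; suff : continuous (fun t => eval r (f t)).
  move=> /continuousP/(_ U oU); congr open; apply/seteqP.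
  by split=> t /=; rewrite evalWE.
elim: ff => {x y U oU f} [a b c cc|j u v c cc|x y z f g _ ff _ fg] /=.
- exact: comp_cont cc (@rA_cont _ _ r a b).
- exact: comp_cont cc (@rQ_cont _ _ r j u v).
- have [_ gc _] := Gflow; exact: kelley_prod_path (gc _ _ _) ff fg.
Qed.

Lemma evalWM x y z (c : wpath x y) (d : wpath y z) :
  evalW (wconcat c d) = flow_concat (evalW c) (evalW d).
Proof.
have [w ->] := wcl_surj c; have [w' ->] := wcl_surj d.
by rewrite wconcatE !evalWE.
Qed.

Definition evalW_map : flow_map wflow G := @FlowMap wflow G th evalW evalW_cont evalWM.

End Evaluation.

Lemma wflow_path_gen x y : path_generated R (wpath x y).
Proof.
move=> U oU; have : wopen U; last by [].
by move=> f ff; apply: (oU (fun r => wcl (f r))); exact: fam_cont.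
Qed.

Inductive is_evalW x y : forall U : topologicalType, (wpath x y -> U) -> Prop :=
| IsEvalW G th (r : @realization G th) : is_flow R hd G ->
    is_evalW (U := flow_path (th x) (th y)) (@evalW G th r x y).

(** Separation holds because evaluations in flows separate words by definition of [word_eq].
    Composition is continuous because the families [fam] generate the topology and concatenating two
    of them is again a [fam]. *)
Lemma is_flow_W : is_flow R hd wflow.
Proof.
split=> /= [x y|x y z|x y z t c d e].
- apply/in_TopP; split=> [|h]; first exact: wflow_path_gen.
  apply: (path_separated_joint (P := @is_evalW x y)) => [U f|c d].
    case=> {U f} G th r Gf; split=> [c cc|]; first exact: comp_cont cc (@evalW_cont G th r Gf x y).
    by have [GT _ _] := Gf; exact: in_Top_sep (GT _ _) h.
  have [w ->] := wcl_surj c; have [w' ->] := wcl_surj d => H.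
  apply/wclP => G th r Gf; rewrite -!evalWE //.
  by apply: H; constructor.
- apply: kelley_prod_cont => a b ca cb.
  apply: (final_prod (@fam_final x y) (@fam_final y z) (g := @wconcat x y z)) => //.
  move=> _ _ [f ff ->] [g fg ->].
  apply: (path_cont (@II_delta_generated R)) => p cp.
  rewrite (_ : _ \o _ = fun r => wcl (wC (f (p r).1) (g (p r).2))); last first.
    by apply/funext => r /=; rewrite wconcatE.
  apply: fam_cont; apply: famC.
    by apply: (fam_comp _ ff) => //; exact: comp_cont cp (@fst_cont _ _).
  by apply: (fam_comp _ fg) => //; exact: comp_cont cp (@snd_cont _ _).
- have [w ->] := wcl_surj c; have [w' ->] := wcl_surj d; have [w'' ->] := wcl_surj e.
  rewrite !wconcatE; apply/wclP => G th r Gf /=.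
  by have [_ _ ->] := Gf.
Qed.

Definition iA a b (v : A a b) : wpath (Old nn a) (Old nn b) := wcl (wA v).
Definition iQ j u v (q : Q u v) : wpath (@sg j u) (@sg j v) := wcl (wQ q).

Lemma iA_cont a b : continuous (@iA a b).
Proof.
have [AT _ _] := Aflow; apply: (path_cont (in_Top_gen (AT a b))) => c cc.
exact: fam_cont (famA cc).
Qed.

Lemma iQ_cont j u v : continuous (@iQ j u v).
Proof.
have [QT _ _] := Qflow (nn j); apply: (path_cont (in_Top_gen (QT u v))) => c cc.
exact: fam_cont (famQ cc).
Qed.

Lemma iAM a b c (x : A a b) (y : A b c) : iA (ac x y) = wconcat (iA x) (iA y).
Proof. by rewrite wconcatE; apply/wclP => G th r Gf; exact: rAM. Qed.

Lemma iQM j u v w (x : Q u v) (y : Q v w) :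
  iQ (j := j) (qc x y) = wconcat (iQ x) (iQ y).
Proof. by rewrite wconcatE; apply/wclP => G th r Gf; exact: rQM. Qed.

Lemma iK j (k : K (nn j)) : @iQ j Bot Top (gK k) = iA (gam j).
Proof. by apply/wclP => G th r Gf; exact: rK. Qed.

Lemma wpath_ind (P : forall x y, wpath x y -> Prop) :
  (forall a b v, P _ _ (@iA a b v)) -> (forall j u v q, P _ _ (@iQ j u v q)) ->
  (forall x y z c d, P x y c -> P y z d -> P x z (wconcat c d)) ->
  forall x y c, P x y c.
Proof.
move=> PA PQ PC x y c; have [w ->] := wcl_surj c.
elim: w => [a b v|j u v q|x' y' z w Pw w' Pw']; [exact: PA|exact: PQ|].
by rewrite -wconcatE; exact: PC.
Qed.

End Presentation.

(** * Wide pushouts as cell complexes *)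

Section WithTop.
Variables (J : choiceType) (r : rel J) (wo : well_order r).

Let wo_pick (P : J -> Prop) : (exists x, P x) ->
  exists m, [/\ P m, forall x, P x -> r m x
    & forall m', P m' -> (forall x, P x -> r m' x) -> m' = m].
Proof.
move=> [x Px]; have [|m [[/asboolP Pm lm] um]] := wo (A := fun k => `[< P k >]).
  by exists x; apply/asboolP.
exists m; split => // [y Py|m' Pm' lm']; first by apply: lm; apply/asboolP.
by symmetry; apply: um; split; [apply/asboolP|move=> y /asboolP; exact: lm'].
Qed.

Let r_refl : reflexive r.
Proof.
by move=> x; have [m [-> + _]] := wo_pick (P := fun y => y = x) (ex_intro _ x erefl); exact.
Qed.

Let r_total : total r.
Proof.
move=> x y; have [|m [[->|->] lm _]] := wo_pick (P := fun z => z = x \/ z = y).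
- by exists x; left.
- by rewrite lm //; right.
- by rewrite orbC lm //; left.
Qed.

Let r_anti : antisymmetric r.
Proof.
move=> x y /andP[xy yx]; have [|m [_ _ um]] := wo_pick (P := fun z => z = x \/ z = y).
  by exists x; left.
have ex : x = m by apply: um; [left|move=> z [->|->]; [exact: r_refl|]].
have ey : y = m by apply: um; [right|move=> z [->|->]; [|exact: r_refl]].
by rewrite ex.
Qed.

Let r_trans : transitive r.
Proof.
move=> y x z xy yz.
have [|m [[->|[->|->]] lm _]] := wo_pick (P := fun t => t = x \/ (t = y \/ t = z)).
- by exists x; left.
- by apply: lm; right; right.
- by have -> : x = y by apply: r_anti; rewrite xy lm //; left.
- by have <- : y = z by apply: r_anti; rewrite yz lm //; right; left.
Qed.

(** Stage [t] of the tower attaches the cells strictly below [t]; the added top makes the last stage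
    contain all of them. The proof [wo] is recorded in the type so that the order instances can
    depend on it. *)
Definition with_top : Type := let _ := wo in option J.
HB.instance Definition _ := Choice.on with_top.

Definition tle (x y : with_top) : bool :=
  match x, y with
  | _, None => true | None, Some _ => false | Some i, Some j => r i j
  end.

Lemma tle_refl : reflexive tle. Proof. by case=> [x|] //=; exact: r_refl. Qed.

Lemma tle_anti : antisymmetric tle.
Proof. by case=> [x|] [y|] //= /r_anti ->. Qed.

Lemma tle_trans : transitive tle.
Proof. by case=> [y|] [x|] [z|] //=; exact: r_trans. Qed.

Lemma tle_total : total tle.
Proof. by case=> [x|] [y|] //=; exact: r_total. Qed.

HB.instance Definition _ := Order.Le_isPOrder.Build Order.default_display with_top
  tle_refl tle_anti tle_trans.
HB.instance Definition _ := Order.POrder_isTotal.Build Order.default_display with_top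
  tle_total.

Lemma with_top_wo : well_order (<=%O : rel with_top).
Proof.
move=> A [x Ax].
suff [m [Am lm]] : exists m, m \in A /\ forall y, y \in A -> (m <= y)%O.
  exists m; split=> [|m' [Am' lm']]; first by split.
  by apply: le_anti; rewrite lm //= lm'.
have [[i Ai]|nA] := pselect (exists i : J, (Some i : with_top) \in A).
  have [|m [Am lm _]] := wo_pick (P := fun j => (Some j : with_top) \in A); first by exists i.
  exists (Some m); split => // -[j|] // Aj; exact: lm.
exists None; split=> [|[j|] Aj] //; first by case: x Ax => [i|] // Ai; case: nA; exists i.
by case: nA; exists j.
Qed.

End WithTop.

Section Isomorphisms.
Variable C : category.

Definition inverse (a b : C) (f : hom a b) (g : hom b a) := g \c f = idm a /\ f \c g = idm b.

Lemma pushout_iso (a b a' b' c d : C) (f : hom a b) (f' : hom a' b')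
    (x : hom a a') (x' : hom a' a) (y : hom b b') (y' : hom b' b)
    (g : hom a c) (i : hom b d) (j : hom c d) :
  inverse x x' -> inverse y y' -> y \c f = f' \c x -> is_pushout f g i j ->
  is_pushout f' (g \c x') (i \c y') j.
Proof.
move=> [xx xx'] [yy yy'] E [po U].
have E' : y' \c f' = f \c x'.
  by rewrite -[LHS]compm1 -xx' -compA (compA f') -E !compA yy comp1m.
split; first by rewrite -compA E' !compA po.
move=> e u v uv; have [|w [[wi wj] wu]] := U _ (u \c y) v.
  by rewrite -compA E compA uv -!compA xx compm1.
exists w; split=> [|w' [wi' wj']]; first by rewrite compA wi -compA yy' compm1.
by apply: wu; split => //; rewrite -wi' -!compA yy compm1.
Qed.

End Isomorphisms.

Section WidePushout.
Variables (C : category) (J : choiceType) (P Q : J -> C)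
  (f : forall j, hom (P j) (Q j)) (A : C) (a : forall j, hom (P j) A).

Definition is_wide_pushout (D : J -> Prop) (W : C) (i : hom A W)
    (q : forall j, D j -> hom (Q j) W) :=
  (forall j (Dj : D j), q j Dj \c f j = i \c a j) /\
  forall (G : C) (u : hom A G) (v : forall j, D j -> hom (Q j) G),
    (forall j (Dj : D j), v j Dj \c f j = u \c a j) ->
    exists! w : hom W G, w \c i = u /\ forall j (Dj : D j), w \c q j Dj = v j Dj.

Variables (W : (J -> Prop) -> C) (i : forall D, hom A (W D))
  (q : forall D j, D j -> hom (Q j) (W D)).
Hypothesis Wide : forall D, is_wide_pushout (i D) (@q D).

Lemma wide_eq D (G : C) (w w' : hom (W D) G) : w \c i D = w' \c i D ->
  (forall j (Dj : D j), w \c q Dj = w' \c q Dj) -> w = w'.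
Proof.
move=> E1 E2; have [E U] := Wide D.
have [|w0 [_ w0u]] := U G (w' \c i D) (fun j Dj => w' \c q Dj).
  by move=> j Dj; rewrite -!compA E.
by rewrite -(w0u w) // -(w0u w').
Qed.

Let sub_map D D' : (forall j, D j -> D' j) -> exists w : hom (W D) (W D'),
  w \c i D = i D' /\ forall j (Dj : D j) (Dj' : D' j), w \c q Dj = q Dj'.
Proof.
move=> DD'; have [_ U] := Wide D; have [E _] := Wide D'.
have [|w [[wi wq] _]] := U _ (i D') (fun j Dj => q (DD' _ Dj)); first by move=> j Dj; exact: E.
by exists w; split => // j Dj Dj'; rewrite wq (Prop_irrelevance (DD' j Dj) Dj').
Qed.

Lemma wide_empty D : (forall j, ~ D j) -> exists g, inverse (i D) g.
Proof.
move=> D0; have [_ U] := Wide D.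
have [|g [[gi _] _]] := U _ (idm A) (fun j Dj => False_rect _ (D0 j Dj)).
  by move=> j Dj; case: (D0 j Dj).
exists g; split => //; apply: wide_eq; first by rewrite -compA gi compm1 comp1m.
by move=> j Dj; case: (D0 j Dj).
Qed.

Variables (r : rel J) (wo : well_order r).
Local Notation T := (with_top wo).

Let DT (t : T) : J -> Prop := fun j => ((Some j : T) < t)%O.

Let DT_sub (s t : T) : (s <= t)%O -> forall j, DT s j -> DT t j.
Proof. by move=> st j /lt_le_trans; exact. Qed.

Let tm (s t : T) (h : (s <= t)%O) := projT1 (cid (sub_map (DT_sub h))).

Let tmP (s t : T) (h : (s <= t)%O) : tm h \c i (DT s) = i (DT t) /\
  forall j (Dj : DT s j) (Dj' : DT t j), tm h \c q Dj = q Dj'.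
Proof. by rewrite /tm; case: cid. Qed.

Let tm_id s (h : (s <= s)%O) : tm h = idm (W (DT s)).
Proof.
have [ti tq] := tmP h; apply: wide_eq; first by rewrite ti comp1m.
by move=> j Dj; rewrite (tq _ _ Dj) comp1m.
Qed.

Let tm_comp s t u (h : (s <= t)%O) (h' : (t <= u)%O) (h'' : (s <= u)%O) :
  tm h'' = tm h' \c tm h.
Proof.
have [ti tq] := tmP h; have [ti' tq'] := tmP h'; have [ti'' tq''] := tmP h''.
apply: wide_eq; first by rewrite ti'' -compA ti ti'.
move=> j Dj; rewrite (tq'' _ _ (DT_sub h'' Dj)) -compA (tq _ _ (DT_sub h Dj)).
by rewrite (tq' _ _ (DT_sub h'' Dj)).
Qed.

Let tow : @tower C Order.default_display T := Tower tm_id tm_comp.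

(** The wide pushout over a directed union of index sets is the colimit of the wide pushouts over
    its members; this serves both at the limit stages and for the whole tower. *)
Let wide_colimit (DW : T -> Prop) (t : T)
    (leg : forall s, DW s -> hom (W (DT s)) (W (DT t))) :
  (exists s, DW s) -> (forall j, DT t j -> exists2 s, DW s & DT s j) ->
  (forall s, DW s -> (s <= t)%O) ->
  (forall s (Ds : DW s) (h : (s <= t)%O), leg s Ds = tm h) ->
  is_colimit (X := tow) leg.
Proof.
move=> [s0 Ds0] cov DWt legE; split=> [s u h Ds Du|e u uc].
  rewrite (legE _ _ (DWt _ Ds)) (legE _ _ (DWt _ Du)).
  by symmetry; exact: tm_comp.
have [E U] := Wide (DT t).
have ui s s' (Ds : DW s) (Ds' : DW s') : u s Ds \c i (DT s) = u s' Ds' \c i (DT s').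
  wlog ss' : s s' Ds Ds' / (s <= s')%O.
    by case: (leP s s') => [|/ltW] h H; [|symmetry]; exact: H.
  by rewrite -(uc _ _ ss' Ds Ds') -compA (tmP ss').1.
have uq s s' (Ds : DW s) (Ds' : DW s') j (Dj : DT s j) (Dj' : DT s' j) :
    u s Ds \c q Dj = u s' Ds' \c q Dj'.
  wlog ss' : s s' Ds Ds' Dj Dj' / (s <= s')%O.
    by case: (leP s s') => [|/ltW] h H; [|symmetry]; exact: H.
  by rewrite -(uc _ _ ss' Ds Ds') -compA ((tmP ss').2 _ _ Dj').
have vex j : DT t j -> exists v : hom (Q j) e,
    forall s (Ds : DW s) (Dj : DT s j), u s Ds \c q Dj = v.
  move=> /cov[s Ds Dj]; exists (u s Ds \c q Dj) => s' Ds' Dj'; exact: uq.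
pose v j (Dj : DT t j) := projT1 (cid (vex j Dj)).
have vE j Dj s (Ds : DW s) (Dj' : DT s j) : u s Ds \c q Dj' = v j Dj.
  by rewrite /v; case: cid => /= ? ->.
have [|w [[wi wq] wu]] := U _ (u s0 Ds0 \c i _) v.
  move=> j Dj; have [s Ds Djs] := cov _ Dj.
  by rewrite -(vE _ _ _ Ds Djs) (ui s0 s _ Ds) -!compA (Wide (DT s)).1.
exists w; split=> [s Ds|w' w'l].
  rewrite (legE _ _ (DWt _ Ds)); have [ti tq] := tmP (DWt _ Ds).
  apply: wide_eq; first by rewrite -compA ti wi; exact: ui.
  by move=> j Dj; rewrite -compA (tq _ _ (DT_sub (DWt _ Ds) Dj)) wq -(vE _ _ _ Ds Dj).
apply: wu; split=> [|j Dj].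
  by rewrite -(w'l s0 Ds0) (legE _ _ (DWt _ Ds0)) -compA (tmP _).1.
have [s Ds Djs] := cov _ Dj.
rewrite -(vE _ Dj _ Ds Djs) -(w'l s Ds) (legE _ _ (DWt _ Ds)) -compA.
by rewrite ((tmP _).2 _ _ Dj).
Qed.

(** A wide pushout is reached from its empty stage by attaching one cell at a time along a
    well-order of the index set: passing from [Some k] to its successor is a pushout of the cell
    [k]. *)
Lemma wide_pushout_cell (L : mclass C) :
  (forall j c d (g : hom (P j) c) (k : hom (Q j) d) (t : hom c d),
     is_pushout (f j) g k t -> pushout_of L t) ->
  exists (D D' : J -> Prop) (m : hom (W D) (W D')),
    [/\ forall j, ~ D j, forall j, D' j & cell L m].
Proof.
move=> PL.
have [bt btmin] : exists bt : T, forall t, (bt <= t)%O.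
  have [|bt _ btP] := wo_least (@with_top_wo J r wo) (P := fun _ => True); first by exists None.
  by exists bt => t; exact: btP.
have leT (t : T) : (t <= (None : T))%O by case: t.
exists (DT bt), (DT None), (tm (leT bt)); split.
- by move=> j; rewrite /DT ltNge btmin.
- by move=> j; rewrite /DT lt_neqAle leT andbT.
pose leg s (_ : True) : hom (tob tow s) (W (DT None)) := tm (leT s).
apply: (@TransfiniteComposition C _ _ T bt tow (W (DT None)) leg) => //.
- exact: with_top_wo.
- move=> t [[s0 s0t] nsucc]; apply: wide_colimit.
  + by exists s0.
  (* If no stage below [t] already contains the cell [j], then nothing lies strictly between
     [Some j] and [t], so [t] would be a successor. *)
  + move=> j Dj; apply: contrapT => H; apply: nsucc; exists (Some j); split => // k.
    have [jk|] := ltP (Some j : T) k; last by left.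
    by right; rewrite leNgt; apply/negP => kt; apply: H; exists k.
  + by move=> s /ltW.
  + by move=> s Ds h; congr tm; exact: bool_irrelevance.
- move=> s t h [st stP].
  have [k Ek] : exists k, s = Some k.
    by case: s st {h stP} => [k|] st; [exists k|move: (lt_le_trans st (leT t)); rewrite ltxx].
  have Dtk : DT t k by rewrite /DT -Ek.
  apply: (PL k _ _ (i (DT s) \c a k) (q Dtk)).
  have [ti tq] := tmP h; have [E U] := Wide (DT t).
  split; first by rewrite E compA ti.
  move=> e u v uv.
  have sub j : DT t j -> j <> k -> DT s j.
    move=> Dj jk; rewrite /DT lt_neqAle Ek.
    apply/andP; split; first by apply/eqP => -[].
    rewrite -Ek; have [//|tj] := stP (Some j).
    by move: (lt_le_trans Dj tj); rewrite ltxx.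
  have vex j : DT t j -> exists vj : hom (Q j) e,
      (forall Dj : DT s j, v \c q Dj = vj) /\ (forall e : k = j, eq_rect k (fun j => hom (Q j) _) u j e = vj)
      /\ vj \c f j = v \c i (DT s) \c a j.
    move=> Dj; have [e0|jk] := pselect (k = j).
      subst j; exists u; split=> [Dk|]; first by have : (s < s)%O; [rewrite {1}Ek; exact: Dk|rewrite ltxx].
      split; first by move=> e0; rewrite (Prop_irrelevance e0 erefl).
      by rewrite uv compA.
    exists (v \c q (sub _ Dj (fun e => jk (esym e)))); split=> [Dj'|].
      by congr (_ \c q _); exact: Prop_irrelevance.
    split; first by move=> e0; case: jk.
    by rewrite -!compA (Wide (DT s)).1.
  pose w j (Dj : DT t j) := projT1 (cid (vex j Dj)).
  have wP j Dj := projT2 (cid (vex j Dj)).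
  have [|z [[zi zq] zu]] := U _ (v \c i (DT s)) w.
    by move=> j Dj; have [_ [_]] := wP j Dj.
  exists z; split.
    split; first by have [_ [wPk _]] := wP k Dtk; rewrite zq; symmetry; exact: (wPk erefl).
    apply: wide_eq; first by rewrite -compA ti zi.
    move=> j Dj; rewrite -compA (tq _ _ (DT_sub h Dj)) zq.
    by have [wPj _] := wP j (DT_sub h Dj); symmetry; exact: wPj.
  move=> z' [z'u z'v]; apply: zu; split; first by rewrite -z'v -compA ti.
  move=> j Dj; have [wP1 [wP2 _]] := wP j Dj.
  have [e0|jk] := pselect (k = j).
    subst j; rewrite -[RHS](wP2 erefl) /= -z'u; congr (_ \c q _); exact: Prop_irrelevance.
  have Ds := sub _ Dj (fun e => jk (esym e)).
  by rewrite -[RHS](wP1 Ds) -z'v -compA (tq _ _ Dj).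
- apply: wide_colimit.
  + by exists None.
  + by move=> j Dj; exists None.
  + by move=> s _; exact: leT.
  + by move=> s [] h; rewrite /leg; congr tm; exact: bool_irrelevance.
Qed.

End WidePushout.

(** * Equality of maps of flows, and maps out of globes *)

Section FlowMaps.
Implicit Types F G : flow_data.

(** Bundles a path with its end states, so that paths with only provably equal ends can be
    compared. *)
Definition tot G (a b : flow_state G) (x : flow_path a b) :=
  existT (fun st : flow_state G * flow_state G => flow_path st.1 st.2) (a, b) x.

Lemma tot_inj G (a b : flow_state G) (x y : flow_path a b) : tot x = tot y -> x = y.
Proof. by move=> e; have := projT2_eq e; rewrite (Prop_irrelevance (projT1_eq e) erefl). Qed.

Lemma fm_path_eq F G (f g : flow_map F G) : f = g ->
  forall a b (x : flow_path a b), tot (fm_path f x) = tot (fm_path g x).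
Proof. by move=> ->. Qed.

Lemma flow_map_eq F G (f g : flow_map F G) : fm_state f =1 fm_state g ->
  (forall a b (x : flow_path a b), tot (fm_path f x) = tot (fm_path g x)) -> f = g.
Proof.
case: f g => [s p c m] [s' p' c' m'] /= /funext E; subst s' => H.
have e : p = p'.
  apply: functional_extensionality_dep => a; apply: functional_extensionality_dep => b.
  by apply/funext => x; apply: tot_inj; exact: H.
by subst p'; exact: FlowMap_eq.
Qed.

(** Gives a map a prescribed expression of its state function, so that its path components get the
    expected types without transport. *)
Lemma fm_recast F G (f : flow_map F G) (th : flow_state F -> flow_state G) :
  fm_state f =1 th -> exists p c m, f = @FlowMap F G th p c m.
Proof. by case: f => [s p c m] /= /funext E; subst th; exists p, c, m. Qed.

Section FromGlob.
Variables (Z : topologicalType) (G : flow_data) (a b : flow_state G)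
  (f : Z -> flow_path a b).
Hypothesis cf : continuous f.

Definition from_glob_state (e : bool) := if e then b else a.

Definition from_glob_path (e e' : bool) : glob_path Z e e' ->
    flow_path (from_glob_state e) (from_glob_state e') :=
  match e, e' with
  | false, true => f
  | false, false => fun x => of_void _ x
  | true, false => fun x => of_void _ x
  | true, true => fun x => of_void _ x
  end.

Lemma from_glob_cont e e' : continuous (@from_glob_path e e').
Proof. by case: e e' => [] [] => [[]|[]|//|[]]. Qed.

Lemma from_globM e e' e'' (x : glob_path Z e e') (y : glob_path Z e' e'') :
  from_glob_path (glob_comp x y) = flow_concat (from_glob_path x) (from_glob_path y).
Proof. by case: e e' e'' x y => [] [] [] // []. Qed.

Definition from_glob : flow_map (glob Z) G :=
  @FlowMap (glob Z) G _ from_glob_path from_glob_cont from_globM.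

End FromGlob.

Lemma is_flow_glob (R : realType) hd (Z : topologicalType) : in_Top R hd Z ->
  is_flow R hd (glob Z).
Proof.
move=> ZT; split=> [[] []|[] [] []|[] [] [] []] //; try exact: in_Top_discrete.
all: try by move=> [[]].
all: try by move=> [? []].
all: try by move=> [].
all: try by move=> ? [].
all: try by move=> ? ? [].
Qed.

End FlowMaps.

Section FlowPushout.
Variables (R : realType) (hd : bool).
Local Notation FL := (Flow R hd).
Local Notation obj P H := (exist (fun x => is_flow R hd x) P H : FL).
Variables (S : Type) (A : S -> S -> topologicalType)
  (ac : forall a b c, A a b -> A b c -> A a c).
Variables (Q : forall p, cst p -> cst p -> topologicalType)
  (qc : forall p (u v w : cst p), Q u v -> Q v w -> Q u w)
  (K : nat -> topologicalType) (gK : forall p, K p -> Q (Bot p) (Top p)).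
Variables (J : choiceType) (nn : J -> nat) (src tgt : J -> S)
  (gam : forall j, A (src j) (tgt j)).
Hypotheses (Aflow : is_flow R hd (FlowData ac))
  (Qflow : forall p, is_flow R hd (FlowData (@qc p)))
  (KTop : forall p, in_Top R hd (K p)) (gK_cont : forall p, continuous (@gK p)).

Definition edge_map p : flow_map (glob (K p)) (FlowData (@qc p)) :=
  @from_glob (K p) (FlowData (@qc p)) _ _ (@gK p) (@gK_cont p).

(** The constant map at [gam j]: [K] stands for the one-point path space of {0<1}, so the whole of
    it represents the single line of index [j]. *)
Definition gam_map j : flow_map (glob (K (nn j))) (FlowData ac) :=
  @from_glob (K (nn j)) (FlowData ac) (src j) (tgt j) (fun=> gam j) (@cst_cont _ _ (gam j)).

Let Pj (j : J) : FL := obj (glob (K (nn j))) (is_flow_glob (KTop (nn j))).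
Let Qj (j : J) : FL := obj (FlowData (@qc (nn j))) (Qflow (nn j)).
Let Ao : FL := obj (FlowData ac) Aflow.
Let fj j : hom (Pj j) (Qj j) := edge_map (nn j).
Let aj j : hom (Pj j) Ao := gam_map j.

Section OneStage.
Variable D : J -> Prop.
Local Notation JD := {j : J | D j}.
Let nnD (j : JD) := nn (sval j).
Let srcD (j : JD) := src (sval j).
Let tgtD (j : JD) := tgt (sval j).
Let gamD (j : JD) : A (srcD j) (tgtD j) := gam (sval j).

Definition stage : FL := obj (wflow R hd ac qc gK nnD gamD)
  (@is_flow_W R hd S A ac Q qc K gK JD nnD srcD tgtD gamD).

Definition stage_in : hom Ao stage :=
  @FlowMap (FlowData ac) (sval stage) (Old nnD)
    (fun a b v => @iA R hd S A ac Q qc K gK JD nnD srcD tgtD gamD a b v)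
    (fun a b => @iA_cont R hd S A ac Q qc K gK JD nnD srcD tgtD gamD Aflow a b)
    (fun a b c x y => @iAM R hd S A ac Q qc K gK JD nnD srcD tgtD gamD a b c x y).

Definition stage_cell j (Dj : D j) : hom (Qj j) stage :=
  @FlowMap (FlowData (@qc (nn j))) (sval stage)
    (fun u => @sg S JD nnD srcD tgtD (exist _ j Dj) u)
    (fun u v q => @iQ R hd S A ac Q qc K gK JD nnD srcD tgtD gamD (exist _ j Dj) u v q)
    (fun u v => @iQ_cont R hd S A ac Q qc K gK JD nnD srcD tgtD gamD Qflow (exist _ j Dj) u v)
    (fun u v w x y => @iQM R hd S A ac Q qc K gK JD nnD srcD tgtD gamD (exist _ j Dj) u v w x y).

(** A cocone into [G] determines the images of all states, and after [fm_recast] it is a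
    realization; evaluation of words is the induced map. Uniqueness holds because letters
    generate. *)
Lemma stage_wide : @is_wide_pushout FL J Pj Qj fj Ao aj D stage stage_in stage_cell.
Proof.
split=> [j Dj|[G Gf] u v uv].
  apply: flow_map_eq => [[]|[] [] x] //; try by case: x.
  by congr tot; exact: (@iK R hd S A ac Q qc K gK JD nnD srcD tgtD gamD (exist _ j Dj) x).
change (flow_map (FlowData ac) G) in (type of u).
have uvE j (Dj : D j) := fm_path_eq (uv j Dj : flow_comp (v j Dj) (fj j) = flow_comp u (aj j)).
pose th (x : est S nnD) : flow_state G := match x with
  | Old a => fm_state u a
  | New j i => fm_state (v (proj1_sig j) (proj2_sig j) : flow_map (FlowData (@qc _)) G) (In i) end.
have vth j Dj : fm_state (v j Dj : flow_map (FlowData (@qc _)) G) =1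
    fun c => th (@sg S JD nnD srcD tgtD (exist _ j Dj) c).
  have vs e : fm_state (v j Dj : flow_map (FlowData (@qc _)) G) (if e then Top _ else Bot _) =
      fm_state u (if e then tgt j else src j).
    exact: (congr1 (fun m : flow_map (glob (K (nn j))) G => fm_state m e) (uv j Dj)).
  by move=> c; case: c => [||i]; [exact: (vs false)|exact: (vs true)|].
pose rec j Dj := cid (fm_recast (vth j Dj)).
pose p j Dj := projT1 (rec j Dj).
have pP j Dj : exists c m, v j Dj = @FlowMap (FlowData (@qc (nn j))) G
    (fun c => th (@sg S JD nnD srcD tgtD (exist _ j Dj) c)) (p j Dj) c m by exact: projT2 (rec j Dj).
pose rQ (j : JD) : forall a b : cst (nnD j), Q a b ->
    flow_path (th (@sg S JD nnD srcD tgtD j a)) (th (@sg S JD nnD srcD tgtD j b)) :=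
  match j with exist j Dj => p j Dj end.
pose rA a b (x : A a b) : flow_path (th (Old nnD a)) (th (Old nnD b)) := fm_path u x.
have rA_cont a b : continuous (@rA a b) by exact: (@fm_continuous _ _ u a b).
have rQ_cont j a b : continuous (@rQ j a b).
  by case: j a b => j Dj a b; have [c _] := pP j Dj; exact: c.
have rAM a b c (x : A a b) (y : A b c) : rA _ _ (ac x y) = flow_concat (rA _ _ x) (rA _ _ y).
  exact: (fm_comp u x y).
have rQM j a b c (x : Q a b) (y : Q b c) :
    rQ j _ _ (qc x y) = flow_concat (rQ j _ _ x) (rQ j _ _ y).
  by case: j a b c x y => j Dj a b c x y; have [_ [m _]] := pP j Dj; exact: m.
have rK j (k : K (nnD j)) : rQ j _ _ (gK k) = rA _ _ (gamD j).
  case: j k => j Dj k; have [c [m E]] := pP j Dj.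
  apply: tot_inj; have := uvE j Dj false true k; rewrite E; exact.
pose r := @Realization S A ac Q qc K gK JD nnD srcD tgtD gamD G th rA rQ rA_cont rQ_cont rAM rQM rK.
pose w : hom stage (obj G Gf) := evalW_map r Gf.
exists w; split=> [|w' [w'u w'v]].
  split=> [|j Dj].
    apply: flow_map_eq => // a b x; congr tot; exact: evalWE.
  have [c [m E]] := pP j Dj; rewrite E.
  by apply: flow_map_eq => // a b x; congr tot; exact: evalWE.
change (flow_map (sval stage) G) in (type of w').
have w'th : fm_state w' =1 th.
  case=> [a|[j Dj] i]; first exact: (congr1 (fun m : flow_map (FlowData ac) G => fm_state m a) w'u).
  exact: (congr1 (fun m : flow_map (FlowData (@qc (nn j))) G => fm_state m (In i)) (w'v j Dj)).
have [p' [c' [m' E']]] := fm_recast w'th.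
rewrite E' in w'u w'v *.
apply: flow_map_eq => // x y c; congr tot; move: x y c; apply: wpath_ind.
- move=> a b x; apply: etrans (evalWE _ _ _) _ => //; apply: tot_inj; symmetry.
  exact: (fm_path_eq w'u).
- case=> j Dj a b x; apply: etrans (evalWE _ _ _) _ => //; apply: tot_inj; symmetry.
  have [c [m E]] := pP j Dj; have := fm_path_eq (w'v j Dj) x; rewrite E; exact.
- move=> x y z c d /= Ec Ed; rewrite evalWM // m'.
  by congr flow_concat.
Qed.

End OneStage.
End FlowPushout.

(** * Extension over the solid cylinder *)

Lemma open_sub_cont (S T : topologicalType) (U : set S) (f : S -> T) (g : U -> T) :
  open U -> continuous g -> (forall x : U, f (val x) = g x) ->
  forall x : U, {for (val x), continuous f}.
Proof.
move=> oU cg fg x A; rewrite /continuous_at fg => /cg nA.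
have [_ [[B oB <-] Bx BA]] := nA.
have Ux : U (val x) by exact: set_mem (valP x).
have /filterS : (U `&` B `<=` f @^-1` A).
  move=> y [Uy By]; have := BA (exist (fun y => y \in U) y (mem_set Uy)) By.
  by rewrite /= -fg.
apply; apply: open_nbhs_nbhs; split; first exact: openI.
by split.
Qed.

Lemma prod_hausdorff (S T : topologicalType) : hausdorff_space S -> hausdorff_space T ->
  hausdorff_space (S * T)%type.
Proof.
move=> hS hT [x y] [x' y'] xy; congr pair.
  apply: hS => A B nA nB.
  have [[z t] [/= Az Bz]] := xy _ _ (@fst_cont S T (x, y) A nA) (@fst_cont S T (x', y') B nB).
  by exists z.
apply: hT => A B nA nB.
have [[z t] [/= Az Bz]] := xy _ _ (@snd_cont S T (x, y) A nA) (@snd_cont S T (x', y') B nB).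
by exists t.
Qed.

(* A continuous surjection from a compact space onto a Hausdorff one is a
   quotient map. *)
Lemma compact_factor (C D T : topologicalType) (e : C -> D) (H : C -> T) :
  compact [set: C] -> hausdorff_space D -> continuous e -> (forall d, exists c, e c = d) ->
  continuous H -> (forall c c', e c = e c' -> H c = H c') ->
  exists F : D -> T, continuous F /\ forall c, F (e c) = H c.
Proof.
move=> cC hD ce se cH He.
pose F d := H (projT1 (cid (se d))).
have FE c : F (e c) = H c by rewrite /F; case: cid => c' /= /He.
exists F; split => //; apply/continuousP => U oU.
rewrite -[_ @^-1` _]setCK openC.
have -> : ~` (F @^-1` U) = e @` (~` (H @^-1` U)).
  apply/seteqP; split=> [d nU|_ [c nU <-]]; last by rewrite /= FE.
  by have [c Ec] := se d; exists c => //; rewrite -Ec /= FE in nU *.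
apply: compact_closed => //; apply: continuous_compact.
  exact: continuous_subspaceT.
apply: (subclosed_compact _ cC) => //.
by rewrite closedC; move/continuousP: cH; exact.
Qed.

Lemma eq_from_fst_snd (S T : Type) (x y : S * T) : x.1 = y.1 -> x.2 = y.2 -> x = y.
Proof. by case: x y => [? ?] [? ?] /= -> ->. Qed.

Section Disks.
Variable R : realType.
Local Notation I := (@unitI R).
Local Notation enorm := (@enorm R _).

Lemma disk_hausdorff n : hausdorff_space (@disk R n).
Proof.
apply: set_type_hausdorff => x y xy; apply/rowP => i.
apply: (@Rhausdorff R) => A B nA nB.
have [z [Az Bz]] := xy _ _ (@coord_cont R _ _ 0 i x A nA) (@coord_cont R _ _ 0 i y B nB).
by exists (z 0 i).
Qed.

Lemma disk_compact m : compact [set: @disk R m.+1].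
Proof.
apply: set_type_compact; apply: bounded_closed_compact.
  exists 1; split; first exact: real1.
  move=> M M1 v /= dv; apply: le_trans (ltW M1); rewrite /Num.norm /= mx_normrE.
  apply: (bigmax_le _ ler01) => -[i j] _ /=; rewrite (ord1 i).
  rewrite -(ler_pXn2r (n := 2)) ?nnegrE ?normr_ge0 ?ler01 // real_normK ?num_real // expr1n.
  by apply: le_trans dv; rewrite (bigD1 j) //= lerDl sumr_ge0 // => k _; exact: sqr_ge0.
have -> : @disk R m.+1 = (fun v => enorm v) @^-1` [set x | x <= 1].
  by apply/seteqP; split => v /diskP.
apply: closed_comp => [v _|]; first exact: enorm_cont.
exact: closed_le.
Qed.

Definition disk_of n (v : 'rV[R]_n) (h : enorm v <= 1) : @disk R n :=
  exist (fun v => v \in @disk R n) v (mem_set (iffRL (diskP v) h)).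

Definition sphere_of n (v : 'rV[R]_n) (h : enorm v = 1) : @sphere R n :=
  exist (fun v => v \in @sphere R n) v (mem_set (iffRL (sphereP v) h)).

Lemma enormZ0 n (a : R) (v : 'rV[R]_n) : 0 <= a -> enorm (a *: v) = a * enorm v.
Proof. by move=> a0; rewrite enormZ ger0_norm. Qed.

(** Scaling factor of a map from the disk onto the boundary of the solid cylinder. Radii up to 1/3
    spread over the top, radii from 1/3 to 2/3 run down the side, radii from 2/3 to 1 cover the
    bottom, with the boundary sphere collapsed to the centre of the bottom. *)
Definition mu_ (r : R) : R := Num.min 1 (3 - 3 * r) / Num.max r 3^-1.

Lemma mu_in r : 0 <= r -> r <= 3^-1 -> mu_ r = 3.
Proof.
move=> r0 r1; rewrite /mu_ (max_idPr r1) invrK (min_idPl _) ?mul1r //; lra.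
Qed.

Lemma mu_mid r : 3^-1 <= r -> r <= 2 / 3 -> mu_ r = r^-1.
Proof. by move=> r0 r1; rewrite /mu_ (max_idPl r0) (min_idPl _) ?mul1r //; lra. Qed.

Lemma mu_out r : 2 / 3 <= r -> mu_ r = (3 - 3 * r) / r.
Proof. by move=> r0; rewrite /mu_ (max_idPl _) ?(min_idPr _) //; lra. Qed.

Lemma mu_cont : continuous mu_.
Proof.
have cm : continuous (fun r : R => 3 - 3 * r).
  by apply: rcontB; [exact: cst_cont|apply: rcontM; [exact: cst_cont|exact: id_cont]].
apply: rcontM; first by apply: rcont_min => //; exact: cst_cont.
apply: rcontV; last by apply: rcont_max; [exact: id_cont|exact: cst_cont].
by move=> r; rewrite gt_eqF // lt_max invr_gt0 ltr0n orbT.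
Qed.

Lemma mu_ge0 r : 0 <= r <= 1 -> 0 <= mu_ r.
Proof.
move=> /andP[r0 r1]; apply: divr_ge0; first by rewrite le_min ler01; lra.
by rewrite le_max r0.
Qed.

Lemma mu_norm r : 0 <= r -> mu_ r * r = if r <= 3^-1 then 3 * r else
  if r <= 2 / 3 then 1 else 3 - 3 * r.
Proof.
move=> r0; have [r1|r1] := leP r 3^-1; first by rewrite mu_in.
have rn : r != 0 by rewrite gt_eqF //; apply: lt_trans r1; rewrite invr_gt0 ltr0n.
have [r2|r2] := leP r (2 / 3); first by rewrite mu_mid ?mulVf // ltW.
by rewrite mu_out ?ltW // mulfVK.
Qed.

(** The first function is the radius and the second the height of the image on the cylinder, as
    functions of the radius in the disk; together they determine that radius. *)
Lemma profile_inj (x y : R) :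
  (if x <= 3^-1 then 3 * x else if x <= 2 / 3 then 1 else 3 - 3 * x) =
    (if y <= 3^-1 then 3 * y else if y <= 2 / 3 then 1 else 3 - 3 * y) ->
  (if x <= 3^-1 then 1 else if x <= 2 / 3 then 2 - 3 * x else 0) =
    (if y <= 3^-1 then 1 else if y <= 2 / 3 then 2 - 3 * y else 0) -> x = y.
Proof.
case: (leP x 3^-1) => a; case: (leP y 3^-1) => b; rewrite ?b; try lra.
- by case: (leP y (2 / 3)) => d; lra.
- by case: (leP x (2 / 3)) => d; lra.
- by case: (leP x (2 / 3)) => c; case: (leP y (2 / 3)) => d; lra.
Qed.

Lemma mu_norm1 r : 0 <= r -> mu_ r * r <= 1.
Proof. move=> r0; rewrite mu_norm //; case: (leP r 3^-1) => h; first lra.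
by case: (leP r (2 / 3)) => h'; lra. Qed.

Section Cone.
Variable m : nat.
Local Notation D := (@disk R m.+1).

Let r_ (v : D) := enorm (val v).
Let r0 v : 0 <= r_ v. Proof. exact: enorm_ge0. Qed.
Let r1 v : r_ v <= 1. Proof. exact: disk_enorm. Qed.

Let b1_sub v : enorm (mu_ (r_ v) *: val v) <= 1.
Proof. by rewrite enormZ0 ?mu_norm1 // mu_ge0 // r0 r1. Qed.

Let b1 v : D := disk_of (b1_sub v).
Let b2 v : I := cl (2 - 3 * r_ v).

Let rc : continuous r_.
Proof. by apply: comp_cont (@enorm_cont R _); exact: val_cont. Qed.

Let b1c : continuous b1.
Proof.
apply: sub_cont; apply: scaleM_cont; last exact: val_cont.
exact: comp_cont rc mu_cont.
Qed.

Let b2c : continuous b2.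
Proof.
apply: comp_cont (@cl_cont R); apply: rcontB; first exact: cst_cont.
by apply: rcontM => //; exact: cst_cont.
Qed.

Let b2E v : val (b2 v) = if r_ v <= 3^-1 then 1 else if r_ v <= 2 / 3 then 2 - 3 * r_ v else 0.
Proof.
rewrite /b2; have [h|h] := leP (r_ v) 3^-1; first by rewrite cl_ge1 //=; lra.
have [h'|h'] := leP (r_ v) (2 / 3); first by rewrite val_cl //; lra.
by rewrite cl_le0 //=; lra.
Qed.

Let b1E v : enorm (val (b1 v)) = if r_ v <= 3^-1 then 3 * r_ v else
  if r_ v <= 2 / 3 then 1 else 3 - 3 * r_ v.
Proof. by rewrite /= enormZ0 ?mu_norm // mu_ge0 // r0 r1. Qed.

(** The norm, centred at the middle (0, 1/2) of the solid cylinder, whose unit sphere is its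
    boundary. *)
Let gauge (x : 'rV[R]_m.+1) (t : R) := Num.max (enorm x) `|2 * t - 1|.

Let gauge_b v : gauge (val (b1 v)) (val (b2 v)) = 1.
Proof.
rewrite /gauge b1E b2E; have := r0 v; have := r1 v => h1 h0.
have [h|h] := leP (r_ v) 3^-1.
  by rewrite (_ : 2 * 1 - 1 = 1) ?normr1 ?(max_idPr _) //; lra.
have [h'|h'] := leP (r_ v) (2 / 3).
  by apply/max_idPl; rewrite ler_norml; apply/andP; split; lra.
by rewrite (_ : 2 * 0 - 1 = -1) ?normrN1 ?(max_idPr _) //; lra.
Qed.

Let e1_sub v s : enorm ((1 - val (s : I)) *: val (b1 v)) <= 1.
Proof.
have := I_ge0 s; have := I_le1 s => h1 h0.
rewrite enormZ0 ?subr_ge0 // mulr_ile1 ?subr_ge0 ?enorm_ge0 ?disk_enorm //; lra.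
Qed.

(** The solid cylinder as a cone: at parameter [s] the boundary point ([b1], [b2]) is shrunk by
    [1 - s] towards the middle (0, 1/2). *)
Let e (x : D * I) : D * I :=
  (disk_of (e1_sub x.1 x.2), cl (2^-1 + (1 - val x.2) * (val (b2 x.1) - 2^-1))).

Let e2E x : val (e x).2 = 2^-1 + (1 - val x.2) * (val (b2 x.1) - 2^-1).
Proof.
have s0 := I_ge0 x.2; have s1 := I_le1 x.2; have t0 := I_ge0 (b2 x.1); have t1 := I_le1 (b2 x.1).
by rewrite val_cl //; nra.
Qed.

Let e1E x : val (e x).1 = (1 - val x.2) *: val (b1 x.1).
Proof. by []. Qed.

Let ec : continuous e.
Proof.
have c1 : continuous (fun x : D * I => val x.2).
  exact: comp_cont (@snd_cont _ _) (@val_cont _ _).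
have c2 : continuous (fun x : D * I => 1 - val x.2).
  by apply: rcontB => //; exact: cst_cont.
apply: pair_cont.
  apply: sub_cont; apply: scaleM_cont => //.
  apply: comp_cont (@val_cont _ _); exact: comp_cont (@fst_cont _ _) b1c.
apply: comp_cont (@cl_cont R); apply: rcontD; first exact: cst_cont.
apply: rcontM => //; apply: rcontB; last exact: cst_cont.
by apply: comp_cont (@val_cont _ _); exact: comp_cont (@fst_cont _ _) b2c.
Qed.

Let gauge_e x : gauge (val (e x).1) (val (e x).2) = 1 - val x.2.
Proof.
have s1 := I_le1 x.2.
rewrite /gauge e2E e1E enormZ0 ?subr_ge0 //.
rewrite (_ : 2 * _ - 1 = (1 - val x.2) * (2 * val (b2 x.1) - 1)); last lra.
rewrite normrM ger0_norm ?subr_ge0 // -maxr_pMr ?subr_ge0 //.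
by have := gauge_b x.1; rewrite /gauge => ->; rewrite mulr1.
Qed.

(** The only identifications are at the tip of the cone and on the collapsed boundary sphere. A
    homotopy relative to the boundary that ends at a constant map is compatible with exactly
    these. *)
Let e_fibre x y : e x = e y -> x.2 = y.2 /\
  (x.2 = i1 R \/ x.1 = y.1 \/ (r_ x.1 = 1 /\ r_ y.1 = 1)).
Proof.
move=> E; have E2 : x.2 = y.2.
  apply/val_inj; have := gauge_e x; rewrite E gauge_e => h; lra.
split => //; have [s1|s1] := eqVneq (val x.2) 1; first by left; apply/val_inj.
right; have s0 : 1 - val x.2 != 0 by rewrite subr_eq0 eq_sym.
have Eb1 : val (b1 x.1) = val (b1 y.1).
  have E1 : val (e x).1 = val (e y).1 by rewrite E.
  by move: E1; rewrite !e1E -E2 => /(scalerI s0).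
have Eb2 : val (b2 x.1) = val (b2 y.1).
  have E3 : val (e x).2 = val (e y).2 by rewrite E.
  by move: E3; rewrite !e2E -E2 => /addrI /(mulfI s0) /addIr.
have Er := congr1 enorm Eb1; rewrite !b1E in Er; rewrite !b2E in Eb2.
have := r0 x.1; have := r0 y.1; have := r1 x.1; have := r1 y.1 => hy1 hx1 hy0 hx0.
have Err : r_ x.1 = r_ y.1.
  exact: profile_inj Er Eb2.
have [m0|m0] := eqVneq (mu_ (r_ x.1)) 0; last first.
  left; apply/val_inj; have E3 : mu_ (r_ x.1) *: val x.1 = mu_ (r_ y.1) *: val y.1 := Eb1.
  by move: E3; rewrite -Err => /(scalerI m0).
right; rewrite -Err; suff : r_ x.1 = 1 by [].
have := mu_norm (r0 x.1); rewrite m0 mul0r.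
case: leP => [a|a]; last by case: leP => [b|b]; lra.
by have := mu_in (r0 x.1) a; rewrite m0; lra.
Qed.

Variables (T : topologicalType) (f0 f1 : D -> T) (hom : @sphere R m.+1 * I -> T).
Hypotheses (cf0 : continuous f0) (cf1 : continuous f1) (chom : continuous hom)
  (hom0 : forall z, hom (z, i0 R) = f0 (sphere_to_disk z))
  (hom1 : forall z, hom (z, i1 R) = f1 (sphere_to_disk z)).


Let top_pt (z : D) : exists v, [/\ r_ v <= 3^-1, b1 v = z & b2 v = i1 R].
Proof.
have h : enorm (3^-1 *: val z) <= 1.
  by rewrite enormZ0 ?invr_ge0 ?ler0n //; have := disk_enorm z; lra.
exists (disk_of h); have rE : r_ (disk_of h) = 3^-1 * enorm (val z).
  by rewrite /r_ [val _]/= enormZ0 // invr_ge0 ler0n.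
have le : r_ (disk_of h) <= 3^-1 by rewrite rE; have := disk_enorm z; lra.
split => //; last by apply/val_inj; rewrite b2E le.
apply/val_inj; rewrite [LHS]/= mu_in; [|exact: enorm_ge0|exact: le].
by rewrite scalerA divff ?scale1r // pnatr_eq0.
Qed.

Let bot_pt (z : D) : exists v, [/\ 2 / 3 <= r_ v, b1 v = z & b2 v = i0 R].
Proof.
suff [v [rv vz]] : exists v : D, 2 / 3 <= r_ v /\ (3 - 3 * r_ v) / r_ v *: val v = val z.
  exists v; split => //; first by apply/val_inj; rewrite [LHS]/= mu_out.
  apply/val_inj; rewrite b2E; case: (leP (r_ v) 3^-1) => [h|_]; first lra.
  by case: (leP (r_ v) (2 / 3)) => //= h; lra.
have [z0|z0] := eqVneq (enorm (val z)) 0.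
  have h : enorm (delta_mx 0 0 : 'rV[R]_m.+1) = 1.
    rewrite /enorm (bigD1 ord0) //= big1 ?addr0 => [|i i0]; last first.
      by rewrite mxE eqxx /= (negbTE i0) expr0n.
    by rewrite mxE !eqxx expr1n sqrtr1.
  have h' : enorm (delta_mx 0 0 : 'rV[R]_m.+1) <= 1 by rewrite h.
  exists (disk_of h'); have -> : r_ (disk_of h') = 1 by [].
  split; first lra.
  by move/eqP: z0; rewrite mulr1 subrr mul0r scale0r enorm_eq0 => /eqP ->.
have zp : 0 < enorm (val z) by rewrite lt_neqAle eq_sym z0 enorm_ge0.
have z1 := disk_enorm z.
pose a := (1 - enorm (val z) / 3) / enorm (val z).
have a0 : 0 <= a by apply: divr_ge0; [lra|exact: enorm_ge0].
have aE : a * enorm (val z) = 1 - enorm (val z) / 3 by rewrite /a mulfVK.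
have h : enorm (a *: val z) <= 1 by rewrite enormZ0 // aE; lra.
exists (disk_of h); have rE : r_ (disk_of h) = 1 - enorm (val z) / 3.
  by rewrite /r_ [val _]/= enormZ0.
rewrite rE; split; first lra.
rewrite [val (disk_of h)]/= scalerA -[RHS]scale1r; congr (_ *: _).
have hn : 1 - enorm (val z) / 3 != 0 by rewrite gt_eqF //; lra.
by rewrite /a mulrA mulfVK // (_ : 3 - _ = enorm (val z)) ?divff //; lra.
Qed.

Let side_pt (z : @sphere R m.+1) (t : I) : exists v,
  [/\ 3^-1 <= r_ v <= 2 / 3, b1 v = sphere_to_disk z, b2 v = t & (r_ v)^-1 *: val v = val z].
Proof.
have t0 := I_ge0 t; have t1 := I_le1 t; have z1 := sphere_enorm z.
have h0 : 0 <= (2 - val t) / 3 by lra.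
have h : enorm ((2 - val t) / 3 *: val z) <= 1 by rewrite enormZ0 // z1; lra.
exists (disk_of h); have rE : r_ (disk_of h) = (2 - val t) / 3.
  by rewrite /r_ [val _]/= enormZ0 // z1 mulr1.
have hn : (2 - val t) / 3 != 0 by rewrite gt_eqF //; lra.
split.
- by rewrite rE; apply/andP; split; lra.
- apply/val_inj; rewrite [LHS]/= mu_mid ?rE; [|lra|lra].
  by rewrite scalerA mulVf // scale1r.
- apply/val_inj; rewrite b2E rE; case: (leP ((2 - val t) / 3) 3^-1) => a.
    by apply/eqP; rewrite eq_le; apply/andP; split; lra.
  case: (leP ((2 - val t) / 3) (2 / 3)) => b; first lra.
  by apply/eqP; rewrite eq_le; apply/andP; split; lra.
- by rewrite rE [val (disk_of h)]/= scalerA mulVf // scale1r.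
Qed.

(** Dividing by the gauge pushes a point other than the middle out to the boundary, where it lies on
    the top, on the bottom or on the side. *)
Let e_surj p : exists x, e x = p.
Proof.
suff [v [s [E1 E2]]] : exists v s, (1 - val (s : I)) *: val (b1 v) = val p.1 /\
    2^-1 + (1 - val s) * (val (b2 v) - 2^-1) = val p.2.
  exists (v, s); apply: (@eq_from_fst_snd _ _ (e (v, s)) p); apply/val_inj => //.
  by rewrite e2E.
case: p => [z t]; change (exists v s, (1 - val (s : I)) *: val (b1 v) = val z /\
  2^-1 + (1 - val s) * (val (b2 v) - 2^-1) = val t).
pose N := gauge (val z) (val t).
have t0 := I_ge0 t; have t1 := I_le1 t; have z1 := disk_enorm z; have z0 := enorm_ge0 (val z).
have N0 : 0 <= N by rewrite le_max z0.
have Nz : enorm (val z) <= N by rewrite le_max lexx.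
have Nt : `|2 * val t - 1| <= N by rewrite le_max lexx orbT.
have N1 : N <= 1 by rewrite ge_max z1 ler_norml andTb; apply/andP; split; lra.
have [N00|Nn] := eqVneq N 0.
  exists z, (i1 R); rewrite [val (i1 R)]/= subrr scale0r mul0r addr0; split.
    by symmetry; apply/eqP; rewrite -enorm_eq0; apply/eqP/le_anti; rewrite z0 -N00 Nz.
  move: Nt; rewrite N00 normr_le0 => /eqP; lra.
have Np : 0 < N by rewrite lt_neqAle eq_sym Nn.
have sE : val (cl (1 - N)) = 1 - N by rewrite val_cl; lra.
have zN : enorm (N^-1 *: val z) <= 1.
  by rewrite enormZ0 ?invr_ge0 // mulrC ler_pdivrMr // mul1r.
have NN : N * N^-1 = 1 by rewrite divff.
have scal (x : 'rV[R]_m.+1) : N *: (N^-1 *: x) = x by rewrite scalerA NN scale1r.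
have [h|h] := eqVneq (2 * val t - 1) N.
  have [v [_ v1 v2]] := top_pt (disk_of zN); exists v, (cl (1 - N)).
  by rewrite sE v1 v2 subKr [val (disk_of _)]/= scal (erefl : val (i1 R) = 1); split => //; lra.
have [h'|h'] := eqVneq (2 * val t - 1) (- N).
  have [v [_ v1 v2]] := bot_pt (disk_of zN); exists v, (cl (1 - N)).
  by rewrite sE v1 v2 subKr [val (disk_of _)]/= scal (erefl : val (i0 R) = 0); split => //; lra.
have zN1 : enorm (N^-1 *: val z) = 1.
  have Ntl : `|2 * val t - 1| < N.
    move: Nt; rewrite ler_norml ltr_norml => /andP[n1 n2].
    by rewrite lt_neqAle eq_sym h' n1 lt_neqAle h n2.
  have Nz' : N = enorm (val z).
    by move: Ntl; rewrite /N /gauge lt_max ltxx orbF => /ltW /max_idPl.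
  by rewrite enormZ0 ?invr_ge0 // -Nz' mulrC NN.
pose u := 2^-1 + N^-1 * (val t - 2^-1).
have uE : N * (u - 2^-1) = val t - 2^-1 by rewrite /u addrC addKr mulrA NN mul1r.
move: Nt; rewrite ler_norml => /andP[n1 n2].
have u0 : 0 <= u by nra.
have u1 : u <= 1 by nra.
have [v [_ v1 v2 _]] := side_pt (sphere_of zN1) (cl u); exists v, (cl (1 - N)).
rewrite sE v1 v2 subKr val_cl // uE; split; last lra.
by rewrite [val _]/= scal.
Qed.

Let mid (v : D) : T :=
  if insub ((r_ v)^-1 *: val v) is Some z then hom (z : @sphere R m.+1, b2 v) else f0 v.

Let w (v : D) : T :=
  if r_ v <= 3^-1 then f1 (b1 v) else if r_ v <= 2 / 3 then mid v else f0 (b1 v).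

Let unit_sub (v : D) : r_ v != 0 -> enorm ((r_ v)^-1 *: val v) = 1.
Proof. by move=> rn; rewrite enormZ0 ?invr_ge0 // mulVf. Qed.

Let midE (v : D) (rn : r_ v != 0) : mid v = hom (sphere_of (unit_sub rn), b2 v).
Proof.
rewrite /mid insubT; first exact/mem_set/sphereP/unit_sub.
by move=> h; congr (hom (_, _)); apply/val_inj.
Qed.

Let mid_top (v : D) : r_ v = 3^-1 -> mid v = f1 (b1 v).
Proof.
move=> rE; have rn : r_ v != 0 by rewrite rE invr_eq0 pnatr_eq0.
have b21 : b2 v = i1 R by apply/val_inj; rewrite b2E rE lexx.
rewrite (midE rn) b21 hom1; congr f1; apply/val_inj => /=.
by rewrite mu_mid // rE; lra.
Qed.

Let mid_bot (v : D) : r_ v = 2 / 3 -> mid v = f0 (b1 v).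
Proof.
move=> rE; have rn : r_ v != 0 by rewrite rE mulf_neq0 ?invr_eq0 ?pnatr_eq0.
have b20 : b2 v = i0 R.
  apply/val_inj; rewrite b2E rE; case: (leP (2 / 3 : R) 3^-1) => h; first lra.
  by rewrite lexx /=; lra.
rewrite (midE rn) b20 hom0; congr f0; apply/val_inj => /=.
by rewrite mu_mid // rE; lra.
Qed.

(** Near the centre only the top piece occurs, so the undefined direction does not matter. On the
    open set of positive radius all three pieces are continuous and agree where they meet. *)
Let w_cont : continuous w.
Proof.
have c0 : continuous (fun v => f0 (b1 v)) by exact: comp_cont b1c cf0.
have c1 : continuous (fun v => f1 (b1 v)) by exact: comp_cont b1c cf1.
move=> v; have [rv|rv] := ltP (r_ v) 3^-1.
  apply: near_cont (c1 v).
  have : nbhs v [set x | r_ x < 3^-1].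
    apply: open_nbhs_nbhs; split => //.
    by have /continuousP/(_ [set y : R | y < 3^-1] (@open_lt R _)) := rc.
  by apply: filterS => x /= h; rewrite /w ltW.
pose U : set D := [set x | 0 < r_ x].
have oU : open U by have /continuousP/(_ [set y : R | 0 < y] (@open_gt R _)) := rc.
have rn (x : U) : r_ (val x) != 0 by rewrite gt_eqF //; exact: set_mem (valP x).
have cv : continuous (fun x : U => val x) by exact: val_cont.
have crU : continuous (fun x : U => r_ (val x)) by exact: comp_cont cv rc.
have cb2U : continuous (fun x : U => b2 (val x)) by exact: comp_cont cv b2c.
have cmid : continuous (fun x : U => mid (val x)).
  rewrite (_ : (fun _ => _) = fun x : U => hom (sphere_of (unit_sub (rn x)), b2 (val x))); last first.
    by apply/funext => x; exact: midE.
  apply: (comp_cont _ chom); apply: pair_cont => //.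
  apply: sub_cont; apply: scaleM_cont; first by apply: rcontV.
  exact: comp_cont cv (@val_cont _ _).
have cf0U : continuous (fun x : U => f0 (b1 (val x))) by exact: comp_cont cv c0.
have cf1U : continuous (fun x : U => f1 (b1 (val x))) by exact: comp_cont cv c1.
have cpsi a : continuous (fun x : U => r_ (val x) - a) by apply: rcontB => //; exact: cst_cont.
pose w' (x : U) : T := if r_ (val x) <= 2 / 3 then mid (val x) else f0 (b1 (val x)).
have cw' : continuous w'.
  apply: (glue_cont (cpsi (2 / 3)) cmid cf0U) => x; rewrite /w'.
    by rewrite subr_le0 => ->.
  rewrite subr_ge0 => h; case: ifP => // h'; apply: mid_bot.
  by apply/le_anti; rewrite h h'.
have cwU : continuous (fun x : U => w (val x)).
  apply: (glue_cont (cpsi 3^-1) cf1U cw') => x; rewrite /w.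
    by rewrite subr_le0 => ->.
  rewrite subr_ge0 => h; case: ifP => // h'; rewrite /w'.
  have E : r_ (val x) = 3^-1 by apply/le_anti; rewrite h h'.
  by rewrite E ifT ?mid_top //; lra.
have Uv : U v by rewrite /U /=; lra.
exact: (@open_sub_cont _ _ U w (fun x => w (val x)) oU cwU (fun=> erefl)
  (exist (fun y => y \in U) v (mem_set Uv))).
Qed.

Let ctr : D := disk_of (n := m.+1) (v := 0) (eq_ind_r (fun x => x <= 1) ler01
  (eqP (eq_ind_r (fun b : bool => b) (eqxx 0) (enorm_eq0 0)))).

Let w_sphere v : r_ v = 1 -> w v = f0 ctr.
Proof.
move=> rE; rewrite /w rE; case: (leP (1 : R) 3^-1) => h; first by exfalso; lra.
case: (leP (1 : R) (2 / 3)) => h'; first by exfalso; lra.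
congr f0; apply/val_inj; rewrite [LHS]/= mu_out rE; last lra.
by rewrite mulr1 subrr mul0r scale0r.
Qed.

(* The boundary data, read off on the cone over the boundary, form a spheroid;
   a null-homotopy of it descends to the solid cylinder. *)
Lemma cylinder_extension :
  (forall u : D -> T, spheroid (f0 ctr) u -> homotopic_rel (f0 ctr) u (fun=> f0 ctr)) ->
  exists F : D * I -> T, [/\ continuous F, forall z, F (z, i0 R) = f0 z,
    forall z, F (z, i1 R) = f1 z & forall z t, F (sphere_to_disk z, t) = hom (z, t)].
Proof.
move=> null; have [|H [cH H0 H1 Hs]] := null w.
  by split=> [|v /sphereP rv]; [exact: w_cont|exact: w_sphere].
have [||||||F [cF FE]] := @compact_factor (D * I)%type (D * I)%type T e H.
- rewrite -setXTT; apply: compact_setX; first exact: disk_compact.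
  exact: I_compact.
- by apply: prod_hausdorff; [exact: disk_hausdorff|exact: I_hausdorff].
- exact: ec.
- exact: e_surj.
- exact: cH.
- move=> [v s] [v' s'] /e_fibre[/= <- [->|[->|[rv rv']]]] //; first by rewrite !H1.
  by rewrite !Hs //; apply/sphereP.
have F0 v : F (b1 v, b2 v) = w v.
  rewrite -H0 -FE; congr F; apply: (@eq_from_fst_snd _ _ (b1 v, b2 v) (e (v, i0 R))).
    by apply/val_inj; rewrite e1E subr0 scale1r.
  by apply/val_inj; rewrite e2E subr0 mul1r addrC subrK.
exists F; split => // [z|z|z t].
- have [v [rv v1 v2]] := bot_pt z; rewrite -{1}v1 -v2 F0 /w v1.
  case: (leP (r_ v) 3^-1) => h; first by exfalso; lra.
  by case: (leP (r_ v) (2 / 3)) => // h'; rewrite mid_bot ?v1 //; apply/le_anti/andP.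
- by have [v [rv v1 v2]] := top_pt z; rewrite -{1}v1 -v2 F0 /w v1 rv.
- have [v [/andP[ra rb] v1 v2 v3]] := side_pt z t.
  have rn : r_ v != 0 by rewrite gt_eqF //; lra.
  have midz : mid v = hom (z, t).
    by rewrite (midE rn) v2; congr (hom (_, _)); apply/val_inj.
  rewrite -v1 -{1}v2 F0 /w rb; case: (leP (r_ v) 3^-1) => // h.
  by rewrite -midz mid_top //; apply/le_anti/andP.
Qed.

End Cone.
End Disks.

(** * Trivial fibrations of flows *)

Section Lifting.
Variables (R : realType) (hd : bool).
Local Notation I := (@unitI R).

(** Weak contractibility, spelled out in the form in which it is used: nonempty, path-connected,
    every spheroid null-homotopic relative to the boundary. *)
Definition wcontr (T : topologicalType) := [/\ exists x : T, True,
  forall x y : T, joined R x y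
  & forall n a (u : @disk R n.+1 -> T), spheroid a u -> homotopic_rel a u (fun=> a)].

Lemma weq_point (b : bool) (T : topologicalType)
    (f : T -> discrete_topology {_ : unit | b}) :
  weak_homotopy_equivalence R f -> if b then wcontr T else T -> False.
Proof.
move=> [cf [j1 j2] pi]; case: b f cf j1 j2 pi => f cf j1 j2 pi; last by move=> /f[].
have eqp (x y : discrete_topology {_ : unit | true}) : x = y.
  by apply: val_inj; case: (val x) (val y) => -[].
split=> [|x y|n a u su].
- by have [x _] := j2 (exist _ tt erefl); exists x.
- apply: j1; exists (fun=> f x); split=> //; exact: cst_cont.
have [inj _] := pi n a; apply: inj => [//||]; first by split => //; exact: cst_cont.
by exists (fun=> f a); split=> *; [exact: cst_cont|exact: eqp|exact: eqp|].
Qed.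

Lemma TOP_uncurry (S T : topologicalType) (u : S -> TOP R I T) : continuous u ->
  continuous (fun x : S * I => TOP_fun (u x.1) x.2).
Proof.
move=> cu; have cu' : continuous ((fun s => TOP_fun (u s)) : S -> {compact-open, I -> T}).
  apply: comp_cont (@val_cont _ _); exact: comp_cont cu (@kelley_id_cont R _).
have E : (fun x : S * I => TOP_fun (u x.1) x.2) = uncurry (fun s => TOP_fun (u s)).
  by apply/funext => -[].
rewrite E; apply: continuous_uncurry; first exact: I_locally_compact.
- exact: I_hausdorff.
- exact: cu'.
- by move=> s; exact: TOP_fun_cont.
Qed.

(** The right lifting property against the sphere in the disk. That the disk is Delta-generated is
    supplied in [flow_rlp] by the fact that its globe is an object of [Flow]. *)
Definition path_rlp (T U : topologicalType) (r : T -> U) :=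
  forall n (u : @sphere R n -> T) (v : @disk R n -> U),
  delta_generated R (@disk R n) -> continuous u -> continuous v ->
  (forall z, r (u z) = v (sphere_to_disk z)) ->
  exists w : @disk R n -> T, [/\ continuous w, forall z, w (sphere_to_disk z) = u z
    & forall z, r (w z) = v z].

Definition ends (T : topologicalType) (f : TOP R I T) : kelley R (T * T)%type :=
  (TOP_fun f (i0 R), TOP_fun f (i1 R)).

Lemma ends_cont T : continuous (@ends T).
Proof.
apply: (path_cont (@kelley_delta_generated R _)) => c cc; apply: path_to_kelley.
exact: pair_cont (comp_cont cc (@TOP_eval_cont _ _ _)) (comp_cont cc (@TOP_eval_cont _ _ _)).
Qed.

Lemma disk0_eq (x y : @disk R 0) : x = y.
Proof. by apply/val_inj/rowP => -[]. Qed.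

Lemma disk_ctr n : @disk R n.
Proof.
apply: (@disk_of R n 0); rewrite (_ : enorm 0 = 0) ?ler01 //.
by apply/eqP; rewrite enorm_eq0.
Qed.

Lemma sphere0_absurd : @sphere R 0 -> False.
Proof.
move=> z; have := sphere_enorm z; rewrite (_ : val z = 0); last by apply/rowP => -[].
have -> : enorm (0 : 'rV[R]_0) = 0 by apply/eqP; rewrite enorm_eq0.
by move=> /esym/eqP; rewrite oner_eq0.
Qed.

(** A lifting problem prescribes a map on the boundary of a solid cylinder, its two ends by [v] and
    its side by [u], so [cylinder_extension] solves it. In dimension 0 it asks for a path between
    two points. *)
Lemma path_rlp_ends T : wcontr T \/ (T -> False) -> path_rlp (@ends T).
Proof.
move=> [[_ jT nT]|nT]; last by move=> n u v _ _ _ _; case: (nT (v (disk_ctr n)).1).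
move=> n u v gD cu cv uv.
have cv' : continuous ((fun z => v z) : @disk R n -> (T * T)%type).
  exact: comp_cont cv (@kelley_id_cont R _).
have cf0 : continuous (fun z => (v z).1) by exact: comp_cont cv' (@fst_cont _ _).
have cf1 : continuous (fun z => (v z).2) by exact: comp_cont cv' (@snd_cont _ _).
suff [F [cF F0 F1 Fs]] : exists F : @disk R n * I -> T, [/\ continuous F,
    forall z, F (z, i0 R) = (v z).1, forall z, F (z, i1 R) = (v z).2
    & forall z t, F (sphere_to_disk z, t) = TOP_fun (u z) t].
  have cFz z : continuous (fun t => F (z, t)).
    by apply: comp_cont cF; apply: pair_cont; [exact: cst_cont|exact: id_cont].
  exists (fun z => TOP_mk (cFz z)); split=> [|z|z].
  - apply: (path_cont gD) => c cc; apply/TOP_contP; apply: comp_cont cF.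
    by apply: pair_cont; [exact: comp_cont (@fst_cont _ _) cc|exact: snd_cont].
  - by apply: TOP_fun_inj; apply/funext => t; exact: Fs.
  - change ((F (z, i0 R), F (z, i1 R)) = (v z : T * T)%type); rewrite F0 F1; by case: (v z).
case: n u v gD cu cv uv cv' cf0 cf1 => [|m] u v gD cu cv uv cv' cf0 cf1.
  have [p [cp p0 p1]] := jT (v (disk_ctr 0)).1 (v (disk_ctr 0)).2.
  exists (fun x => p x.2); split=> [|z|z|z]; last by case: (sphere0_absurd z).
  - exact: comp_cont (@snd_cont _ _) cp.
  - by rewrite (disk0_eq z (disk_ctr 0)).
  - by rewrite (disk0_eq z (disk_ctr 0)).
apply: (cylinder_extension cf0 cf1 (hom := fun x => TOP_fun (u x.1) x.2)) => //.
- exact: TOP_uncurry.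
- by move=> z; rewrite -uv.
- by move=> z; rewrite -uv.
- by move=> u0 su; exact: nT.
Qed.

Section Criterion.
Variables (S : Type) (E F : S -> S -> topologicalType)
  (ec : forall a b c, E a b -> E b c -> E a c) (fc : forall a b c, F a b -> F b c -> F a c)
  (r : forall a b, E a b -> F a b).
Hypotheses (r_cont : forall a b, continuous (@r a b))
  (rM : forall a b c (x : E a b) (y : E b c), r (ec x y) = fc (r x) (r y))
  (rlpr : forall a b, path_rlp (@r a b)).
Local Notation obj P H := (exist (fun x => is_flow R hd x) P H : Flow R hd).

Definition path_map : flow_map (FlowData ec) (FlowData fc) :=
  @FlowMap (FlowData ec) (FlowData fc) id r r_cont rM.

Let from_set (S' : Type) (G : flow_data) (s : S' -> flow_state G) :
    exists f : flow_map (set_flow S') G, fm_state f = s.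
Proof.
by unshelve eexists (@FlowMap (set_flow S') G s (fun a b x => of_void _ x) _ _) => // a b [].
Qed.

(** The map is the identity on states, so C and R lift at once, and a lift against a globe is a lift
    on a single path space. *)
Lemma flow_rlp (HE : is_flow R hd (FlowData ec)) (HF : is_flow R hd (FlowData fc)) :
  rlp (C := Flow R hd) (restrict_class (flow_gen R)) (path_map : hom (obj _ HE) (obj _ HF)).
Proof.
move=> [a Ha] [b Hb] f; rewrite /restrict_class /= => gf.
change (@Defs.hom FlowData_cat a b) in (type of f).
move: Ha Hb; case: a b f / gf => [n||] Ha Hb u v uv.
- change (flow_map (glob (@sphere R n)) (FlowData ec)) in (type of u).
  change (flow_map (glob (@disk R n)) (FlowData fc)) in (type of v).
  change (flow_comp path_map u = flow_comp v (glob_map (@sphere_to_disk_continuous R n))) in (type of uv).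
  have vu : fm_state v =1 fm_state u.
    by move=> e; symmetry; exact: (congr1 (fun m : flow_map (glob (@sphere R n)) (FlowData fc) => fm_state m e) uv).
  have [p [c [m Ev]]] := fm_recast vu.
  have pE z : r (fm_path u (a := false) (b := true) z) = p false true (sphere_to_disk z).
    apply: (@tot_inj (FlowData fc) (fm_state u false) (fm_state u true)).
    by have := fm_path_eq uv (a := false) (b := true) z; rewrite Ev.
  have [||||w [cw ws wr]] := rlpr (u := fm_path u (a := false) (b := true)) (v := p false true).
  + by have [DT _ _] := Hb; exact: (in_Top_gen (DT false true)).
  + exact: (@fm_continuous _ _ u false true).
  + exact: (c false true).
  + exact: pE.
  pose h : flow_map (glob (@disk R n)) (FlowData ec) := from_glob (G := FlowData ec) cw.
  exists h; split.
  + apply: flow_map_eq => [[]//|[] [] x] //; try by case: x.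
    by congr tot; exact: ws.
  + rewrite Ev; apply: flow_map_eq => [[]//|[] [] x] //; try by case: x.
    by congr tot; exact: wr.
- change (flow_map (set_flow unit) (FlowData fc)) in (type of v).
  have [h hE] := @from_set unit (FlowData ec) (fm_state v).
  exists h; split; first by apply: flow_map_eq => [[]|[]].
  by apply: flow_map_eq => [t|t t' []]; rewrite /= hE.
- change (flow_map (set_flow unit) (FlowData fc)) in (type of v).
  have [h hE] := @from_set unit (FlowData ec) (fm_state v).
  exists h; split.
    apply: flow_map_eq => [e|e e' []]; rewrite /= hE.
    by symmetry; exact: (congr1 (fun m : flow_map (set_flow bool) (FlowData fc) => fm_state m e) uv).
  by apply: flow_map_eq => [t|t t' []]; rewrite /= hE.
Qed.

End Criterion.

Section PathFlow.
Variables (S : Type) (V : S -> S -> topologicalType)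
  (vc : forall a b c, V a b -> V b c -> V a c).
Hypothesis Vflow : is_flow R hd (FlowData vc).

Definition pf_path (a b : S) : topologicalType := TOP R I (V a b).

Lemma pf_concat_cont (a b c : S) (f : pf_path a b) (g : pf_path b c) :
  continuous (fun t => vc (TOP_fun f t) (TOP_fun g t)).
Proof.
have [_ vcc _] := Vflow.
exact: kelley_prod_path (vcc a b c) (@TOP_fun_cont _ _ f) (@TOP_fun_cont _ _ g).
Qed.

Definition pf_concat (a b c : S) (f : pf_path a b) (g : pf_path b c) : pf_path a c :=
  TOP_mk (@pf_concat_cont a b c f g).

Lemma II_prod_cont (a b c : S) (f : I * I -> V a b) (g : I * I -> V b c) :
  continuous f -> continuous g -> continuous (fun x => vc (f x) (g x)).
Proof.
move=> cf cg; have [_ vcc _] := Vflow.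
apply: (path_cont (@II_delta_generated R)) => p cp.
exact: (kelley_prod_path (vcc a b c) (comp_cont cp cf) (comp_cont cp cg)).
Qed.

Lemma is_flow_pf : is_flow R hd (FlowData pf_concat).
Proof.
have [VT vcc vcA] := Vflow; split=> [a b|a b c|a b c d x y z].
- by apply: in_Top_TOP => h; exact: in_Top_sep (VT a b) h.
- apply: (@kelley_prod_cont R (pf_path a b) (pf_path b c) (pf_path a c)
    (fun x => pf_concat x.1 x.2)) => f g /TOP_contP cf /TOP_contP cg; apply/TOP_contP.
  exact: II_prod_cont.
- by apply: TOP_fun_inj; apply/funext => t; exact: vcA.
Qed.

Definition sq_path (a b : S) : topologicalType := kelley R (V a b * V a b)%type.

Definition sq_concat (a b c : S) (f : sq_path a b) (g : sq_path b c) : sq_path a c :=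
  (vc f.1 g.1, vc f.2 g.2).

Lemma is_flow_sq : is_flow R hd (FlowData sq_concat).
Proof.
have [VT vcc vcA] := Vflow; split=> [a b|a b c|a b c d x y z].
- apply: in_Top_kelley => h; apply: path_separatedM; exact: in_Top_sep (VT a b) h.
- apply: (@kelley_prod_cont R (sq_path a b) (sq_path b c) (sq_path a c)
    (fun x => sq_concat x.1 x.2)) => f g cf cg; apply: path_to_kelley.
  have {}cf := path_of_kelley cf; have {}cg := path_of_kelley cg.
  have cp1 := comp_cont cf (@fst_cont _ _); have cp2 := comp_cont cf (@snd_cont _ _).
  have cq1 := comp_cont cg (@fst_cont _ _); have cq2 := comp_cont cg (@snd_cont _ _).
  apply: pair_cont; first exact: kelley_prod_path (vcc a b c) cp1 cq1.
  exact: kelley_prod_path (vcc a b c) cp2 cq2.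
- by rewrite /flow_concat /sq_concat /=; congr (_, _); exact: vcA.
Qed.

Lemma endsM (a b c : S) (f : pf_path a b) (g : pf_path b c) :
  ends (pf_concat f g) = sq_concat (ends f) (ends g).
Proof. by []. Qed.

Local Notation obj P H := (exist (fun x => is_flow R hd x) P H : Flow R hd).

Definition ends_map : flow_map (FlowData pf_concat) (FlowData sq_concat) :=
  path_map (fun a b => @ends_cont (V a b)) endsM.

(** Lifting against this map of flows yields homotopies with prescribed ends that are compatible
    with composition. *)
Lemma ends_rlp : (forall a b, wcontr (V a b) \/ (V a b -> False)) ->
  rlp (C := Flow R hd) (restrict_class (flow_gen R))
    (ends_map : hom (obj _ is_flow_pf) (obj _ is_flow_sq)).
Proof. by move=> wV; apply: flow_rlp => a b; exact: path_rlp_ends. Qed.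

End PathFlow.
End Lifting.

(** * Models of subdivided globes *)

Lemma lifts_iso (C : category) (a b a' b' c d : C) (f : hom a b) (f' : hom a' b')
    (x : hom a a') (x' : hom a' a) (y : hom b b') (y' : hom b' b) (r : hom c d) :
  inverse x x' -> inverse y y' -> y \c f = f' \c x -> lifts f' r -> lifts f r.
Proof.
move=> [xx xx'] [yy yy'] E L u v uv.
have E' : y' \c f' = f \c x'.
  by rewrite -[LHS]compm1 -xx' -compA (compA f') -E !compA yy comp1m.
have [|h [hf rh]] := L (u \c x') (v \c y'); first by rewrite compA uv -!compA E'.
exists (h \c y); split; first by rewrite -compA E compA hf -compA xx compm1.
by rewrite compA rh -compA yy compm1.
Qed.

Lemma cofibrant_lift (C : category) (L : mclass C) (b c d : C) (r : hom c d) (v : hom b d) :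
  cofibrant L b -> rlp L r -> exists h, r \c h = v.
Proof.
move=> [a [f [ia cf]]] rr; have [u _] := ia c.
have [|h [_ rh]] := cf _ _ r rr u v; last by exists h.
by have [w [_ wu]] := ia d; rewrite -(wu (r \c u)) // -(wu (v \c f)).
Qed.

Section FlowIso.

Lemma tot_concat (G : flow_data) (a b c a' b' c' : flow_state G)
    (x : flow_path a b) (x' : flow_path a' b') (y : flow_path b c) (y' : flow_path b' c') :
  tot x = tot x' -> tot y = tot y' -> tot (flow_concat x y) = tot (flow_concat x' y').
Proof.
move=> Ex Ey; have [Ea Eb] : a = a' /\ b = b' by have := congr1 (@projT1 _ _) Ex; case.
have Ec : c = c' by have := congr1 (@projT1 _ _) Ey; case.
by subst a' b' c'; rewrite (tot_inj Ex) (tot_inj Ey).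
Qed.

Lemma flow_iso (F G : flow_data) (m : flow_map F G) : bijective (fm_state m) ->
  (forall a b, homeomorphism (@fm_path _ _ m a b)) ->
  exists n : flow_map G F, flow_comp n m = flow_id F /\ flow_comp m n = flow_id G.
Proof.
move=> [s mK sK] hm.
have hex a b : exists h : flow_path a b -> flow_path (s a) (s b),
    continuous h /\ forall y, tot (fm_path m (h y)) = tot y.
  have [a0 Ea] : exists a0, fm_state m a0 = a by exists (s a); rewrite sK.
  have [b0 Eb] : exists b0, fm_state m b0 = b by exists (s b); rewrite sK.
  subst a b; move: (s _) (mK a0) (s _) (mK b0) => a1 E b1 E'; subst a1 b1.
  have [_ [g [cg _ gK]]] := hm a0 b0.
  by exists g; split => // y; rewrite gK.
pose h a b := projT1 (cid (hex a b)).
have hP a b : continuous (h a b) /\ forall y, tot (fm_path m (h a b y)) = tot y.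
  exact: projT2 (cid (hex a b)).
have m_inj a b : injective (@fm_path _ _ m a b).
  by have [_ [g [_ gK _]]] := hm a b; exact: can_inj gK.
have hM a b c (x : flow_path a b) (y : flow_path b c) :
    h _ _ (flow_concat x y) = flow_concat (h _ _ x) (h _ _ y).
  apply: m_inj; rewrite fm_comp; apply: tot_inj; rewrite (hP _ _).2.
  by apply: tot_concat; rewrite (hP _ _).2.
exists (@FlowMap G F s h (fun a b => (hP a b).1) hM); split; apply: flow_map_eq => //.
- move=> a b x /=; have := (hP _ _).2 (fm_path m x).
  move: (h _ _ _); rewrite /= /id; move: (s _) (s _) (mK a) (mK b) => a1 b1 E E' y.
  by subst a1 b1 => /tot_inj /m_inj ->.
- by move=> a b y; exact: (hP a b).2.
Qed.

End FlowIso.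

Section HomeoWeq.
Variable R : realType.

Lemma homeomorphism_weq (S T : topologicalType) (f : S -> T) : homeomorphism f ->
  weak_homotopy_equivalence R f.
Proof.
move=> [cf [g [cg fK gK]]]; split => //.
- split=> [x y [p [cp p0 p1]]|y].
    by exists (g \o p); split; [exact: comp_cont cp cg|rewrite /= p0|rewrite /= p1].
  exists (g y), (fun=> y); split; [exact: cst_cont|by rewrite gK|by []].
- move=> n a; split=> [u v su sv [H [cH H0 H1 Hs]]|v [cv vs]].
    exists (g \o H); split=> [|x|x|x t xs]; first exact: comp_cont cH cg.
    - by rewrite /= H0 /= fK.
    - by rewrite /= H1 /= fK.
    - by rewrite /= Hs // fK.
  exists (g \o v).
    by split=> [|x xs]; [exact: comp_cont cv cg|rewrite /= vs // fK].
  exists (fun x => v x.1); split=> [|x|x|x t xs]; last exact: vs.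
  - exact: comp_cont (@fst_cont _ _) cv.
  - by rewrite /= gK.
  - by [].
Qed.

Lemma homeo_flow_weq (F G : flow_data) (m : flow_map F G) : bijective (fm_state m) ->
  (forall a b, homeomorphism (@fm_path _ _ m a b)) -> flow_weq R m.
Proof. by move=> bm hm; split => // a b; exact: homeomorphism_weq. Qed.

End HomeoWeq.

(** * Chains and the inclusion of {0<1} into them *)

Section Rank.
Variable p : nat.

Definition rk (u : cst p) : nat :=
  match u with Bot => 0 | In i => i.+1 | Top => p.+1 end.

Lemma rk_inj : injective rk.
Proof.
case=> [||i] [||j] //=.
- by move=> [e]; have := ltn_ord j; rewrite -e ltnn.
- by move=> [e]; have := ltn_ord i; rewrite e ltnn.
- by move=> [/val_inj ->].
Qed.

Lemma rk_lt u : (rk u < p.+2)%N.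
Proof. by case: u => //= i; rewrite ltnS ltnW // ltnS. Qed.

Lemma rk_surj m : (m < p.+2)%N -> exists u, rk u = m.
Proof.
case: m => [|m]; first by exists (Bot p).
rewrite ltnS leq_eqVlt => /orP[/eqP [->]|]; first by exists (Top p).
by rewrite ltnS => h; exists (In (Ordinal h)).
Qed.

Definition clt (u v : cst p) : bool := (rk u < rk v)%N.

End Rank.

Definition chain_poset (p : nat) : predArgType := 'I_p.+2.
HB.instance Definition _ p := Order.FinTotal.on (chain_poset p).

Lemma chain_le0 p (x : chain_poset p) : ((ord0 : chain_poset p) <= x)%O.
Proof. by rewrite leEord. Qed.

Lemma chain_le1 p (x : chain_poset p) : (x <= (ord_max : chain_poset p))%O.
Proof. by rewrite leEord -ltnS; case: x. Qed.

HB.instance Definition _ p := Order.hasBottom.Build _ (chain_poset p) (@chain_le0 p).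
HB.instance Definition _ p := Order.hasTop.Build _ (chain_poset p) (@chain_le1 p).

Section ChainInclusion.
Variable p : nat.

Definition chain_fun (b : bool) : chain_poset p := if b then ord_max else ord0.

Lemma chain_mono : {mono chain_fun : x y / (x <= y)%O}.
Proof. by move=> x y; rewrite leEord; case: x y => [] []; rewrite /= ?leqnn. Qed.

Lemma bool_bounded : (\bot%O : bool) != \top%O. Proof. by []. Qed.
Lemma chain_bounded : (\bot%O : chain_poset p) != \top%O. Proof. by []. Qed.
Lemma chain_bot : chain_fun \bot%O = \bot%O. Proof. by []. Qed.
Lemma chain_top : chain_fun \top%O = \top%O. Proof. by []. Qed.

Definition chain_incl : poset_inclusion :=
  @PosetInclusion _ _ bool (chain_poset p) chain_fun bool_bounded chain_bounded
    chain_mono chain_bot chain_top.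

Lemma chain_incl_globular : globular_inclusion chain_incl.
Proof.
split=> [[]|]; [by right|by left|]; split; first exact: chain_bounded.
exists [:: [seq x <- enum (chain_poset p) | (x != \bot%O) && (x != \top%O)]]; split.
- by rewrite /= cats0.
- rewrite /= andbT; apply: sorted_filter; first exact: lt_trans.
  have -> : sorted <%O (enum (chain_poset p)) = sorted ltn (map val (enum 'I_p.+2)).
    by rewrite sorted_map; apply: eq_sorted => x y /=; rewrite ltEord.
  by rewrite val_enum_ord iota_ltn_sorted.
- by [].
Qed.

End ChainInclusion.

Section Model.
Variables (R : realType) (hd : bool).
Local Notation I := (@unitI R).
Local Notation obj P H := (exist (fun x => is_flow R hd x) P H : Flow R hd).

(* A replacement of the inclusion of [{0<1}] into a chain, on the standard set
   of states, with what is needed to compare it to the chain: [mh] measures how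
   far a path from bottom to top is from the original globe, [mc] is a section
   over the chain, [md] joins the globe to it, and [mG] contracts the rest. *)
Record chain_model (g : arrow (Flow R hd)) (p : nat) := ChainModel {
  mQ : cst p -> cst p -> topologicalType;
  mqc : forall u v w, mQ u v -> mQ v w -> mQ u w;
  mK : topologicalType;
  mg : mK -> mQ (Bot p) (Top p);
  mQ_flow : is_flow R hd (FlowData mqc);
  mK_Top : in_Top R hd mK;
  mg_cont : continuous mg;
  m_push : forall (HK : is_flow R hd (glob mK)) (c d : Flow R hd)
    (x : hom (obj _ HK) c) (k : hom (obj _ mQ_flow) d) (t : hom c d),
    is_pushout (from_glob (G := FlowData mqc) mg_cont : hom (obj _ HK) (obj _ mQ_flow)) x k t ->
    exists x' k', is_pushout (arr g) x' k' t;
  m_lt : forall u v, mQ u v -> clt u v;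
  mh : mQ (Bot p) (Top p) -> I;
  mh_cont : continuous mh;
  mhK : forall k, mh (mg k) = i0 R;
  mhM : forall u (x : mQ (Bot p) u) (y : mQ u (Top p)), mh (mqc x y) = i1 R;
  mc : forall u v, clt u v -> mQ u v;
  mcc : forall u v w (h : clt u v) (h' : clt v w) (h'' : clt u w),
    mqc (mc h) (mc h') = mc h'';
  md : I -> mQ (Bot p) (Top p);
  md_cont : continuous md;
  md0 : exists k, md (i0 R) = mg k;
  md1 : forall h, md (i1 R) = mc h;
  mG : forall u v, mQ u v -> TOP R I (mQ u v);
  mG_cont : forall u v, continuous (@mG u v);
  mGM : forall u v w (x : mQ u v) (y : mQ v w) t,
    TOP_fun (mG (mqc x y)) t = mqc (TOP_fun (mG x) t) (TOP_fun (mG y) t);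
  mG0 : forall u v (x : mQ u v), TOP_fun (mG x) (i0 R) = x;
  mG1 : forall x : mQ (Bot p) (Top p), TOP_fun (mG x) (i1 R) = md (mh x);
  mG1' : forall u v (x : mQ u v) (h : clt u v), ~ (u = Bot p /\ v = Top p) ->
    TOP_fun (mG x) (i1 R) = mc h;
  mGK : forall k t, exists k', TOP_fun (mG (mg k)) t = mg k' }.

Lemma path_rlp_I (T : choiceType) (f : I -> discrete_topology T) :
  (forall x y : T, x = y) -> path_rlp R f.
Proof.
move=> T1 n u v gD cu cv _.
pose u' (x : @sphere R n * I) := u x.1.
have cu' : continuous (u' : kelley R (@sphere R n * I)%type -> I).
  exact: (comp_cont (@kelley_id_cont R _) (comp_cont (@fst_cont _ _) cu)).
exists (fun z => cl (enorm (val z) * radial u' (val z) (i0 R))); split.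
- apply: (path_cont gD) => c cc; apply: comp_cont (@cl_cont R).
  apply: (radial_cont cu' (c := id) (p := c) (q := fun=> i0 R)) => //.
    exact: id_cont.
  exact: cst_cont.
- move=> z; rewrite sphere_enorm mul1r radial_sphere; exact: clK.
- by move=> z; exact: T1.
Qed.

Lemma path_rlp_id (T U : topologicalType) (f : T -> U) (g : U -> T) :
  continuous g -> cancel f g -> cancel g f -> path_rlp R f.
Proof.
move=> cg fK gK n u v _ cu cv uv; exists (fun z => g (v z)); split.
- exact: comp_cont cv cg.
- by move=> z; rewrite -uv fK.
- by move=> z; rewrite gK.
Qed.

Section Interval.
Variable p : nat.

Definition pt (u v : cst p) : topologicalType := discrete_topology {_ : unit | clt u v}.

(** The chain with its path space from bottom to top enlarged to an interval, every composite being
    put at 1. It is a trivial fibration over the chain, so sending the original globe to 0 extends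
    to the replacement; the resulting function is [mh]. *)
Definition E1 (u v : cst p) : topologicalType :=
  match u, v with Bot, Top => I | _, _ => pt u v end.

Lemma clt_trans (u v w : cst p) : clt u v -> clt v w -> clt u w.
Proof. exact: ltn_trans. Qed.

Lemma e1lt u v : E1 u v -> clt u v.
Proof. by case: u v => [||i] [||j] => // x; exact: (svalP x). Qed.

Definition e1mk u v : clt u v -> E1 u v :=
  match u, v return clt u v -> E1 u v with
  | Bot, Top => fun _ => i1 R
  | Bot, Bot => fun h => exist _ tt h | Bot, In _ => fun h => exist _ tt h
  | Top, _ => fun h => exist _ tt h | In _, _ => fun h => exist _ tt h end.

Definition e1c u v w (x : E1 u v) (y : E1 v w) : E1 u w := e1mk (clt_trans (e1lt x) (e1lt y)).

Definition ptc u v w (x : pt u v) (y : pt v w) : pt u w :=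
  exist _ tt (clt_trans (svalP x) (svalP y)).

Lemma e1mk_irr u v (h h' : clt u v) : e1mk h = e1mk h'.
Proof. by rewrite (bool_irrelevance h h'). Qed.

Lemma is_flow_E1 : is_flow R hd (FlowData e1c).
Proof.
split=> [u v|u v w|u v w t x y z]; last exact: e1mk_irr.
  by case: u v => [||i] [||j]; first [exact: in_Top_I|exact: in_Top_discrete].
apply: (@kelley_prod_cont R (E1 u v) (E1 v w) (E1 u w) (fun x => e1c x.1 x.2)) => a b _ _.
rewrite (_ : (fun _ => _) = fun=> e1c (a (i0 R)) (b (i0 R))); first exact: cst_cont.
by apply/funext => t; exact: e1mk_irr.
Qed.

Lemma pt_eq u v (x y : pt u v) : x = y.
Proof. by apply: val_inj; case: (val x) (val y) => -[]. Qed.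

Lemma is_flow_pt : is_flow R hd (FlowData ptc).
Proof.
split=> [u v|u v w|u v w t x y z]; last exact: pt_eq.
  exact: in_Top_discrete.
apply: (@kelley_prod_cont R (pt u v) (pt v w) (pt u w) (fun x => ptc x.1 x.2)) => a b _ _.
rewrite (_ : (fun _ => _) = fun=> ptc (a (i0 R)) (b (i0 R))); first exact: cst_cont.
by apply/funext => t; exact: pt_eq.
Qed.

Definition e1pt u v (x : E1 u v) : pt u v := exist _ tt (e1lt x).

Lemma e1pt_cont u v : continuous (@e1pt u v).
Proof.
rewrite (_ : @e1pt u v = fun x => e1pt x) //; apply/continuousP => U _.
have [ET _ _] := is_flow_E1; have /in_TopP[gE _] := ET u v; apply: gE => c cc.
rewrite (_ : _ @^-1` _ = (fun t : I => e1pt (c (i0 R))) @^-1` U).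
  by have /continuousP := @cst_cont I _ (e1pt (c (i0 R))); apply; exact: discrete_open.
by apply/seteqP; split=> t /=; rewrite (pt_eq (e1pt (c t)) (e1pt (c (i0 R)))).
Qed.

Lemma e1pt_rlp u v : path_rlp R (@e1pt u v).
Proof.
have base : ~ (u = Bot p /\ v = Top p) -> path_rlp R (@e1pt u v).
  move=> uv; have [g [cg fK gK]] : exists g : pt u v -> E1 u v,
      [/\ continuous g, cancel (@e1pt u v) g & cancel g (@e1pt u v)].
    case: u v uv => [||i] [||j] uv; try (by case: uv; split);
      by exists (fun x => x); split; [exact: id_cont|move=> x; exact: sig_unit|
        move=> x; exact: sig_unit].
  exact: path_rlp_id cg fK gK.
have [[-> ->]|uv] := pselect (u = Bot p /\ v = Top p); last exact: base.
by apply: path_rlp_I => x y; exact: pt_eq.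
Qed.

End Interval.
End Model.

Section ChainModel.
Variables (R : realType) (hd : bool).
Local Notation I := (@unitI R).
Local Notation obj P H := (exist (fun x => is_flow R hd x) P H : Flow R hd).

Lemma const_like_cont (S T : topologicalType) (f : S -> T) :
  (forall x y, f x = f y) -> continuous f.
Proof.
move=> fE; apply/continuousP => U _.
have [[x Ux]|nU] := pselect (exists x, U (f x)).
  rewrite (_ : _ @^-1` _ = setT); first exact: openT.
  by apply/seteqP; split => // y _ /=; rewrite (fE y x).
rewrite (_ : _ @^-1` _ = set0); first exact: open0.
by apply/seteqP; split => // y Uy; case: nU; exists y.
Qed.

Section Section_.
Variables (p : nat) (Q : cst p -> cst p -> topologicalType)
  (qc : forall u v w, Q u v -> Q v w -> Q u w).
Hypothesis qcA : forall u v w t (x : Q u v) (y : Q v w) (z : Q w t),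
  qc (qc x y) z = qc x (qc y z).

(* Compose chosen points between consecutive states. *)
Lemma coherent_points : (forall u v, clt u v -> exists x : Q u v, True) ->
  exists c : forall u v, clt u v -> Q u v, forall u v w (h : clt u v) (h' : clt v w)
    (h'' : clt u w), qc (c u v h) (c v w h') = c u w h''.
Proof.
move=> ne; pose d u v (h : clt u v) : Q u v := projT1 (cid (ne u v h)).
pose between (u v : cst p) := exists v', clt u v' /\ rk v = (rk v').+1.
have slt (v' v : cst p) : rk v = (rk v').+1 -> clt v' v by rewrite /clt => ->.
pose fix cc (m : nat) (u v : cst p) (h : clt u v) {struct m} : Q u v :=
  match m with
  | 0 => d u v h
  | m.+1 => match pselect (between u v) with
     | left b => qc (cc m u (projT1 (cid b)) (projT2 (cid b)).1)
         (d _ v (slt _ _ (projT2 (cid b)).2))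
     | right _ => d u v h end
  end.
have ccS m u v v' (h : clt u v) (h1 : clt u v') (h2 : clt v' v) : rk v = (rk v').+1 ->
    cc m.+1 u v h = qc (cc m u v' h1) (d v' v h2).
  move=> e; rewrite /=; case: pselect => [b|nb]; last by case: nb; exists v'.
  case: (cid b) => v'' [h4 e2] /=; move: (slt _ _ e2) => h3.
  have ev : v'' = v' by apply: rk_inj; apply: succn_inj; rewrite -e2 e.
  by subst v''; congr (qc (cc _ _ _ _) (d _ _ _)); exact: bool_irrelevance.
have cc0 m u v (h : clt u v) : ~ between u v -> cc m u v h = d u v h.
  by case: m => //= m nb; case: pselect.
exists (fun u v h => cc (rk v) u v h) => u v w h h' h''.
have [m mE] : exists m, m = rk w by exists (rk w).
elim: m w h' h'' mE => [|m IH] w h' h'' mE.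
  by have : (rk v < rk w)%N := h'; rewrite -mE ltn0.
have [w' w'E] : exists w' : cst p, rk w = (rk w').+1.
  have [|w' E] := @rk_surj p m; first by have := rk_lt w; rewrite -mE; exact: ltnW.
  by exists w'; rewrite E.
have mw' : m = rk w' by apply: succn_inj; rewrite mE.
have w'w : clt w' w by rewrite /clt w'E.
have vw' : (rk v <= rk w')%N by rewrite -ltnS -w'E.
have uw' : clt u w' by apply: leq_trans vw'.
rewrite -[rk w]mE (@ccS m u w w' h'' uw' w'w w'E).
have := vw'; rewrite leq_eqVlt => /orP[/eqP/rk_inj e|lt].
  subst w'; rewrite (@cc0 _ v w); last first.
    by move=> [v' [h1 e]]; move: h1; rewrite /clt -ltnS -e w'E ltnn.
  by rewrite mw' (bool_irrelevance uw' h) (bool_irrelevance h' w'w).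
rewrite (@ccS m v w w' h' lt w'w w'E) -qcA; congr qc.
by rewrite mw'; exact: IH.
Qed.

End Section_.

(** Two lifting properties supply everything: the cofibration lifts against trivial fibrations
    relative to its source, and the source, being cofibrant, lifts as well. Path spaces are weakly
    contractible or empty because they are weakly equivalent to those of a poset. *)
Lemma chain_model_exists (p : nat) (g : arrow (Flow R hd)) :
  cofibrant_replacement (chain_incl p) g -> inhabited (chain_model g p).
Proof.
case: g => [[D HD] [C HC] a] [cofa cofD _ [w1 [w2 [[bw1 ww1] [bw2 ww2] comm]]]].
change (flow_map D C) in (type of a).
change (flow_map D (poset_flow bool)) in (type of w1).
change (flow_map C (poset_flow (chain_poset p))) in (type of w2).
have [s1 s1K s1K'] := bw1; have [s2 s2K s2K'] := bw2.
change (bool -> flow_state D) in (type of s1).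
change (chain_poset p -> flow_state C) in (type of s2).
(* The inner state [i] has rank [i + 1] in the chain. Bottom and top are taken as images under [a],
   so that they match the states of the source without transport. *)
pose be (u : cst p) : flow_state C := match u with
  | Bot => fm_state a (s1 false) | Top => fm_state a (s1 true)
  | In i => s2 (lift ord0 (widen_ord (leqnSn p) i)) end.
have wa b : fm_state w2 (fm_state a (s1 b)) = chain_fun p b.
  have E := congr1 (fun m : flow_map D (poset_flow (chain_poset p)) => fm_state m (s1 b)) comm.
  by apply: etrans E _; rewrite /= s1K'.
have w2be u : nat_of_ord (fm_state w2 (be u) : 'I_p.+2) = rk u.
  by case: u => [||i]; rewrite /be ?wa // s2K'.
have be_inj : injective be by move=> u v E; apply: rk_inj; rewrite -!w2be E.
have be_surj c : exists u, be u = c.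
  have [u uE] := rk_surj (ltn_ord (fm_state w2 c : 'I_p.+2)).
  exists u; apply: (can_inj s2K); apply: val_inj; by rewrite [LHS]w2be uE.
have be_bij : bijective be.
  exists (fun c => projT1 (cid (be_surj c))) => [u|c]; last by case: cid.
  by case: cid => v /= /be_inj.
pose Q u v := flow_path (be u) (be v).
pose qc u v w (x : Q u v) (y : Q v w) : Q u w := flow_concat x y.
have Qflow : is_flow R hd (FlowData qc).
  have [CT Cc CA] := HC; split=> [u v|u v w|u v w t x y z].
  - exact: CT.
  - exact: Cc.
  - exact: CA.
have [_ _ qcA] := Qflow.
pose K : topologicalType := flow_path (s1 false) (s1 true).
pose g : K -> Q (Bot p) (Top p) := @fm_path _ _ a (s1 false) (s1 true).
have gc : continuous g by exact: fm_continuous.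
have KT : in_Top R hd K by have [DT _ _] := HD; exact: DT.
have glt u v (x : Q u v) : clt u v.
  rewrite /clt -!w2be; have := svalP (fm_path w2 x); rewrite ltEord; exact.
have wcQ u v : if clt u v then wcontr R (Q u v) else Q u v -> False.
  have := weq_point (ww2 (be u) (be v)); rewrite ltEord.
  rewrite (_ : (_ < _)%N = clt u v) //; last by rewrite /clt -!w2be.
have wcQ' u v : wcontr R (Q u v) \/ (Q u v -> False).
  by have := wcQ u v; case: (clt u v); [left|right].
have wcK : wcontr R K.
  by have := weq_point (ww1 (s1 false) (s1 true)); rewrite !s1K'.
have noD b b' (x : flow_path (s1 b) (s1 b')) : (b < b')%O.
  by have := svalP (fm_path w1 x); rewrite !s1K'.
have [k0 _] : exists k : K, True by have [] := wcK.
(* A flow weakly equivalent to {0<1} has its two states and paths only from the first to the second,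
   so it is isomorphic to a globe. *)
pose al : flow_map (glob K) D := from_glob (G := D) (@id_cont K).
have als e : fm_state al e = s1 e by case: e.
have [al' [alK alK']] : exists n, flow_comp n al = flow_id _ /\ flow_comp al n = flow_id _.
  apply: flow_iso.
    exists (fm_state w1) => [e|d]; first by rewrite als s1K'.
    by rewrite als s1K.
  have emp e e' (ne : ~~ (e < e')%O) (x : flow_path (from_glob_state (G := D) (s1 false) (s1 true) e) (from_glob_state (G := D) (s1 false) (s1 true) e')) : False.
    by move: ne x; case: e e' => [] [] // _ /noD.
  have hemp e e' : glob_path K e e' = empty_space -> ~~ (e < e')%O ->
      homeomorphism (@fm_path _ _ al e e').
    move=> E ne; split; first exact: fm_continuous.
    exists (fun x => of_void _ (match emp e e' ne x with end)); split=> [x|x|x]; try by case: (emp _ _ ne x).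
    by have y : glob_path K e e' := x; rewrite E in y; case: y.
  case=> [] []; try by apply: hemp.
  split; first exact: fm_continuous.
  by exists id; split => //; exact: id_cont.
pose bt : flow_map (FlowData qc) C := @FlowMap (FlowData qc) C be (fun u v => id)
  (fun u v => @id_cont _) (fun u v w x y => erefl).
have [bt' [btK btK']] : exists n, flow_comp n bt = flow_id _ /\ flow_comp bt n = flow_id _.
  apply: flow_iso; first exact: be_bij.
  by move=> u v; split; [exact: id_cont|exists id; split => //; exact: id_cont].
have HK : is_flow R hd (glob K) by exact: is_flow_glob.
pose eg : flow_map (glob K) (FlowData qc) := from_glob (G := FlowData qc) gc.
have sq : flow_comp bt eg = flow_comp a al.
  by apply: flow_map_eq => [[]|[] [] x] //; case: x.
have elift (c d : Flow R hd) (r : hom c d) : rlp (restrict_class (flow_gen R)) r ->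
    lifts (eg : hom (obj _ HK) (obj _ Qflow)) r.
  move=> rr; apply: (@lifts_iso (Flow R hd) (obj _ HK) (obj _ Qflow) (obj _ HD) (obj _ HC)
    c d eg a al al' bt bt') => //; exact: cofa.
have glift (c d : Flow R hd) (r : hom c d) (v : hom (obj _ HK) d) :
    rlp (restrict_class (flow_gen R)) r -> exists h, r \c h = v.
  move=> rr; have [h rh] := @cofibrant_lift (Flow R hd) _ (obj _ HD) c d r (v \c (al' : hom (obj _ HD) (obj _ HK))) cofD rr.
  exists (h \c (al : hom (obj _ HK) (obj _ HD))).
  by rewrite compA rh -compA [X in v \c X](alK : @mcomp (Flow R hd) (obj _ HK) (obj _ HD) (obj _ HK) al' al = idm _) compm1.
have ptc_cont u v : continuous ((fun x => exist _ tt (glt u v x)) : Q u v -> pt u v).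
  by apply: const_like_cont => x y; exact: pt_eq.
pose qpt : flow_map (FlowData qc) (FlowData (@ptc p)) :=
  @FlowMap (FlowData qc) (FlowData (@ptc p)) id (fun u v x => exist _ tt (glt u v x))
  ptc_cont (fun u v w x y => pt_eq _ _).
have e1ptM u v w (x : @E1 R p u v) (y : E1 R v w) : e1pt (e1c x y) = ptc (e1pt x) (e1pt y).
  exact: pt_eq.
pose ke : flow_map (glob K) (FlowData (@e1c R p)) :=
  @from_glob K (FlowData (@e1c R p)) (Bot p) (Top p) (fun=> i0 R) (@cst_cont K I (i0 R)).
pose r1 : flow_map (FlowData (@e1c R p)) (FlowData (@ptc p)) :=
  path_map (@e1pt_cont R hd p) e1ptM.
(* The measure [mh]: the replacement maps to [E1], with the original globe at 0. *)
have [||hm [hm1 hm2]] := elift (obj _ (is_flow_E1 R hd p)) (obj _ (is_flow_pt R hd p)) r1 _ ke qpt.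
- by apply: flow_rlp => u v; exact: e1pt_rlp.
- by apply: flow_map_eq => [[]|[] [] x] //; try (by case: x); congr tot; exact: pt_eq.
change (flow_map (FlowData qc) (FlowData (@e1c R p))) in (type of hm).
have [ph [phc [phM hmE]]] : exists pa c m, hm = @FlowMap (FlowData qc) (FlowData (@e1c R p)) id pa c m.
  apply: fm_recast => u.
  exact: (congr1 (fun m : flow_map (FlowData qc) (FlowData (@ptc p)) => fm_state m u) hm2).
pose h : Q (Bot p) (Top p) -> I := ph (Bot p) (Top p).
have hK k : h (g k) = i0 R.
  apply: (@tot_inj (FlowData (@e1c R p)) (Bot p) (Top p)).
  by have := fm_path_eq hm1 (a := false) (b := true) k; rewrite hmE.
have hM u (x : Q (Bot p) u) (y : Q u (Top p)) : h (qc _ _ _ x y) = i1 R.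
  exact: (phM _ _ _ x y).
have [c cc] : exists c : forall u v, clt u v -> Q u v, forall u v w (h : clt u v) (h' : clt v w)
    (h'' : clt u w), qc _ _ _ (c u v h) (c v w h') = c u w h''.
  apply: coherent_points; first exact: qcA.
  by move=> u v uv; have := wcQ u v; rewrite uv => -[].
have lt01 : clt (Bot p) (Top p) by [].
have [d [dc d0 d1]] : joined R (g k0) (c _ _ lt01).
  by have [_ jQ _] : wcontr R (Q (Bot p) (Top p)) := wcQ (Bot p) (Top p); exact: jQ.
(* The contraction target. From bottom to top a path is sent into the arc [d], at the position given
   by [h]; since [h] is 1 on composites, where [d] ends on the chain, the map respects
   composition. *)
pose cth u v : Q u v -> Q u v := match u, v return Q u v -> Q u v with
  | Bot, Top => fun x => d (h x) | u, v => fun x => c u v (glt u v x) end.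
have cthE u v (x : Q u v) (uv : clt u v) : ~ (u = Bot p /\ v = Top p) -> cth u v x = c u v uv.
  rewrite (bool_irrelevance uv (glt u v x)).
  by case: u v x uv => [||i] [||j] x uv // nuv; case: nuv.
have cth_cont u v : continuous (cth u v).
  have [[-> ->]|nuv] := pselect (u = Bot p /\ v = Top p).
    by apply: comp_cont dc; exact: (phc (Bot p) (Top p)).
  by apply: const_like_cont => x y; rewrite !(cthE _ _ _ (glt u v x)).
have cthM u v w (x : Q u v) (y : Q v w) : cth _ _ (qc _ _ _ x y) = qc _ _ _ (cth _ _ x) (cth _ _ y).
  have lx := glt _ _ x; have ly := glt _ _ y; have lxy : clt u w by exact: clt_trans lx ly.
  rewrite (cthE u v x lx); last by move=> [_ e]; move: ly; rewrite e /clt /= ltnNge -ltnS rk_lt.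
  rewrite (cthE v w y ly); last by move=> [e _]; move: lx; rewrite e /clt /= ltn0.
  rewrite (cc _ _ _ _ _ lxy).
  have [[e e']|nuw] := pselect (u = Bot p /\ w = Top p); last by rewrite (cthE _ _ _ lxy).
  by subst u w; rewrite /cth hM d1 (bool_irrelevance lt01 lxy).
(* Lifting [k] to a path from [k] to [k0] contracts [K] within itself; this is where the cofibrancy
   of the source enters. *)
have [|ch ch1] := glift (obj _ (is_flow_pf HK)) (obj _ (is_flow_sq HK)) (ends_map HK)
    (@from_glob K (FlowData (sq_concat (@glob_comp K))) false true (fun k => (k, k0))
      (path_cont (in_Top_gen KT) (fun c cc => path_to_kelley (pair_cont cc (@cst_cont _ _ k0))))).
  apply: ends_rlp => -[] []; try by right=> -[].
  by left.
change (flow_map (glob K) (FlowData (pf_concat HK))) in (type of ch).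
have [chp [chc [chM chE]]] : exists pa c m, ch = @FlowMap (glob K) (FlowData (pf_concat HK)) id pa c m.
  apply: fm_recast => e.
  apply: etrans (congr1 (fun m : flow_map (glob K) (FlowData (sq_concat (@glob_comp K))) => fm_state m e) ch1) _.
  by case: e.
pose xi k : TOP R I K := chp false true k.
have xi_cont : continuous xi by exact: (chc false true).
have xiE k : ends (xi k) = (k, k0) :> kelley R (K * K)%type.
  apply: (@tot_inj (FlowData (sq_concat (@glob_comp K))) false true).
  by have := fm_path_eq ch1 (a := false) (b := true) k; rewrite chE.
have cgx k : continuous (fun t => g (TOP_fun (xi k) t)) by exact: comp_cont (@TOP_fun_cont _ _ _) gc.
pose kp k : TOP R I (Q (Bot p) (Top p)) := TOP_mk (cgx k).
have kp_cont : continuous kp.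
  apply: (path_cont (in_Top_gen KT)) => c' cc'; apply/TOP_contP.
  have /TOP_contP cx := comp_cont cc' xi_cont; exact: (comp_cont cx gc).
have qsq_cont u v : continuous ((fun x => (x, cth u v x)) : Q u v -> sq_path R Q u v).
  have [QT _ _] := Qflow; apply: (path_cont (in_Top_gen (QT u v))) => c' cc'.
  by apply: path_to_kelley; apply: pair_cont => //; exact: comp_cont cc' (cth_cont u v).
have qsqM u v w (x : Q u v) (y : Q v w) : (qc _ _ _ x y, cth _ _ (qc _ _ _ x y)) =
    sq_concat (R := R) qc (x, cth _ _ x) (y, cth _ _ y) :> sq_path R Q u w.
  by rewrite cthM.
pose qsq : flow_map (FlowData qc) (FlowData (sq_concat (R := R) qc)) :=
  @FlowMap (FlowData qc) (FlowData (sq_concat qc)) id _ qsq_cont qsqM.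
pose top : flow_map (glob K) (FlowData (pf_concat Qflow)) :=
  @from_glob K (FlowData (pf_concat Qflow)) (Bot p) (Top p) kp kp_cont.
(* A homotopy from the identity to [cth], compatible with composition, that restricts on the
   original globe to the contraction [xi]. Therefore it keeps the globe inside itself. *)
have [||Gm [Gm1 Gm2]] := elift (obj _ (is_flow_pf Qflow)) (obj _ (is_flow_sq Qflow))
    (ends_map Qflow) _ top qsq.
- exact: ends_rlp.
- apply: flow_map_eq => [[]|[] [] x] //; try (by case: x); congr tot.
  have E1 := congr1 (fun y : K * K => y.1) (xiE x); have E2 := congr1 (fun y : K * K => y.2) (xiE x).
  rewrite /= in E1 E2; change ((g (TOP_fun (xi x) (i0 R)), g (TOP_fun (xi x) (i1 R))) =
    (g x, d (h (g x))) :> (Q (Bot p) (Top p) * Q (Bot p) (Top p))%type).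
  by rewrite E1 E2 hK d0.
change (flow_map (FlowData qc) (FlowData (pf_concat Qflow))) in (type of Gm).
have [G [Gc [GM GE]]] : exists pa c m, Gm = @FlowMap (FlowData qc) (FlowData (pf_concat Qflow)) id pa c m.
  apply: fm_recast => u.
  exact: (congr1 (fun m : flow_map (FlowData qc) (FlowData (sq_concat qc)) => fm_state m u) Gm2).
have Gends u v (x : Q u v) : ends (G u v x) = (x, cth _ _ x) :> sq_path R Q u v.
  apply: (@tot_inj (FlowData (sq_concat qc)) u v).
  by have := fm_path_eq Gm2 (a := u) (b := v) x; rewrite GE.
constructor; refine (@ChainModel R hd (Arrow (a : hom (obj _ HD) (obj _ HC))) p Q qc K g Qflow KT gc _ glt h
  (phc (Bot p) (Top p)) hK hM c cc d dc _ _ G Gc _ _ _ _ _).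
- move=> HK' c' d' x k t po; exists (x \c (al' : hom (obj _ HD) (obj _ HK'))),
    (k \c (bt' : hom (obj _ HC) (obj _ Qflow))).
  apply: (@pushout_iso (Flow R hd) (obj _ HK') (obj _ Qflow) (obj _ HD) (obj _ HC) c' d'
    eg a al al' bt bt' x k t) => //; by split.
- by exists k0.
- by move=> h'; rewrite d1 (bool_irrelevance h' lt01).
- by move=> u v w x y t; have := GM u v w x y; move=> ->.
- by move=> u v x; exact: (congr1 (fun y : Q u v * Q u v => y.1) (Gends u v x)).
- by move=> x; exact: (congr1 (fun y : Q (Bot p) (Top p) * Q (Bot p) (Top p) => y.2) (Gends _ _ x)).
- move=> u v x h' nuv; rewrite -(cthE u v x h' nuv).
  exact: (congr1 (fun y : Q u v * Q u v => y.2) (Gends u v x)).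
- move=> k t; exists (TOP_fun (xi k) t).
  suff -> : G _ _ (g k) = kp k by [].
  apply: (@tot_inj (FlowData (pf_concat Qflow)) (Bot p) (Top p)).
  by have := fm_path_eq Gm1 (a := false) (b := true) k; rewrite GE.
Qed.

End ChainModel.

(** * Fibrewise deformation retractions *)

Section FibrewiseRetraction.
Variable R : realType.
Local Notation I := (@unitI R).

Lemma disk_seq_rich n : seq_rich R (@disk R n.+1).
Proof.
apply: convex_seq_rich => x y l hx hy l0 l1; rewrite /disk /= in hx hy *.
apply: (@le_trans _ _ (\sum_i ((1 - l) * x 0 i ^+ 2 + l * y 0 i ^+ 2))).
  apply: ler_sum => i _; rewrite !mxE -subr_ge0.
  rewrite (_ : _ - _ = (1 - l) * l * (x 0 i - y 0 i) ^+ 2); last by rewrite !expr2; lra.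
  by rewrite mulr_ge0 ?sqr_ge0 // mulr_ge0 // subr_ge0.
by rewrite big_split /= -!mulr_sumr; nra.
Qed.

Lemma disk_cylinder_gen n : delta_generated R (@disk R n.+1 * I)%type.
Proof.
apply/delta_generatedP; apply: seq_rich_path_generated.
by apply: seq_richM; [exact: disk_seq_rich|exact: I_seq_rich].
Qed.

Section Rel.
Variables (A : topologicalType) (n : nat) (a : A).
Local Notation D := (@disk R n.+1).
Local Notation hrel := (@homotopic_rel R A n.+1 a).

Lemma homotopic_rel_sym (u v : D -> A) : hrel u v -> hrel v u.
Proof.
move=> [H [cH H0 H1 Hs]]; exists (fun x => H (x.1, Irev x.2)); split=> [|x|x|x t xs].
- apply: comp_cont cH; apply: pair_cont; first exact: fst_cont.
  exact: comp_cont (@snd_cont _ _) (@Irev_cont R).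
- by rewrite Irev0.
- by rewrite Irev1.
- exact: Hs.
Qed.

Lemma homotopic_rel_trans (u v w : D -> A) : hrel u v -> hrel v w -> hrel u w.
Proof.
move=> [H [cH H0 H1 Hs]] [K [cK K0 K1 Ks]].
exists (fun x => if val x.2 <= 2^-1 then H (x.1, cl (2 * val x.2)) else K (x.1, cl (2 * val x.2 - 1))).
have c2 : continuous (fun x : D * I => val x.2) by exact: comp_cont (@snd_cont _ _) (@val_cont _ _).
have c22 : continuous (fun x : D * I => 2 * val x.2) by apply: rcontM => //; exact: cst_cont.
split=> [|x|x|x t xs].
- apply: (@glue_cont R _ _ (fun x : D * I => val x.2 - 2^-1)
    (fun x => H (x.1, cl (2 * val x.2))) (fun x => K (x.1, cl (2 * val x.2 - 1)))).
  + by apply: rcontB => //; exact: cst_cont.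
  + apply: comp_cont cH; apply: pair_cont; first exact: fst_cont.
    exact: comp_cont c22 (@cl_cont R).
  + apply: comp_cont cK; apply: pair_cont; first exact: fst_cont.
    by apply: comp_cont (@cl_cont R); apply: rcontB => //; exact: cst_cont.
  + by move=> x; rewrite subr_le0 => ->.
  + move=> x; rewrite subr_ge0 => h; case: ifP => // h'.
    have e : val x.2 = 2^-1 by apply/le_anti; rewrite h h'.
    by rewrite e divff ?pnatr_eq0 // subrr cl_ge1 // cl_le0 // H1 K0.
- by rewrite /= invr_ge0 ler0n mulr0 cl_le0.
- rewrite /= ifF; last by apply/negbTE; rewrite -ltNge invf_lt1 ?ltr1n.
  by rewrite mulr1 cl_ge1 ?K1 //; lra.
- by case: ifP => _; [exact: Hs|exact: Ks].
Qed.

End Rel.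

Lemma joined_sym (A : topologicalType) (x y : A) : joined R x y -> joined R y x.
Proof.
move=> [p [cp p0 p1]]; exists (fun t => p (Irev t)); split.
- exact: comp_cont (@Irev_cont R) cp.
- by rewrite Irev0.
- by rewrite Irev1.
Qed.

Lemma joined_trans (A : topologicalType) (x y z : A) :
  joined R x y -> joined R y z -> joined R x z.
Proof.
move=> [p [cp p0 p1]] [q [cq q0 q1]]; exists (concat p q); split.
- by apply: concat_cont1 => //; rewrite p1 q0.
- by rewrite concat0.
- by rewrite concat1.
Qed.

Variables (S T : topologicalType) (f : S -> T) (s : T -> S) (H : S -> I -> S).
Hypotheses (cf : continuous f) (cs : continuous s) (fs : cancel s f)
  (H_cont : forall c : I -> S, continuous c -> continuous (fun x : I * I => H (c x.1) x.2))
  (H0 : forall x, H x (i0 R) = x) (H1 : forall x, H x (i1 R) = s (f x))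
  (fH : forall x t, f (H x t) = f x).


Let joinH x : joined R x (s (f x)).
Proof.
exists (H x); split; [|exact: H0|exact: H1].
have cH := H_cont (@cst_cont I S x).
by apply: (comp_cont (f := fun t => (i0 R, t)) _ cH); apply: pair_cont; [exact: cst_cont|exact: id_cont].
Qed.

Section Spheroids.
Variable n : nat.
Local Notation D := (@disk R n.+1).

Let clip_sub (x : 'rV[R]_n.+1) : enorm ((Num.max 1 (enorm x))^-1 *: x) <= 1.
Proof.
have m0 : 0 < Num.max 1 (enorm x) by rewrite lt_max ltr01.
by rewrite enormZ0 ?invr_ge0 ?(ltW m0) // mulrC ler_pdivrMr // mul1r le_max lexx orbT.
Qed.

(* The radial retraction of the vector space onto the disk. *)
Let clip x : D := disk_of (clip_sub x).

Let clip_cont : continuous clip.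
Proof.
apply: sub_cont; apply: scaleM_cont; last exact: id_cont.
apply: rcontV => [x|]; first by rewrite gt_eqF // lt_max ltr01.
by apply: rcont_max; [exact: cst_cont|exact: enorm_cont].
Qed.

Let clip_id (z : D) : clip (val z) = z.
Proof. by apply/val_inj; rewrite /= (max_idPl (disk_enorm z)) invr1 scale1r. Qed.

Let clip_out x : 1 <= enorm x -> sphere n.+1 (val (clip x)).
Proof.
move=> h; apply/sphereP; rewrite [val _]/= (max_idPr h) enormZ0 ?invr_ge0 ?enorm_ge0 //.
by rewrite mulVf // gt_eqF //; apply: lt_le_trans h.
Qed.

Let cDI (F : D * I -> R) : continuous F -> continuous (fun x : D * I => F x *: val x.1).
Proof.
move=> cF; apply: scaleM_cont => //; exact: comp_cont (@fst_cont _ _) (@val_cont _ _).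
Qed.

Let cr : continuous (fun x : D * I => enorm (val x.1)).
Proof.
apply: comp_cont (@enorm_cont R _); exact: comp_cont (@fst_cont _ _) (@val_cont _ _).
Qed.

Let ct : continuous (fun x : D * I => val x.2).
Proof. exact: comp_cont (@snd_cont _ _) (@val_cont _ _). Qed.

Variable a : S.

(** The homotopy moves the base point from [a] to [s (f a)]. As the radius goes from 1/2 to 1, [eta]
    follows this track backwards and brings the base point home to [a]. *)
Let eta (r : R) := H a (cl (2 - 2 * r)).

Let eta_cont : continuous eta.
Proof.
have cH := H_cont (@cst_cont I S a).
have c1 : continuous (fun r : R => (i0 R, cl (2 - 2 * r))).
  apply: pair_cont; first exact: cst_cont.
  apply: comp_cont (@cl_cont R); apply: rcontB; first exact: cst_cont.
  by apply: rcontM; [exact: cst_cont|exact: id_cont].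
exact: (comp_cont c1 cH).
Qed.

Let collar (w : D -> S) (z : D) : S :=
  if enorm (val z) <= 2^-1 then w (clip (2 *: val z)) else eta (enorm (val z)).

Let collar_homotopy (u v : D -> T) : homotopic_rel (f a) u v ->
  homotopic_rel a (collar (s \o u)) (collar (s \o v)).
Proof.
move=> [K [cK K0 K1 Ks]].
pose L (x : D * I) := if enorm (val x.1) <= 2^-1 then s (K (clip (2 *: val x.1), x.2))
  else eta (enorm (val x.1)).
exists L; split=> [|x|x|x t /sphereP xs].
- apply: (@glue_cont R _ _ (fun x : D * I => enorm (val x.1) - 2^-1)
    (fun x => s (K (clip (2 *: val x.1), x.2))) (fun x => eta (enorm (val x.1)))).
  + by apply: rcontB => //; exact: cst_cont.
  + apply: comp_cont cs; apply: comp_cont cK; apply: pair_cont; last exact: snd_cont.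
    by apply: comp_cont clip_cont; apply: (cDI (F := fun=> 2)); exact: cst_cont.
  + exact: comp_cont cr eta_cont.
  + by move=> x; rewrite /L subr_le0 => ->.
  + move=> x; rewrite /L subr_ge0 => h; case: ifP => // h'.
    have e : enorm (val x.1) = 2^-1 by apply/le_anti; rewrite h h'.
    rewrite Ks; last by apply: clip_out; rewrite enormZ0 // e divff // pnatr_eq0.
    by rewrite /eta e divff ?pnatr_eq0 // cl_ge1 ?H1 //; lra.
- by rewrite /L /collar /= K0.
- by rewrite /L /collar /= K1.
- rewrite /L xs ifF; last by apply/negbTE; rewrite -ltNge invf_lt1 ?ltr1n.
  by rewrite /eta cl_le0 ?H0 //; lra.
Qed.

(** At time [t] the spheroid, moved by [H] up to time [t], is squeezed into the radius [1 - t/2],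
    and the collar fills the rest. At the interface both sides equal [H a t]. *)
Let to_collar (u : D -> S) : spheroid a u -> homotopic_rel a u (collar (s \o (f \o u))).
Proof.
move=> [cu us].
pose q (x : D * I) : R := 1 - val x.2 / 2.
have q0 x : 0 < q x by have := I_le1 x.2; rewrite /q; lra.
have q1 x : q x <= 1 by have := I_ge0 x.2; rewrite /q; lra.
have cq : continuous q.
  apply: rcontB; first exact: cst_cont.
  by apply: rcontM => //; exact: cst_cont.
pose w (x : D * I) := u (clip ((q x)^-1 *: val x.1)).
have cw : continuous w.
  apply: comp_cont cu; apply: comp_cont clip_cont; apply: (cDI (F := fun x => (q x)^-1)).
  by apply: rcontV => // x; rewrite gt_eqF.
pose U (x : D * I) := if enorm (val x.1) <= q x then H (w x) x.2 else eta (enorm (val x.1)).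
exists U; split=> [|x|x|x t xs].
- apply: (@glue_cont R _ _ (fun x : D * I => enorm (val x.1) - q x)
    (fun x => H (w x) x.2) (fun x => eta (enorm (val x.1)))).
  + exact: rcontB.
  + apply: (path_cont (@disk_cylinder_gen n)) => c cc.
    have cH := H_cont (comp_cont cc cw).
    apply: (comp_cont (f := fun t => (t, (c t).2)) _ cH).
    by apply: pair_cont; [exact: id_cont|exact: comp_cont cc (@snd_cont _ _)].
  + exact: comp_cont cr eta_cont.
  + by move=> x; rewrite /U subr_le0 => ->.
  + move=> x; rewrite /U subr_ge0 => h; case: ifP => // h'.
    have e : enorm (val x.1) = q x by apply/le_anti; rewrite h h'.
    rewrite /w us; last first.
      by apply: clip_out; rewrite enormZ0 ?invr_ge0 ?(ltW (q0 x)) // e mulVf // gt_eqF.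
    rewrite /eta e; congr (H a _); rewrite -[LHS]clK; congr cl; rewrite /q; lra.
- rewrite /U /w /q [(x, i0 R).2]/= (erefl : val (i0 R) = 0) mul0r subr0 disk_enorm H0.
  by rewrite invr1 scale1r clip_id.
- have qE : q (x, i1 R) = 2^-1 by rewrite /q [val _]/=; lra.
  by rewrite /U /w /collar qE H1 invrK.
- rewrite /U; have e : enorm (val x) = 1 by apply/sphereP.
  rewrite [(x, t).1]/= e; case: ifP => h.
    have q11 : q (x, t) = 1 by apply/le_anti; rewrite q1 h.
    have t0 : t = i0 R by apply/val_inj; move: q11; rewrite /q [(x, t).2]/= (erefl : val (i0 R) = 0); lra.
    by rewrite /w q11 invr1 scale1r clip_id us // t0 H0.
  by rewrite /eta cl_le0 ?H0 //; lra.
Qed.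

Let collar_spheroid (w : D -> T) : spheroid (f a) w -> spheroid a (collar (s \o w)).
Proof.
move=> [cw ws]; have hw : homotopic_rel (f a) w w.
  exists (fun x => w x.1); split=> // [|x t xs]; last exact: ws.
  exact: comp_cont (@fst_cont _ _) cw.
have [L [cL L0 L1 Ls]] := collar_homotopy hw; split=> [|x xs].
  rewrite (_ : collar _ = fun x => L (x, i0 R)); last by apply/funext => x; rewrite L0.
  apply: (comp_cont (f := fun x => (x, i0 R)) _ cL).
  by apply: pair_cont; [exact: id_cont|exact: cst_cont].
by rewrite -L0 Ls.
Qed.

(** Because [H] moves inside the fibres of [f], the collar becomes constant in [T], and only a
    rescaling of the disk by the factor 2/(1+t) remains. *)
Let f_collar (v : D -> T) : spheroid (f a) v -> homotopic_rel (f a) (f \o collar (s \o v)) v.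
Proof.
move=> [cv vs].
pose q (x : D * I) : R := 2 / (1 + val x.2).
have q1 x : 1 <= q x.
  have := I_le1 x.2; have := I_ge0 x.2 => t0 t1; rewrite /q ler_pdivlMr; lra.
exists (fun x => v (clip (q x *: val x.1))); split=> [|x|x|x t xs].
- apply: comp_cont cv; apply: comp_cont clip_cont; apply: cDI.
  apply: rcontM; first exact: cst_cont.
  apply: rcontV => [x|]; first by have := I_ge0 x.2 => t0; rewrite gt_eqF //; lra.
  by apply: rcontD => //; exact: cst_cont.
- rewrite /q [val (x, i0 R).2]/= addr0 divr1 /= /collar; case: ifP => h; first by rewrite /= fs.
  rewrite /eta fH vs //; apply: clip_out; rewrite enormZ0 //.
  move/negbT: h; rewrite -ltNge; lra.
- have e : (2 : R) / (1 + 1) = 1 by rewrite -[1 + 1]/(2%:R) divff // pnatr_eq0.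
  by rewrite /q [val (x, i1 R).2]/= e scale1r clip_id.
- apply: vs; apply: clip_out; rewrite enormZ0; last by apply: le_trans (q1 _).
  by move/sphereP: xs => ->; rewrite mulr1.
Qed.

Lemma fibrewise_pi : (forall u v : D -> S, spheroid a u -> spheroid a v ->
    homotopic_rel (f a) (f \o u) (f \o v) -> homotopic_rel a u v) /\
  (forall v : D -> T, spheroid (f a) v ->
     exists2 u, spheroid a u & homotopic_rel (f a) (f \o u) v).
Proof.
split=> [u v su sv /collar_homotopy huv|v sv].
  apply: homotopic_rel_trans (to_collar su) _; apply: homotopic_rel_trans huv _.
  exact: homotopic_rel_sym (to_collar sv).
by exists (collar (s \o v)); [exact: collar_spheroid|exact: f_collar].
Qed.

End Spheroids.

Lemma fibrewise_weq : weak_homotopy_equivalence R f.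
Proof.
split => //; last by move=> n a; exact: fibrewise_pi.
split=> [x y [p [cp p0 p1]]|y]; last first.
  by exists (s y), (fun=> y); split; [exact: cst_cont|rewrite fs|].
apply: joined_trans (joinH x) _; apply: joined_trans (joined_sym (joinH y)).
by exists (s \o p); split; [exact: comp_cont cp cs|rewrite /= p0|rewrite /= p1].
Qed.

End FibrewiseRetraction.

(** * Attaching the models *)

Lemma no_clt_top p (v : cst p) : clt (Top p) v -> False.
Proof. by rewrite /clt /= ltnNge -ltnS rk_lt. Qed.

Section ExtRealization.
Variables (R : realType) (hd : bool).
Local Notation I := (@unitI R).
Variables (g : nat -> arrow (Flow R hd)) (M : forall p, chain_model (g p) p).
Let Q p := mQ (M p).
Let qc p := @mqc _ _ _ _ (M p).
Let K p := mK (M p).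
Let gK p := @mg _ _ _ _ (M p).
Variables (S : Type) (A : S -> S -> topologicalType)
  (ac : forall a b c, A a b -> A b c -> A a c).
Variables (J : Type) (nn : J -> nat) (src tgt : J -> S)
  (gam : forall j, A (src j) (tgt j)).
Hypothesis Aflow : is_flow R hd (FlowData ac).

Lemma model_flow p : is_flow R hd (FlowData (@qc p)). Proof. exact: mQ_flow. Qed.

Section Out.
Variables (V : S -> S -> topologicalType) (vc : forall a b c, V a b -> V b c -> V a c)
  (gamV : forall j, V (src j) (tgt j))
  (phi : forall a b, A a b -> V a b)
  (xi : forall j, Q (Bot (nn j)) (Top (nn j)) -> V (src j) (tgt j)).
Hypotheses (Vflow : is_flow R hd (FlowData vc))
  (phi_cont : forall a b, continuous (@phi a b)) (xi_cont : forall j, continuous (@xi j))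
  (phiM : forall a b c (x : A a b) (y : A b c), phi (ac x y) = vc (phi x) (phi y))
  (xiM : forall j u (x : Q (Bot (nn j)) u) (y : Q u (Top _)), xi (qc x y) = gamV j)
  (xiK : forall j (k : K (nn j)), xi (gK k) = phi (gam j)).
Local Notation E := (@epath S J nn src tgt V).
Local Notation sgj j u := (@sg S J nn src tgt j u).

Lemma kc_bot j (i : 'I_(nn j)) : kc src tgt (Old nn (src j)) (New S i) true.
Proof. by apply/andP; split=> //; apply/asboolP. Qed.

Lemma kc_top j (i : 'I_(nn j)) : kc src tgt (New S i) (Old nn (tgt j)) true.
Proof. by apply/andP; split=> //; apply/asboolP. Qed.

Lemma kc_chain j (i i' : 'I_(nn j)) : (i.+1 < i'.+1)%N -> kc src tgt (New S i) (New S i') false.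
Proof. by move=> h; apply/andP; split=> //; apply/asboolP. Qed.

Definition ext_cell j (u v : cst (nn j)) : Q u v -> E (sgj j u) (sgj j v) :=
  match u, v with
  | Bot, Top => fun q => inl (xi q)
  | Bot, In i => fun _ => inr (exist (fun e => kc src tgt (Old nn (src j)) (New S i) e) true (kc_bot i))
  | In i, Top => fun _ => inr (exist (fun e => kc src tgt (New S i) (Old nn (tgt j)) e) true (kc_top i))
  | In i, In i' => fun q =>
      inr (exist (fun e => kc src tgt (New S i) (New S i') e) false (kc_chain (m_lt q)))
  | Bot, Bot => fun q => False_rect _ (notF (m_lt q))
  | Top, v => fun q => False_rect _ (no_clt_top (m_lt q))
  | In i, Bot => fun q => False_rect _ (notF (m_lt q))
  end.

Lemma ext_cell_cont j u v : continuous (@ext_cell j u v).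
Proof.
case: u v => [||i] [||i'] /=; try by move=> q; have := m_lt q.
- exact: comp_cont (@xi_cont j) (@inl_cont _ _).
- exact: cst_cont.
- by move=> q; case: (no_clt_top (m_lt q)).
- by move=> q; case: (no_clt_top (m_lt q)).
- exact: cst_cont.
- apply: (path_cont (in_Top_gen (let: And3 QT _ _ := model_flow (nn j) in QT _ _))) => c cc.
  rewrite (_ : _ \o _ = fun=> ext_cell (c (i0 R))); first exact: cst_cont.
  by apply/funext => r /=; congr inr; exact: val_inj.
Qed.

Lemma ext_cellM j u v w (x : Q u v) (y : Q v w) :
  ext_cell (j := j) (qc x y) = ecomp vc gamV (ext_cell x) (ext_cell y).
Proof.
apply: emb_inj; rewrite emb_comp.
have xl := m_lt x; have yl := m_lt y.
case: u v w x y xl yl => [||i] [||i'] [||i''] // x y xl yl;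
  try by [case: (no_clt_top xl)|case: (no_clt_top yl)].
- apply: (congr1 inl); rewrite /= xiM; symmetry.
  by apply: etrans (mulp1 _ _ _) _; exact: mul1p.
- by apply: (congr1 inl); symmetry; exact: mul_pid.
- by apply: (congr1 inl); symmetry; exact: mul_pid.
- by apply: (congr1 inr); exact: sig_unit.
Qed.

Lemma ext_phiM a b c (x : A a b) (y : A b c) : (inl (phi (ac x y)) : E (Old nn a) (Old nn c)) =
  ecomp vc gamV (inl (phi x) : E (Old nn a) (Old nn b)) (inl (phi y) : E (Old nn b) (Old nn c)).
Proof.
apply: emb_inj; rewrite emb_comp; apply: (congr1 inl); rewrite /= phiM; symmetry.
by rewrite -mulll; apply: (congr1 (fun z => mul vc z _)); exact: mulp1.
Qed.

Lemma ext_cellK j (k : K (nn j)) :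
  @ext_cell j (Bot _) (Top _) (gK k) = (inl (phi (gam j)) : E (Old nn _) (Old nn _)).
Proof. by rewrite /= xiK. Qed.

(** Used twice: with coefficients [A] it gives the map [to_ext] from W to Ext, and with coefficients
    in paths of W between old states it gives the second half of the deformation. *)
Definition ext_realization : @realization S A ac Q qc K gK J nn src tgt gam
    (ext_flow nn vc gamV) id :=
  @Realization S A ac Q qc K gK J nn src tgt gam (ext_flow nn vc gamV) id
    (fun a b x => inl (phi x)) (fun j u v q => ext_cell q)
    (fun a b => comp_cont (@phi_cont a b) (@inl_cont _ _)) ext_cell_cont
    ext_phiM ext_cellM ext_cellK.

End Out.
Local Notation W := (wpath R hd ac qc gK (nn := nn) (src := src) (tgt := tgt) gam).
Local Notation wc := (wconcat (R := R) (hd := hd) (ac := ac) (qc := qc) (gK := gK) (gam := gam)).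
Local Notation jA := (@iA R hd S A ac Q qc K gK J nn src tgt gam).
Local Notation jQ := (@iQ R hd S A ac Q qc K gK J nn src tgt gam).
Local Notation Wflow := (wflow R hd ac qc gK nn gam).
Local Notation X := (est S nn).
Local Notation E V := (@epath S J nn src tgt V).

Lemma jW_flow : is_flow R hd Wflow.
Proof. exact: (@is_flow_W R hd S A ac Q qc K gK J nn src tgt gam). Qed.

Let WS (a b : S) : topologicalType := W (Old nn a) (Old nn b).
Let wS a b c (x : WS a b) (y : WS b c) : WS a c := wc x y.

Lemma WS_flow : is_flow R hd (FlowData wS).
Proof.
have [WT Wc WA] := jW_flow; split=> [a b|a b c|a b c d x y z]; [exact: WT|exact: Wc|exact: WA].
Qed.

Let xr := ext_realization (gamV := gam) (xi := fun j _ => gam j) (fun a b => @id_cont (A a b))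
  (fun j => @cst_cont _ _ (gam j)) (fun a b c x y => erefl) (fun j u x y => erefl)
  (fun j k => erefl).
Let EF := is_flow_ext nn gam Aflow.

Definition to_ext x y : W x y -> E A x y :=
  @evalW R hd S A ac Q qc K gK J nn src tgt gam _ _ xr x y.

Lemma to_ext_cont x y : continuous (@to_ext x y).
Proof. exact: (@evalW_cont R hd S A ac Q qc K gK J nn src tgt gam _ _ xr EF). Qed.

Lemma to_extM x y z (w : W x y) (w' : W y z) :
  to_ext (wc w w') = ecomp ac gam (to_ext w) (to_ext w').
Proof. exact: (@evalWM R hd S A ac Q qc K gK J nn src tgt gam _ _ xr EF). Qed.

Lemma to_extA a b (v : A a b) : to_ext (jA v) = inl v.
Proof. exact: (@evalWE R hd S A ac Q qc K gK J nn src tgt gam _ _ xr EF _ _ _). Qed.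

Lemma to_extQ j u v (q : Q u v) : to_ext (jQ (j := j) q) = ext_cell (fun j _ => gam j) q.
Proof. exact: (@evalWE R hd S A ac Q qc K gK J nn src tgt gam _ _ xr EF _ _ _). Qed.

Definition to_ext_map : flow_map Wflow (ext_flow nn ac gam) :=
  @FlowMap Wflow (ext_flow nn ac gam) id to_ext to_ext_cont to_extM.

Definition dn_cell j (i : 'I_(nn j)) : W (Old nn (src j)) (New S i) :=
  @jQ j (Bot _) (In i) (mc (M _) (erefl true : clt (Bot _) (In i))).

Definition up_cell j (i : 'I_(nn j)) : W (New S i) (Old nn (tgt j)) :=
  @jQ j (In i) (Top _) (mc (M _) (ltn_ord i : clt (In i) (Top _))).

Definition ch_cell (x y : X) : chain x y -> W x y :=
  match x, y return chain x y -> W x y with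
  | New j i, New j' i' => fun h =>
      match (asboolW (proj1 (elimTF andP h))) in _ = j'
        return forall i' : 'I_(nn j'), (i < i')%N -> W (New S i) (New S i') with
      | erefl => fun i' hl => @jQ j (In i) (In i') (mc (M _) (hl : clt (In i) (In i')))
      end i' (proj2 (elimTF andP h))
  | _, _ => fun h => False_rect _ (notF h)
  end.

Lemma ch_cellE j (i i' : 'I_(nn j)) (h : chain (New S i) (New S i')) (hl : clt (In i) (In i')) :
  ch_cell h = @jQ j (In i) (In i') (mc (M _) hl).
Proof.
rewrite /ch_cell (Prop_irrelevance (asboolW _) erefl).
by rewrite (bool_irrelevance (proj2 (elimTF andP h)) hl).
Qed.

(** Turns an extended path with coefficients in W into a word, using the section [mc] of the models
    for the pieces of edges. Such words are the normal forms. *)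
Definition from_ext x y : E WS x y -> W x y :=
  @eout S J nn src tgt WS Wflow id (fun a b w => w) up_cell dn_cell ch_cell x y.

Lemma from_ext_cont x y : continuous (@from_ext x y).
Proof.
apply: (@eout_cont R hd S J nn src tgt WS Wflow id jW_flow (fun a b w => w)) => [|a b].
  exact: (@in_Top_epath R hd S J nn src tgt WS wS WS_flow x y).
exact: id_cont.
Qed.

Let gam0 j : WS (src j) (tgt j) := @jQ j (Bot _) (Top _) (md (M _) (i1 R)).

Lemma cell_comp j u v w (h : clt u v) (h' : clt v w) (h'' : clt u w) :
  wc (@jQ j u v (mc (M _) h)) (@jQ j v w (mc (M _) h')) = @jQ j u w (mc (M _) h'').
Proof. by rewrite -(mcc (M _) h h' h''); symmetry; exact: iQM. Qed.

Lemma from_extM x y z (u : E WS x y) (u' : E WS y z) :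
  from_ext (ecomp wS gam0 u u') = wc (from_ext u) (from_ext u').
Proof.
apply: (@eoutM R hd S J nn src tgt WS wS gam0 Wflow id jW_flow (fun a b w => w)) => //.
- move=> j i; rewrite /gam0 (md1 (M _) (erefl true : clt (Bot _) (Top _))).
  exact: (@cell_comp j (Bot _) (In i) (Top _) _ _ _).
- move=> j i i' h; rewrite (ch_cellE h (proj2 (elimTF andP h))).
  exact: (@cell_comp j (Bot _) (In i) (In i') _ _ _).
- move=> j i i' h; rewrite (ch_cellE h (proj2 (elimTF andP h))).
  exact: (@cell_comp j (In i) (In i') (Top _) _ _ _).
- move=> [a|j i] [b|j' i'] [c|j'' i''] // h h' h''.
  have [/asboolP e l] := andP h; have [/asboolP e' l'] := andP h'; subst j' j''.
  rewrite (ch_cellE h l) (ch_cellE h' l') (ch_cellE h'' (ltn_trans l l')).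
  exact: (@cell_comp j (In i) (In i') (In i'') _ _ _).
Qed.

Lemma jQ_cont j u v : continuous (@jQ j u v).
Proof. exact: (@iQ_cont R hd S A ac Q qc K gK J nn src tgt gam model_flow). Qed.

Lemma jA_cont a b : continuous (@jA a b).
Proof. exact: (@iA_cont R hd S A ac Q qc K gK J nn src tgt gam Aflow). Qed.

Let cpath (T : topologicalType) (x : T) : TOP R I T := TOP_mk (@cst_cont _ _ x).

Let cpath_cont (T : topologicalType) (U : topologicalType) (f : T -> U) :
  delta_generated R T -> continuous f -> continuous (fun x => cpath (f x)).
Proof.
move=> gT cf; apply: (path_cont gT) => c cc; apply/TOP_contP.
exact: (comp_cont (comp_cont (@fst_cont _ _) cc) cf).
Qed.

Definition slide (s t : I) : I := cl ((1 - val t) * val s).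

Lemma slide_cont (U : topologicalType) (f h : U -> I) : continuous f -> continuous h ->
  continuous (fun x => slide (f x) (h x)).
Proof.
move=> cf ch; apply: comp_cont (@cl_cont R); apply: rcontM; last exact: comp_cont cf (@val_cont _ _).
by apply: rcontB; [exact: cst_cont|exact: comp_cont ch (@val_cont _ _)].
Qed.

Lemma slide_cont1 (s : I) : continuous (slide s).
Proof. by apply: slide_cont; [exact: cst_cont|exact: id_cont]. Qed.

Lemma slide0 s : slide s (i0 R) = s.
Proof. by rewrite /slide (erefl : val (i0 R) = 0) subr0 mul1r clK. Qed.

Lemma slide1 s : slide s (i1 R) = i0 R.
Proof. by rewrite /slide (erefl : val (i1 R) = 1) subrr mul0r; exact: cl_le0. Qed.

Lemma slide_i0 t : slide (i0 R) t = i0 R.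
Proof. by rewrite /slide (erefl : val (i0 R) = 0) mulr0; exact: cl_le0. Qed.

Let jmd j (s : I) : WS (src j) (tgt j) := @jQ j (Bot _) (Top _) (md (M _) s).

Let jmd_cont j : continuous (jmd j).
Proof. exact: comp_cont (@md_cont _ _ _ _ (M (nn j))) (@jQ_cont j _ _). Qed.

Let jmd0 j : jmd j (i0 R) = jA (gam j).
Proof.
rewrite /jmd; have [k ->] := md0 (M (nn j)).
exact: (@iK R hd S A ac Q qc K gK J nn src tgt gam j k).
Qed.

Let PS (a b : S) := pf_path R WS a b.
Let pS := pf_concat WS_flow.
Let PS_flow : is_flow R hd (FlowData pS). Proof. exact: is_flow_pf WS_flow. Qed.

(** A path in W that starts where the contraction [mG] has left [q], at position [mh q] on the arc
    [md], and slides back to position 0, which is the original edge. *)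
Let xi j (q : Q (Bot (nn j)) (Top (nn j))) : PS (src j) (tgt j) :=
  TOP_mk (comp_cont (@slide_cont1 (mh q)) (@jmd_cont j)).
Let gamP j : PS (src j) (tgt j) := TOP_mk (comp_cont (@slide_cont1 (i1 R)) (@jmd_cont j)).

Let AT a b : delta_generated R (A a b).
Proof. by have [AT _ _] := Aflow; exact: in_Top_gen (AT a b). Qed.

Let QT p u v : delta_generated R (@Q p u v).
Proof. by have [QT _ _] := model_flow p; exact: in_Top_gen (QT u v). Qed.

Let xi_cont j : continuous (@xi j).
Proof.
apply: (path_cont (@QT _ _ _)) => c cc; apply/TOP_contP.
apply: comp_cont (@jmd_cont j); apply: slide_cont; last exact: snd_cont.
exact: (comp_cont (comp_cont (@fst_cont _ _) cc) (@mh_cont _ _ _ _ (M (nn j)))).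
Qed.

Let phiP a b (x : A a b) : PS a b := cpath (jA x).

Let phiP_cont a b : continuous (@phiP a b).
Proof. by apply: cpath_cont; [exact: AT|exact: jA_cont]. Qed.

Let phiPM a b c (x : A a b) (y : A b c) : phiP (ac x y) = pS (phiP x) (phiP y).
Proof. by apply: TOP_fun_inj; apply/funext => t; exact: iAM. Qed.

Let xiM j u (x : Q (Bot (nn j)) u) (y : Q u (Top _)) : xi (qc x y) = gamP j.
Proof. by rewrite /xi (mhM x y). Qed.

Let xiK j (k : K (nn j)) : xi (gK k) = phiP (gam j).
Proof.
apply: TOP_fun_inj; apply/funext => t.
by rewrite /TOP_fun /= (mhK k) slide_i0 jmd0.
Qed.

Let kr := ext_realization phiP_cont xi_cont phiPM xiM xiK.
Let EPS := is_flow_ext nn gamP PS_flow.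

Let kk x y : W x y -> E PS x y :=
  @evalW R hd S A ac Q qc K gK J nn src tgt gam _ _ kr x y.

Let kkM x y z (w : W x y) (w' : W y z) : kk (wc w w') = ecomp pS gamP (kk w) (kk w').
Proof. exact: (@evalWM R hd S A ac Q qc K gK J nn src tgt gam _ _ kr EPS). Qed.

Let kkA a b (v : A a b) : kk (jA v) = inl (phiP v).
Proof. exact: (@evalWE R hd S A ac Q qc K gK J nn src tgt gam _ _ kr EPS). Qed.

Let kkQ j u v (q : Q u v) : kk (@jQ j u v q) = ext_cell xi q.
Proof. exact: (@evalWE R hd S A ac Q qc K gK J nn src tgt gam _ _ kr EPS). Qed.

Let kk_cont x y : continuous (@kk x y).
Proof. exact: (@evalW_cont R hd S A ac Q qc K gK J nn src tgt gam _ _ kr EPS). Qed.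

Let PW_flow := is_flow_pf jW_flow.

Let jG j u v (q : Q u v) : TOP R I (W (sg _ _ _) (sg _ _ _)) :=
  TOP_mk (comp_cont (@TOP_fun_cont _ _ (mG q)) (@jQ_cont j u v)).

Let jG_cont j u v : continuous (@jG j u v).
Proof.
apply: (path_cont (@QT _ _ _)) => c cc; apply/TOP_contP.
apply: comp_cont (@jQ_cont j u v).
by have /TOP_contP := comp_cont cc (@mG_cont _ _ _ _ (M (nn j)) u v); apply.
Qed.

(** The contraction [mG] applied letter by letter, as a cocone into the flow of paths of W. It
    respects the gluing because [mG] keeps the globe in itself and all of the globe is one edge of
    W. *)
Let hr : @realization S A ac Q qc K gK J nn src tgt gam
    (FlowData (pf_concat jW_flow)) id.
Proof.
apply: (@Realization S A ac Q qc K gK J nn src tgt gam (FlowData (pf_concat jW_flow)) id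
  (fun a b x => cpath (jA x)) jG _ jG_cont).
- by move=> a b; apply: cpath_cont; [exact: AT|exact: jA_cont].
- by move=> a b c x y; apply: TOP_fun_inj; apply/funext => t; exact: iAM.
- move=> j u v w x y; apply: TOP_fun_inj; apply/funext => t.
  apply: etrans (congr1 (@jQ j u w) (mGM x y t)) _; exact: iQM.
- move=> j k; apply: TOP_fun_inj; apply/funext => t.
  have [k' Ek] := mGK k t.
  apply: etrans (congr1 (@jQ j _ _) Ek) _.
  exact: (@iK R hd S A ac Q qc K gK J nn src tgt gam j k').
Defined.

Let hh x y : W x y -> TOP R I (W x y) :=
  @evalW R hd S A ac Q qc K gK J nn src tgt gam _ _ hr x y.

Let hhM x y z (w : W x y) (w' : W y z) t :
  TOP_fun (hh (wc w w')) t = wc (TOP_fun (hh w) t) (TOP_fun (hh w') t).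
Proof.
exact: (congr1 (fun f => TOP_fun f t)
  (@evalWM R hd S A ac Q qc K gK J nn src tgt gam _ _ hr PW_flow _ _ _ w w')).
Qed.

Let hhA a b (v : A a b) t : TOP_fun (hh (jA v)) t = jA v.
Proof.
have e : hh (jA v) = cpath (jA v).
  apply: etrans (@evalWE R hd S A ac Q qc K gK J nn src tgt gam _ _ hr PW_flow _ _ (@wA S A Q J nn src tgt a b v)) _.
  exact: erefl.
by rewrite e.
Qed.

Let hhQ j u v (q : Q u v) t : TOP_fun (hh (@jQ j u v q)) t = @jQ j u v (TOP_fun (mG q) t).
Proof.
exact: (congr1 (fun f => TOP_fun f t)
  (@evalWE R hd S A ac Q qc K gK J nn src tgt gam _ _ hr PW_flow _ _ (wQ _ _ _ q))).
Qed.

Let hh_cont x y : continuous (@hh x y).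
Proof. exact: (@evalW_cont R hd S A ac Q qc K gK J nn src tgt gam _ _ hr PW_flow). Qed.

Let ev t a b (f : PS a b) : WS a b := TOP_fun f t.
Let evS t x y (u : E PS x y) : E WS x y := emap (ev t) u.

Let from_ext_inl a b (v : WS a b) : from_ext (inl v : E WS (Old nn a) (Old nn b)) = v.
Proof. exact: (@eout_old S J nn src tgt WS Wflow id (fun a b w => w) up_cell dn_cell ch_cell). Qed.

Let from_ext_dn j i h :
  from_ext (inr (exist (fun e => kc src tgt (Old nn (src j)) (New S i) e) true h)) = dn_cell (j := j) i.
Proof. exact: (@eout_dn S J nn src tgt WS Wflow id (fun a b w => w) up_cell dn_cell ch_cell). Qed.

Let from_ext_up j i h :
  from_ext (inr (exist (fun e => kc src tgt (New S i) (Old nn (tgt j)) e) true h)) = up_cell (j := j) i.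
Proof. exact: (@eout_up S J nn src tgt WS Wflow id (fun a b w => w) up_cell dn_cell ch_cell). Qed.

Let from_ext_ch x y (h : chain x y) :
  from_ext (inr (exist (fun e => kc src tgt x y e) false h)) = ch_cell h.
Proof. exact: (@eout_ch S J nn src tgt WS Wflow id (fun a b w => w) up_cell dn_cell ch_cell). Qed.

Let ev0_gam j : ev (i0 R) (gamP j) = gam0 j.
Proof. by rewrite /ev /TOP_fun /= slide0. Qed.

Let hh1 x y (w : W x y) : TOP_fun (hh w) (i1 R) = from_ext (evS (i0 R) (kk w)).
Proof.
move: x y w; apply: wpath_ind => [a b v|j u v q|x y z w w' Ew Ew'].
- by rewrite hhA kkA [RHS]from_ext_inl.
- rewrite hhQ kkQ; have qlt := m_lt q.
  case: u v q qlt => [||i] [||i'] // q qlt; try by case: (no_clt_top qlt).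
  + by rewrite [RHS]from_ext_inl mG1 /ev /TOP_fun /= slide0.
  + rewrite [RHS]from_ext_dn; apply: congr1; apply: mG1'; by case.
  + rewrite [RHS]from_ext_up; apply: congr1; apply: mG1'; by case.
  + rewrite [RHS]from_ext_ch (ch_cellE _ qlt); apply: congr1; apply: mG1'; by case.
- rewrite hhM kkM Ew Ew' /evS (emapM (vc' := wS) (gam' := gam0)) ?from_extM //.
Qed.

Let hh0 x y (w : W x y) : TOP_fun (hh w) (i0 R) = w.
Proof.
move: x y w; apply: wpath_ind => [a b v|j u v q|x y z w w' Ew Ew'].
- exact: hhA.
- by rewrite hhQ mG0.
- by rewrite hhM Ew Ew'.
Qed.

Let kk1 x y (w : W x y) : evS (i1 R) (kk w) = emap (fun a b => @jA a b) (to_ext w).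
Proof.
move: x y w; apply: wpath_ind => [a b v|j u v q|x y z w w' Ew Ew'].
- by rewrite kkA to_extA.
- rewrite kkQ to_extQ; have qlt := m_lt q.
  case: u v q qlt => [||i] [||i'] // q qlt; try by case: (no_clt_top qlt).
  by apply: (congr1 inl); rewrite /ev /TOP_fun /= slide1; exact: jmd0.
- rewrite kkM to_extM [in LHS]/evS (emapM (vc' := wS) (gam' := fun j => jmd j (i0 R))) //; last first.
    by move=> j; rewrite /ev /TOP_fun /= slide1.
  rewrite (emapM (vc' := wS) (gam' := fun j => jmd j (i0 R))) //; last first.
    by move=> a b c v v'; exact: iAM.
  rewrite -Ew -Ew'; exact: erefl.
Qed.

Let kc_old a b e : kc src tgt (Old nn a) (Old nn b) e = false.
Proof. by case: e; rewrite //= andbF. Qed.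

Let old_ext a b (u : E A (Old nn a) (Old nn b)) : A a b :=
  match u with
  | inl v => v
  | inr e => False_rect _ (notF (etrans (esym (kc_old a b (val e))) (valP e)))
  end.

Let old_extE a b (u : E A (Old nn a) (Old nn b)) : inl (old_ext u) = u.
Proof. by case: u => [v|[e h]] //; exfalso; rewrite kc_old in h. Qed.

Let fS a b (w : WS a b) : A a b := old_ext (to_ext w).

Let fSE a b (w : WS a b) : inl (fS w) = to_ext w. Proof. exact: old_extE. Qed.

Let inlM a b c (v : A a b) (v' : A b c) : (inl (ac v v') : E A (Old nn a) (Old nn c)) =
  ecomp ac gam (inl v : E A (Old nn a) (Old nn b)) (inl v' : E A (Old nn b) (Old nn c)).
Proof. exact: (@ext_phiM A ac gam (fun a b v => v)). Qed.

Let fSM a b c (w : WS a b) (w' : WS b c) : fS (wS w w') = ac (fS w) (fS w').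
Proof.
apply: (@inl_inj _ (discrete_topology {e : bool | kc src tgt (Old nn a) (Old nn c) e})).
rewrite inlM !fSE; exact: (@to_extM _ _ _ w w').
Qed.

Let fS_md j s : fS (jmd j s) = gam j.
Proof.
apply: (@inl_inj _ (discrete_topology {e : bool | kc src tgt (Old nn (src j)) (Old nn (tgt j)) e})).
rewrite fSE; exact: (@to_extQ j (Bot _) (Top _) (md _ s)).
Qed.

Let fSA a b (v : A a b) : fS (jA v) = v.
Proof.
apply: (@inl_inj _ (discrete_topology {e : bool | kc src tgt (Old nn a) (Old nn b) e})).
by rewrite fSE to_extA.
Qed.

Let fk x y (w : W x y) t : emap fS (evS t (kk w)) = to_ext w.
Proof.
move: x y w; apply: wpath_ind => [a b v|j u v q|x y z w w' Ew Ew'].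
- rewrite kkA to_extA; apply: (congr1 inl); exact: fSA.
- rewrite kkQ to_extQ; have qlt := m_lt q.
  case: u v q qlt => [||i] [||i'] // q qlt; try by case: (no_clt_top qlt).
  by apply: (congr1 inl); exact: fS_md.
- rewrite kkM to_extM /evS (emapM (vc' := wS) (gam' := fun j => ev t (gamP j))) //.
  rewrite (emapM (vc' := ac) (gam' := gam)); first by congr ecomp.
  + exact: fSM.
  + by move=> j; exact: fS_md.
Qed.

Let fh x y (w : W x y) t : to_ext (TOP_fun (hh w) t) = to_ext w.
Proof.
move: x y w; apply: wpath_ind => [a b v|j u v q|x y z w w' Ew Ew'].
- by rewrite hhA.
- rewrite hhQ !to_extQ; have qlt := m_lt q.
  case: u v q qlt => [||i] [||i'] // q qlt; try by case: (no_clt_top qlt).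
  by apply: (congr1 inr); exact: val_inj.
- by rewrite hhM !to_extM Ew Ew'.
Qed.

Let fplus := plus_map (V := W) (V' := fun x y => E A x y) (th := id) to_ext.
Let emul := mul (V := fun x y => E A x y) (fun x y z => ecomp ac gam (x := x) (y := y) (z := z)).

Let fplusM x y z (p : plus (fun x y => W x y) x y) (q : plus _ y z) :
  fplus (mul (fun x y z => wc (x := x) (y := y) (z := z)) p q) = emul (fplus p) (fplus q).
Proof. exact: (plus_mapM (th := id) to_extM). Qed.

Let U (x : X) : plus (fun x y => E A x y) x (Old nn (tx tgt x)) :=
  match x with
  | Old a => pid _ (erefl (Old nn a))
  | New j i => inl (inr (exist (fun e => kc src tgt (New S i) (Old nn (tgt j)) e) true (kc_top i)))
  end.

Let D (x : X) : plus (fun x y => E A x y) (Old nn (sx src x)) x :=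
  match x with
  | Old a => pid _ (erefl (Old nn a))
  | New j i => inl (inr (exist (fun e => kc src tgt (Old nn (src j)) (New S i) e) true (kc_bot i)))
  end.

Let fU x : fplus (@upp S J nn tgt Wflow id up_cell x) = U x.
Proof.
case: x => [a|j i]; first by apply: etrans (plus_map_pid _ _) _; congr pid; exact: Prop_irrelevance.
by apply: (congr1 inl); exact: (@to_extQ j (In i) (Top _) (mc (M _) (ltn_ord i : clt (In i) (Top _)))).
Qed.

Let fD x : fplus (@dnp S J nn src Wflow id dn_cell x) = D x.
Proof.
case: x => [a|j i]; first by apply: etrans (plus_map_pid _ _) _; congr pid; exact: Prop_irrelevance.
by apply: (congr1 inl); exact: (@to_extQ j (Bot _) (In i) (mc (M _) (erefl true : clt (Bot _) (In i)))).
Qed.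

Let midU (x y : X) (v : A (tx tgt x) (sx src y)) :
  emul (emul (U x) (inl (inl v : E A (Old nn _) (Old nn _)))) (D y) = inl (inl v : E A x y).
Proof.
have UU : emul (U x) (inl (inl v : E A (Old nn _) (Old nn _))) =
    inl (inl v : E A x (Old nn (sx src y))).
  case: x v => [a|j i] v; first exact: mul1p.
  apply: etrans (mulll _ _ _) _; apply: (congr1 inl); apply: emb_inj; rewrite emb_comp.
  by apply: (congr1 inl); rewrite /= mul1p mul1p.
rewrite UU; case: y v {UU} => [a|j i] v; first exact: mulp1.
apply: etrans (mulll _ _ _) _; apply: (congr1 inl); apply: emb_inj; rewrite emb_comp.
by apply: (congr1 inl); rewrite /= mulp1 mulp1.
Qed.

Let id_comp (x y : X) b c (e : Old nn b = Old nn c) (hx : kc src tgt x (Old nn b) true)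
    (hy : kc src tgt (Old nn c) y true) (h : kc src tgt x y true) :
  emul (emul (inl (inr (exist (fun e => kc src tgt x (Old nn b) e) true hx))) (pid _ e))
    (inl (inr (exist (fun e => kc src tgt (Old nn c) y e) true hy))) =
  inl (inr (exist (fun e => kc src tgt x y e) true h)).
Proof.
have e' : b = c by case: e.
subst c; rewrite [X in emul X](@mulp1 _ _ _ _ _ _ _).
apply: etrans (mulll _ _ _) _; apply: (congr1 inl); apply: emb_inj; rewrite emb_comp.
apply: (congr1 inl); apply: etrans (congr1 (fun z => mul _ z _) (@mulp1 _ _ _ _ _ _ _)) _.
exact: mul_pid.
Qed.

Let midE (x y : X) (e : Old nn (tx tgt x) = Old nn (sx src y)) (h : kc src tgt x y true) :
  emul (emul (U x) (pid _ e)) (D y) = inl (inr (exist (fun e => kc src tgt x y e) true h)).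
Proof.
case: x y e h => [a|j i] [b|j' i'] e h; first by exfalso; rewrite kc_old in h.
- have e' : a = src j' by case: e.
  subst a; rewrite /emul mul1p mul1p.
  by apply: (congr1 inl); congr inr; exact: val_inj.
- have e' : tgt j = b by case: e.
  subst b; rewrite /emul mulp1 mulp1.
  by apply: (congr1 inl); congr inr; exact: val_inj.
- exact: id_comp.
Qed.

(** This makes [ss] a section of [to_ext], and with [fk] it keeps the sliding inside the fibres of
    [to_ext]. *)
Let f_from_ext x y (u : E WS x y) : to_ext (from_ext u) = emap fS u.
Proof.
apply: (@inl_inj _ (discrete_topology {_ : unit | `[< x = y >]})).
have E1 : inl (to_ext (from_ext u)) = fplus (inl (from_ext u)) by [].
rewrite E1 [X in fplus X](@eoutE S J nn src tgt WS Wflow id (fun a b w => w) up_cell dn_cell ch_cell).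
case: u {E1} => [v|[[] h]].
- by rewrite /eoutp /emb !fplusM fU fD [fplus (plus_map _ _)]/fplus /= -fSE; exact: midU.
- rewrite /eoutp /emb !fplusM fU fD plus_map_pid [fplus (pid _ _)]plus_map_pid; exact: midE.
- rewrite /eoutp /emb; apply: (congr1 inl).
  case: x y h => [a|j i] [b|j' i'] // h; have [/asboolP e l] := andP h; subst j'.
  rewrite (ch_cellE _ l); apply: etrans (@to_extQ j (In i) (In i') (mc (M _) (l : clt (In i) (In i')))) _.
  by apply: (congr1 inr); exact: val_inj.
Qed.

Let ss x y (u : E A x y) : W x y := from_ext (emap (fun a b => @jA a b) u).

Let ss_cont x y : continuous (@ss x y).
Proof.
apply: comp_cont (@from_ext_cont x y); apply: emap_cont => a b; exact: jA_cont.
Qed.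

(* Every word is first contracted by [mG] to its normal form, and the globes of
   the normal form are then slid along [md] back to the original edges. *)
Let HH x y (w : W x y) (t : I) : W x y :=
  concat (TOP_fun (hh w)) (fun s => from_ext (evS s (kk w))) t.

Let f_HH x y (w : W x y) t : to_ext (HH w t) = to_ext w.
Proof. by rewrite /HH /concat; case: ifP => _; rewrite ?fh // f_from_ext fk. Qed.

Lemma to_ext_weq x y : weak_homotopy_equivalence R (@to_ext x y).
Proof.
apply: (@fibrewise_weq R _ _ (@to_ext x y) (@ss x y) (@HH x y)).
- exact: to_ext_cont.
- exact: ss_cont.
- move=> u; rewrite /ss f_from_ext; case: u => [v|e] //.
  by apply: (congr1 inl); exact: fSA.
- move=> c cc.
  apply: (@concat_cont R I (W x y) (fun r => TOP_fun (hh (c r)))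
    (fun r s => from_ext (evS s (kk (c r))))).
  + by have /TOP_contP := comp_cont cc (@hh_cont x y).
  + have ckc := comp_cont cc (@kk_cont x y).
    have [[v cv Ev]|[e Ee]] := path_epath ckc; last first.
      rewrite (_ : (fun _ => _) = fun=> from_ext (inr e)); first exact: cst_cont.
      apply/funext => -[r s] /=.
      by rewrite [kk _](congr1 (fun f => f r) Ee).
    rewrite (_ : (fun _ => _) = fun z => from_ext (inl (TOP_fun (v z.1) z.2))); last first.
      by apply/funext => -[r s] /=; rewrite [kk _](congr1 (fun f => f r) Ev).
    apply: comp_cont (@from_ext_cont x y); apply: comp_cont (@inl_cont _ _).
    by apply/TOP_contP.
  + by move=> r; rewrite hh1.
- by move=> w; rewrite /HH concat0 hh0.
- by move=> w; rewrite /HH concat1 kk1.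
- exact: f_HH.
Qed.

Lemma to_ext_flow_weq : flow_weq R to_ext_map.
Proof. by split=> [|x y]; [exists id|exact: to_ext_weq]. Qed.

End ExtRealization.

(** * Execution paths of a subdivision *)

Section Runs.
Variable R : realType.
Local Notation I := (@unitI R).
Variable T : Type.
Implicit Types (g h m l : I -> T) (b c d s t u v w : I).

Definition seg g b c : I -> T := fun t => g (cl (val b + val t * (val c - val b))).

Lemma seg01 g : seg g (i0 R) (i1 R) = g.
Proof.
apply/funext => t; rewrite /seg (erefl : val (i0 R) = 0) (erefl : val (i1 R) = 1).
by rewrite subr0 mulr1 add0r clK.
Qed.

Lemma seg_at0 g b c : seg g b c (i0 R) = g b.
Proof. by rewrite /seg (erefl : val (i0 R) = 0) mul0r addr0 clK. Qed.

Lemma seg_at1 g b c : seg g b c (i1 R) = g c.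
Proof. by rewrite /seg (erefl : val (i1 R) = 1) mul1r addrC subrK clK. Qed.

Lemma val_seg b c t : val b <= val c ->
  val (cl (val b + val t * (val c - val b))) = val b + val t * (val c - val b).
Proof.
move=> bc; have t0 := I_ge0 t; have t1 := I_le1 t; have b0 := I_ge0 b; have c1 := I_le1 c.
by rewrite val_cl //; nra.
Qed.

Lemma seg_inv b c s : val b < val c -> val b <= val s -> val s <= val c ->
  cl (val b + val (cl ((val s - val b) / (val c - val b))) * (val c - val b)) = s.
Proof.
move=> bc bs sc; have d : 0 < val c - val b by rewrite subr_gt0.
rewrite val_cl; last by rewrite ler_pdivrMr // mul1r lerD2r.
  by rewrite divfK ?gt_eqF // addrC subrK clK.
by rewrite divr_ge0 ?subr_ge0 // ltW.
Qed.

(** On [[b,c]] the path [g] follows [m] from [v] to [v'], monotonically and onto, possibly with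
    pauses. The map [phi] is constrained on [[b,c]] only, and [b = c] is allowed; this makes runs
    easy to concatenate. *)
Definition run m g v v' b c := val b <= val c /\ exists phi : I -> I,
  [/\ forall s t, val b <= val s -> val s <= val t -> val t <= val c ->
        val (phi s) <= val (phi t),
      phi b = v, phi c = v',
      forall w, val v <= val w -> val w <= val v' ->
        exists s, [/\ val b <= val s, val s <= val c & phi s = w]
    & forall s, val b <= val s -> val s <= val c -> g s = m (phi s)].

Lemma run_refl m g v b : g b = m v -> run m g v v b b.
Proof.
move=> e; split=> //; exists (fun=> v); split=> // [w vw wv|s bs sb].
  by exists b; split=> //; apply/val_inj/le_anti; rewrite vw wv.
by have -> : s = b by apply/val_inj/le_anti; rewrite bs sb.
Qed.

Lemma run_ends m g v v' b c : run m g v v' b c ->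
  [/\ val b <= val c, val v <= val v', g b = m v & g c = m v'].
Proof.
move=> [bc [phi [pm <- <- _ pg]]]; split=> //; first exact: pm.
- exact: pg.
- exact: pg.
Qed.

Lemma run_at m g v v' b c s : run m g v v' b c -> val b <= val s -> val s <= val c ->
  exists w, [/\ val v <= val w, val w <= val v' & g s = m w].
Proof.
move=> [bc [phi [pm <- <- _ pg]]] bs sc; exists (phi s); split.
- exact: pm.
- exact: pm.
- exact: pg.
Qed.

Lemma run_at2 m g v v' b c s t : run m g v v' b c -> val b <= val s -> val s <= val t ->
  val t <= val c ->
  exists w w', [/\ val v <= val w, val w <= val w', val w' <= val v', g s = m w & g t = m w'].
Proof.
move=> [bc [phi [pm <- <- _ pg]]] bs st tc; exists (phi s), (phi t); split.
- by apply: pm => //; exact: le_trans st tc.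
- exact: pm.
- by apply: pm => //; exact: le_trans bs st.
- by apply: pg => //; exact: le_trans st tc.
- by apply: pg => //; exact: le_trans bs st.
Qed.

Lemma run_cat m g v v' v'' b c d : run m g v v' b c -> run m g v' v'' c d ->
  run m g v v'' b d.
Proof.
move=> [bc [p [pm pb pc ps pg]]] [cd [q [qm qc qd qs qg]]]; split; first exact: le_trans bc cd.
exists (fun s => if val s <= val c then p s else q s); split.
- move=> s t bs st td; case: ifP => sc; case: ifP => tc.
  + exact: pm.
  + move/negbT: tc; rewrite -ltNge => tc.
    apply: (@le_trans _ _ (val v')); first by rewrite -pc; exact: pm.
    by rewrite -qc; apply: qm => //; exact: ltW.
  + by move: sc; rewrite (le_trans st tc).
  + by move/negbT: sc; rewrite -ltNge => /ltW sc; exact: qm.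
- by rewrite bc.
- case: ifP => // dc; have e : d = c by apply/val_inj/le_anti; rewrite dc cd.
  by rewrite -qd e pc qc.
- move=> w vw wv; case: (leP (val w) (val v')) => wv'.
    have [s [bs sc e]] := ps w vw wv'; exists s; split=> //; first exact: le_trans sc cd.
    by rewrite sc.
  have [s [cs sd e]] := qs w (ltW wv') wv; exists s; split=> //; first exact: le_trans bc cs.
  case: ifP => // sc; have E : s = c by apply/val_inj/le_anti; rewrite sc cs.
  by move: wv'; rewrite -e E qc ltxx.
- move=> s bs sd; case: ifP => sc; first exact: pg.
  by move/negbT: sc; rewrite -ltNge => /ltW sc; exact: qg.
Qed.

Lemma run_seg m g v v' b c : run m g v v' b c -> val v < val v' ->
  val b < val c /\ exists2 chi, reparam chi & seg g b c = seg m v v' \o chi.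
Proof.
move=> [bc [p [pm pb pc ps pg]]] vv'.
have bc' : val b < val c.
  rewrite lt_neqAle bc andbT; apply/eqP => /val_inj e.
  by move: vv'; rewrite -pb -pc e ltxx.
split=> //; have dv : 0 < val v' - val v by rewrite subr_gt0.
pose a t : I := cl (val b + val t * (val c - val b)).
have ab t : val b <= val (a t) <= val c.
  have t0 := I_ge0 t; have t1 := I_le1 t; rewrite val_seg //; apply/andP; split; nra.
have am s t : val s <= val t -> val (a s) <= val (a t).
  by move=> st; rewrite !val_seg //; nra.
have pv t : val v <= val (p (a t)) <= val v'.
  have /andP[h1 h2] := ab t; rewrite -pb -pc; apply/andP; split; exact: pm.
pose chi t : I := cl ((val (p (a t)) - val v) / (val v' - val v)).
have chiE t : val (chi t) = (val (p (a t)) - val v) / (val v' - val v).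
  have /andP[h1 h2] := pv t; rewrite val_cl ?divr_ge0 ?subr_ge0 ?(ltW vv') //.
  by rewrite ler_pdivrMr // mul1r lerD2r.
exists chi.
  split=> [s t st|].
    rewrite !chiE ler_pM2r ?invr_gt0 // lerD2r; apply: pm; last by case/andP: (ab t).
      by case/andP: (ab s).
    exact: am.
  apply/seteqP; split=> // y _.
  have y0 := I_ge0 y; have y1 := I_le1 y.
  have wE := val_seg y (ltW vv').
  have [||s [bs sc e]] := ps (cl (val v + val y * (val v' - val v))); rewrite ?wE; try nra.
  exists (cl ((val s - val b) / (val c - val b))) => //.
  rewrite /chi /a seg_inv // e wE.
  by rewrite (addrC (val v)) addrK mulfK ?gt_eqF // clK.
apply/funext => t; have /andP[h1 h2] := pv t; have /andP[h3 h4] := ab t.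
rewrite /seg /comp pg // chiE divfK ?gt_eqF // (addrC (val v)) subrK clK.
by [].
Qed.

Lemma run_line_seg m g b c : run m g (i0 R) (i1 R) b c ->
  val b < val c /\ exists2 chi, reparam chi & seg g b c = m \o chi.
Proof. by move=> /run_seg; rewrite seg01; apply; exact: ltr01. Qed.

Variable L : set (I -> T).

(** The tree of [gen_paths] flattened into consecutive runs along complete lines, up to a given
    time. It allows induction along time, which the concatenations do not. *)
Inductive tr g : I -> Prop :=
| tr0 : tr g (i0 R)
| trS b c m : tr g b -> L m -> run m g (i0 R) (i1 R) b c -> tr g c.

(** The reparametrization may pause at 0 before the first line, and the base case records only time
    0; the last hypothesis lets that pause be absorbed into the first run. *)
Lemma tr_reparam g (phi : I -> I) c c' : reparam phi -> tr g c -> phi c' = c ->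
  (c = i0 R -> c' = i0 R) -> tr (g \o phi) c'.
Proof.
move=> rphi tc; elim: tc c' => {c} [|b c m _ IH Lm rm] c' ec; first by move=> /(_ erefl) ->; constructor.
move=> _; have [bc [p [pm pb pc ps pg]]] := rm.
have [b' eb b0] : exists2 b', phi b' = b & b = i0 R -> b' = i0 R.
  have [->|bn] := pselect (b = i0 R); first by exists (i0 R) => //; exact: reparam0.
  by have [b' eb] := reparam_surj rphi b; exists b'.
have [hp _] := rphi.
have bc' : val b' < val c'.
  rewrite ltNge; apply/negP => /hp; rewrite ec eb => cb.
  have e : b = c by apply/val_inj/le_anti; rewrite bc cb.
  have := pc; rewrite -e pb => /(congr1 val) /= h.
  by have := @ltr01 R; rewrite h ltxx.
apply: (trS (b := b') (m := m)) => //; first exact: IH.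
split; first exact: ltW.
exists (fun s => p (phi s)); split.
- by move=> s t bs st tc; apply: pm; rewrite -?eb -?ec; exact: hp.
- by rewrite eb.
- by rewrite ec.
- move=> w w0 w1; have [s [bs sc e]] := ps w w0 w1.
  have [s' es] := reparam_surj rphi s.
  have [sb|sb] := leP (val s') (val b').
    exists b'; split=> //; first exact: ltW.
    rewrite -e; congr p; rewrite eb; apply/val_inj/le_anti; rewrite bs /=.
    by rewrite -es -eb; exact: hp.
  have [sc'|sc'] := leP (val s') (val c'); first by exists s'; rewrite es; split=> //; exact: ltW.
  exists c'; split=> //; first exact: ltW.
  rewrite -e; congr p; rewrite ec; apply/val_inj/le_anti; rewrite sc andbT.
  by rewrite -es -ec; apply: hp; exact: ltW.
- by move=> s bs sc; apply: pg; rewrite -?eb -?ec; exact: hp.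
Qed.

Lemma run_id m b c : val b <= val c -> run m m b c b c.
Proof. by move=> bc; split=> //; exists id; split=> // w w0 w1; exists w. Qed.

Lemma run_affine m g h v v' b c b' c' (al be : R) : 0 < al ->
  val b' = al * val b + be -> val c' = al * val c + be ->
  (forall s, val b <= val s -> val s <= val c -> h (cl (al * val s + be)) = g s) ->
  run m g v v' b c -> run m h v v' b' c'.
Proof.
move=> al0 eb ec E [bc [p [pm pb pc ps pg]]].
have b0 := I_ge0 b; have c1 := I_le1 c; have b'0 := I_ge0 b'; have c'1 := I_le1 c'.
pose r (s : I) : I := cl ((val s - be) / al).
have rE s : val b' <= val s -> val s <= val c' -> val (r s) = (val s - be) / al.
  move=> bs sc; rewrite val_cl //.
    rewrite ler_pdivlMr // mul0r; nra.
  rewrite ler_pdivrMr //; nra.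
have rb s : val b' <= val s -> val s <= val c' -> val b <= val (r s) <= val c.
  by move=> bs sc; rewrite rE // ler_pdivlMr // ler_pdivrMr //; apply/andP; split; nra.
have rK s : val b' <= val s -> val s <= val c' -> cl (al * val (r s) + be) = s.
  by move=> bs sc; rewrite rE // mulrCA mulfV ?gt_eqF // mulr1 subrK clK.
have rbE : r b' = b by rewrite /r eb addrK mulrC mulKf ?gt_eqF // clK.
have rcE : r c' = c by rewrite /r ec addrK mulrC mulKf ?gt_eqF // clK.
split; first by rewrite eb ec; nra.
exists (fun s => p (r s)); split.
- move=> s t bs st tc.
  have sc := le_trans st tc; have bt := le_trans bs st.
  have /andP[h1 h2] := rb s bs sc; have /andP[h3 h4] := rb t bt tc.
  by apply: pm => //; rewrite !rE // ler_pM2r ?invr_gt0 // lerD2r.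
- by rewrite rbE.
- by rewrite rcE.
- move=> w vw wv; have [s [bs sc e]] := ps w vw wv.
  have s0 := I_ge0 s; have s1 := I_le1 s.
  have sE : val (cl (al * val s + be)) = al * val s + be by rewrite val_cl //; nra.
  exists (cl (al * val s + be)); rewrite sE; split; [rewrite eb; nra|rewrite ec; nra|].
  by rewrite /r sE addrK mulrC mulKf ?gt_eqF // clK.
- move=> s bs sc; have /andP[h1 h2] := rb s bs sc.
  by rewrite -pg // -E // rK.
Qed.

(** Up to an affine change of time each piece of [g] is a run along one half of the concatenation;
    the two runs are then joined. *)
Lemma concat_seg g b c d : val b < val c -> val c < val d ->
  exists2 chi, reparam chi & seg g b d = concat (seg g b c) (seg g c d) \o chi.
Proof.
move=> bc' cd'.
pose m := concat (seg g b c) (seg g c d).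
have d1 : 0 < val c - val b by rewrite subr_gt0.
have d2 : 0 < val d - val c by rewrite subr_gt0.
have half : val (cl 2^-1 : I) = 2^-1 by rewrite val_cl; lra.
have r1 : run m g (i0 R) (cl 2^-1) b c.
  apply: (run_affine (g := m) (al := 2 * (val c - val b)) (be := val b) _ _ _ _
    (run_id m (b := i0 R) (c := cl 2^-1) (I_ge0 _))).
  - by rewrite mulr_gt0.
  - by rewrite (erefl : val (i0 R) = 0) mulr0 add0r.
  - rewrite half; lra.
  - move=> s _ s1; have s0 := I_ge0 s; rewrite half in s1; rewrite /m concatE s1 /seg val_cl; [|lra..].
    by congr (g (cl _)); lra.
have r2 : run m g (cl 2^-1) (i1 R) c d.
  apply: (run_affine (g := m) (al := 2 * (val d - val c)) (be := val c - (val d - val c)) _ _ _ _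
    (run_id m (b := cl 2^-1) (c := i1 R) (I_le1 _))).
  - by rewrite mulr_gt0.
  - rewrite half; lra.
  - rewrite (erefl : val (i1 R) = 1); lra.
  - move=> s; rewrite half (erefl : val (i1 R) = 1) => s0 s1; rewrite /m concatE; case: ifP => h.
      have e : val s = 2^-1 by apply/le_anti; rewrite h.
      rewrite [X in seg _ _ _ X]cl_ge1; last by rewrite e; lra.
      by rewrite seg_at1 e -[in RHS](clK c); congr (g (cl _)); lra.
    by rewrite /seg val_cl; [congr (g (cl _))|..]; lra.
have [_ [chi rchi ->]] := run_line_seg (run_cat r1 r2).
by exists chi.
Qed.

Lemma run_of_seg m b c : val b < val c -> run m (seg m b c) b c (i0 R) (i1 R).
Proof.
move=> bc; have d : 0 < val c - val b by rewrite subr_gt0.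
apply: (run_affine (g := m) (al := (val c - val b)^-1) (be := - val b / (val c - val b)) _ _ _ _
  (run_id m (ltW bc))).
- by rewrite invr_gt0.
- by rewrite mulrC -mulrDl subrr mul0r.
- by rewrite mulrC -mulrDl mulfV // gt_eqF.
- by move=> s bs sc; rewrite mulrC -mulrDl /seg seg_inv.
Qed.

Lemma concat_left g h s : concat g h (cl (2^-1 * val s + 0)) = g s.
Proof.
have s0 := I_ge0 s; have s1 := I_le1 s.
by rewrite concatE addr0 val_cl ?ifT ?mulrA ?mulfV ?mul1r ?clK //; lra.
Qed.

Lemma concat_right g h s : g (i1 R) = h (i0 R) -> concat g h (cl (2^-1 * val s + 2^-1)) = h s.
Proof.
move=> gh; have s0 := I_ge0 s; have s1 := I_le1 s.
rewrite concatE val_cl; [|lra..].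
have e : 2 * (2^-1 * val s + 2^-1) = val s + 1 by lra.
rewrite e addrK clK; case: ifP => // hs.
have -> : s = i0 R by apply/val_inj; rewrite (erefl : val (i0 R) = 0); lra.
by rewrite -gh cl_ge1 // (erefl : val (i0 R) = 0) add0r.
Qed.

Lemma tr_left g h c c' : val c' = 2^-1 * val c + 0 -> tr g c -> tr (concat g h) c'.
Proof.
move=> ec tc; elim: tc c' ec => {c} [|b c m _ IH Lm rm] c' ec.
  have -> : c' = i0 R; last by constructor.
  by apply/val_inj; rewrite ec (erefl : val (i0 R) = 0) mulr0 addr0.
have b0 := I_ge0 b; have b1 := I_le1 b.
have eb : val (cl (2^-1 * val b + 0)) = 2^-1 * val b + 0 by rewrite val_cl //; lra.
apply: (trS (IH _ eb) Lm).
apply: (run_affine (g := g) _ eb ec _ rm); first by rewrite invr_gt0.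
by move=> s _ _; exact: concat_left.
Qed.

Lemma tr_right g h c c' : tr g (i1 R) -> g (i1 R) = h (i0 R) ->
  val c' = 2^-1 * val c + 2^-1 -> tr h c -> tr (concat g h) c'.
Proof.
move=> tg gh ec tc; elim: tc c' ec => {c} [|b c m _ IH Lm rm] c' ec.
  apply: (@tr_left g h (i1 R) c') => //.
  by rewrite ec (erefl : val (i0 R) = 0) (erefl : val (i1 R) = 1); lra.
have b0 := I_ge0 b; have b1 := I_le1 b.
have eb : val (cl (2^-1 * val b + 2^-1)) = 2^-1 * val b + 2^-1 by rewrite val_cl //; lra.
apply: (trS (IH _ eb) Lm).
apply: (run_affine (g := h) _ eb ec _ rm); first by rewrite invr_gt0.
by move=> s _ _; exact: concat_right.
Qed.

Lemma run_const m g v b c : val b <= val c ->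
  (forall s, val b <= val s -> val s <= val c -> g s = m v) -> run m g v v b c.
Proof.
move=> bc H; split=> //; exists (fun=> v); split=> // w vw wv; exists b; split=> //.
by apply/val_inj/le_anti; rewrite vw wv.
Qed.

Lemma gen_paths_tr g : gen_paths L g -> tr g (i1 R).
Proof.
elim=> {g} [l Ll|g phi _ IH rphi|g h _ IHg _ IHh gh].
- apply: (trS (tr0 l) Ll); split; first exact: ler01.
  by exists id; split=> // w w0 w1; exists w; split.
- apply: (tr_reparam rphi IH); first exact: reparam1.
  by move=> /(congr1 val) /= h; have := @ltr01 R; rewrite h ltxx.
- by apply: (tr_right IHg gh _ IHh) => /=; lra.
Qed.

End Runs.

(** * The lines of X and the lines of its subdivision Y *)

Section TwoLineStructures.
Variable R : realType.
Local Notation I := (@unitI R).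
Variable T : choiceType.
Variables (SX SY : set T) (EX LX LY : set (I -> T)).
Implicit Types (g h m l : I -> T) (b c d s t u v w : I).
Hypotheses (SXY : SX `<=` SY)
  (LXin : forall l t, LX l -> 0 < val t < 1 -> ~ SX (l t))
  (LXend : forall l, LX l -> SX (l (i0 R)) /\ SX (l (i1 R)))
  (LXcov : forall p, ~ SX p -> exists l t, [/\ LX l, 0 < val t < 1 & l t = p])
  (LXuniq : forall l l' t t', LX l -> LX l' -> 0 < val t < 1 -> 0 < val t' < 1 ->
    l t = l' t' -> l = l' /\ t = t')
  (LXE : LX `<=` EX) (EXr : forall g phi, EX g -> reparam phi -> EX (g \o phi))
  (EXc : forall g h, EX g -> EX h -> g (i1 R) = h (i0 R) -> EX (concat g h))
  (LXY : forall l, LX l -> gen_paths LY l)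
  (LYin : forall l t, LY l -> 0 < val t < 1 -> ~ SY (l t))
  (LYend : forall l, LY l -> SY (l (i0 R)) /\ SY (l (i1 R)))
  (LYuniq : forall l l' t t', LY l -> LY l' -> 0 < val t < 1 -> 0 < val t' < 1 ->
    l t = l' t' -> l = l' /\ t = t').

Lemma I_cases w : [\/ w = i0 R, w = i1 R | 0 < val w < 1].
Proof.
have [w0|w0] := leP (val w) 0.
  by constructor 1; apply/val_inj/le_anti; rewrite w0 I_ge0.
have [w1|w1] := leP 1 (val w); last by constructor 3; apply/andP.
by constructor 2; apply/val_inj/le_anti; rewrite w1 I_le1.
Qed.

Lemma LY_state m w : LY m -> SY (m w) -> w = i0 R \/ w = i1 R.
Proof. by move=> Lm; case: (I_cases w) => [->|->|h] Sm; [left|right|case: (LYin Lm h)]. Qed.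

(** Each line adds at most its two end states. The list is one of points and not of times, since the
    path may wait at a state. *)
Lemma tr_states g c : tr LY g c ->
  exists ps : seq T, forall s, val s <= val c -> SY (g s) -> g s \in ps.
Proof.
elim=> {c} [|b c m _ [ps IH] Lm rm].
  exists [:: g (i0 R)] => s s0 _; rewrite inE; apply/eqP; congr g.
  by apply/val_inj/le_anti; rewrite s0 I_ge0.
exists [:: m (i0 R), m (i1 R) & ps] => s sc Sg; rewrite !inE.
have [sb|bs] := leP (val s) (val b); first by rewrite IH // !orbT.
have [w [_ _ e]] := run_at rm (ltW bs) sc.
by move: Sg; rewrite e => /(LY_state Lm) [->|->]; rewrite eqxx ?orbT.
Qed.

Lemma LX_inj l s t : LX l -> l s = l t -> 0 < val s < 1 -> s = t.
Proof.
move=> Ll e hs; case: (I_cases t) => [et|et|ht]; last by have [] := LXuniq Ll Ll hs ht e.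
  by have := LXin Ll hs; rewrite e et; case: (LXend Ll).
by have := LXin Ll hs; rewrite e et; case: (LXend Ll).
Qed.

(** A line of X does not return to an interior point, so its finitely many states of Y are met at
    finitely many interior times. *)
Lemma positions l : LX l -> exists s : seq R, sorted <%R s /\
  forall x, x \in s <-> exists t : I, [/\ val t = x, 0 < val t < 1 & SY (l t)].
Proof.
move=> Ll; have [ps Hps] := tr_states (gen_paths_tr (LXY Ll)).
pose P t := 0 < val t < 1 /\ SY (l t).
have [ts Hts] : exists ts : seq R, forall t, P t -> val t \in ts.
  have : forall qs : seq T, exists ts : seq R, forall t, P t -> l t \in qs -> val t \in ts.
    elim=> [|q qs [ts IH]]; first by exists [::].
    have [[t0 [Pt0 e0]]|no] := pselect (exists t0, P t0 /\ l t0 = q); last first.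
      exists ts => t Pt; rewrite inE => /orP[/eqP e|]; last exact: IH.
      by case: no; exists t.
    exists (val t0 :: ts) => t Pt; rewrite !inE => /orP[/eqP e|/(IH _ Pt) ->]; last by rewrite orbT.
    by rewrite (LX_inj Ll (etrans e (esym e0)) Pt.1) eqxx.
  move=> /(_ ps)[ts H]; exists ts => t Pt; apply: H => //; apply: Hps; last exact: Pt.2.
  exact: I_le1.
exists (sort <=%R (undup [seq x <- ts | `[< exists t : I, [/\ val t = x, 0 < val t < 1 & SY (l t)] >]])).
split; first by rewrite sort_lt_sorted undup_uniq.
move=> x; rewrite mem_sort mem_undup mem_filter; split=> [/andP[/asboolP]|] //.
move=> [t [e h Sl]]; apply/andP; split; first by apply/asboolP; exists t.
by rewrite -e; exact: Hts.
Qed.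

Lemma tr_point g c m t t0 : tr LY g c -> LY m -> 0 < val t0 < 1 -> val t <= val c ->
  SY (g (i0 R)) -> g t = m t0 ->
  exists b c, [/\ run m g (i0 R) (i1 R) b c, val b <= val t & val t <= val c].
Proof.
move=> tg Lm h0 tc Sg e; elim: tg tc => {c} [|b c m' _ IH Lm' rm'] tc.
  have et : t = i0 R by apply/val_inj/le_anti; rewrite tc I_ge0.
  by case: (LYin Lm h0); rewrite -e et.
have [tb|bt] := leP (val t) (val b); first exact: IH.
have [w [_ _ ew]] := run_at rm' (ltW bt) tc.
have hw : 0 < val w < 1.
  case: (I_cases w) => // E; case: (LYin Lm h0); rewrite -e ew E; by case: (LYend Lm').
have [E _] := LYuniq Lm' Lm hw h0 (etrans (esym ew) e); subst m'.
by exists b, c; split=> //; exact: ltW.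
Qed.

(** The midpoint of [m] is not a state of X, so it lies on a line [l] of X; as [l] is made of lines
    of Y, it runs through the whole of [m] on some [[u,u']]. Since [l] is injective there, this run
    can be inverted, and following [m] amounts to following [l] from [u] to [u']. *)
Lemma sub_line m : LY m -> exists l u u', [/\ LX l, val u < val u' &
  forall g b c, run m g (i0 R) (i1 R) b c -> run l g u u' b c].
Proof.
move=> Lm; pose t0 : I := cl 2^-1.
have h0 : 0 < val t0 < 1 by rewrite val_cl; [apply/andP; split|..]; lra.
have nS : ~ SX (m t0) by move=> /SXY; exact: LYin.
have [l [t [Ll ht e]]] := LXcov nS.
have [Sl0 Sl1] := LXend Ll.
have [||u [u' [rl _ _]]] := tr_point (gen_paths_tr (LXY Ll)) Lm h0 _ _ e.
- exact: I_le1.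
- exact: SXY.
have [uu _] := run_line_seg rl.
exists l, u, u'; split=> // g b c [bc [q [qm qb qc qs qg]]].
have [_ [p [pm pu pu' ps pl]]] := rl.
have pinj s s' : val u <= val s -> val s <= val u' -> val u <= val s' -> val s' <= val u' ->
    p s = p s' -> s = s'.
  move=> us su us' su' es.
  have el : l s = l s' by rewrite !pl // es.
  case: (I_cases s) (I_cases s') => [e1|e1|h1] [e2|e2|h2]; try by [rewrite e1 e2];
    try by [exact: (LX_inj Ll el h1)|symmetry; exact: (LX_inj Ll (esym el) h2)].
  - have e3 : u = s by apply/val_inj/le_anti; rewrite us e1 I_ge0.
    have e4 : u' = s' by apply/val_inj/le_anti; rewrite su' e2 I_le1.
    by move: es; rewrite -e3 -e4 pu pu' => /(congr1 val) /= h; have := @ltr01 R; rewrite h ltxx.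
  - have e3 : u = s' by apply/val_inj/le_anti; rewrite us' e2 I_ge0.
    have e4 : u' = s by apply/val_inj/le_anti; rewrite su e1 I_le1.
    by move: es; rewrite -e3 -e4 pu pu' => /(congr1 val) /= h; have := @ltr01 R; rewrite h ltxx.
have ex s : exists w, [/\ val u <= val w, val w <= val u' & p w = q s].
  by apply: ps; [exact: I_ge0|exact: I_le1].
pose z s := projT1 (cid (ex s)).
have zP s : [/\ val u <= val (z s), val (z s) <= val u' & p (z s) = q s] by exact: projT2 (cid (ex s)).
split=> //; exists z; split.
- move=> s t' bs st tc; rewrite leNgt; apply/negP => h.
  have [z1 z2 z3] := zP s; have [z4 z5 z6] := zP t'.
  have e1 : p (z s) = p (z t').
    apply/val_inj/le_anti/andP; split; first by rewrite z3 z6; exact: qm.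
    by apply: pm => //; exact: ltW.
  by move: h; rewrite (pinj _ _ z1 z2 z4 z5 e1) ltxx.
- have [z1 z2 z3] := zP b; apply: pinj => //; first exact: ltW.
  by rewrite z3 qb pu.
- have [z1 z2 z3] := zP c; apply: pinj => //; first exact: ltW.
  by rewrite z3 qc pu'.
- move=> w uw wu; have [s [bs sc es]] := qs (p w) (I_ge0 _) (I_le1 _).
  exists s; split=> //; have [z1 z2 z3] := zP s.
  by apply: pinj => //; rewrite z3.
- by move=> s bs sc; have [z1 z2 z3] := zP s; rewrite pl // z3 qg.
Qed.

Definition xseg g b c := val b <= val c /\ (b = c \/ (val b < val c /\ EX (seg g b c))).

Lemma xseg_refl g b : xseg g b b. Proof. by split=> //; left. Qed.

Lemma xseg_line l g b c : LX l -> run l g (i0 R) (i1 R) b c -> xseg g b c.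
Proof.
move=> Ll /run_line_seg[bc [chi rchi E]]; split; first exact: ltW.
by right; split=> //; rewrite E; apply: EXr => //; exact: LXE.
Qed.

Lemma xseg_cat g b c d : xseg g b c -> xseg g c d -> xseg g b d.
Proof.
case=> bc [->|[bc' E1]] //; case=> cd [<-|[cd' E2]]; first by split=> //; right.
have bd := lt_trans bc' cd'; split; [exact: ltW|right; split=> //].
have Em : EX (concat (seg g b c) (seg g c d)) by apply: EXc => //; rewrite seg_at1 seg_at0.
have [chi rchi ->] := concat_seg g bc' cd'.
exact: EXr.
Qed.

Definition st_run g s := s = i0 R /\ SX (g (i0 R)) \/
  exists l v, [/\ LX l, 0 < val v < 1 & run l g v (i1 R) (i0 R) s].

Definition end_run g s c := s = c \/
  exists l v, [/\ LX l, 0 < val v < 1 & run l g (i0 R) v s c].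

(* A path whose ends are states of [Y] either stays inside one line of [X], or
   it follows a line up to the first visit [s1] to a state of [X], is an execution
   path of [X] until the last visit [s2], and then follows a line again. *)
Definition inside g c := exists l v v', [/\ LX l, 0 < val v, val v' < 1,
  run l g v v' (i0 R) c & val v < val v' \/ c = i0 R].

Definition across g c := exists s1 s2, [/\ st_run g s1, xseg g s1 s2, SX (g s2),
  val s2 <= val c & end_run g s2 c].

Lemma LX_endpoint l w : LX l -> SX (l w) -> w = i0 R \/ w = i1 R.
Proof. by move=> Ll Sw; case: (I_cases w) => [->|->|h]; [left|right|case: (LXin Ll h)]. Qed.

(** Each new line of Y is a piece of a line [l] of X. If it starts off the states of X, uniqueness
    of lines shows that it continues the current run on [l]; if it reaches the end of [l], that run
    closes up into an initial run or an execution path of X. The clause with [c] equal to 0 in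
    [inside] is the start of the induction. *)
Lemma normal_form_tr g c : SY (g (i0 R)) -> tr LY g c -> inside g c \/ across g c.
Proof.
move=> Sg; elim=> {c} [|b c m _ IH Lm rm].
  have [S0|S0] := pselect (SX (g (i0 R))).
    by right; exists (i0 R), (i0 R); split=> //; [left|exact: xseg_refl|left].
  have [l [t [Ll ht e]]] := LXcov S0; have /andP[t0 t1] := ht.
  by left; exists l, t, t; split=> //; [exact: run_refl|right].
have [l [u [u' [Ll uu H]]]] := sub_line Lm.
have rl := H _ _ _ rm; have [bc _ gb gc] := run_ends rl.
have u0 := I_ge0 u; have u1 := I_le1 u'.
have uint : ~ SX (g b) -> 0 < val u < 1.
  move=> nS; rewrite (lt_le_trans uu u1) andbT lt_neqAle u0 andbT; apply/eqP => e; apply: nS.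
  by rewrite gb (_ : u = i0 R); [case: (LXend Ll)|apply/val_inj; rewrite -e].
have u'cases : val u' < 1 \/ u' = i1 R.
  by have [h|h] := ltP (val u') 1; [left|right; apply/val_inj/le_anti; rewrite u1].
have Sl1 : SX (l (i1 R)) by case: (LXend Ll).
have bnd : val b < val c by case: (run_line_seg rm).
case: IH => [[l' [v [v' [Ll' v0 v1 rv vv]]]]|[s1 [s2 [st sx Ss sb en]]]].
  have [_ vv' _ gb'] := run_ends rv.
  have hv' : 0 < val v' < 1 by rewrite v1 andbT; exact: lt_le_trans vv'.
  have nS : ~ SX (g b) by rewrite gb'; exact: LXin.
  have [E1 E2] := LXuniq Ll' Ll hv' (uint nS) (etrans (esym gb') gb); subst l' v'.
  have rvc := run_cat rv rl.
  case: u'cases => [h|h]; [left|right].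
    exists l, v, u'; split=> //; left; exact: le_lt_trans vv' uu.
  subst u'; exists c, c; split=> //; last by left.
  - right; exists l, v; split=> //; rewrite v0; exact: le_lt_trans vv' v1.
  - exact: xseg_refl.
  - by rewrite gc.
right; case: en => [e|[l' [v [Ll' hv rv]]]].
  subst s2; have eu : u = i0 R.
    case: (LX_endpoint Ll (w := u)) => [|//|e]; first by rewrite -gb.
    by move: (lt_le_trans uu u1); rewrite e ltxx.
  subst u; case: u'cases => [h|h].
    exists s1, b; split=> //; right; exists l, u'; split=> //.
    by rewrite h andbT; exact: uu.
  subst u'; exists s1, c; split=> //; last by left.
  - exact: xseg_cat sx (xseg_line Ll rl).
  - by rewrite gc.
have [_ _ _ gb'] := run_ends rv.
have nS : ~ SX (g b) by rewrite gb'; exact: LXin.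
have [E1 E2] := LXuniq Ll' Ll hv (uint nS) (etrans (esym gb') gb); subst l' v.
have rvc := run_cat rv rl.
case: u'cases => [h|h].
  exists s1, s2; split=> //; first exact: le_trans sb bc.
  right; exists l, u'; split=> //; rewrite h andbT; case/andP: hv => h0 _; exact: lt_trans h0 uu.
subst u'; exists s1, c; split=> //; last by left.
- exact: xseg_cat sx (xseg_line Ll rvc).
- by rewrite gc.
Qed.

Lemma normal_form g : SY (g (i0 R)) -> gen_paths LY g -> inside g (i1 R) \/ across g (i1 R).
Proof. by move=> Sg /gen_paths_tr; exact: normal_form_tr. Qed.

Definition const_on g b c := forall s, val b <= val s -> val s <= val c -> g s = g b.

(** The path may be waiting at a state at time [b] or [d], and half a pause belongs to no complete
    line. After trimming the pauses, what remains consists of complete lines. *)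
Lemma tr_seg (EY : set (I -> T)) g c b d :
  LY `<=` EY -> (forall g phi, EY g -> reparam phi -> EY (g \o phi)) ->
  (forall g h, EY g -> EY h -> g (i1 R) = h (i0 R) -> EY (concat g h)) ->
  tr LY g c -> val b <= val d -> val d <= val c -> SY (g b) -> SY (g d) ->
  exists b' d', [/\ val b <= val b', val b' <= val d' & val d' <= val d] /\
    [/\ const_on g b b', const_on g d' d &
      b' = d' \/ val b' < val d' /\ EY (seg g b' d')].
Proof.
move=> LYE EYr EYc tc; elim: tc b d => {c} [|a c m _ IH Lm rm] b d bd dc Sb Sd.
  have e : b = d by apply/val_inj/le_anti; rewrite bd (le_trans dc) ?I_ge0.
  subst d; exists b, b; split=> //; split; [| |by left]; move=> s h1 h2;
    by congr g; apply/val_inj/le_anti; rewrite h1 h2.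
have [da|ad] := leP (val d) (val a); first exact: IH.
have [ac [p [pm pa pc ps pg]]] := rm.
have Ed := pg d (ltW ad) dc.
have cst s t : val a <= val s -> val s <= val t -> val t <= val c -> p s = p t -> const_on g s t.
  move=> as_ st tc e r sr rt; rewrite !pg //; [|exact: le_trans tc|exact: le_trans sr|exact: le_trans tc].
  congr m; apply/val_inj/le_anti/andP; split; first by rewrite e; apply: pm => //; exact: le_trans sr.
  by apply: pm => //; exact: le_trans tc.
have refl s : const_on g s s by move=> r h1 h2; congr g; apply/val_inj/le_anti; rewrite h1 h2.
have rr s t : val a <= val s -> val s <= val t -> val t <= val c -> p s = i0 R -> p t = i1 R ->
    val s < val t /\ EY (seg g s t).
  move=> as_ st tc p0 p1.
  have r : run m g (i0 R) (i1 R) s t.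
    split=> //; exists p; split=> //.
    - by move=> r r' sr rr' r't; apply: pm => //; [exact: le_trans sr|exact: le_trans tc].
    - move=> w w0 w1; have [r [ar rc e]] := ps w w0 w1.
      have [rs|sr] := ltP (val r) (val s).
        exists s; split=> //; rewrite p0; apply/val_inj/le_anti; rewrite w0 andTb -e -p0.
        by apply: pm => //; [exact: ltW|exact: le_trans tc].
      have [rt|tr] := leP (val r) (val t); first by exists r.
      exists t; split=> //; rewrite p1; apply/val_inj/le_anti; rewrite w1 andbT -e -p1.
      by apply: pm => //; [exact: le_trans st|exact: ltW].
    - by move=> r sr rt; apply: pg; [exact: le_trans sr|exact: le_trans tc].
  have [lt [chi rchi ->]] := run_line_seg r; split=> //; apply: EYr => //; exact: LYE.
have Sm : SY (m (p d)) by rewrite -Ed.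
have ga : g a = m (i0 R) by rewrite pg ?pa.
have [ba|ab] := leP (val b) (val a); last first.
  have gb := pg b (ltW ab) (le_trans bd dc).
  have Smb : SY (m (p b)) by rewrite -gb.
  have [e|n] := pselect (p b = p d).
    exists d, d; split=> //; split=> //; last by left.
    by apply: cst => //; exact: ltW.
  have pbd := pm b d (ltW ab) bd dc.
  exists b, d; split=> //; split=> //; right; apply: rr => //; first exact: ltW.
    case: (LY_state Lm Smb) => // pb; case: n; apply/val_inj/le_anti; rewrite pbd.
    by rewrite pb; exact: I_le1.
  case: (LY_state Lm Sm) => // pd; case: n; apply/val_inj/le_anti; rewrite pbd.
  by rewrite pd; exact: I_ge0.
have Sa : SY (g a) by rewrite ga; case: (LYend Lm).
have [b' [d1 [[bb' b'd1 d1a] [c1 c2 X]]]] := IH b a ba (lexx _) Sb Sa.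
have [pd|pd] := LY_state Lm Sm.
  exists b', d1; split; first by split=> //; exact: le_trans d1a (ltW ad).
  split=> // s ds sd; have [sa|as_] := leP (val s) (val a); first exact: c2.
  rewrite (cst a d (lexx _) (ltW ad) dc _ s (ltW as_) sd) ?pa ?pd //.
  exact: c2.
exists b', d; split; first by split=> //; exact: le_trans b'd1 (le_trans d1a (ltW ad)).
split=> //; right.
have r1 : run m g (i0 R) (i0 R) d1 a.
  by apply: run_const => // s ds sa; rewrite c2 // -ga -(c2 a).
have r2 : run m g (i0 R) (i1 R) a d.
  split; first exact: ltW.
  exists p; split=> //.
  - by move=> r r' sr rr' r't; apply: pm => //; exact: le_trans dc.
  - move=> w w0 w1; have [r [ar rc e]] := ps w w0 w1.
    have [rt|tr] := leP (val r) (val d); first by exists r.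
    exists d; split=> //; first exact: ltW.
    rewrite pd; apply/val_inj/le_anti; rewrite w1 andbT -e -pd.
    by apply: pm => //; exact: ltW.
  - by move=> r sr rt; apply: pg => //; exact: le_trans dc.
have [lt [chi rchi E]] := run_line_seg (run_cat r1 r2).
have Ed1 : EY (seg g d1 d) by rewrite E; apply: EYr => //; exact: LYE.
case: X => [->//|[lt' E']]; split; first exact: lt_trans lt.
have [chi' rchi' ->] := concat_seg g lt' lt.
by apply: EYr => //; apply: EYc => //; rewrite seg_at1 seg_at0.
Qed.

Lemma line_seg (EY : set (I -> T)) l b d :
  LY `<=` EY -> (forall g phi, EY g -> reparam phi -> EY (g \o phi)) ->
  (forall g h, EY g -> EY h -> g (i1 R) = h (i0 R) -> EY (concat g h)) ->
  LX l -> val b < val d -> SY (l b) -> SY (l d) -> EY (seg l b d).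
Proof.
move=> LYE EYr EYc Ll bd Sb Sd.
have [b' [d' [[h1 h2 h3] [c1 c2 X]]]] := tr_seg LYE EYr EYc (gen_paths_tr (LXY Ll))
  (ltW bd) (I_le1 d) Sb Sd.
(* A line of X has no pauses: otherwise the points at 1/2 and 3/4 of the interval would contradict
   its injectivity at interior times. *)
have mid s t : val s <= val t -> const_on l s t -> s = t.
  move=> st cst; apply/val_inj/eqP; rewrite eq_le st andTb leNgt; apply/negP => lt.
  have s0 := I_ge0 s; have t1 := I_le1 t.
  have hw : 0 < (val s + val t) / 2 < 1 by apply/andP; split; lra.
  pose w : I := cl ((val s + val t) / 2); pose w' : I := cl ((val s + 3 * val t) / 4).
  have wE : val w = (val s + val t) / 2 by rewrite val_cl; lra.
  have wE' : val w' = (val s + 3 * val t) / 4 by rewrite val_cl; lra.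
  have e : w = w'.
    apply: (LX_inj Ll); last by rewrite wE.
    by rewrite (cst w) ?(cst w') //; lra.
  by move: (congr1 val e); rewrite wE wE' => E; move: lt; lra.
have eb := mid _ _ h1 c1; have ed := mid _ _ h3 c2; subst b' d'.
by case: X => [e|[]] //; move: bd; rewrite e ltxx.
Qed.

End TwoLineStructures.

(** * Holding a path at a point until it is first reached *)

Section Cut.
Variable R : realType.
Local Notation I := (@unitI R).

Definition Imul (s t : I) : I := cl (val s * val t).

Lemma val_Imul s t : val (Imul s t) = val s * val t.
Proof.
have s0 := I_ge0 s; have s1 := I_le1 s; have t0 := I_ge0 t; have t1 := I_le1 t.
by rewrite val_cl //; nra.
Qed.

Lemma Imul_le s t : val (Imul s t) <= val s.
Proof. by rewrite val_Imul; have := I_ge0 s; have := I_le1 t; nra. Qed.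

Lemma Imul_surj s s' : val s' <= val s -> exists t, s' = Imul s t.
Proof.
move=> h; have s0 := I_ge0 s'.
have [e|n0] := eqVneq (val s) 0.
  by exists s; apply/val_inj; rewrite val_Imul e mul0r; apply/le_anti; rewrite s0 -e h.
have p0 : 0 < val s by rewrite lt_neqAle eq_sym n0 I_ge0.
exists (cl (val s' / val s)); apply/val_inj; rewrite val_Imul val_cl ?divr_ge0 ?(ltW p0) //.
  by rewrite mulrCA mulfV // mulr1.
by rewrite ler_pdivrMr // mul1r.
Qed.

Lemma Imul_cont (S : topologicalType) (f h : S -> I) : continuous f -> continuous h ->
  continuous (fun x => Imul (f x) (h x)).
Proof.
move=> cf ch; apply: comp_cont (@cl_cont R); apply: rcontM.
  exact: comp_cont cf (@val_cont _ _).
exact: comp_cont ch (@val_cont _ _).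
Qed.

Lemma closed_ex (S : topologicalType) (C : set (S * I)) : closed C ->
  closed [set y | exists t, C (y, t)].
Proof.
move=> cC; apply: closed_neg; apply: open_at => y nC.
have H : nbhs y [set z | forall t, (~` C) (z, t)].
  apply: I_tube => -[z t] /= ->; apply: open_nbhs_nbhs; split; first exact: closed_openC.
  by move=> Cyt; apply: nC; exists t.
by apply: filterS H => z h [t Ct]; exact: h Ct.
Qed.

Lemma closed_all (S U : topologicalType) (C : set (S * U)) : closed C ->
  closed [set y | forall t, C (y, t)].
Proof.
move=> cC; rewrite (_ : [set _ | _] = \bigcap_t (fun y => (y, t)) @^-1` C).
  apply: closed_bigI => t _; apply: preimage_closed cC => y _.
  by apply: pair_cont => z; [exact: cvg_id|exact: cvg_cst].
by apply/seteqP; split=> [y h t _|y h t]; [exact: h|exact: (h t Logic.I)].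
Qed.

Lemma closed_disjoint_cover (A B : set I) : closed A -> closed B ->
  (forall r, A r \/ B r) -> (forall r, A r -> ~ B r) ->
  (forall r, A r) \/ (forall r, B r).
Proof.
move=> cA cB AB nAB; have [[r Ar]|no] := pselect (exists r, A r); last first.
  by right => r; case: (AB r) => // Ar; case: no; exists r.
left; apply: (I_clopen (A := A)) => //; last by exists r.
rewrite (_ : A = ~` B); first exact: closed_openC.
by apply/seteqP; split=> [r' /nAB //|r' nB]; case: (AB r').
Qed.

Variable T : topologicalType.
Implicit Types (g : I -> T) (p q : T).

Definition hit p g (s : I) := exists s' : I, val s' <= val s /\ g s' = p.
(** The path waits at [p] until [g] reaches [p], and then follows [g]. No time of first visit
    appears, and this is what makes it continuous in families. *)
Definition cutL p g (s : I) := if `[< hit p g s >] then g s else p.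
Definition cutR q g (s : I) := cutL q (g \o @Irev R) (Irev s).

Definition moves (Rel : set (T * T)) g (s : I) := forall a b : I,
  val a <= val b -> val b <= val s -> Rel (g a, g b).

Variable G : I * I -> T.
Hypothesis cG : continuous G.
Local Notation Gr r := (fun s => G (r, s)).

(** Earlier times are written as [Imul s t], so the set is the projection of a closed set along a
    compact factor. *)
Lemma hit_closed p : closed [set p] -> closed [set x | hit p (Gr x.1) x.2].
Proof.
move=> cp.
rewrite (_ : [set _ | _] = [set x | exists t, [set z : (I * I) * I |
    G (z.1.1, Imul z.1.2 z.2) = p] (x, t)]).
  apply: closed_ex; rewrite (_ : [set _ | _] = (fun z : (I * I) * I => G (z.1.1, Imul z.1.2 z.2)) @^-1` [set p]) //.
  apply: preimage_closed cp => z _; apply: comp_cont cG _.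
  apply: pair_cont; first exact: comp_cont (@fst_cont _ _) (@fst_cont _ _).
  by apply: Imul_cont (@snd_cont _ _); exact: comp_cont (@fst_cont _ _) (@snd_cont _ _).
apply/seteqP; split=> [[r s] [s' [h e]]|[r s] [t e]].
  by have [t et] := Imul_surj h; exists t; rewrite /= -et.
by exists (Imul s t); split=> //; exact: Imul_le.
Qed.

Lemma moves_closed Rel : closed Rel -> closed [set x | moves Rel (Gr x.1) x.2].
Proof.
move=> cR.
pose K (z : (I * I) * (I * I)) : T * T :=
  (G (z.1.1, Imul (Imul z.1.2 z.2.1) z.2.2), G (z.1.1, Imul z.1.2 z.2.1)).
rewrite (_ : [set _ | _] = [set x | forall t, (K @^-1` Rel) (x, t)]).
  apply: closed_all; apply: preimage_closed cR => z _.
  have c1 : continuous (fun z : (I * I) * (I * I) => z.1.1).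
    exact: comp_cont (@fst_cont _ _) (@fst_cont _ _).
  have c2 : continuous (fun z : (I * I) * (I * I) => Imul z.1.2 z.2.1).
    apply: Imul_cont; first exact: comp_cont (@fst_cont _ _) (@snd_cont _ _).
    exact: comp_cont (@snd_cont _ _) (@fst_cont _ _).
  apply: pair_cont; apply: comp_cont cG; apply: pair_cont => //.
  by apply: Imul_cont c2 _; exact: comp_cont (@snd_cont _ _) (@snd_cont _ _).
apply/seteqP; split=> [[r s] h [t t']|[r s] h a b ab bs].
  by apply: h; exact: Imul_le.
have [t et] := Imul_surj bs; subst b; have [t' et'] := Imul_surj ab; subst a.
exact: (h (t, t')).
Qed.

(** The parameters where [p] has been reached and those where the path is still on its initial line
    form two closed sets. On the second one [cutL] is constant: by the hypothesis on [Rel], a path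
    still on that line which has reached [p] is still at [p]. *)
Lemma cutL_cont p Rel : closed [set p] -> closed Rel -> (forall q, Rel (p, q) -> q = p) ->
  (forall r s, hit p (Gr r) s \/ moves Rel (Gr r) s) ->
  continuous (fun x : I * I => cutL p (Gr x.1) x.2).
Proof.
move=> cp cR Rp H; apply: (paste_cont (hit_closed cp) (moves_closed cR)).
- by apply/seteqP; split=> // -[r s] _; exact: H.
- by apply: (within_ext cG) => -[r s] h; rewrite /cutL asboolT.
- apply: (within_ext (@cst_cont _ _ p)) => -[r s] h; rewrite /cutL.
  by case: asboolP => // -[s' [ss e]]; apply: Rp; rewrite -e; exact: h.
Qed.

Lemma hit_all p Rel : closed [set p] -> closed Rel ->
  (forall r, hit p (Gr r) (i1 R) \/ moves Rel (Gr r) (i1 R)) ->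
  (forall r, hit p (Gr r) (i1 R) -> ~ moves Rel (Gr r) (i1 R)) ->
  (forall r, hit p (Gr r) (i1 R)) \/ (forall r, moves Rel (Gr r) (i1 R)).
Proof.
move=> cp cR H nH.
have c1 : continuous (fun r : I => (r, i1 R)).
  by apply: pair_cont; [exact: id_cont|exact: cst_cont].
apply: closed_disjoint_cover => //.
- by apply: (preimage_closed (f := fun r : I => (r, i1 R))) (hit_closed cp) => r _; exact: c1.
- by apply: (preimage_closed (f := fun r : I => (r, i1 R))) (moves_closed cR) => r _; exact: c1.
Qed.

(** Both conditions are closed in the parameter and exclude each other, so connectedness of the
    interval decides for the whole family. *)
Lemma peak_all (U : T -> I) : continuous U ->
  (forall r, (forall s, U (G (r, s)) = i0 R) \/ exists s, U (G (r, s)) = i1 R) ->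
  (forall r s, U (G (r, s)) = i0 R) \/ (forall r, exists s, U (G (r, s)) = i1 R).
Proof.
move=> cU H; have cI (w : I) : closed ((U \o G) @^-1` [set w]).
  apply: preimage_closed => [x _|]; first exact: comp_cont cG cU x.
  by apply: accessible_closed_set1; apply: hausdorff_accessible; exact: I_hausdorff.
apply: closed_disjoint_cover => //.
- exact: closed_all (cI (i0 R)).
- exact: closed_ex (cI (i1 R)).
- by move=> r h [s e]; have := congr1 val e; rewrite h /= => /eqP; rewrite eq_sym oner_eq0.
Qed.

End Cut.

(** * Cutting paths *)

Section CutPaths.
Variable R : realType.
Local Notation I := (@unitI R).
Variable T : topologicalType.
Variables (SX SY : set T) (EX LX LY : set (I -> T)).

Record line_subdivision : Prop := LineSubdivision {
  SXY : SX `<=` SY;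
  LXin : forall l t, LX l -> 0 < val t < 1 -> ~ SX (l t);
  LXend : forall l, LX l -> SX (l (i0 R)) /\ SX (l (i1 R));
  LXcov : forall p, ~ SX p -> exists l t, [/\ LX l, 0 < val t < 1 & l t = p];
  LXuniq : forall l l' t t', LX l -> LX l' -> 0 < val t < 1 -> 0 < val t' < 1 ->
    l t = l' t' -> l = l' /\ t = t';
  LXE : LX `<=` EX;
  LXr : forall g phi, EX g -> reparam phi -> EX (g \o phi);
  LXc : forall g h, EX g -> EX h -> g (i1 R) = h (i0 R) -> EX (concat g h);
  LXY : forall l, LX l -> gen_paths LY l;
  LYin : forall l t, LY l -> 0 < val t < 1 -> ~ SY (l t);
  LYend : forall l, LY l -> SY (l (i0 R)) /\ SY (l (i1 R));
  LYuniq : forall l l' t t', LY l -> LY l' -> 0 < val t < 1 -> 0 < val t' < 1 ->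
    l t = l' t' -> l = l' /\ t = t';
  LX_cont : forall l, LX l -> continuous l }.

Hypothesis sub : line_subdivision.
Hypothesis hT : hausdorff_space T.
Implicit Types (g h l : I -> T) (x y p q : T) (s t v w : I).

Let inj l s t : LX l -> l s = l t -> 0 < val s < 1 -> s = t.
Proof. exact: (LX_inj (LXin sub) (LXend sub) (LXuniq sub)). Qed.

(* The state at which a path from [x] first meets [SX], and the pairs of points
   that it can meet in this order before. *)
Variant start_at x : T -> set (T * T) -> Prop :=
| StartState of SX x : start_at x x set0
| StartLine l v of LX l & 0 < val v < 1 & x = l v :
    start_at x (l (i1 R)) [set p | exists a b : I,
      [/\ val v <= val a, val a <= val b & p = (l a, l b)]].

Variant end_at y : T -> set (T * T) -> Prop :=
| EndState of SX y : end_at y y set0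
| EndLine l v of LX l & 0 < val v < 1 & y = l v :
    end_at y (l (i0 R)) [set p | exists a b : I,
      [/\ val a <= val b, val b <= val v & p = (l b, l a)]].

Let cI (f : I * I -> R) : continuous f -> closed [set z | f z <= 0].
Proof. by move=> cf; exact: (preimage_closed (fun z _ => cf z) (@closed_le R 0)). Qed.

Lemma image_closed l (C : set (I * I)) (k : I * I -> T * T) : LX l -> closed C ->
  continuous k -> closed (k @` C).
Proof.
move=> Ll cC ck; apply: compact_closed; first exact: prod_hausdorff.
apply: continuous_compact; first exact: continuous_subspaceT.
apply: subclosed_compact cC _ (@subsetT _ C).
rewrite -setXTT; apply: compact_setX; exact: I_compact.
Qed.

Let diff_cont (f k : I * I -> I) : continuous f -> continuous k ->
  closed [set z | val (f z) <= val (k z)].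
Proof.
move=> cf ck; rewrite (_ : [set _ | _] = [set z | val (f z) - val (k z) <= 0]).
  by apply: cI; apply: rcontB; [exact: comp_cont cf (@val_cont _ _)|exact: comp_cont ck (@val_cont _ _)].
by apply/seteqP; split=> z /=; rewrite subr_le0.
Qed.

Lemma start_closed x p Rel : start_at x p Rel -> closed Rel.
Proof.
case=> [_|l v Ll hv _]; first exact: closed0.
rewrite (_ : [set _ | _] = (fun z : I * I => (l z.1, l z.2)) @`
  ([set z | val v <= val z.1] `&` [set z | val z.1 <= val z.2])).
  apply: (image_closed Ll).
    apply: closedI; first exact: (diff_cont (f := fun=> v) (@cst_cont _ _ v) (@fst_cont _ _)).
    exact: (diff_cont (@fst_cont _ _) (@snd_cont _ _)).
  have cl := LX_cont sub Ll.
  by apply: pair_cont; [exact: comp_cont (@fst_cont _ _) cl|exact: comp_cont (@snd_cont _ _) cl].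
apply/seteqP; split=> [_ [a [b [va ab ->]]]|_ [[a b] [va ab] <-]]; last by exists a, b.
by exists (a, b).
Qed.

Lemma end_closed y q Rel : end_at y q Rel -> closed Rel.
Proof.
case=> [_|l v Ll hv _]; first exact: closed0.
rewrite (_ : [set _ | _] = (fun z : I * I => (l z.2, l z.1)) @`
  ([set z | val z.2 <= val v] `&` [set z | val z.1 <= val z.2])).
  apply: (image_closed Ll).
    apply: closedI; first exact: (diff_cont (k := fun=> v) (@snd_cont _ _) (@cst_cont _ _ v)).
    exact: (diff_cont (@fst_cont _ _) (@snd_cont _ _)).
  have cl := LX_cont sub Ll.
  by apply: pair_cont; [exact: comp_cont (@snd_cont _ _) cl|exact: comp_cont (@fst_cont _ _) cl].
apply/seteqP; split=> [_ [a [b [va ab ->]]]|_ [[a b] [va ab] <-]]; last by exists a, b.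
by exists (a, b).
Qed.

Lemma start_fix x p Rel : start_at x p Rel -> forall q, Rel (p, q) -> q = p.
Proof.
case=> [_ q []|l v Ll /andP[v0 v1] _ q [a [b [va ab [e ->]]]]].
have a1 : a = i1 R.
  case: (I_cases a) => // [ea|ha]; last by rewrite (inj Ll (esym e) ha).
  by move: va; rewrite ea leNgt v0.
by congr l; apply/val_inj/le_anti; rewrite I_le1 -a1.
Qed.

Lemma end_fix y p Rel : end_at y p Rel -> forall q, Rel (p, q) -> q = p.
Proof.
case=> [_ q []|l v Ll /andP[v0 v1] _ q [a [b [ab bv [e ->]]]]].
have b0 : b = i0 R.
  case: (I_cases b) => // [eb|hb]; last by rewrite (inj Ll (esym e) hb).
  by move: bv; rewrite eb leNgt v1.
by congr l; apply/val_inj/le_anti; rewrite -{1}b0 ab I_ge0.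
Qed.

Lemma start_state x p Rel : start_at x p Rel -> SX p.
Proof. by case=> // l v Ll _ _; case: (LXend sub Ll). Qed.

Let onln x l v : LX l -> 0 < val v < 1 -> x = l v -> ~ SX x.
Proof. by move=> Ll hv ->; exact: (LXin sub Ll hv). Qed.

Definition clip (a b : I) s : I := if val b <= val s then b else if val s <= val a then a else s.

Lemma across_start g p Rel s1 : start_at (g (i0 R)) p Rel -> st_run SX LX g s1 ->
  g s1 = p /\ forall s, val s < val s1 -> moves Rel g s.
Proof.
move=> sp [[-> S0]|[l [v [Ll hv rv]]]].
  split=> [|s]; last by rewrite ltNge I_ge0.
  case: sp => // l v Ll hv e; by case: (onln Ll hv e).
have [_ _ e0 e1] := run_ends rv.
case: sp => [S0|l' v' Ll' hv' e']; first by case: (onln Ll hv e0).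
have [E1 E2] := LXuniq sub Ll Ll' hv hv' (etrans (esym e0) e'); subst l' v'.
split=> // s ss1 a b ab bs.
have [w [w' [h1 h2 h3 -> ->]]] := run_at2 rv (I_ge0 a) ab (le_trans bs (ltW ss1)).
by exists w, w'.
Qed.

Lemma across_end g q Rel s2 : end_at (g (i1 R)) q Rel -> SX (g s2) -> end_run LX g s2 (i1 R) ->
  g s2 = q /\ forall s, val s2 < val s -> moves Rel (g \o @Irev R) (Irev s).
Proof.
move=> eq Ss [e1|[l [v [Ll hv rv]]]].
  rewrite e1 in Ss *.
  split=> [|s]; last by rewrite ltNge I_le1.
  case: eq => // l v Ll hv e; by case: (onln Ll hv e).
have [_ _ e0 e1] := run_ends rv.
case: eq => [S0|l' v' Ll' hv' e']; first by case: (onln Ll hv e1).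
have [E1 E2] := LXuniq sub Ll Ll' hv hv' (etrans (esym e1) e'); subst l' v'.
split=> // s ss2 a b ab bs.
have sb : val s <= val (Irev b) by move: bs; rewrite !val_Irev; lra.
have ba : val (Irev b) <= val (Irev a) by rewrite !val_Irev; lra.
have [w [w' [h1 h2 h3 E E']]] := run_at2 rv (le_trans (ltW ss2) sb) ba (I_le1 _).
by exists w, w'; rewrite /= E E'.
Qed.

Definition cut p q g := cutR q (cutL p g).

Section Across.
Variables (g : I -> T) (p q : T) (Rel Rel' : set (T * T)).
Hypotheses (sp : start_at (g (i0 R)) p Rel) (ep : end_at (g (i1 R)) q Rel').

Lemma cutL_across s1 : st_run SX LX g s1 ->
  cutL p g = fun s => g (if val s <= val s1 then s1 else s).
Proof.
move=> /(across_start sp)[e1 H]; apply/funext => s; rewrite /cutL.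
case: asboolP => [[s' [ss es]]|nh]; case: ifP => h //; last first.
- by case: nh; exists s1; split=> //; move/negbT: h; rewrite -ltNge => /ltW.
- have [E|n] := eqVneq (val s) (val s1); first by rewrite (val_inj E).
  have lt : val s < val s1 by rewrite lt_neqAle n h.
  by rewrite e1; apply: (start_fix sp); rewrite -es; exact: (H s lt).
Qed.

Lemma hit_or_move1 s1 s : st_run SX LX g s1 -> hit p g s \/ moves Rel g s.
Proof.
move=> /(across_start sp)[e1 H]; have [h|h] := leP (val s1) (val s); last by right; exact: H.
by left; exists s1.
Qed.

Variables s1 s2 : I.
Hypotheses (st : st_run SX LX g s1) (s12 : val s1 <= val s2) (Ss : SX (g s2))
  (en : end_run LX g s2 (i1 R)).

Lemma hit_or_move2 s : hit q (cutL p g \o @Irev R) s \/ moves Rel' (cutL p g \o @Irev R) s.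
Proof.
have [e2 H] := across_end ep Ss en; rewrite (cutL_across st).
have [h|h] := leP (val (Irev s2)) (val s).
  left; exists (Irev s2); split=> //; rewrite /comp IrevK.
  by case: ifP => // h'; rewrite (_ : s1 = s2) //; apply/val_inj/le_anti; rewrite s12 h'.
right=> a b ab bs; have h2 : val s2 < val (Irev s) by move: h; rewrite !val_Irev; lra.
have := H (Irev s) h2 a b ab; rewrite IrevK => /(_ bs) /=.
have nle c : val c <= val s -> (val (Irev c) <= val s1) = false.
  by move=> cs; apply/negbTE; rewrite -ltNge; move: h s12; rewrite !val_Irev => h h'; lra.
by rewrite !nle //; exact: le_trans bs.
Qed.

(** Identifies the cut, defined without times, with the path stopped outside the interval between
    the first and the last visit. *)
Lemma cut_across : cut p q g = g \o clip s1 s2.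
Proof.
have [e2 H] := across_end ep Ss en; apply/funext => s; rewrite /cut /cutR /comp /clip.
rewrite {1}/cutL; case: asboolP => [hh|nh]; last first.
  case: ifP => h; first by rewrite e2.
  case: nh; exists (Irev s2); split.
    by move/negbT: h; rewrite -ltNge !val_Irev; lra.
  rewrite (cutL_across st) /comp IrevK.
  by case: ifP => // h'; rewrite (_ : s1 = s2) //; apply/val_inj/le_anti; rewrite s12 h'.
rewrite IrevK (cutL_across st).
have [h|h] := leP (val s2) (val s); last by case: ifP.
have [E|n] := eqVneq (val s) (val s2).
  rewrite (val_inj E); case: ifP => // h'.
  by rewrite (_ : s1 = s2) //; apply/val_inj/le_anti; rewrite s12 h'.
have lt : val s2 < val s by rewrite lt_neqAle eq_sym n h.
rewrite ifF; last by apply/negbTE; rewrite -ltNge; exact: le_lt_trans lt.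
case: hh => s' [ss es]; move: es; rewrite (cutL_across st) /=.
have ss' : val s <= val (Irev s') by move: ss; rewrite !val_Irev; lra.
rewrite ifF; last by apply/negbTE; rewrite -ltNge; exact: le_lt_trans (lt_le_trans lt ss').
move=> es; rewrite e2; apply: (end_fix ep); rewrite -es.
have := H s lt s' (Irev s) ss (lexx _).
by rewrite /= IrevK.
Qed.

Lemma cut_across_exec : xseg EX g s1 s2 ->
  (cut p q g = (fun=> p) /\ p = q) \/ EX (cut p q g).
Proof.
move=> [_ [e|[lt E]]]; rewrite cut_across.
  have [e1 _] := across_start sp st; have [e2 _] := across_end ep Ss en.
  left; split; last by rewrite -e1 -e2 e.
  apply/funext => s; rewrite /clip /comp -e; case: ifP => [//|/negbT].
  by rewrite -ltNge => h; rewrite (ltW h).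
right; have d : 0 < val s2 - val s1 by rewrite subr_gt0.
rewrite (_ : g \o _ = seg g s1 s2 \o (fun t => cl ((val t - val s1) / (val s2 - val s1)))).
  apply: (LXr sub) => //; split=> [s t hst|].
    by apply: cl_mono; rewrite ler_pM2r ?invr_gt0 // lerD2r.
  apply/seteqP; split=> // y _.
  exists (cl (val s1 + val y * (val s2 - val s1))) => //.
  by rewrite val_seg // (addrC (val s1)) addrK mulfK ?gt_eqF // clK.
apply/funext => s; rewrite /comp /clip; case: ifP => h.
  by rewrite cl_ge1 ?seg_at1 // ler_pdivlMr // mul1r lerD2r.
case: ifP => h'; last first.
  move/negbT: h; move/negbT: h'; rewrite -!ltNge => /ltW h1 /ltW h2.
  by rewrite /seg seg_inv.
by rewrite cl_le0 ?seg_at0 // ler_pdivrMr // mul0r subr_le0.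
Qed.

End Across.

Lemma cutL_comp p g phi : reparam phi -> cutL p (g \o phi) = cutL p g \o phi.
Proof.
move=> rphi; have [hp _] := rphi.
apply/funext => s; rewrite /cutL /comp; congr (if _ then _ else _); apply: asbool_equiv_eq.
split=> -[s' [ss e]]; first by exists (phi s'); split=> //; exact: hp.
have [t et] := reparam_surj rphi s'; have [ts|st] := leP (val t) (val s).
  by exists t; split=> //; rewrite et.
exists s; split=> //; rewrite -e; congr g; apply/val_inj/le_anti; rewrite ss andbT.
by rewrite -et; apply: hp; exact: ltW.
Qed.

Lemma cutR_comp q g phi : reparam phi -> cutR q (g \o phi) = cutR q g \o phi.
Proof.
move=> rphi; have [hp _] := rphi.
apply/funext => s; rewrite /cutR /cutL /comp !IrevK; congr (if _ then _ else _).
apply: asbool_equiv_eq; split=> -[s' [ss e]].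
  exists (Irev (phi (Irev s'))); rewrite IrevK; split=> //.
  have : val (phi s) <= val (phi (Irev s')) by apply: hp; move: ss; rewrite !val_Irev; lra.
  by rewrite !val_Irev; lra.
have [t et] := reparam_surj rphi (Irev s'); have [ts|st] := leP (val s) (val t).
  by exists (Irev t); rewrite IrevK et; split=> //; rewrite !val_Irev; lra.
exists (Irev s); rewrite IrevK; split=> //; rewrite -e; congr g.
apply/val_inj/le_anti/andP; split; first by move: ss; rewrite !val_Irev; lra.
by rewrite -et; apply: hp; exact: ltW.
Qed.

Lemma cut_comp p q g phi : reparam phi -> cut p q (g \o phi) = cut p q g \o phi.
Proof. by move=> rphi; rewrite /cut cutL_comp // cutR_comp. Qed.

Lemma cutL_only p g : g (i1 R) = p -> (forall s, val s < 1 -> g s <> p) -> cutL p g = fun=> p.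
Proof.
move=> g1 gn; apply/funext => s; rewrite /cutL; case: asboolP => // -[s' [ss e]].
have [lt|ge] := ltP (val s') 1; first by case: (gn s' lt).
rewrite (_ : s = i1 R) //; apply/val_inj/le_anti; rewrite I_le1 /=.
exact: le_trans ge ss.
Qed.

Lemma cutR_only q g : g (i0 R) = q -> (forall s, 0 < val s -> g s <> q) -> cutR q g = fun=> q.
Proof.
move=> g0 gn; apply/funext => s; rewrite /cutR cutL_only //.
  by rewrite /comp Irev1.
by move=> t t1; apply: gn; rewrite val_Irev subr_gt0.
Qed.

Lemma reparam_late : reparam (fun s => cl (2 * val s - 1) : I).
Proof.
split=> [s t st|]; first by apply: cl_mono; lra.
apply/seteqP; split=> // y _; exists (cl ((1 + val y) / 2)) => //.
have y0 := I_ge0 y; have y1 := I_le1 y; rewrite -[RHS]clK; congr cl; rewrite val_cl; lra.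
Qed.

Lemma reparam_early : reparam (fun s => cl (2 * val s) : I).
Proof.
split=> [s t st|]; first by apply: cl_mono; lra.
apply/seteqP; split=> // y _; exists (cl (val y / 2)) => //.
have y0 := I_ge0 y; have y1 := I_le1 y; rewrite -[RHS]clK; congr cl; rewrite val_cl; lra.
Qed.

(** The cut replaces [g] by a pause, so that [h] survives only up to reparametrization. *)
Lemma cutL_concat p g h : g (i1 R) = p -> h (i0 R) = p ->
  (forall s, val s < 1 -> g s <> p) ->
  cutL p (concat g h) = h \o (fun s => cl (2 * val s - 1)).
Proof.
move=> g1 h0 gn; apply/funext => s; rewrite /cutL /comp concatE; case: asboolP => [[s' [ss e]]|nh].
  case: ifP => hs //; rewrite [X in h X]cl_le0 ?h0; last lra.
  move: e; rewrite concatE ifT; last exact: le_trans hs.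
  have [lt|ge _] := ltP (2 * val s') 1.
    by move=> e; case: (gn (cl (2 * val s'))) => //; have := I_ge0 s' => s0; rewrite val_cl //; lra.
  by rewrite cl_ge1 //; lra.
have [hs|hs] := leP (val s) 2^-1; first by rewrite cl_le0 ?h0 //; lra.
case: nh; exists (cl 2^-1); rewrite val_cl; [|lra..]; split; first exact: ltW.
by rewrite concatE val_cl ?lexx ?mulfV // ?cl_ge1 //; lra.
Qed.

Lemma cutR_concat q g h : h (i0 R) = q -> g (i1 R) = q ->
  (forall s, 0 < val s -> h s <> q) ->
  cutR q (concat g h) = g \o (fun s => cl (2 * val s)).
Proof.
move=> h0 g1 hn; apply/funext => s; rewrite /cutR /cutL /comp IrevK concatE.
case: asboolP => [[s' [ss e]]|nh].
  case: ifP => // /negbT; rewrite -ltNge => hs; exfalso.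
  have ss' : val s <= val (Irev s') by move: ss; rewrite !val_Irev; lra.
  move: e; rewrite concatE ifF; last by apply/negbTE; rewrite -ltNge; exact: lt_le_trans ss'.
  apply: hn; have := I_le1 (Irev s') => s1; rewrite val_cl; lra.
have [hs|hs] := leP (val s) 2^-1; last by rewrite cl_ge1 ?g1 //; lra.
case: nh; exists (Irev (cl 2^-1)); split.
  by rewrite !val_Irev val_cl; lra.
by rewrite IrevK concatE val_cl ?lexx ?mulfV // ?cl_ge1 //; lra.
Qed.

Lemma cutL_start p g : g (i0 R) = p -> cutL p g = g.
Proof. by move=> g0; apply/funext => s; rewrite /cutL asboolT //; exists (i0 R); split=> //; exact: I_ge0. Qed.

Lemma cutR_end q g : g (i1 R) = q -> cutR q g = g.
Proof.
move=> g1; apply/funext => s; rewrite /cutR cutL_start ?/comp ?IrevK //.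
by rewrite Irev0.
Qed.

End CutPaths.

(** * Cutting continuous families of paths *)

Section CutFamilies.
Variable R : realType.
Local Notation I := (@unitI R).
Variable T : topologicalType.
Variables (SX SY : set T) (EX LX LY : set (I -> T)).
Hypothesis sub : line_subdivision SX SY EX LX LY.
Hypothesis hT : hausdorff_space T.
Implicit Types (g h l : I -> T) (x y p q : T) (s t v w : I).

Let nf g : SY (g (i0 R)) -> gen_paths LY g ->
  inside LX g (i1 R) \/ across SX EX LX g (i1 R).
Proof.
exact: (normal_form (SXY sub) (LXin sub) (LXend sub) (LXcov sub) (LXuniq sub) (LXE sub)
  (LXr sub) (LXc sub) (LXY sub) (LYin sub) (LYend sub) (LYuniq sub)).
Qed.

Lemma inside_no_state g s : inside LX g (i1 R) -> ~ SX (g s).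
Proof.
move=> [l [v [v' [Ll v0 v1 rv _]]]]; have [w [h1 h2 ->]] := run_at rv (I_ge0 s) (I_le1 s).
by apply: (LXin sub Ll); rewrite (lt_le_trans v0 h1) (le_lt_trans h2 v1).
Qed.

Lemma inside_ends g : inside LX g (i1 R) -> exists l v v',
  [/\ LX l, 0 < val v, val v < val v', val v' < 1 & g (i0 R) = l v /\ g (i1 R) = l v'].
Proof.
move=> [l [v [v' [Ll v0 v1 rv [vv|e]]]]]; have [_ _ g0 g1] := run_ends rv.
  by exists l, v, v'.
by have := congr1 val e => /eqP; rewrite /= oner_eq0.
Qed.

Lemma inside_moves g p Rel s : inside LX g (i1 R) -> start_at SX LX (g (i0 R)) p Rel ->
  moves Rel g s.
Proof.
move=> ins; have [l [v [v' [Ll v0 v1 rv _]]]] := ins.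
have [_ vv g0 _] := run_ends rv.
have hv : 0 < val v < 1 by rewrite v0 (le_lt_trans vv v1).
case=> [S0|l' w Ll' hw e]; first by case: (inside_no_state ins S0).
have [E1 E2] := LXuniq sub Ll Ll' hv hw (etrans (esym g0) e); subst l' w.
move=> a b ab bs; have [w [w' [h1 h2 h3 -> ->]]] := run_at2 rv (I_ge0 a) ab (I_le1 b).
by exists w, w'.
Qed.

Lemma cut_ends g p q Rel Rel' : start_at SX LX (g (i0 R)) p Rel -> end_at SX LX (g (i1 R)) q Rel' ->
  across SX EX LX g (i1 R) -> cut p q g (i0 R) = p /\ cut p q g (i1 R) = q.
Proof.
move=> sp ep [s1 [s2 [st [s12 _] Ss _ en]]].
have [e1 _] := across_start sub sp st; have [e2 _] := across_end sub ep Ss en.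
rewrite (cut_across sub sp ep st s12 Ss en) /comp /clip I_le1; split=> //.
rewrite I_ge0; case: ifP => // h; rewrite (_ : s2 = s1) //.
by apply/val_inj/le_anti; rewrite s12 andbT (le_trans h) // I_ge0.
Qed.

Variable G : I * I -> T.
Hypothesis cG : continuous G.
Local Notation Gr r := (fun s => G (r, s)).
Variables (x y p q : T) (Rel Rel' : set (T * T)).
Hypotheses (Sx : SY x) (sp : start_at SX LX x p Rel) (ep : end_at SX LX y q Rel').
Hypotheses (Gx : forall r, G (r, i0 R) = x) (Gy : forall r, G (r, i1 R) = y)
  (Gg : forall r, gen_paths LY (Gr r)).

Let pt (z : T) : closed [set z].
Proof. by apply: accessible_closed_set1; exact: hausdorff_accessible. Qed.

Let nfr r : inside LX (Gr r) (i1 R) \/ across SX EX LX (Gr r) (i1 R).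
Proof. by apply: nf (Gg r); rewrite Gx. Qed.

Let spr r : start_at SX LX (Gr r (i0 R)) p Rel. Proof. by rewrite /= Gx. Qed.
Let epr r : end_at SX LX (Gr r (i1 R)) q Rel'. Proof. by rewrite /= Gy. Qed.

Let across_hit r : across SX EX LX (Gr r) (i1 R) -> hit p (Gr r) (i1 R).
Proof.
move=> [s1 [s2 [st [s12 _] Ss _ en]]]; have [e _] := across_start sub (spr r) st.
by exists s1; split=> //; exact: I_le1.
Qed.

Let inside_nohit r : inside LX (Gr r) (i1 R) -> ~ hit p (Gr r) (i1 R).
Proof.
move=> ins [s [_ e]]; apply: (inside_no_state ins (s := s)); rewrite e.
exact: start_state sub _ _ _ sp.
Qed.

(** Paths that stay inside a line never meet the point [p], while the others do. The two closed
    conditions of [hit_all] exclude each other, since a path satisfying both would end at the state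
    [p] of X. *)
Lemma family_cases :
  (forall r, inside LX (Gr r) (i1 R)) \/ (forall r, across SX EX LX (Gr r) (i1 R)).
Proof.
have [Sy|nSy] := pselect (SX y).
  right => r; case: (nfr r) => // ins.
  by case: (inside_no_state ins (s := i1 R)); rewrite Gy.
have [|||] := hit_all cG (@pt p) (start_closed sub hT sp).
- move=> r; case: (nfr r) => [ins|[s1 [s2 [st _ _ _ _]]]].
    by right; exact: inside_moves (spr r).
  exact: (hit_or_move1 sub (spr r) _ st).
- move=> r [s [_ e]] mv; apply: nSy; have := mv s (i1 R) (I_le1 s) (lexx _).
  rewrite e Gy => /(start_fix sub sp) ->; exact: start_state sub _ _ _ sp.
- by move=> H; right => r; case: (nfr r) => // /inside_nohit; case.
move=> H; left => r; case: (nfr r) => // acr; exfalso.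
have [s [_ e]] := across_hit acr; apply: nSy; have := H r s (i1 R) (I_le1 s) (lexx _).
rewrite e Gy => /(start_fix sub sp) ->; exact: start_state sub _ _ _ sp.
Qed.

Hypothesis acr : forall r, across SX EX LX (Gr r) (i1 R).

Lemma cut_family_cont : continuous (fun z : I * I => cut p q (Gr z.1) z.2).
Proof.
have c1 : continuous (fun z : I * I => cutL p (Gr z.1) z.2).
  apply: (cutL_cont cG (@pt p) (start_closed sub hT sp) (start_fix sub sp)) => r s.
  have [s1 [s2 [st _ _ _ _]]] := acr r; exact: (hit_or_move1 sub (spr r) _ st).
pose G' (z : I * I) := cutL p (Gr z.1) (Irev z.2).
have rev_cont : continuous (fun z : I * I => (z.1, Irev z.2)).
  apply: pair_cont; first exact: fst_cont.
  exact: comp_cont (@snd_cont _ _) (@Irev_cont R).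
have cG' : continuous G' by exact: (comp_cont rev_cont c1).
have c2 : continuous (fun z : I * I => cutL q (fun s => G' (z.1, s)) z.2).
  apply: (cutL_cont cG' (@pt q) (end_closed sub hT ep) (end_fix sub ep)) => r s.
  have [s1 [s2 [st [s12 _] Ss _ en]]] := acr r.
  exact: (hit_or_move2 sub (spr r) (epr r) st s12 Ss en s).
exact: (comp_cont rev_cont c2).
Qed.

Variable U : T -> I.
Hypotheses (cU : continuous U) (U0 : forall z, SX z -> U z = i0 R)
  (UE : forall g, EX g -> exists s, U (g s) = i1 R).

(** The cut is constant when the first and last visits coincide. Then [U] vanishes along it, whereas
    [U] reaches 1 on execution paths of X, so [peak_all] separates the two cases. *)
Lemma cut_family_cases :
  (p = q /\ forall r, cut p q (Gr r) = fun=> p) \/ (forall r, EX (cut p q (Gr r))).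
Proof.
have H r : (cut p q (Gr r) = (fun=> p) /\ p = q) \/ EX (cut p q (Gr r)).
  have [s1 [s2 [st xs Ss _ en]]] := acr r; have [s12 _] := xs.
  exact: (cut_across_exec sub (spr r) (epr r) st s12 Ss en xs).
have Up : U p = i0 R by apply: U0; exact: start_state sub _ _ _ sp.
have [|H0|H1] := peak_all cut_family_cont cU.
- move=> r; case: (H r) => [[e _]|E]; first by left => s /=; rewrite e.
  by right; exact: UE E.
- left; case: (H (i0 R)) => [[_ e]|/UE[s e]]; last first.
    by have := H0 (i0 R) s; rewrite /= e => /(congr1 val) /eqP; rewrite /= oner_eq0.
  split=> // r; case: (H r) => [[]//|/UE[s e']].
  by have := H0 r s; rewrite /= e' => /(congr1 val) /eqP; rewrite /= oner_eq0.
- right => r; case: (H r) => [[e _]|//]; have [s es] := H1 r.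
  by move: es; rewrite /= e Up => /(congr1 val) /eqP; rewrite /= eq_sym oner_eq0.
Qed.

End CutFamilies.

(** * Subdivision as adding states *)

Lemma exec_path (R : realType) hd (Z : MdTop R hd) (a b : sval Z) (g : @unitI R -> sval Z) :
  exec (sval Z) g -> g (i0 R) = a -> g (i1 R) = b ->
  exists q : path_space a b, path_fun q = g.
Proof.
move=> Eg g0 g1; have [_ H _ _] := proj2_sig Z; have [cg _ _] := H _ Eg.
by exists (path_mk cg Eg g0 g1).
Qed.

Lemma gen_paths_moves (R : realType) (T : Type) (S : set T) (L : set (@unitI R -> T))
    (g : @unitI R -> T) :
  (forall l t, L l -> 0 < val t < 1 -> ~ S (l t)) -> gen_paths L g -> exists m, ~ S (g m).
Proof.
move=> Lin; elim=> {g} [l Ll|g phi _ [m nm] rphi|g h _ [m nm] _ _ gh].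
- by exists (cl 2^-1); apply: Lin => //; rewrite val_cl; lra.
- by have [m' e] := reparam_surj rphi m; exists m'; rewrite /comp e.
- by exists (cl (2^-1 * val m + 0)); rewrite concat_left.
Qed.

(** * The isomorphism between Ext and cat Y *)

Section Comparison.
Variables (R : realType) (hd : bool) (X Y : MdTop R hd) (f : hom X Y).
Local Notation I := (@unitI R).
Variables (finv : sval Y -> sval X) (L0 : set (I -> sval X)) (LY : set (I -> sval Y)).
Local Notation F := (sval f : sval X -> sval Y).
Hypotheses (finv_cont : continuous finv) (fK : cancel F finv) (finvK : cancel finv F)
  (HX : line_structure L0) (HY : line_structure LY) (hY : hausdorff_space (sval Y)).

Let SX : set (sval Y) := [set p | states (sval X) (finv p)].
Let EX : set (I -> sval Y) := [set g | exec (sval X) (finv \o g)].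
Let LX : set (I -> sval Y) := [set l | L0 (finv \o l)].
Let SY := states (sval Y).
Let EY := exec (sval Y).

Let F_cont : continuous F. Proof. by have [] := proj2_sig f. Qed.

Let F_finv (g : I -> sval Y) : F \o (finv \o g) = g.
Proof. by apply/funext => t; exact: finvK. Qed.

Let EXY : EX `<=` EY.
Proof. by move=> g Eg; have [_ _ H] := proj2_sig f; have := H _ Eg; rewrite F_finv. Qed.

Let SXY' : SX `<=` SY.
Proof. by move=> p Sp; have [_ H _] := proj2_sig f; have := H _ Sp; rewrite finvK. Qed.

Let EY_cont g : EY g -> continuous g.
Proof. by move=> Eg; have [_ H _ _] := proj2_sig Y; have [] := H _ Eg. Qed.

Lemma subdivision_lines : line_subdivision SX SY EX LX LY.
Proof.
have [_ Xe Xr Xc] := proj2_sig X; have [_ Ye Yr Yc] := proj2_sig Y.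
have [X1 X2 X3 X4 X5] := HX; have [Y1 Y2 Y3 Y4 Y5] := HY.
split=> //.
- by move=> l t Ll ht; exact: X2 Ll ht.
- by move=> l Ll; have [_ S0 S1] := Xe _ (X1 _ Ll).
- move=> p nS; have [l [t [Ll ht e]]] := X3 _ nS; exists (F \o l), t; split=> //.
    by rewrite /LX /mkset (_ : finv \o _ = l) //; apply/funext => s; exact: fK.
  by rewrite /= e finvK.
- move=> l l' t t' Ll Ll' ht ht' e.
  have [E1 E2] := X4 _ _ _ _ Ll Ll' ht ht' (congr1 finv e); split=> //.
  by rewrite -(F_finv l) -(F_finv l') E1.
- by move=> l Ll; exact: X1.
- by move=> g phi Eg rphi; exact: Xr Eg rphi.
- move=> g h Eg Eh e; rewrite /EX /mkset concat_comp; apply: Xc => //.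
  by rewrite /= e.
- by move=> l Ll; apply: Y5; apply: EXY; exact: X1.
- by move=> l Ll; have [_ S0 S1] := Ye _ (Y1 _ Ll).
- by move=> l Ll; apply: EY_cont; apply: EXY; exact: X1.
Qed.
Let sub := subdivision_lines.

Let pos_ex l (Ll : LX l) :=
  positions (LXin sub) (LXend sub) (LXuniq sub) (LXY sub) (LYin sub) Ll.
Definition line_positions l (Ll : LX l) : seq R := projT1 (cid (pos_ex Ll)).

Let S := states (sval X).
Let mkX p (h : SX p) : S := exist (fun x => x \in states (sval X)) (finv p) (mem_set h).
Let mkY p (h : SY p) : states (sval Y) := exist (fun x => x \in states (sval Y)) p (mem_set h).

Definition line_src l (Ll : LX l) : S := mkX (LXend sub Ll).1.
Definition line_tgt l (Ll : LX l) : S := mkX (LXend sub Ll).2.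

Lemma line_path_ex l (Ll : LX l) :
  exists q : path_space (val (line_src Ll)) (val (line_tgt Ll)), path_fun q = finv \o l.
Proof. by have [X1 _ _ _ _] := HX; apply: exec_path; [exact: X1 Ll|..]. Qed.

Variables (cells : Type) (line : cells -> I -> sval Y).
Hypotheses (LXj : forall j, LX (line j)) (line_inj : forall j j', line j = line j' -> j = j')
  (line_surj : forall l, LX l -> exists j, line j = l).
Implicit Types j : cells.

Definition cell_positions j : seq R := line_positions (LXj j).
Definition cell_size j := size (cell_positions j).

Let pos j (i : 'I_(cell_size j)) : R := nth 0 (cell_positions j) i.

Let posP j : sorted <%R (cell_positions j) /\
  forall x, x \in cell_positions j <->
    exists t : I, [/\ val t = x, 0 < val t < 1 & SY (line j t)].
Proof. exact: projT2 (cid (pos_ex (LXj j))). Qed.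

Definition time j (u : cst (cell_size j)) : I :=
  match u with Bot => i0 R | Top => i1 R | In i => cl (pos i) end.

Let time_in j (i : 'I_(cell_size j)) : [/\ val (time (In i)) = pos i,
  0 < pos i < 1 & SY (line j (time (In i)))].
Proof.
have [_ H] := posP j; have /H[t [e ht St]] : pos i \in cell_positions j by exact: mem_nth.
by rewrite /time -e clK; split.
Qed.

Lemma time_lt j (u v : cst (cell_size j)) : clt u v -> val (time u) < val (time v).
Proof.
case: u v => [||i] [||i'] // h; try by case: (no_clt_top h).
all: rewrite ?(erefl : val (time (Bot _)) = 0) ?(erefl : val (time (Top _)) = 1).
- by have [-> /andP[]] := time_in i'.
- by have [-> /andP[]] := time_in i.
- have [-> _ _] := time_in i; have [-> _ _] := time_in i'.
  have [st _] := posP j; rewrite /pos lt_sorted_ltn_nth //; exact: ltn_ord.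
Qed.

Lemma time_state j (u : cst (cell_size j)) : SY (line j (time u)).
Proof.
have [S0 S1] := LXend sub (LXj j).
by case: u => [||i]; [exact: SXY'|exact: SXY'|have [] := time_in i].
Qed.

Lemma time_surj j (t : I) : SY (line j t) -> exists u, time (j := j) u = t.
Proof.
move=> St; case: (I_cases t) => [->|->|ht]; [by exists (Bot _)|by exists (Top _)|].
have [_ H] := posP j; have : val t \in cell_positions j by apply/H; exists t.
rewrite -index_mem => h; exists (In (Ordinal h)).
by rewrite /time /pos /= nth_index ?clK // -index_mem.
Qed.

Definition cell_src j : S := line_src (LXj j).
Definition cell_tgt j : S := line_tgt (LXj j).
Local Notation est := (est S cell_size).

Definition old_point (a : S) : sval Y := F (val a).
Lemma old_pointP a : SX (old_point a).
Proof. by rewrite /SX /mkset /old_point fK; exact: set_mem (valP a). Qed.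

Definition point (x : est) : sval Y :=
  match x with Old a => old_point a | New j i => line j (time (In i)) end.

Lemma pointP x : SY (point x).
Proof. by case: x => [a|j i]; [exact: SXY' (old_pointP a)|exact: time_state]. Qed.

Definition new_state (x : est) : states (sval Y) := mkY (pointP x).

Lemma point_sg j u : point (@sg S cells cell_size cell_src cell_tgt j u) = line j (time u).
Proof. by case: u => [||i] //=; rewrite /old_point /= finvK. Qed.

Lemma point_old_or x : SX (point x) <-> old x.
Proof.
case: x => [a|j i]; first by split=> // _; exact: old_pointP.
split=> // Sx; have [e h _] := time_in i; exfalso.
by apply: (LXin sub (LXj j)) Sx; rewrite e.
Qed.

Lemma point_inj : injective point.
Proof.
move=> x y e; have := point_old_or x; rewrite e point_old_or.
case: x y e => [a|j i] [b|j' i'] // e h; try by [have := h.1 isT|have := h.2 isT].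
  by congr Old; apply: val_inj; rewrite -(fK (val a)) -(fK (val b)); congr finv.
have [E h1 _] := time_in i; have [E' h1' _] := time_in i'.
have [||ej et] := LXuniq sub (LXj j) (LXj j') (t := time (In i)) (t' := time (In i')) _ _ e.
- by rewrite E.
- by rewrite E'.
have {}ej := line_inj ej; subst j'; congr New; apply/val_inj.
have lt (k k' : 'I_(cell_size j)) : (k < k')%N -> time (In k) <> time (In k').
  by move=> kk E1; have := @time_lt j (In k) (In k') kk; rewrite E1 ltxx.
by case: (ltngtP i i') => // /lt; [case|case; rewrite et].
Qed.

Lemma new_state_bij : bijective new_state.
Proof.
have ex (y : states (sval Y)) : exists x, new_state x = y.
  suff [x e] : exists x, point x = val y by exists x; exact: val_inj.
  have [Sy|nS] := pselect (SX (val y)); first by exists (Old _ (mkX Sy)); exact: finvK.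
  have [l [t [Ll ht e]]] := LXcov sub nS; have [j ej] := line_surj Ll; subst l.
  have [u eu] : exists u, time (j := j) u = t by apply: time_surj; rewrite /= e; exact: set_mem (valP y).
  by exists (@sg S cells cell_size cell_src cell_tgt j u); rewrite point_sg eu.
exists (fun y => projT1 (cid (ex y))) => [x|y]; last exact: projT2 (cid (ex y)).
by apply: point_inj; exact: (congr1 val (projT2 (cid (ex (new_state x))))).
Qed.

Let FX : is_flow R hd (cat_flow X) := is_flow_cat X.
Let FY : is_flow R hd (cat_flow Y) := is_flow_cat Y.
Let old_state (a : S) : states (sval Y) := new_state (Old cell_size a).

Lemma push_path_ex (a b : S) (p : path_space (val a) (val b)) :
  exists q : path_space (val (old_state a)) (val (old_state b)), path_fun q = F \o path_fun p.
Proof.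
have [Ep p0 p1] := path_funP p; have [_ _ H] := proj2_sig f.
by apply: exec_path (H _ Ep) _ _; rewrite /comp ?p0 ?p1.
Qed.

Definition push_path (a b : S) (p : path_space (val a) (val b)) := projT1 (cid (push_path_ex p)).

Lemma push_pathE a b (p : path_space (val a) (val b)) :
  path_fun (push_path p) = F \o path_fun p.
Proof. exact: projT2 (cid (push_path_ex p)). Qed.

Let push_cls a b (p : path_space (val a) (val b)) : Defs.cat_path (old_state a) (old_state b) :=
  cls (push_path p).

Let push_cls_cont a b : continuous (@push_cls a b).
Proof.
apply: comp_cont (@cls_cont _ _ Y _ _); apply: (path_cont (@path_space_gen _ _ _ _)) => c cc.
apply/path_space_contP.
rewrite (_ : (fun _ => _) = fun x => F (path_fun (c x.1) x.2)); last first.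
  by apply/funext => x; rewrite /comp push_pathE.
by apply: comp_cont F_cont; apply/(path_space_contP c).
Qed.

Let push_cls_eq a b (p q : path_space (val a) (val b)) : reparam_rel p q -> push_cls p = push_cls q.
Proof. by move=> [phi rphi E]; apply: (cls_reparam rphi); rewrite !push_pathE E. Qed.

Let YT a b : in_Top R hd (Defs.cat_path (X := Y) a b). Proof. exact: in_Top_cat_path. Qed.

Definition push (a b : S) (c : Defs.cat_path a b) : Defs.cat_path (old_state a) (old_state b) :=
  push_cls (repr c).

Lemma pushE a b (p : path_space (val a) (val b)) : push (cls p) = push_cls p.
Proof. exact: (top_lift_eq (@path_space_gen _ _ _ _) (@push_cls_cont a b) (in_Top_sep (YT _ _)) (@push_cls_eq a b)). Qed.

Lemma push_cont a b : continuous (@push a b).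
Proof. exact: (top_lift_cont (@path_space_gen _ _ _ _) (@push_cls_cont a b) (in_Top_sep (YT _ _)) (@push_cls_eq a b)). Qed.

Lemma pushM a b c (x : flow_path (f := cat_flow X) a b) (y : flow_path b c) :
  push (flow_concat x y) = flow_concat (push x : flow_path (f := cat_flow Y) _ _) (push y).
Proof.
have [p <-] := cls_surj x; have [q <-] := cls_surj y.
rewrite flow_concatE !pushE flow_concatE; congr cls; apply: path_fun_inj.
by rewrite push_pathE !path_fun_concat concat_comp !push_pathE.
Qed.


Let sgj j u := @sg S cells cell_size cell_src cell_tgt j u.

Lemma seg_exec j (u v : cst (cell_size j)) : clt u v -> EY (seg (line j) (time u) (time v)).
Proof.
have [_ _ Yr Yc] := proj2_sig Y; have [Y1 _ _ _ _] := HY.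
move=> h; apply: (line_seg (LXin sub) (LXend sub) (LXuniq sub) (LXY sub) (LYin sub) (LYend sub) Y1).
- exact: Yr.
- exact: Yc.
- exact: LXj.
- exact: time_lt.
- exact: time_state.
- exact: time_state.
Qed.

Lemma seg_path_ex j (u v : cst (cell_size j)) : clt u v ->
  exists q : path_space (val (new_state (sgj u))) (val (new_state (sgj v))),
    path_fun q = seg (line j) (time u) (time v).
Proof.
by move=> h; apply: exec_path (seg_exec h) _ _; rewrite ?seg_at0 ?seg_at1 /= point_sg.
Qed.

Definition seg_path j (u v : cst (cell_size j)) (h : clt u v) := projT1 (cid (seg_path_ex h)).

Lemma seg_pathE j (u v : cst (cell_size j)) (h : clt u v) :
  path_fun (seg_path h) = seg (line j) (time u) (time v).
Proof. exact: projT2 (cid (seg_path_ex h)). Qed.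

Definition seg_cls j (u v : cst (cell_size j)) (h : clt u v) :
  flow_path (f := cat_flow Y) (new_state (sgj u)) (new_state (sgj v)) := cls (seg_path h).

Lemma seg_clsM j (u v w : cst (cell_size j)) (h : clt u v) (h' : clt v w) (h'' : clt u w) :
  flow_concat (seg_cls h) (seg_cls h') = seg_cls h''.
Proof.
rewrite flow_concatE.
have [chi rchi E] := concat_seg (line j) (time_lt h) (time_lt h').
by apply: (cls_reparam rchi); rewrite path_fun_concat !seg_pathE.
Qed.

Definition cell_path j : path_space (val (cell_src j)) (val (cell_tgt j)) :=
  projT1 (cid (line_path_ex (LXj j))).

Lemma cell_pathE j : path_fun (cell_path j) = finv \o line j.
Proof. exact: projT2 (cid (line_path_ex (LXj j))). Qed.

Definition cell_cls j : Defs.cat_path (cell_src j) (cell_tgt j) := cls (cell_path j).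

Lemma push_cell j : push (cell_cls j) = seg_cls (erefl true : clt (Bot _) (Top (cell_size j))).
Proof.
rewrite pushE; congr cls; apply: path_fun_inj.
apply: etrans (push_pathE _) _; rewrite cell_pathE F_finv.
by apply: etrans (esym (seg01 _)) _; symmetry; exact: seg_pathE.
Qed.

Definition seg_dn j (i : 'I_(cell_size j)) := seg_cls (erefl true : clt (Bot _) (In i)).
Definition seg_up j (i : 'I_(cell_size j)) := seg_cls (ltn_ord i : clt (In i) (Top _)).

Definition seg_ch (x y : est) : chain x y ->
    flow_path (f := cat_flow Y) (new_state x) (new_state y) :=
  match x, y return chain x y -> flow_path (f := cat_flow Y) (new_state x) (new_state y) with
  | New j i, New j' i' => fun h =>
      match (asboolW (proj1 (elimTF andP h))) in _ = j'
        return forall i' : 'I_(cell_size j'), (i < i')%N ->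
          flow_path (f := cat_flow Y) (new_state (New S i)) (new_state (New S i')) with
      | erefl => fun i' hl => seg_cls (hl : clt (In i) (In i'))
      end i' (proj2 (elimTF andP h))
  | _, _ => fun h => False_rect _ (notF h)
  end.

Lemma seg_chE j (i i' : 'I_(cell_size j)) (h : chain (New S i) (New S i')) (hl : clt (In i) (In i')) :
  seg_ch h = seg_cls hl.
Proof.
rewrite /seg_ch (Prop_irrelevance (asboolW _) erefl).
by rewrite (bool_irrelevance (proj2 (elimTF andP h)) hl).
Qed.

Let AX (a b : S) : topologicalType := Defs.cat_path (X := X) a b.
Let aX (a b c : S) (x : AX a b) (y : AX b c) : AX a c := flow_concat (f := cat_flow X) x y.
Let AX_flow : is_flow R hd (FlowData aX). Proof. by have [? ? ?] := FX; split. Qed.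
Local Notation E := (@epath S cells cell_size cell_src cell_tgt AX).

Definition assemble (x y : est) : E x y -> flow_path (f := cat_flow Y) (new_state x) (new_state y) :=
  @eout S cells cell_size cell_src cell_tgt AX (cat_flow Y) new_state push seg_up seg_dn seg_ch x y.

Lemma assemble_cont x y : continuous (@assemble x y).
Proof.
apply: (@eout_cont R hd S cells cell_size cell_src cell_tgt AX (cat_flow Y) new_state FY) => [|a b].
  exact: (@in_Top_epath R hd S cells cell_size cell_src cell_tgt AX aX AX_flow x y).
exact: push_cont.
Qed.

Lemma assembleM x y z (u : E x y) (u' : E y z) :
  assemble (ecomp aX cell_cls u u') = flow_concat (assemble u) (assemble u').
Proof.
apply: (@eoutM R hd S cells cell_size cell_src cell_tgt AX aX cell_cls (cat_flow Y) new_state FY) => //.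
- exact: pushM.
- move=> j i; rewrite push_cell; exact: (@seg_clsM j (Bot _) (In i) (Top _)).
- move=> j i i' h; rewrite (seg_chE h (proj2 (elimTF andP h))).
  exact: (@seg_clsM j (Bot _) (In i) (In i')).
- move=> j i i' h; rewrite (seg_chE h (proj2 (elimTF andP h))).
  exact: (@seg_clsM j (In i) (In i') (Top _)).
- move=> [a|j i] [b|j' i'] [c|j'' i''] // h h' h''.
  have [/asboolP e l] := andP h; have [/asboolP e' l'] := andP h'; subst j' j''.
  rewrite (seg_chE h l) (seg_chE h' l') (seg_chE h'' (ltn_trans l l')).
  exact: (@seg_clsM j (In i) (In i') (In i'')).
Qed.

Definition assemble_map : flow_map (ext_flow cell_size aX cell_cls) (cat_flow Y) :=
  @FlowMap (ext_flow cell_size aX cell_cls) (cat_flow Y) new_state assemble assemble_cont assembleM.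

Lemma assemble_seg j (u v : cst (cell_size j)) (h : clt u v) :
  exists w : E (sgj u) (sgj v), assemble w = seg_cls h.
Proof.
case: u v h => [||i] [||i'] // h; try by case: (no_clt_top h).
- exists (inl (cell_cls j)); apply: etrans (eout_old _ _ _ _ _) _; rewrite push_cell.
  by rewrite (bool_irrelevance h (erefl true : clt (Bot _) (Top _))).
- exists (inr (exist (fun e => kc cell_src cell_tgt (Old cell_size (cell_src j)) (New S i') e) true (kc_bot _ _ i'))).
  apply: etrans (eout_dn _ _ _ _ _) _; 
  by rewrite (bool_irrelevance h (erefl true : clt (Bot _) (In i'))).
- exists (inr (exist (fun e => kc cell_src cell_tgt (New S i) (Old cell_size (cell_tgt j)) e) true (kc_top _ _ i))).
  apply: etrans (eout_up _ _ _ _ _) _; 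
  by rewrite (bool_irrelevance h (ltn_ord i : clt (In i) (Top _))).
- exists (inr (exist (fun e => kc cell_src cell_tgt (New S i) (New S i') e) false (kc_chain _ _ h))).
  apply: etrans (eout_ch _ _ _ _ _) _; exact: seg_chE.
Qed.

Lemma point_surj p : SY p -> exists x, point x = p.
Proof.
move=> Sp; have [th _ thK] := new_state_bij.
by exists (th (mkY Sp)); exact: (congr1 val (thK (mkY Sp))).
Qed.

(** Induction on the generation of execution paths by lines of Y. By [sub_line] such a line is, up
    to reparametrization, a segment of a line of X between two of its states of Y. *)
Lemma assemble_surj x y (c : flow_path (f := cat_flow Y) (new_state x) (new_state y)) :
  exists u : E x y, assemble u = c.
Proof.
have [p <-] := cls_surj c; move: {c} (erefl (path_fun p)).
move: {2}(path_fun p) => g pg; have Eg : EY g by rewrite -pg; case: (path_funP p).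
have [_ Ye Yr Yc] := proj2_sig Y; have [Y1 _ _ _ Y5] := HY.
have gen_exec h : gen_paths LY h -> EY h.
  by elim=> [l /Y1|h' phi _ Eh rphi|h1 h2 _ E1 _ E2 e] //; [exact: Yr|exact: Yc].
elim: (Y5 _ Eg) x y p pg => {g Eg} [m Lm|g phi Gg IH rphi|g h Gg IHg Gh IHh gh] x y p pg.
- have [l [u [u' [Ll uu H]]]] := sub_line (SXY sub) (LXin sub) (LXend sub) (LXcov sub)
    (LXuniq sub) (LXY sub) (LYin sub) (LYend sub) (LYuniq sub) Lm.
  have rm := H m _ _ (run_id m (b := i0 R) (c := i1 R) ler01).
  have [_ _ m0 m1] := run_ends rm; have [_ [chi rchi Em]] := run_seg rm uu.
  rewrite seg01 in Em; have [j ej] := line_surj Ll; subst l.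
  have [Sm0 Sm1] := LYend sub Lm.
  have [cu eu] : exists cu, time (j := j) cu = u by apply: time_surj; rewrite /= -m0.
  have [cv ev] : exists cv, time (j := j) cv = u' by apply: time_surj; rewrite /= -m1.
  have [_ p0 p1] := path_funP p.
  have ex : x = sgj cu by apply: point_inj; rewrite point_sg eu; apply: etrans m0; rewrite -pg; exact: esym p0.
  have ey : y = sgj cv by apply: point_inj; rewrite point_sg ev; apply: etrans m1; rewrite -pg; exact: esym p1.
  subst x y; have h : clt cu cv.
    rewrite /clt ltnNge leq_eqVlt; apply/negP => /orP[/eqP/rk_inj e|].
      by move: uu; rewrite -eu -ev e ltxx.
    by move=> /(@time_lt j cv cu); rewrite eu ev => /(lt_trans uu); rewrite ltxx.
  have [w ew] := assemble_seg h; exists w; rewrite ew; apply: (cls_reparam rchi).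
  by rewrite pg seg_pathE eu ev.
- have [_ p0 p1] := path_funP p.
  have [||q eq] := exec_path (a := val (new_state x)) (b := val (new_state y)) (gen_exec _ Gg).
  + by rewrite -p0 pg /comp reparam0.
  + by rewrite -p1 pg /comp reparam1.
  have [u eu] := IH x y q eq; exists u; rewrite eu; apply: (cls_reparam rphi).
  by rewrite pg eq.
- have [_ p0 p1] := path_funP p; rewrite pg concat0 in p0; rewrite pg concat1 in p1.
  have [_ _ Sg1] := Ye _ (gen_exec _ Gg); have [z ez] := point_surj Sg1.
  have [q eq] := exec_path (a := val (new_state x)) (b := val (new_state z)) (gen_exec _ Gg) p0 (esym ez).
  have [q' eq'] := exec_path (a := val (new_state z)) (b := val (new_state y)) (gen_exec _ Gh)
    (etrans (esym gh) (esym ez)) p1.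
  have [u eu] := IHg x z q eq; have [u' eu'] := IHh z y q' eq'.
  exists (ecomp aX cell_cls u u'); rewrite assembleM eu eu' flow_concatE.
  by congr cls; apply: path_fun_inj; rewrite path_fun_concat eq eq' pg.
Qed.

Variable U : sval X -> I.
Hypotheses (cU : continuous U) (U0 : forall z, states (sval X) z -> U z = i0 R)
  (UE : forall g, exec (sval X) g -> exists s, U (g s) = i1 R).

(** The first state of X that a path starting at [x] can meet; [back] is the last one before
    arriving at a state. *)
Definition front (x : est) : sval Y :=
  match x with Old a => old_point a | New j _ => line j (i1 R) end.
Definition back (x : est) : sval Y :=
  match x with Old a => old_point a | New j _ => line j (i0 R) end.

Let finv_front x : finv (front x) = val (tx cell_tgt x).
Proof. by case: x => [a|j i] //=; exact: fK. Qed.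
Let finv_back x : finv (back x) = val (sx cell_src x).
Proof. by case: x => [a|j i] //=; exact: fK. Qed.

Let start_pt x : exists Rel, start_at SX LX (point x) (front x) Rel.
Proof.
case: x => [a|j i]; first by eexists; apply: StartState; exact: old_pointP.
have [e h _] := time_in i.
by eexists; apply: (StartLine (v := time (In i)) _ (LXj j)) => //; rewrite e.
Qed.

Let end_pt x : exists Rel, end_at SX LX (point x) (back x) Rel.
Proof.
case: x => [a|j i]; first by eexists; apply: EndState; exact: old_pointP.
have [e h _] := time_in i.
by eexists; apply: (EndLine (v := time (In i)) _ (LXj j)) => //; rewrite e.
Qed.

Local Notation YP x y := (path_space (val (new_state x)) (val (new_state y))).

(* The graph of the inverse of [assemble], on execution paths: it is continuous
   because [cut] is, although the times [s1] and [s2] of the cuts are not. *)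
Definition decomposes x y (p : YP x y) (u : E x y) : Prop :=
  match u with
  | inl v => (exists s, SX (path_fun p s)) /\
      exists q : path_space (val (tx cell_tgt x)) (val (sx cell_src y)),
        v = cls q /\ path_fun q = finv \o cut (front x) (back y) (path_fun p)
  | inr (exist true _) => (exists s, SX (path_fun p s)) /\
      cut (front x) (back y) (path_fun p) = fun=> front x
  | inr (exist false _) => inside LX (path_fun p) (i1 R)
  end.

Let exec_nonconst g (z : sval X) : exec (sval X) g -> states (sval X) z -> g <> fun=> z.
Proof. by move=> /UE[s es] Sz e; move: es; rewrite e U0 // => /(congr1 val) /eqP; rewrite /= eq_sym oner_eq0. Qed.

Let front_state x : states (sval X) (finv (front x)).
Proof. by rewrite finv_front; exact: set_mem (valP _). Qed.

(** The three cases exclude each other: a path inside one line meets no state of X, and a constant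
    cut is not an execution path of X. Cutting commutes with reparametrization. *)
Lemma decomposes_reparam x y (p p' : YP x y) (u u' : E x y) : reparam_rel p p' ->
  decomposes p u -> decomposes p' u' -> u = u'.
Proof.
move=> [phi rphi Ep].
have st : (exists s, SX (path_fun p s)) -> exists s, SX (path_fun p' s).
  by move=> [s Ss]; have [t et] := reparam_surj rphi s; exists t; rewrite Ep /comp et.
have st' : (exists s, SX (path_fun p' s)) -> exists s, SX (path_fun p s).
  by move=> [s Ss]; exists (phi s); move: Ss; rewrite Ep.
have nin (r : YP x y) : (exists s, SX (path_fun r s)) -> ~ inside LX (path_fun r) (i1 R).
  by move=> [s Ss] ins; exact: inside_no_state sub _ _ ins Ss.
have Ec : cut (front x) (back y) (path_fun p') = cut (front x) (back y) (path_fun p) \o phi.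
  by rewrite Ep; exact: cut_comp.
case: u => [v|[[] h]]; case: u' => [v'|[[] h']]; rewrite /decomposes ?Ec.
- move=> [_ [q [-> Eq]]] [_ [q' [-> Eq']]]; congr inl; apply: (cls_reparam rphi).
  by rewrite Eq' Eq.
- move=> [_ [q [_ Eq]]] [_ E2]; exfalso.
  have [Ex _ _] := path_funP q; apply: (exec_nonconst Ex (front_state x)).
  rewrite Eq; apply/funext => s; have [t et] := reparam_surj rphi s.
  by rewrite /comp -et; congr finv; exact: (congr1 (fun k => k t) E2).
- by move=> [/st/nin n _] /n.
- move=> [_ E2] [_ [q [_ Eq]]]; exfalso.
  have [Ex _ _] := path_funP q; apply: (exec_nonconst Ex (front_state x)).
  by rewrite Eq E2.
- by move=> _ _; congr inr; exact: val_inj.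
- by move=> [/st/nin n _] /n.
- by move=> ins [S0 _]; case: (nin p) => //; exact: st'.
- by move=> ins [S0 _]; case: (nin p) => //; exact: st'.
- by move=> _ _; congr inr; exact: val_inj.
Qed.

(** One case holds for the whole family. In the two degenerate cases the decomposition is constant,
    and otherwise it is the class of a continuous family of cut paths. *)
Lemma decomposes_family x y (c : I -> YP x y) : continuous c ->
  exists2 d : I -> E x y, continuous d & forall r, decomposes (c r) (d r).
Proof.
move=> /path_space_contP cc.
have [_ _ _ _ Y5] := HY.
pose G (z : I * I) := path_fun (c z.1) z.2.
have Gx r : G (r, i0 R) = point x by have [] := path_funP (c r).
have Gy r : G (r, i1 R) = point y by have [] := path_funP (c r).
have Gg r : gen_paths LY (fun s => G (r, s)) by apply: Y5; have [] := path_funP (c r).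
have [Rel sp] := start_pt x; have [Rel' ep] := end_pt y.
have UEY g : EX g -> exists s, (U \o finv) (g s) = i1 R by exact: UE.
have [ins|acr] := family_cases sub hY cc (pointP x) sp Gx Gy Gg.
  have [l [v [v' [Ll v0 vv v1 [g0 g1]]]]] := inside_ends (ins (i0 R)).
  have [j ej] := line_surj Ll; subst l.
  have {}g0 : point x = line j v by rewrite -(Gx (i0 R)); exact: g0.
  have {}g1 : point y = line j v' by rewrite -(Gy (i0 R)); exact: g1.
  have Sv : SY (line j v) by rewrite /= -g0; exact: pointP.
  have Sv' : SY (line j v') by rewrite /= -g1; exact: pointP.
  have [cu eu] := time_surj Sv; have [cv ev] := time_surj Sv'.
  have ex : x = sgj cu by apply: point_inj; rewrite point_sg eu g0.
  have ey : y = sgj cv by apply: point_inj; rewrite point_sg ev g1.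
  have ch : chain x y.
    subst x y; case: cu cv eu ev {sp ep c cc G Gx Gy Gg ins g0 g1 Sv Sv'} => [||i] [||i'] /= eu ev.
    all: try by [move: v0; rewrite -eu ltxx].
    all: try by [move: (lt_trans v0 vv); rewrite -ev ltxx].
    all: try by [move: (lt_trans vv v1); rewrite -eu ltxx].
    all: try by [move: v1; rewrite -ev ltxx].
    apply/andP; split; first by apply/asboolP.
    rewrite ltnNge leq_eqVlt; apply/negP => /orP[/eqP/val_inj e|h].
      by move: vv; rewrite -eu -ev e ltxx.
    have := @time_lt j (In i') (In i) h; rewrite /time eu ev => h'.
    by move: (lt_trans vv h'); rewrite ltxx.
  exists (fun=> inr (exist (fun e => kc cell_src cell_tgt x y e) false ch)); first exact: cst_cont.
  by move=> r; exact: ins.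
have st r : exists s, SX (path_fun (c r) s).
  by have [s1 [s2 [_ _ Ss _ _]]] := acr r; exists s2.
have [[pq H]|H] := cut_family_cases sub hY cc sp ep Gx Gy acr (comp_cont finv_cont cU) (fun z => @U0 (finv z)) UEY.
  have k : kc cell_src cell_tgt x y true.
    apply/andP; split.
      by apply/asboolP; apply: val_inj; rewrite -finv_front -finv_back pq.
    (* Between old states nothing is cut off, so a constant cut would be the path itself; but an
       execution path leaves the states. *)
    apply/negP => /andP[ox oy].
    have cutE : cut (front x) (back y) (path_fun (c (i0 R))) = path_fun (c (i0 R)).
      rewrite /cut cutL_start; last by apply: etrans (Gx (i0 R)) _; case: (x) ox.
      by rewrite cutR_end //; apply: etrans (Gy (i0 R)) _; case: (y) oy.
    have [m nm] := gen_paths_moves (LYin sub) (Gg (i0 R)).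
    apply: nm; apply: SXY'; have := congr1 (fun k => k m) (etrans (esym cutE) (H (i0 R))).
    by rewrite /G => -> ; exact: front_state.
  exists (fun=> inr (exist (fun e => kc cell_src cell_tgt x y e) true k)); first exact: cst_cont.
  by move=> r; split; [exact: st|exact: H].
have qex r : exists q : path_space (val (tx cell_tgt x)) (val (sx cell_src y)),
    path_fun q = finv \o cut (front x) (back y) (path_fun (c r)).
  have [e0 e1] := cut_ends sub (g := path_fun (c r)) (p := front x) (q := back y)
    (eq_ind_r (fun z => start_at SX LX z _ Rel) sp (Gx r)) (eq_ind_r (fun z => end_at SX LX z _ Rel') ep (Gy r)) (acr r).
  by apply: exec_path (H r) _ _; rewrite /comp ?e0 ?e1 ?finv_front ?finv_back.
pose q r := projT1 (cid (qex r)).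
have qE r : path_fun (q r) = finv \o cut (front x) (back y) (path_fun (c r)) by exact: projT2 (cid (qex r)).
exists (fun r => inl (cls (q r))); last by move=> r; split; [exact: st|exists (q r)].
apply: comp_cont (@inl_cont _ _); apply: comp_cont (@cls_cont _ _ X _ _).
apply/path_space_contP.
rewrite (_ : (fun _ => _) = fun z : I * I => finv (cut (front x) (back y) (fun s => G (z.1, s)) z.2)); last first.
  by apply/funext => z; rewrite qE.
exact: comp_cont (cut_family_cont sub hY cc sp ep Gx Gy acr) finv_cont.
Qed.


Lemma decomposes_ex x y (p : YP x y) : exists u, decomposes p u.
Proof.
have [d _ dP] := decomposes_family (@cst_cont I _ p).
by exists (d (i0 R)); exact: (dP (i0 R)).
Qed.

Lemma decomposes_fun x y (p : YP x y) (u u' : E x y) : decomposes p u -> decomposes p u' -> u = u'.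
Proof. exact: decomposes_reparam (reparam_rel_refl p). Qed.

Definition decompose_path x y (p : YP x y) : E x y := projT1 (cid (decomposes_ex p)).

Lemma decompose_pathP x y (p : YP x y) : decomposes p (decompose_path p).
Proof. exact: projT2 (cid (decomposes_ex p)). Qed.

Lemma decompose_path_cont x y : continuous (@decompose_path x y).
Proof.
apply: (path_cont (@path_space_gen _ _ _ _)) => c cc; have [d cd dP] := decomposes_family cc.
rewrite (_ : _ \o c = d) //; apply/funext => r.
exact: decomposes_fun (decompose_pathP (c r)) (dP r).
Qed.

Let ET x y : in_Top R hd (E x y).
Proof. exact: (@in_Top_epath R hd S cells cell_size cell_src cell_tgt AX aX AX_flow x y). Qed.

Lemma decompose_path_eq x y (p p' : YP x y) : reparam_rel p p' -> decompose_path p = decompose_path p'.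
Proof. by move=> pp; exact: decomposes_reparam pp (decompose_pathP p) (decompose_pathP p'). Qed.

Definition split_path x y (c : Defs.cat_path (X := Y) (new_state x) (new_state y)) : E x y :=
  decompose_path (repr c).

Lemma split_pathE x y (p : YP x y) : split_path (cls p) = decompose_path p.
Proof.
exact: (top_lift_eq (@path_space_gen _ _ _ _) (@decompose_path_cont x y) (in_Top_sep (ET _ _)) (@decompose_path_eq x y)).
Qed.

Lemma split_path_cont x y : continuous (@split_path x y).
Proof.
exact: (top_lift_cont (@path_space_gen _ _ _ _) (@decompose_path_cont x y) (in_Top_sep (ET _ _)) (@decompose_path_eq x y)).
Qed.

Lemma seg_avoids j (u v : cst (cell_size j)) s : clt u v ->
  0 < val (time u) + val s * (val (time v) - val (time u)) < 1 ->
  ~ SX (seg (line j) (time u) (time v) s).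
Proof.
move=> /time_lt lt h; apply: (LXin sub (LXj j)); rewrite val_seg //; exact: ltW.
Qed.

Lemma up_avoids j (i : 'I_(cell_size j)) s : val s < 1 ->
  seg (line j) (time (In i)) (i1 R) s <> line j (i1 R).
Proof.
move=> s1 e; apply: (@seg_avoids j (In i) (Top _) s (ltn_ord i)).
  have [-> /andP[h0 h1] _] := time_in i; rewrite (erefl : val (time (Top _)) = 1).
  by have := I_ge0 s => s0; apply/andP; split; nra.
by rewrite e; case: (LXend sub (LXj j)).
Qed.

Lemma dn_avoids j (i : 'I_(cell_size j)) s : 0 < val s ->
  seg (line j) (i0 R) (time (In i)) s <> line j (i0 R).
Proof.
move=> s0 e; apply: (@seg_avoids j (Bot _) (In i) s (erefl true)).
  have [-> /andP[h0 h1] _] := time_in i; rewrite (erefl : val (time (Bot _)) = 0).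
  by have := I_le1 s => s1; apply/andP; split; nra.
by rewrite e; case: (LXend sub (LXj j)).
Qed.

Lemma compose_cast (a b c d : states (sval Y)) (p1 : path_space (val a) (val b)) (e : b = c)
    (p2 : path_space (val c) (val d)) :
  exists p : path_space (val a) (val d), path_fun p = concat (path_fun p1) (path_fun p2) /\
    inl (cls p) = mul (@flow_concat (cat_flow Y)) (mul (@flow_concat (cat_flow Y))
      (inl (cls p1 : flow_path (f := cat_flow Y) a b)) (pid _ e))
      (inl (cls p2 : flow_path (f := cat_flow Y) c d)).
Proof.
subst c; exists (concat_path p1 p2); split; first exact: path_fun_concat.
rewrite mulp1; apply: etrans (esym (mulll _ _ _)); apply: (congr1 inl); symmetry; exact: flow_concatE.
Qed.

Let assembleE x y (u : E x y) :
  inl (assemble u) = eoutp (G := cat_flow Y) (th := new_state) push seg_up seg_dn seg_ch (emb u).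
Proof. exact: eoutE. Qed.

(** Exhibits a concatenation of an upper piece, a path of X and a lower piece. Its cut is the middle
    path with pauses, which explains the reparametrizations [reparam_early] and [reparam_late] of
    the representative. *)
Lemma assemble_decomposes x y (u : E x y) : exists p : YP x y, cls p = assemble u /\ decomposes p u.
Proof.
have [_ _ Xr _] := proj2_sig X.
have [_ _ gA] := FY.
have aq (a b : S) (q : path_space (val a) (val b)) phi : reparam phi ->
    exists q' : path_space (val a) (val b), cls q = cls q' /\ path_fun q' = path_fun q \o phi.
  move=> rphi; have [Eq q0 q1] := path_funP q.
  have [q' eq'] := exec_path (Xr _ _ Eq rphi) (etrans (congr1 (path_fun q) (reparam0 rphi)) q0)
    (etrans (congr1 (path_fun q) (reparam1 rphi)) q1).
  by exists q'; split=> //; apply: (cls_reparam rphi).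
have finvF (g : I -> sval X) : finv \o (F \o g) = g by apply/funext => t; exact: fK.
case: u => [v|[[] h]].
- have [a ea] := cls_surj v; have [_ a0 a1] := path_funP a.
  case: x y v a ea a0 a1 => [b|j i] [b'|j' i'] v a ea a0 a1.
  + exists (push_path a); split; first by rewrite -ea; apply: etrans (esym (pushE a)) _; symmetry; exact: (@eout_old S cells cell_size cell_src cell_tgt AX (cat_flow Y) new_state push seg_up seg_dn seg_ch b b' (cls a)).
    have p0 : path_fun (push_path a) (i0 R) = old_point b by rewrite push_pathE /comp a0.
    have p1 : path_fun (push_path a) (i1 R) = old_point b' by rewrite push_pathE /comp a1.
    split; first by exists (i0 R); rewrite p0; exact: old_pointP.
    exists a; split; first by rewrite ea.
    by rewrite /cut cutL_start // cutR_end // push_pathE finvF.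
  + exists (concat_path (push_path a) (seg_path (erefl true : clt (Bot _) (In i')))); split.
      rewrite -flow_concatE; apply: (@inl_inj _ {_ : unit | `[< new_state (Old _ b) = new_state (New _ i') >]}).
      rewrite assembleE /eoutp /emb -ea; symmetry.
      apply: etrans (congr1 (fun z => mul _ z _) (@mul1p _ _ _ _ _ _ _)) _.
      by apply: etrans (mulll _ _ _) _; exact: (congr1 (fun z => inl (@flow_concat (cat_flow Y) _ _ _ z (seg_dn i'))) (pushE a)).
    have [q [eq Eq]] := aq _ _ a _ (reparam_early R).
    split.
      by exists (i0 R); rewrite path_fun_concat concat0 push_pathE /comp a0; exact: old_pointP.
    exists q; split; first by rewrite -ea.
    have Fa1 : (F \o path_fun a) (i1 R) = line j' (i0 R) by rewrite /comp a1; exact: finvK.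
    rewrite Eq path_fun_concat [X in concat _ X]seg_pathE [X in concat X _]push_pathE /cut cutL_start; last by rewrite concat0 /comp a0.
    rewrite (cutR_concat (seg_at0 (line j') (i0 R) (time (In i'))) Fa1 (@dn_avoids j' i')).
    by apply/funext => t; rewrite /comp fK.
  + exists (concat_path (seg_path (ltn_ord i : clt (In i) (Top _))) (push_path a)); split.
      rewrite -flow_concatE; apply: (@inl_inj _ {_ : unit | `[< new_state (New _ i) = new_state (Old _ b') >]}).
      rewrite assembleE /eoutp /emb -ea; symmetry; apply: etrans (@mulp1 _ _ _ _ _ _ _) _.
      by apply: etrans (mulll _ _ _) _; exact: (congr1 (fun z => inl (@flow_concat (cat_flow Y) _ _ _ (seg_up i) z)) (pushE a)).
    have [q [eq Eq]] := aq _ _ a _ (reparam_late R).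
    have Fa1 : F (path_fun a (i1 R)) = old_point b' by rewrite a1.
    split.
      by exists (i1 R); rewrite path_fun_concat concat1 push_pathE /comp Fa1; exact: old_pointP.
    exists q; split; first by rewrite -ea.
    have Fa0 : (F \o path_fun a) (i0 R) = line j (i1 R) by rewrite /comp a0; exact: finvK.
    rewrite Eq path_fun_concat [X in concat X _]seg_pathE [X in concat _ X]push_pathE /cut.
    rewrite (cutL_concat (seg_at1 (line j) (time (In i)) (i1 R)) Fa0 (@up_avoids j i)).
    rewrite cutR_end; last by rewrite /comp (reparam1 (reparam_late R)).
    by apply/funext => t; rewrite /comp fK.
  + exists (concat_path (seg_path (ltn_ord i : clt (In i) (Top _)))
      (concat_path (push_path a) (seg_path (erefl true : clt (Bot _) (In i'))))); split.
      rewrite -!flow_concatE; apply: (@inl_inj _ {_ : unit | `[< new_state (New _ i) = new_state (New _ i') >]}).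
      rewrite assembleE /eoutp /emb -ea; symmetry.
      apply: etrans (congr1 (fun z => mul _ z _) (mulll _ _ _)) _.
      apply: etrans (mulll _ _ _) _; rewrite -gA.
      exact: (congr1 (fun z => inl (@flow_concat (cat_flow Y) _ _ _
        (@flow_concat (cat_flow Y) _ _ _ (seg_up i) z) (seg_dn i'))) (pushE a)).
    have [q [eq Eq]] := aq _ _ a _ (reparam_early R).
    have [q' [eq' Eq']] := aq _ _ q _ (reparam_late R).
    have Fa1 : (F \o path_fun a) (i1 R) = line j' (i0 R) by rewrite /comp a1; exact: finvK.
    have Fa0 : concat (F \o path_fun a) (seg (line j') (i0 R) (time (In i'))) (i0 R) = line j (i1 R).
      by rewrite concat0 /comp a0; exact: finvK.
    split.
      exists (cl 2^-1); rewrite path_fun_concat concatE val_cl ?lexx ?mulfV //; [|lra..].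
      by rewrite cl_ge1 // [path_fun _]seg_pathE seg_at1; case: (LXend sub (LXj j)).
    exists q'; split; first by rewrite -ea eq eq'.
    rewrite Eq' Eq path_fun_concat [X in concat _ X]path_fun_concat [X in concat X (concat _ _)]seg_pathE.
    rewrite [X in concat _ (concat X _)]push_pathE [X in concat _ (concat _ X)]seg_pathE /cut.
    rewrite (cutL_concat (seg_at1 (line j) (time (In i)) (i1 R)) Fa0 (@up_avoids j i)).
    rewrite (cutR_comp _ _ (reparam_late R)).
    rewrite (cutR_concat (seg_at0 (line j') (i0 R) (time (In i'))) Fa1 (@dn_avoids j' i')).
    by apply/funext => t; rewrite /comp fK.
- case: x y h => [b|j i] [b'|j' i'] h; first by exfalso; rewrite /kc andbF in h.
  + have e : b = cell_src j' by exact: kc_id h.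
    subst b; exists (seg_path (erefl true : clt (Bot _) (In i'))); split; first by symmetry; exact: (@eout_dn S cells cell_size cell_src cell_tgt AX (cat_flow Y) new_state push seg_up seg_dn seg_ch j' i' h).
    rewrite /decomposes [path_fun _]seg_pathE; have fr : old_point (cell_src j') = line j' (i0 R) by exact: finvK.
    split; first by exists (i0 R); rewrite seg_at0; case: (LXend sub (LXj j')).
    rewrite /cut cutL_start ?seg_at0 // [front _]fr.
    by apply: cutR_only; [rewrite seg_at0|exact: dn_avoids].
  + have e : cell_tgt j = b' by exact: kc_id h.
    subst b'; exists (seg_path (ltn_ord i : clt (In i) (Top _))); split; first by symmetry; exact: (@eout_up S cells cell_size cell_src cell_tgt AX (cat_flow Y) new_state push seg_up seg_dn seg_ch j i h).
    rewrite /decomposes [path_fun _]seg_pathE; have fr : old_point (cell_tgt j) = line j (i1 R) by exact: finvK.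
    split; first by exists (i1 R); rewrite seg_at1; case: (LXend sub (LXj j)).
    rewrite /cut cutL_only; [|by rewrite seg_at1|exact: up_avoids].
    by rewrite cutR_end // [back _]fr.
  + have e : cell_tgt j = cell_src j' by exact: kc_id h.
    have e' : new_state (Old cell_size (cell_tgt j)) = new_state (Old cell_size (cell_src j')).
      by rewrite e.
    have [p [pE Ep]] := compose_cast (seg_path (ltn_ord i : clt (In i) (Top _))) e'
      (seg_path (erefl true : clt (Bot _) (In i'))).
    exists p; split.
      apply: (@inl_inj _ {_ : unit | `[< new_state (New _ i) = new_state (New _ i') >]}).
      rewrite assembleE /eoutp /emb plus_map_pid Ep; symmetry.
      by congr (mul _ (mul _ _ (pid _ _)) _); exact: Prop_irrelevance.
    have fb : line j (i1 R) = line j' (i0 R).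
      have := congr1 (fun a : S => F (val a)) e => /= E0; rewrite -(finvK (line j (i1 R))).
      by rewrite -(finvK (line j' (i0 R))).
    split.
      exists (cl 2^-1); rewrite pE concatE val_cl ?lexx ?mulfV //; [|lra..].
      by rewrite cl_ge1 // [path_fun _]seg_pathE seg_at1; case: (LXend sub (LXj j)).
    have d0 : seg (line j') (i0 R) (time (In i')) (i0 R) = line j (i1 R) by rewrite seg_at0.
    rewrite pE [X in concat X _]seg_pathE [X in concat _ X]seg_pathE /cut.
    rewrite (cutL_concat (seg_at1 (line j) (time (In i)) (i1 R)) d0 (@up_avoids j i)).
    rewrite (cutR_comp _ _ (reparam_late R)).
    rewrite (cutR_only (seg_at0 (line j') (i0 R) (time (In i'))) (@dn_avoids j' i')).
    by rewrite /front fb.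
- case: x y h => [b|j i] [b'|j' i'] // h; have [/asboolP e l] := andP h; subst j'.
  exists (seg_path (l : clt (In i) (In i'))); split.
    exact: (esym (etrans (@eout_ch S cells cell_size cell_src cell_tgt AX (cat_flow Y) new_state
      push seg_up seg_dn seg_ch (New S i) (New S i') h) (@seg_chE j i i' h l))).
  rewrite /decomposes [path_fun _]seg_pathE.
  have [e0 /andP[h0 _] _] := time_in i; have [e1 /andP[_ h1] _] := time_in i'.
  have lt := @time_lt j (In i) (In i') l.
  exists (line j), (time (In i)), (time (In i')); split; rewrite ?e0 ?e1 //; last by rewrite -e0 -e1; left.
  exact: run_of_seg.
Qed.

Lemma split_pathK x y : cancel (@assemble x y) (@split_path x y).
Proof.
move=> u; have [p [<- du]] := assemble_decomposes u; rewrite split_pathE.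
exact: decomposes_fun (decompose_pathP p) du.
Qed.

Lemma assemble_homeo x y : homeomorphism (@assemble x y).
Proof.
split; first exact: assemble_cont.
exists (@split_path x y); split; [exact: split_path_cont|exact: split_pathK|].
by move=> c; have [u <-] := assemble_surj c; rewrite split_pathK.
Qed.

Lemma assemble_weq : flow_weq R assemble_map.
Proof. by apply: homeo_flow_weq; [exact: new_state_bij|exact: assemble_homeo]. Qed.


End Comparison.

(** * The theorem *)

Section Zigzags.
Variable C : category.
Implicit Types K L : mclass C.

Lemma zigzag_trans K (a b c : C) : zigzag K a b -> zigzag K b c -> zigzag K a c.
Proof.
move=> ab; elim: ab c => // {a b} [a b d f Kf _ IH|a b d f Kf _ IH] c /IH.
  exact: zigzag_forth Kf.
exact: zigzag_back Kf.
Qed.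

Lemma zigzag_sym K (a b : C) : zigzag K a b -> zigzag K b a.
Proof.
elim=> {a b} [a|a b d f Kf _ IH|a b d f Kf _ IH]; first exact: zigzag_refl.
  exact: zigzag_trans IH (zigzag_back Kf (zigzag_refl _ _)).
exact: zigzag_trans IH (zigzag_forth Kf (zigzag_refl _ _)).
Qed.

Lemma zigzag_mono K L (a b : C) : (forall c d (f : hom c d), K c d f -> L c d f) ->
  zigzag K a b -> zigzag L a b.
Proof.
move=> KL; elim=> {a b} [a|a b d f /KL Lf _ IH|a b d f /KL Lf _ IH].
- exact: zigzag_refl.
- exact: zigzag_forth Lf IH.
- exact: zigzag_back Lf IH.
Qed.

Lemma cell_mono K L (a b : C) (f : hom a b) : (forall c d (g : hom c d), K c d g -> L c d g) ->
  cell K f -> cell L f.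
Proof.
move=> KL; case=> disp W o X c leg wo oi cX sX lX; apply: TransfiniteComposition => //.
move=> i j h /(sX i j h)[a' [b' [g [g' [k [Kg P]]]]]].
by exists a', b', g, g', k; split=> //; exact: KL.
Qed.

Lemma retract_refl K (a b : C) (f : hom a b) : K a b f -> retract_of K f.
Proof.
move=> Kf; exists a, b, f; split=> //; exists (idm a), (idm a), (idm b), (idm b).
by rewrite !comp1m !compm1.
Qed.

End Zigzags.

Lemma tot_map (F G : flow_data) (m : flow_map F G) (a b a' b' : flow_state F)
    (x : flow_path a b) (x' : flow_path a' b') :
  tot x = tot x' -> tot (fm_path m x) = tot (fm_path m x').
Proof.
move=> E; have [Ea Eb] : a = a' /\ b = b' by have := congr1 (@projT1 _ _) E; case.
by subst a' b'; rewrite (tot_inj E).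
Qed.

Lemma iso_flow_weq (R : realType) (F G : flow_data) (m : flow_map F G) (n : flow_map G F) :
  flow_comp n m = flow_id F -> flow_comp m n = flow_id G -> flow_weq R m.
Proof.
move=> nm mn.
have nmE a : n (m a) = a := congr1 (fun k : flow_map F F => fm_state k a) nm.
have mnE a : m (n a) = a := congr1 (fun k : flow_map G G => fm_state k a) mn.
apply: homeo_flow_weq => [|a b]; first by exists n.
have [h [ch hE]] : exists h : flow_path (m a) (m b) -> flow_path a b,
    continuous h /\ forall y, tot (h y) = tot (fm_path n y).
  have gen a' b' (k : flow_path (m a) (m b) -> flow_path a' b') : continuous k ->
      a' = a -> b' = b -> exists h : flow_path (m a) (m b) -> flow_path a b,
      continuous h /\ forall y, tot (h y) = tot (k y).
    by move=> ck ea eb; subst a' b'; exists k.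
  by apply: gen; [exact: fm_continuous|exact: nmE|exact: nmE].
split; first exact: fm_continuous.
exists h; split=> // [x|y]; apply: tot_inj.
  by rewrite hE; exact: (fm_path_eq nm x).
by rewrite (tot_map m (hE y)); exact: (fm_path_eq mn y).
Qed.

Definition line_type (T : Type) (L : set T) : Type := {l : T | L l}.
HB.instance Definition _ (T : Type) (L : set T) := gen_eqMixin (line_type L).
HB.instance Definition _ (T : Type) (L : set T) := gen_choiceMixin (line_type L).

(** * From one subdivision to zigzags *)

Section Assembly.
Variables (R : realType) (hd : bool).
Local Notation I := (@unitI R).
Local Notation obj P H := (exist (fun x => is_flow R hd x) P H : Flow R hd).
Variables (Tcof : poset_inclusion -> arrow (Flow R hd)).
Hypothesis hTcof : forall f, cofibrant_replacement f (Tcof f).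

Definition catF (X : MdTop R hd) : Flow R hd := obj (cat_flow X) (is_flow_cat X).

Local Notation K := (mclassU (cell (values_on Tcof globular_inclusion))
  (@flow_weak_equivalence R hd)).

(** All four arrows point from cat X to cat Y: an isomorphism onto the empty stage, the cell
    complex, the weak equivalence onto Ext, and the comparison with cat Y. *)
Lemma subdivision_zigzag (X Y : MdTop R hd) (f : hom X Y) :
  globular_subdivision f -> zigzag K (catF X) (catF Y).
Proof.
move=> [/cellularP[_ [L0 HX] [U [cU U0 UE]]] /cellularP[hY [LY HY] _] [_ [finv [cfi fK finvK]]]].
pose g p := Tcof (chain_incl p).
pose M p : chain_model (g p) p := inhabited_witness (chain_model_exists (hTcof (chain_incl p))).
pose J : choiceType := line_type [set l : I -> sval Y | L0 (finv \o l)].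
pose line (j : J) : I -> sval Y := proj1_sig j.
have LJ (j : J) : [set l | L0 (finv \o l)] (line j) := proj2_sig j.
pose S := states (sval X).
pose A (a b : S) : topologicalType := Defs.cat_path (X := X) a b.
pose ac (a b c : S) (x : A a b) (y : A b c) : A a c := flow_concat (f := cat_flow X) x y.
pose Aflow : is_flow R hd (FlowData ac) := is_flow_cat X.
pose nn : J -> nat := cell_size fK finvK HX HY LJ.
pose src : J -> S := cell_src fK finvK HX HY LJ.
pose tgt : J -> S := cell_tgt fK finvK HX HY LJ.
pose gam (j : J) : A (src j) (tgt j) := cell_cls fK finvK HX HY LJ j.
have [r wo] := well_ordering_principle J.
have Wide D := @stage_wide R hd S A ac _ _ _ _ J nn src tgt gam Aflow
  (fun p => mQ_flow (M p)) (fun p => mK_Top (M p)) (fun p => @mg_cont _ _ _ _ (M p)) D.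
have [|D [D' [m [D0 D1 cm]]]] := wide_pushout_cell Wide wo
  (L := values_on Tcof globular_inclusion).
  move=> j c d x k t /(m_push (c0 := M (nn j)))[x' [k' P]].
  exists (dom (g (nn j))), (cod (g (nn j))), (arr (g (nn j))), x', k'; split=> //.
  exact: ValuesOn (chain_incl_globular (nn j)).
have [h [hi ih]] := wide_empty Wide D0.
pose JD := {j : J | D' j}.
pose nnD (j : JD) := nn (sval j).
pose gamD (j : JD) : A (src (sval j)) (tgt (sval j)) := gam (sval j).
pose EX := is_flow_ext nnD gamD Aflow.
have wE := @to_ext_flow_weq R hd g M S A ac JD nnD _ _ gamD Aflow.
have line_inj (j j' : JD) : line (sval j) = line (sval j') -> j = j'.
  case: j j' => [[l Ll] Dj] [[l' Ll'] Dj'] /= e; subst l'.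
  move: Dj Dj'; rewrite (Prop_irrelevance Ll Ll') => Dj Dj'.
  by rewrite (Prop_irrelevance Dj Dj').
have line_surj (l : I -> sval Y) : L0 (finv \o l) -> exists j : JD, line (sval j) = l.
  by move=> Ll; exists (exist _ (exist _ l Ll : J) (D1 _)).
have UE' k : exec (sval X) k -> exists s, U (k s) = i1 R by move=> /UE[_ [_ [s e]]]; exists s.
have wG := assemble_weq cfi fK finvK HX HY hY (line := fun j : JD => line (sval j))
  (fun j => LJ (sval j)) line_inj line_surj cU U0 UE'.
(* The stage with no cell is only isomorphic to cat X, its paths being classes of words; the
   isomorphism counts as a weak equivalence. *)
apply: (zigzag_forth (f := stage_in _ _ nn gam Aflow D : hom (catF X) _)).
  by right; exact: iso_flow_weq hi ih.
apply: (zigzag_forth (f := m)); first by left.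
apply: (zigzag_forth (f := to_ext_map M nnD gamD Aflow :
  hom (stage R hd ac (fun p => @mqc _ _ _ _ (M p)) (fun p => @mg _ _ _ _ (M p)) nn gam D') (obj _ EX))); first by right.
apply: (zigzag_forth (f := assemble_map fK finvK HX HY (fun j : JD => LJ (sval j)) : hom (obj _ EX) (catF Y))).
  by right.
exact: zigzag_refl.
Qed.

Lemma cellular_zigzag (X Y : MdTop R hd) :
  zigzag (@globular_subdivision R hd) X Y -> zigzag K (catF X) (catF Y).
Proof.
elim=> {X Y} [X|X Y Z f /subdivision_zigzag XY _ IH|X Y Z f /subdivision_zigzag YX _ IH].
- exact: zigzag_refl.
- exact: zigzag_trans XY IH.
- exact: zigzag_trans (zigzag_sym YX) IH.
Qed.

Lemma values_on_generating A (a b : Flow R hd) (f : hom a b) :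
  values_on Tcof A f -> generating_subdivision f.
Proof. by case=> i _; exists i; case: (Tcof i) (hTcof i). Qed.


End Assembly.

Theorem corollary9p4 (R : realType) (hd : bool) (X Y : MdTop R hd)
  (Tcof : poset_inclusion -> arrow (Flow R hd))
  (hTcof : forall f, cofibrant_replacement f (Tcof f))
  (hX : cellular X) (hY : cellular Y)
  (hXY : zigzag (@globular_subdivision R hd) X Y) :
  exists (FX : is_flow R hd (cat_flow X)) (FY : is_flow R hd (cat_flow Y)),
    let catX : Flow R hd := exist _ (cat_flow X) FX in
    let catY : Flow R hd := exist _ (cat_flow Y) FY in
    [/\ zigzag (mclassU (cell (values_on Tcof (fun _ => True)))
          (@flow_weak_equivalence R hd)) catX catY,
        dihomotopy_equivalent catX catY
      & zigzag (mclassU (cell (values_on Tcof globular_inclusion))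
          (@flow_weak_equivalence R hd)) catX catY].
Proof.
exists (is_flow_cat X), (is_flow_cat Y); have Z := cellular_zigzag hTcof hXY; split=> //.
- apply: zigzag_mono Z => c d f [cf|]; [left|by right].
  by apply: cell_mono cf => c' d' k [i _]; exact: ValuesOn.
- apply: zigzag_mono Z => c d f [cf|]; [right|by left].
  by apply: retract_refl; apply: cell_mono cf => c' d' k; exact: values_on_generating.
Qed.
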